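(* Let $\lambda\in(0,1]$ and let $c^{in}\in\mathcal M_\lambda^+$. Assume that the coagulation kernel $K$ and the fragmentation kernel $F$ satisfy Hypothesis (KF) with this $\lambda$, and that the measure $\beta$ on $\Theta$ satisfies Hypothesis (B) with the same $\lambda$. Then there exists a unique $(c^{in},K,F,\beta,\lambda)$-weak solution $(c_t)_{t\ge 0}$ of the coagulation multiple-fragmentation equation.
   Context: $\mathcal M^+$ is the set of non-negative Radon measures on $(0,\infty)$. For $\lambda\in\mathbb R$ and $c\in\mathcal M^+$, $M_\lambda(c)=\int_0^\infty x^\lambda\,c(dx)$ and $\mathcal M_\lambda^+=\{c\in\mathcal M^+: M_\lambda(c)<\infty\}$. For $\lambda\in(0,1]$, $\mathcal H_\lambda$ is the set of $\phi\in C([0,\infty))$ with $\phi(0)=0$ and $\sup_{x\ne y}|\phi(x)-\phi(y)|/|x-y|^\lambda<\infty$. $\Theta=\{\theta=(\theta_k)_{k\ge1}: 1>\theta_1\ge\theta_2\ge\dots\ge0\}$ (with the product $\sigma$-algebra). Write $x\wedge y=\min\{x,y\}$. Hypothesis (KF) with parameter $\lambda\in(0,1]$: $K:(0,\infty)^2\to[0,\infty)$ is symmetric, belongs to $W^{1,\infty}((\varepsilon,1/\varepsilon)^2)$ for every $\varepsilon\in(0,1)$ (i.e. is locally Lipschitz), and there are constants $\kappa_0,\kappa_1>0$ with $K(x,y)\le\kappa_0(x+y)^\lambda$ and $(x^\lambda\wedge y^\lambda)|\partial_xK(x,y)|\le\kappa_1x^{\lambda-1}y^\lambda$ for all $(x,y)\in(0,\infty)^2$;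 $F:(0,\infty)\to[0,\infty)$ belongs to $W^{1,\infty}((\varepsilon,1/\varepsilon))$ for every $\varepsilon\in(0,1)$, and there are constants $\kappa_2,\kappa_3>0$ with $F(x)\le\kappa_2$ and $|F'(x)|\le\kappa_3x^{-1}$ for $x\in(0,\infty)$. (Conditions on derivatives are understood at the points where the derivatives exist.) Hypothesis (B) with parameter $\lambda\in(0,1]$: $\beta$ is a non-negative measure on $\Theta$ (possibly infinite) with $\beta(\{\theta:\sum_{k\ge1}\theta_k>1\})=0$ and $C_\beta^\lambda:=\int_\Theta\big[\sum_{k\ge2}\theta_k^\lambda+(1-\theta_1)^\lambda\big]\beta(d\theta)<\infty$. For a function $\phi$ set $(A\phi)(x,y)=\phi(x+y)-\phi(x)-\phi(y)$ and $(B\phi)(\theta,x)=\sum_{i\ge1}\phi(\theta_ix)-\phi(x)$. Weak solution: given $c^{in}\in\mathcal M_\lambda^+$, a family $(c_t)_{t\ge0}\subset\mathcal M^+$ is a $(c^{in},K,F,\beta,\lambda)$-weak solution of the coagulation multiple-fragmentation equation if $c_0=c^{in}$; for each $\phi\in\mathcal H_\lambda$ the map $t\mapsto\int_0^\infty\phi(x)c_t(dx)$ is differentiable on $[0,\infty)$; $\sup_{s\in[0,t]}M_\lambda(c_s)<\infty$ for every $t\in[0,\infty)$; and for all $\phi\in\mathcal H_\lambda$ and all $t\ge0$, $$\frac{d}{dt}\int_0^\infty\phi(x)c_t(dx)=\frac12\int_0^\infty\!\!\int_0^\infty K(x,y)(A\phi)(x,y)c_t(dx)c_t(dy)+\int_0^\infty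 F(x)\int_\Theta(B\phi)(\theta,x)\beta(d\theta)c_t(dx).$$ *)

(* Defs.v *)
From HB Require Import structures.
From mathcomp Require Import all_boot all_order all_algebra.
From mathcomp Require Import all_classical all_reals all_analysis.
Set Implicit Arguments.
Unset Strict Implicit.
Unset Printing Implicit Defensive.
Import Order.TTheory GRing.Theory Num.Theory.
Import numFieldNormedType.Exports.
Local Open Scope classical_set_scope.
Local Open Scope ring_scope.

(* A measure on (0,oo) is encoded as a Borel measure on R that does not charge
   ]-oo, 0].  On (0,oo), every Borel measure that is finite on compact sets is
   regular, hence Radon. *)
Definition radon_pos (R : realType) (c : {measure set R -> \bar R}) : Prop :=
  c `]-oo, 0]%classic = 0%E /\
  forall C : set R, compact C -> C `<=` `]0, +oo[ -> (c C < +oo)%E.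

Definition moment (R : realType) (lambda : R)
    (c : {measure set R -> \bar R}) : \bar R :=
  (\int[c]_(x in `]0%R, +oo[) (x `^ lambda)%:E)%E.

Definition radon_pos_moment (R : realType) (lambda : R)
    (c : {measure set R -> \bar R}) : Prop :=
  radon_pos c /\ (moment lambda c < +oo)%E.

(* The set H_lambda; only the restriction of phi to [0,oo) is relevant. *)
Definition holder_class (R : realType) (lambda : R) (phi : R -> R) : Prop :=
  [/\ {within `[0, +oo[, continuous phi},
      phi 0 = 0 &
      has_ubound [set r | exists x y : R, [/\ 0 <= x, 0 <= y, x != y &
                          r = `|phi x - phi y| / `|x - y| `^ lambda]]].

(* Sequences are indexed from 0: [th k] is the usual theta_(k+1). *)
Record Theta (R : realType) := MkTheta {
  theta_seq :> nat -> R;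
  theta_lt1 : theta_seq 0%N < 1;
  theta_noninc : forall k, theta_seq k.+1 <= theta_seq k;
  theta_ge0 : forall k, 0 <= theta_seq k }.

Section Theta_measurable.
Context {R : realType}.

Definition theta0 : Theta R :=
  @MkTheta R (fun=> 0) ltr01 (fun=> lexx 0) (fun=> lexx 0).

HB.instance Definition _ := gen_eqMixin (Theta R).
HB.instance Definition _ := gen_choiceMixin (Theta R).
HB.instance Definition _ := isPointed.Build (Theta R) theta0.

(* The sets depending on one coordinate, which generate the (trace of the)
   product sigma-algebra. *)
Definition theta_cylinders : set (set (Theta R)) :=
  \bigcup_k preimage_set_system setT (fun th : Theta R => th k) measurable.

HB.instance Definition _ := @isMeasurable.Build (sigma_display theta_cylinders)
  (Theta R) <<s theta_cylinders >> (@sigma_algebra0 _ setT theta_cylinders)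
  (@sigma_algebraC _ theta_cylinders)
  (@sigma_algebra_bigcup _ setT theta_cylinders).

End Theta_measurable.

(* Membership in W^{1,oo} of a bounded open interval or square means being
   Lipschitz there.  The bounds on derivatives are required exactly at the
   points where the derivatives exist. *)
Record hypothesis_KF (R : realType) (lambda : R) (K : R -> R -> R) (F : R -> R)
    : Prop := HypothesisKF {
  K_ge0 : forall x y : R, 0 < x -> 0 < y -> 0 <= K x y;
  K_sym : forall x y : R, 0 < x -> 0 < y -> K x y = K y x;
  K_lip : forall e : R, 0 < e < 1 ->
    [lipschitz K z.1 z.2 | z in (`]e, e^-1[ `*` `]e, e^-1[ : set (R * R))];
  K_bound : exists2 kappa0 : R, 0 < kappa0 &
    forall x y : R, 0 < x -> 0 < y -> K x y <= kappa0 * (x + y) `^ lambda;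
  K_deriv : exists2 kappa1 : R, 0 < kappa1 &
    forall x y : R, 0 < x -> 0 < y -> derivable (K ^~ y) x 1 ->
      Num.min (x `^ lambda) (y `^ lambda) * `|derive1 (K ^~ y) x|
        <= kappa1 * x `^ (lambda - 1) * y `^ lambda;
  F_ge0 : forall x : R, 0 < x -> 0 <= F x;
  F_lip : forall e : R, 0 < e < 1 ->
    [lipschitz F x | x in (`]e, e^-1[ : set R)];
  F_bound : exists2 kappa2 : R, 0 < kappa2 & forall x : R, 0 < x -> F x <= kappa2;
  F_deriv : exists2 kappa3 : R, 0 < kappa3 &
    forall x : R, 0 < x -> derivable F x 1 -> `|derive1 F x| <= kappa3 * x^-1 }.

Definition C_beta (R : realType) (lambda : R)
    (beta : {measure set (Theta R) -> \bar R}) : \bar R :=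
  (\int[beta]_th (\sum_(1 <= k <oo) ((th k) `^ lambda)%:E
                  + ((1 - th 0%N) `^ lambda)%:E))%E.

Definition hypothesis_B (R : realType) (lambda : R)
    (beta : {measure set (Theta R) -> \bar R}) : Prop :=
  beta [set th : Theta R | (\sum_(0 <= k <oo) (th k)%:E > 1)%E] = 0%E /\
  (C_beta lambda beta < +oo)%E.

Definition coag_op (R : realType) (phi : R -> R) (x y : R) : R :=
  phi (x + y) - phi x - phi y.

Definition frag_op (R : realType) (phi : R -> R) (th : Theta R) (x : R) : R :=
  limn (series (fun i => phi (th i * x))) - phi x.

(* All the integrals below converge absolutely when phi is in H_lambda, the
   lambda-moment of c is finite and the two hypotheses above hold. *)
Definition pairing (R : realType) (c : {measure set R -> \bar R})
    (phi : R -> R) : R :=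
  \int[c]_(x in `]0, +oo[) phi x.

Definition weak_rhs (R : realType) (K : R -> R -> R) (F : R -> R)
    (beta : {measure set (Theta R) -> \bar R})
    (c : {measure set R -> \bar R}) (phi : R -> R) : R :=
  2^-1 * \int[c]_(y in `]0, +oo[) \int[c]_(x in `]0, +oo[)
           (K x y * coag_op phi x y)
  + \int[c]_(x in `]0, +oo[) (F x * \int[beta]_th frag_op phi th x).

(* Differentiability and derivative on [0,oo): two-sided at t > 0 and
   one-sided at t = 0. *)
Definition derivable_halfline (R : realType) (g : R -> R) (t : R) : Prop :=
  cvg ((fun s => (s - t)^-1 * (g s - g t)) @ within [set s | 0 <= s] t^').

Definition derive_halfline (R : realType) (g : R -> R) (t : R) : R :=
  lim ((fun s => (s - t)^-1 * (g s - g t)) @ within [set s | 0 <= s] t^').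

(* The family is indexed by R, but only its members with t >= 0 matter. *)
Record weak_solution (R : realType) (cin : {measure set R -> \bar R})
    (K : R -> R -> R) (F : R -> R) (beta : {measure set (Theta R) -> \bar R})
    (lambda : R) (c : R -> {measure set R -> \bar R}) : Prop := WeakSolution {
  ws_radon : forall t : R, 0 <= t -> radon_pos (c t);
  ws_init : forall A, measurable A -> c 0 A = cin A;
  ws_derivable : forall phi, holder_class lambda phi -> forall t : R, 0 <= t ->
    derivable_halfline (fun s => pairing (c s) phi) t;
  ws_moment : forall t : R, 0 <= t ->
    (ereal_sup [set moment lambda (c s) | s in `[0%R, t]] < +oo)%E;
  ws_eq : forall phi, holder_class lambda phi -> forall t : R, 0 <= t ->
    derive_halfline (fun s => pairing (c s) phi) t
      = weak_rhs K F beta (c t) phi }.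

(* Submission.v *)
Require Import Defs.
From HB Require Import structures.
From mathcomp Require Import all_boot all_order all_algebra.
From mathcomp Require Import all_classical all_reals all_analysis.
From mathcomp Require Import measurable_realfun ring lra.
Set Implicit Arguments.
Unset Strict Implicit.
Unset Printing Implicit Defensive.
Import Order.TTheory GRing.Theory Num.Theory.
Import numFieldNormedType.Exports.
Local Open Scope classical_set_scope.
Local Open Scope ring_scope.

(* Two measures c, d on (0,oo) are compared through their tails, by
     dist(c, d) = \int_0^oo lambda z^(lambda-1) |c(]z,oo[) - d(]z,oo[)| dz.
   This is the value of <c - d, r> for the primitive r of
   lambda z^(lambda-1) sgn(c(]z,oo[) - d(]z,oo[)), and r is lambda-Hoelder.  The
   bounds on the derivatives of K and F are what is needed to control the weak
   right-hand side tested against this optimal r: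
     rhs(c, r) - rhs(d, r) <= C (1 + M_lambda(c) + M_lambda(d)) dist(c, d).
   Freezing r at time t bounds the left derivative of t |-> dist(c_t, d_t) at t,
   and a Gronwall argument gives uniqueness, as well as stability for families
   solving the equation up to a small error.
   For existence, fragmentation is truncated to finitely many fragments and to
   theta_1 bounded away from 1, and K to a bounded interval; for data with finite
   mass of 1 + x^(2 lambda) an explicit Euler scheme stays positive and yields
   solutions up to an arbitrarily small error.  By stability they form a Cauchy
   sequence.  As dist(c, d) is the L^1 distance of the lambda-th powers of the
   quantile functions of c and d, fast convergence for dist gives dominated almost
   everywhere convergence of the quantiles, hence a limit measure and the
   convergence of the right-hand sides. *)

(** * Integration tools *)

(** The obstacle is that [K] grows at infinity, so the term in which [r] rather than [K] is
    differentiated is not bounded by the distance. It has a sign instead: at x the choice of [r]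
    produces -w(x)|E(x)|, with E the difference of the tails and w(z) = lambda z^(lambda-1), and
    this beats the contribution of x + y because lambda <= 1 makes w nonincreasing. Likewise the
    parent of a fragmentation absorbs its largest fragment, and the others add up to the integrand
    of [C_beta].

    Left derivatives are the natural notion: at s < t the function optimal at t only bounds the
    distance from below, and this yields an upper bound for the increment from s to t.

    The moment of order 2 lambda pays for the pairs discarded when [K] is truncated. Its growth
    depends on the truncation of fragmentation but not on that of [K], so the cutoff of [K] can be
    chosen afterwards; the growth of the lambda-moment depends on neither.

    Measures may have infinite mass near 0. Hence quantiles live on the Lebesgue half-line, and
    tails are only used at positive points. *)

Section measure_tools.
Context d (T : measurableType d) (R : realType).
Implicit Types m : {measure set T -> \bar R}.

(** Sigma-finiteness is a proved property of the measures at hand, whereas Fubini's theorem is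
    stated for the bundled structure. *)
Definition sigma_finite_pack m (h : sigma_finite setT m) :
    {sigma_finite_measure set T -> \bar R} :=
  HB.pack_for {sigma_finite_measure set T -> \bar R} (Measure.sort m)
    (@isSFinite.Build _ _ _ m (sfinite_measure_sigma_finite h))
    (@isSigmaFinite.Build _ _ _ m h).

Lemma integrable_le m (f g : T -> R) : measurable_fun setT f ->
  m.-integrable setT (EFin \o g) -> (forall x, `|f x| <= g x) ->
  m.-integrable setT (EFin \o f).
Proof.
move=> mf ig fg; apply: le_integrable ig => //; first exact/measurable_EFinP.
by move=> x _; rewrite /= lee_fin (le_trans (fg x))// ler_norm.
Qed.

Lemma le_Rintegral_setT m (f g : T -> R) : m.-integrable setT (EFin \o f) ->
  m.-integrable setT (EFin \o g) -> (forall x, f x <= g x) ->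
  \int[m]_x f x <= \int[m]_x g x.
Proof. by move=> fi gi fg; apply: le_Rintegral. Qed.

Lemma Rintegral_EFin m (f : T -> R) : m.-integrable setT (EFin \o f) ->
  (\int[m]_x f x)%:E = (\int[m]_x (f x)%:E)%E.
Proof. by move=> fi; rewrite /Rintegral fineK//; apply: integrable_fin_num. Qed.

Lemma Rintegral_dct m (f_ : nat -> T -> R) (f g : T -> R) :
  (forall n, measurable_fun setT (f_ n)) -> measurable_fun setT f ->
  {ae m, forall x, (f_ n x) @[n --> \oo] --> f x} ->
  m.-integrable setT (EFin \o g) -> {ae m, forall x n, `|f_ n x| <= g x} ->
  m.-integrable setT (EFin \o f) /\
  (\int[m]_x f_ n x) @[n --> \oo] --> \int[m]_x f x.
Proof.
move=> mf_ mf cf ig fg.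
have [] := @dominated_convergence _ T R m setT measurableT
  (fun n => EFin \o f_ n) (EFin \o f) (EFin \o g).
- by move=> n; exact/measurable_EFinP.
- exact/measurable_EFinP.
- apply: filterS cf => x cx _; apply: cvg_EFin => //.
  by near=> n.
- by [].
- by apply: filterS fg => x fx n _ /=; rewrite lee_fin.
- move=> fi _ ci; split => //.
  apply: fine_cvg; rewrite fineK ?integrable_fin_num//.
Unshelve. all: by end_near.
Qed.

End measure_tools.

Section fubini_dominated.
Context d1 d2 (T1 : measurableType d1) (T2 : measurableType d2) (R : realType).
Variables (m1 : {measure set T1 -> \bar R}) (m2 : {measure set T2 -> \bar R}).
Hypothesis s1 : sigma_finite setT m1.
Hypothesis s2 : sigma_finite setT m2.
Variables (f : T1 * T2 -> R) (u : T1 -> R) (v : T2 -> R).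
Hypothesis mf : measurable_fun setT f.
Hypothesis iu : m1.-integrable setT (EFin \o u).
Hypothesis iv : m2.-integrable setT (EFin \o v).
Hypothesis fuv : forall a b, `|f (a, b)| <= u a * v b.

Let n1 := sigma_finite_pack s1.
Let n2 := sigma_finite_pack s2.

(** The domination by [u a * v b] holds at every point, so all slices are integrable, not only
    almost all of them; iterated real integrals then never meet a default value. *)
Lemma fubini_integrable_r a : m2.-integrable setT (fun b => (f (a, b))%:E).
Proof.
apply: (@integrable_le _ _ _ m2 (fun b => f (a, b)) (fun b => u a * v b)) => //.
  exact: measurableT_comp.
by rewrite (_ : _ \o _ = (fun x => (u a)%:E * (EFin \o v) x)%E) //; apply: integrableZl.
Qed.

Lemma fubini_integrable_l b : m1.-integrable setT (fun a => (f (a, b))%:E).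
Proof.
apply: (@integrable_le _ _ _ m1 (fun a => f (a, b)) (fun a => u a * v b)) => //.
  exact: measurableT_comp.
by rewrite (_ : _ \o _ = (fun x => (EFin \o u) x * (v b)%:E)%E) //; apply: integrableZr.
Qed.

Let fi : (n1 \x n2)%E.-integrable setT (EFin \o f).
Proof.
apply/integrable12ltyP; first exact/measurable_EFinP.
have muv : measurable_fun setT (fun z : T1 * T2 => ((u z.1 * v z.2)%:E)).
  apply/measurable_EFinP; apply: measurable_funM.
    by apply: measurableT_comp => //; apply/measurable_EFinP; case/integrableP: iu.
  by apply: measurableT_comp => //; apply/measurable_EFinP; case/integrableP: iv.
apply: (@le_lt_trans _ _ (\int[n1]_x \int[n2]_y (`|u x| * `|v y|)%:E)%E).
  apply: ge0_le_integral => //.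
  - by move=> x _; apply: integral_ge0 => y _.
  - apply: (@measurable_fun_fubini_tonelli_F _ _ _ _ _ n2 (fun z => (`|f z|)%:E)) => //.
    by apply/measurable_EFinP; apply: measurableT_comp.
  - apply: (@measurable_fun_fubini_tonelli_F _ _ _ _ _ n2 (fun z => (`|u z.1| * `|v z.2|)%:E)) => //.
      rewrite (_ : (fun z => _) = (fun z : T1 * T2 => (`|u z.1 * v z.2|)%:E)).
        by apply/measurable_EFinP; apply: measurableT_comp => //; apply/measurable_EFinP.
      by apply/funext => z /=; rewrite normrM.
  - move=> x _; apply: ge0_le_integral => //.
    + by apply: measurableT_comp => //; apply/measurable_EFinP; apply: measurableT_comp.
    + apply/measurable_EFinP; apply: measurable_funM => //.
      apply: measurableT_comp => //; apply/measurable_EFinP; by case/integrableP: iv.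
    + by move=> y _ /=; rewrite lee_fin -normrM (le_trans (fuv _ _))// ler_norm.
have Hv : (\int[n2]_y (`|v y|)%:E < +oo)%E by case/integrableP: iv.
have Hu : (\int[n1]_y (`|u y|)%:E < +oo)%E by case/integrableP: iu.
have mv : measurable_fun setT (fun y => (`|v y|)%:E).
  by apply/measurable_EFinP; apply: measurableT_comp => //; apply/measurable_EFinP; case/integrableP: iv.
have mu : measurable_fun setT (fun y => (`|u y|)%:E).
  by apply/measurable_EFinP; apply: measurableT_comp => //; apply/measurable_EFinP; case/integrableP: iu.
under eq_integral do (under eq_integral do rewrite EFinM; rewrite ge0_integralZl//).
rewrite ge0_integralZr// ?integral_ge0//.
by rewrite lte_mul_pinfty// ?integral_ge0// ge0_fin_numE// integral_ge0.
Qed.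

Lemma fubini_integrable_Rl :
  m1.-integrable setT (fun a => (\int[m2]_b f (a, b))%:E).
Proof.
rewrite (_ : (fun _ => _) = fubini_F n2 (EFin \o f)).
  exact: (@integrable_fubini_F _ _ _ _ _ n1 n2 _ fi).
by apply/funext => a; rewrite (@Rintegral_EFin _ _ _ m2 (fun b => f (a, b)))//; exact: fubini_integrable_r.
Qed.

Lemma fubini_dominated :
  \int[m1]_a \int[m2]_b f (a, b) = \int[m2]_b \int[m1]_a f (a, b).
Proof.
rewrite /Rintegral.
under eq_integral do rewrite -/(Rintegral m2 setT (fun b => f (_, b))) (Rintegral_EFin (fubini_integrable_r _)).
under [in RHS]eq_integral do rewrite -/(Rintegral m1 setT (fun b => f (b, _))) (Rintegral_EFin (fubini_integrable_l _)).
by congr fine; exact: (Fubini fi).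
Qed.

End fubini_dominated.

Lemma fubini_integrable_Rr d1 d2 (T1 : measurableType d1)
    (T2 : measurableType d2) (R : realType)
    (m1 : {measure set T1 -> \bar R}) (m2 : {measure set T2 -> \bar R})
    (f : T1 * T2 -> R) (u : T1 -> R) (v : T2 -> R) :
  sigma_finite setT m1 -> sigma_finite setT m2 -> measurable_fun setT f ->
  m1.-integrable setT (EFin \o u) -> m2.-integrable setT (EFin \o v) ->
  (forall a b, `|f (a, b)| <= u a * v b) ->
  m2.-integrable setT (fun b => (\int[m1]_a f (a, b))%:E).
Proof.
move=> s1 s2 mf iu iv fuv.
apply: (@fubini_integrable_Rl _ _ T2 T1 R m2 m1 s2 s1 (fun z => f (z.2, z.1)) v u) => //.
- by apply: measurableT_comp => //; apply: measurable_fun_pair.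
- by move=> a b; rewrite mulrC /=.
Qed.

Lemma le_Rintegral_ae d (T : measurableType d) (R : realType)
    (m : {measure set T -> \bar R}) (f g : T -> R) :
  m.-integrable setT (EFin \o f) -> m.-integrable setT (EFin \o g) ->
  {ae m, forall x, f x <= g x} -> \int[m]_x f x <= \int[m]_x g x.
Proof.
move=> fi gi fg.
have mf : measurable_fun setT f by apply/measurable_EFinP; case/integrableP: fi.
have mg : measurable_fun setT g by apply/measurable_EFinP; case/integrableP: gi.
(* [h] equals [f] almost everywhere and lies below [g] everywhere. *)
pose h x := Num.min (f x) (g x).
have mh : measurable_fun setT h by exact: measurable_minr.
have hi : m.-integrable setT (EFin \o h).
  apply: (@integrable_le _ _ _ m h (fun x => `|f x| + `|g x|)) => //.
    rewrite (_ : _ \o _ = ((EFin \o (fun x => `|f x|)%R) \+ (EFin \o (fun x => `|g x|)%R))%E) //.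
    by apply: integrableD => //; exact: integrable_norm.
  move=> x; rewrite /h; case: (leP (f x) (g x)) => _; first by rewrite lerDl.
  by rewrite lerDr.
have -> : \int[m]_x f x = \int[m]_x h x.
  rewrite /Rintegral; congr fine; apply: ae_eq_integral => //.
  - exact/measurable_EFinP.
  - exact/measurable_EFinP.
  - by apply: filterS fg => x fgx _; rewrite /h (min_idPl fgx).
by apply: le_Rintegral_setT => // x; rewrite /h ge_min lexx orbT.
Qed.

Section image_density.
Context d1 d2 (T1 : measurableType d1) (T2 : measurableType d2) (R : realType).
Variables (m : {measure set T1 -> \bar R}) (rho : T1 -> R) (X : T1 -> T2).
Hypothesis mrho : measurable_fun setT rho.
Hypothesis rho0 : forall t, 0 <= rho t.
Hypothesis mX : measurable_fun setT X.

(** The image under [X] of the measure with density [rho] with respect to [m]. Restrictions, Euler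
    steps and limit measures are all obtained from such images. *)
Definition image_density (A : set T2) : \bar R :=
  (\int[m]_(t in X @^-1` A) (rho t)%:E)%E.

Let mXA A : measurable A -> measurable (X @^-1` A).
Proof. by move=> mA; rewrite -[X in measurable X]setTI; apply: mX. Qed.

Let image_density0 : image_density set0 = 0%E.
Proof. by rewrite /image_density preimage_set0 integral_set0. Qed.

Let image_density_ge0 A : (0 <= image_density A)%E.
Proof. by apply: integral_ge0 => t _; rewrite lee_fin. Qed.

Let image_density_sigma_additive : semi_sigma_additive image_density.
Proof.
move=> F mF tF mUF; rewrite /image_density preimage_bigcup.
apply: (@semi_sigma_additive_nng_induced _ _ R m (EFin \o rho)).
- exact/measurable_EFinP.
- by move=> t; rewrite lee_fin.
- by move=> i; apply: mXA.
- apply/trivIsetP => i j _ _ ij; rewrite -preimage_setI.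
  by move/trivIsetP : tF => /(_ i j Logic.I Logic.I ij) ->; rewrite preimage_set0.
- by apply: bigcup_measurable => i _; apply: mXA.
Qed.

HB.instance Definition _ := isMeasure.Build _ _ _ image_density
  image_density0 image_density_ge0 image_density_sigma_additive.

Import HBNNSimple.

Let integral_image_density_nnsfun (h : {nnsfun T2 >-> R}) :
  (\int[image_density]_x (h x)%:E = \int[m]_t (h (X t) * rho t)%:E)%E.
Proof.
have mi y : measurable_fun setT (\1_(h @^-1` [set y]) : T2 -> R) by [].
have hE x : (h x)%:E = (\sum_(y \in range h) (y * \1_(h @^-1` [set y]) x)%:E)%E.
  by rewrite fimfunE fsumEFin.
transitivity (\int[image_density]_x (\sum_(y \in range h) (y * \1_(h @^-1` [set y]) x)%:E))%E.
  by apply: eq_integral => x _; rewrite -hE.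
rewrite ge0_integral_fsum//; last 2 first.
- by move=> y; apply/measurable_EFinP; apply: measurable_funM.
- by move=> y t _; exact: nnfun_muleindic_ge0.
have -> : (\int[m]_t (h (X t) * rho t)%:E = \int[m]_t (\sum_(y \in range h)
    (y * \1_(h @^-1` [set y]) (X t))%:E * (rho t)%:E))%E.
  apply: eq_integral => t _; rewrite EFinM hE ge0_mule_fsuml// => y.
  exact: nnfun_muleindic_ge0.
rewrite ge0_integral_fsum//; last 2 first.
- move=> y; apply: emeasurable_funM; last exact/measurable_EFinP.
  apply/measurable_EFinP; apply: measurable_funM => //.
  exact: (measurableT_comp (mi y) mX).
- by move=> y t _; rewrite mule_ge0 ?lee_fin//; exact: nnfun_muleindic_ge0.
apply: eq_fsbigr => y /[!inE] -[t _ hty].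
have y0 : 0 <= y by rewrite -hty.
under eq_integral do rewrite EFinM.
rewrite ge0_integralZl//; last exact/measurable_EFinP.
rewrite integral_indic// setIT.
under [RHS]eq_integral do rewrite EFinM -muleA.
rewrite ge0_integralZl//; last 2 first.
- apply: emeasurable_funM; last exact/measurable_EFinP.
  by apply/measurable_EFinP; exact: (measurableT_comp (mi y) mX).
- by move=> ? _; rewrite mule_ge0 ?lee_fin.
congr (_ * _)%E; rewrite /= /image_density integral_mkcond.
apply: eq_integral => s _; rewrite patchE indicE /=.
have -> : (X s \in h @^-1` [set y]) = (s \in X @^-1` (h @^-1` [set y])).
  by apply/idP/idP; rewrite !inE.
by case: ifP => _; rewrite ?mul1e ?mul0e.
Qed.

Lemma integral_image_density (g : T2 -> \bar R) : measurable_fun setT g ->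
  (forall x, 0 <= g x)%E ->
  (\int[image_density]_x g x = \int[m]_t (g (X t) * (rho t)%:E))%E.
Proof.
move=> mg g0.
pose h := nnsfun_approx measurableT mg.
have gE x : g x = limn ((EFin \o h^~ x)).
  by apply/esym/cvg_lim => //; exact: cvg_nnsfun_approx.
transitivity (limn (fun n => \int[image_density]_x (h n x)%:E))%E.
  under eq_integral do rewrite gE.
  apply: monotone_convergence => //.
  - by move=> n; apply/measurable_EFinP.
  - by move=> n x _; rewrite lee_fin.
  - by move=> x _ a b ab; rewrite lee_fin; exact/lefP/nd_nnsfun_approx.
under eq_fun do rewrite integral_image_density_nnsfun.
have -> : (\int[m]_t (g (X t) * (rho t)%:E) = \int[m]_t limn (fun n => (h n (X t) * rho t)%:E))%E.
  apply: eq_integral => t _; apply/esym/cvg_lim => //.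
  under eq_fun do rewrite EFinM.
  by apply: cvgeZr => //; exact: cvg_nnsfun_approx.
rewrite monotone_convergence //.
- move=> n; apply/measurable_EFinP; apply: measurable_funM => //.
  exact: measurableT_comp.
- by move=> n t _; rewrite lee_fin mulr_ge0.
- move=> t _ a b ab; rewrite lee_fin ler_wpM2r//; exact/lefP/nd_nnsfun_approx.
Qed.

Lemma ex_image_density : exists nu : {measure set T2 -> \bar R},
  (forall A, nu A = \int[m]_(t in X @^-1` A) (rho t)%:E)%E /\
  forall g : T2 -> \bar R, measurable_fun setT g -> (forall x, 0 <= g x)%E ->
    (\int[nu]_x g x = \int[m]_t (g (X t) * (rho t)%:E))%E.
Proof.
by exists image_density; split => // g mg g0; exact: integral_image_density.
Qed.

End image_density.

(** * Lipschitz functions are integrals of their derivative *)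

Section lipschitz_ftc.
Context (R : realType).
Notation mu := (@lebesgue_measure R).

Definition clamp (a b x : R) := Num.max a (Num.min x b).

Lemma clamp_itv a b x : a <= b -> a <= clamp a b x <= b.
Proof. by move=> ab; rewrite /clamp le_max lexx ge_max ab ge_min lexx orbT. Qed.

Lemma clamp_id a b x : a <= x <= b -> clamp a b x = x.
Proof. by move=> /andP[ax xb]; rewrite /clamp (min_idPl xb) (max_idPr ax). Qed.

Lemma clamp_lip a b x y : a <= b -> x <= y -> 0 <= clamp a b y - clamp a b x <= y - x.
Proof.
move=> ab xy; apply/andP; split; rewrite /clamp;
  case: (leP x b) => ?; case: (leP y b) => ?;
  case: (leP a x) => ?; case: (leP a y) => ?; case: (leP a b) => ?; lra.
Qed.

Lemma stieltjes_itv (f : cumulative R R) (a b : R) : a <= b ->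
  lebesgue_stieltjes_measure f `]a, b]%classic = (f b - f a)%:E.
Proof.
move=> ab; rewrite /lebesgue_stieltjes_measure/= /measure_extension/= measurable_mu_extE/=; last exact: is_ocitv.
move: ab; rewrite le_eqVlt => /predU1P[->|ab].
  by rewrite set_itvoc0 wlength0 subrr.
by rewrite wlength_itv_bnd// ltW.
Qed.

(* [g] and [L x - g] are both nondecreasing, so their Stieltjes measures add up
   to [L] times the Lebesgue measure. *)
Lemma stieltjes_dominated (g h : cumulative R R) (L : R) : 0 < L ->
  (forall x, g x + h x = L * x) ->
  forall A, mu A = 0%E -> measurable A -> lebesgue_stieltjes_measure g A = 0%E.
Proof.
move=> L0 ghL A muA mA.
have Li0 : 0 <= L^-1 by rewrite invr_ge0 ltW.
pose k := NngNum Li0.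

pose m := mscale k (measure_add (lebesgue_stieltjes_measure g)
  (lebesgue_stieltjes_measure h)).
have mE B : m B = (L^-1%:E * (lebesgue_stieltjes_measure g B +
    lebesgue_stieltjes_measure h B))%E.
  by congr (_ * _)%E; exact: measure_addE.
have muE B : measurable B -> mu B = m B.
  apply: lebesgue_measure_unique => X [[a b] _ <-]; apply: etrans; last exact/esym/mE.
  rewrite /=.
  have [ab|ba] := leP a b; last first.
    by rewrite set_itv_ge ?measure0 ?adde0 ?mule0// bnd_simp -leNgt ltW.
  rewrite lebesgue_measure_itv/= !stieltjes_itv//.
  rewrite lte_fin -EFinD -EFinM /=; have := ghL a; have := ghL b => Hb Ha.
  have -> : g b - g a + (h b - h a) = L * (b - a) by lra.
  rewrite mulKf ?gt_eqF//; move: ab; rewrite le_eqVlt => /predU1P[->|->//].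
  by rewrite ltxx subrr.
apply/eqP; rewrite eq_le measure_ge0 andbT.
move: muA; rewrite (etrans (muE _ mA) (mE A)) => /eqP.
rewrite mule_eq0 /= eqe invr_eq0 gt_eqF//= => /eqP H.
by rewrite -H leeDl.
Qed.

(** Adding [M x] makes the clamped function nondecreasing. Its Stieltjes measure is absolutely
    continuous by [stieltjes_dominated], and the Radon-Nikodym density minus [M] on []a, b]] is the
    required [g]. Lebesgue's differentiation theorem then identifies [g] with the derivative of [f]
    almost everywhere. *)
Lemma lipschitz_ftc (f : R -> R) (a b L : R) : a < b ->
  (forall x y, a <= x <= b -> a <= y <= b -> `|f x - f y| <= L * `|x - y|) ->
  exists g : R -> R, [/\ measurable_fun [set: measurableTypeR R] g,
    mu.-integrable setT (EFin \o g),
    forall y, f (clamp a b y) - f a = \int[mu]_(t in `]a, y]%classic) g t &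
    {ae mu, forall y, a < y < b -> derivable f y 1 /\ derive1 f y = g y}].
Proof.
move=> ab lipf.
(* [L] may be 0, whereas the domination needs a positive factor. *)
pose M := `|L| + 1.
have M0 : 0 < M by rewrite ltr_pwDr.
pose F y := f (clamp a b y).
have lipF x y : x <= y -> `|F y - F x| <= M * (y - x).
  move=> xy; have /andP[c0 c1] := clamp_lip (ltW ab) xy.
  apply: (le_trans (lipf _ _ (clamp_itv _ (ltW ab)) (clamp_itv _ (ltW ab)))).
  rewrite (ger0_norm c0) (@le_trans _ _ (M * (clamp a b y - clamp a b x)))//.
    by rewrite ler_wpM2r// /M (le_trans (ler_norm L))// lerDl.
  by rewrite ler_wpM2l// ltW.
have nd s : `|s| = 1 -> {homo (fun x => M * x + s * F x) : x y / x <= y}.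
  move=> s1 x y xy; have := lipF _ _ xy.
  rewrite -[`|_|]mul1r -s1 -normrM ler_norml => /andP[? _]; lra.
have ct s : right_continuous (fun x => M * x + s * F x).
  apply: right_continuousW => x; apply: cvgD; first exact: cvgMr.
  apply: cvgMr; apply/cvgrPdist_le => e e0.
  near=> t.
  have [tx|xt] := leP t x.
    apply: (le_trans (lipF _ _ tx)); rewrite mulrC -ler_pdivlMr//.
    rewrite -[leLHS]ger0_norm ?subr_ge0//; near: t.
    by apply: cvgr_dist_le => //; rewrite divr_gt0.
  rewrite distrC; apply: (le_trans (lipF _ _ (ltW xt))); rewrite mulrC -ler_pdivlMr//.
  rewrite -[leLHS]ger0_norm ?subr_ge0 ?(ltW xt)// distrC; near: t.
  by apply: cvgr_dist_le => //; rewrite divr_gt0.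
pose G : cumulative R R := HB.pack (fun x => M * x + 1 * F x)
  (isCumulative.Build R _ R (fun x => M * x + 1 * F x) (nd 1 (normr1 _)) (@ct 1)).
pose H : cumulative R R := HB.pack (fun x => M * x + -1 * F x)
  (isCumulative.Build R _ R (fun x => M * x + -1 * F x) (nd (-1) (normrN1 _)) (@ct (-1))).
have GE x : G x = M * x + F x by rewrite /G /= mul1r.
have mab : measurable (`]a, b]%classic : set (measurableTypeR R)).
  exact: measurable_itv.
pose nu0 := mrestr (lebesgue_stieltjes_measure G) mab.
have finnu0 : fin_num_fun nu0.
  move=> U mU; rewrite /nu0 /mrestr ge0_fin_numE//.
  apply: (@le_lt_trans _ _ (lebesgue_stieltjes_measure G `]a, b]%classic)).
    by apply: le_measure; rewrite ?inE//; exact: measurableI.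
  by rewrite stieltjes_itv ?ltry// ltW.
pose nu : {finite_measure set _ -> \bar R} := HB.pack_for
  (FiniteMeasure.type (measurableTypeR R) R) nu0 (Measure_isFinite.Build _ _ _ nu0 finnu0).
have numu : nu `<< mu.
  apply/null_content_dominatesP => A mA muA.
  have : lebesgue_stieltjes_measure G A = 0%E.
    apply: (@stieltjes_dominated G H (2 * M)) => //; first by rewrite mulr_gt0.
    by move=> x /=; ring.
  move=> GA; apply/eqP; rewrite eq_le measure_ge0 andbT -GA.
  by apply: le_measure; rewrite ?inE//; exact: measurableI.
have [rho [rho0 rhof irho nuE]] := radon_nikodym_sigma_finite numu.
pose r x := fine (rho x).
have rE x : (r x)%:E = rho x by rewrite /r fineK.
have ir : mu.-integrable setT (EFin \o r).
  by apply: eq_integrable irho => // x _; rewrite /= rE.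
pose g x := r x - M * \1_(`]a, b]%classic) x.
have ii : mu.-integrable setT (EFin \o (fun x => M * \1_(`]a, b]%classic : set R) x)).
  rewrite (_ : _ \o _ = (fun x => M%:E * (\1_(`]a, b]%classic : set R) x)%:E)%E) //.
  by apply: integrableZl => //; apply: integrable_indic_itv.
have ig : mu.-integrable setT (EFin \o g).
  rewrite (_ : _ \o _ = ((EFin \o r) \- (EFin \o (fun x => (M * \1_(`]a, b]%classic : set R) x)%R)))%E) //.
  exact: integrableB.
have FE y : F y - f a = \int[mu]_(t in `]a, y]%classic) g t.
  rewrite RintegralB//; [|exact: integrableS ir|exact: integrableS ii].
  have Hmin : `]a, y]%classic `&` `]a, b]%classic = `]a, clamp a b y]%classic.
    apply/seteqP; split => z /=; rewrite !in_itv/= /clamp.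
      by move=> [/andP[-> zy] /andP[_ zb]]; rewrite le_max le_min zy zb orbT.
    rewrite le_max le_min => /andP[az /orP[za|/andP[zy zb]]]; last by rewrite az zy zb.
    by move: az; rewrite ltNge za.
  have /andP[cl1 cl2] := clamp_itv y (ltW ab).
  have -> : \int[mu]_(t in `]a, y]) r t = G (clamp a b y) - G a.
    rewrite /Rintegral; under eq_integral do rewrite rE.
    rewrite -nuE//= /nu0 /mrestr Hmin stieltjes_itv//.
  have -> : \int[mu]_(t in `]a, y]) (M * \1_(`]a, b]%classic : set R) t) = M * (clamp a b y - a).
    rewrite RintegralZl//; last first.
      by apply: (@integrableS _ _ _ mu setT) => //; apply: integrable_indic_itv.
    congr (_ * _); rewrite /Rintegral integral_indic//= setIC Hmin.
    rewrite lebesgue_measure_itv/= lte_fin.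
    move: cl1; rewrite le_eqVlt => /predU1P[<-|->//].
    by rewrite ltxx subrr.
  rewrite !GE /F (@clamp_id a b (clamp a b y)) ?clamp_itv ?(ltW ab)//.
  by rewrite (@clamp_id a b a) ?lexx ?(ltW ab)//; ring.
exists g; split => //.
- by apply/measurable_EFinP; case/integrableP: ig.
- have := lebesgue_differentiation (open_integrable_locally openT ig).
  have FF := ae_filter_ringOfSetsType mu.
  apply: filterS => y gy /andP[ay yb].
  have [||dF dFE] := @FTC1_lebesgue_pt R g (BRight a) y b yb _ _ gy.
    by apply: integrableS ig.
    by [].

  have nE : {near y, (fun z => \int[mu]_(t in `]a, z]) g t + f a) =1 f}.
    have yab : y \in `]a, b[ by rewrite in_itv/= ay.
    near=> z; rewrite -FE subrK /F clamp_id//.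
    have : z \in `]a, b[ by near: z; exact: near_in_itvoo.
    by rewrite in_itv/= => /andP[/ltW-> /ltW->].
  split.
    apply: near_eq_derivable nE _; apply: derivableD => //.
  rewrite derive1E -(near_eq_derive _ nE)// deriveD//.
  by rewrite derive_cst addr0 -derive1E dFE.
Unshelve. all: by end_near.
Qed.

End lipschitz_ftc.

(** * The weight and the test functions *)

Record exponent (R : realType) := Exponent {
  exponent_val :> R; exponent_itv : 0 < exponent_val <= 1 }.

Section weight.
Context {R : realType} (l : exponent R).
Implicit Types x y : R.

Lemma exponent_gt0 : 0 < l :> R.
Proof. by case/andP: (exponent_itv l). Qed.

Lemma exponent_le1 : l <= 1 :> R.
Proof. by case/andP: (exponent_itv l). Qed.

Lemma exponent_neq0 : l != 0 :> R.
Proof. by rewrite gt_eqF// exponent_gt0. Qed.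

(** The power x^l extended by 0 to negative x. It serves both as weight and as modulus of continuity
    of the test functions, and lets all integrals run over the whole line. *)
Definition pw x := (Num.max x 0) `^ l.

Lemma pw_ge0 x : 0 <= pw x. Proof. exact: powR_ge0. Qed.

Lemma pw_le0 x : x <= 0 -> pw x = 0.
Proof. by move=> x0; rewrite /pw (max_idPr x0) powR0// exponent_neq0. Qed.

Lemma pwE x : 0 <= x -> pw x = x `^ l.
Proof. by move=> x0; rewrite /pw (max_idPl x0). Qed.

Lemma pw0 : pw 0 = 0. Proof. exact: pw_le0. Qed.

Lemma pw_gt0 x : 0 < x -> 0 < pw x.
Proof. by move=> x0; rewrite (pwE (ltW x0)) powR_gt0. Qed.

Lemma pw_mono : {homo pw : x y / x <= y}.
Proof.
move=> x y xy; rewrite /pw; apply: ge0_ler_powR; rewrite ?nnegrE.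
- exact/ltW/exponent_gt0.
- by rewrite le_max lexx orbT.
- by rewrite le_max lexx orbT.
- by rewrite ge_max !le_max xy lexx orbT.
Qed.

Lemma pw1 : pw 1 = 1. Proof. by rewrite pwE// powR1. Qed.

Lemma pwM x y : 0 <= x -> 0 <= y -> pw (x * y) = pw x * pw y.
Proof. by move=> x0 y0; rewrite !pwE ?mulr_ge0// powRM. Qed.

Lemma pw_le_self x : 0 <= x <= 1 -> x <= pw x.
Proof.
move=> /andP[]; rewrite le_eqVlt => /predU1P[<- _|x0 x1]; first by rewrite pw0.
by rewrite (pwE (ltW x0)) ger1_powR ?x0// exponent_le1.
Qed.

(** For s = x + y and z in [0, s], the inequality t <= t^l on [0, 1] gives (z / s) s^l <= z^l; the
    cases z = x and z = y add up to the claim. *)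
Lemma pw_subadd x y : 0 <= x -> 0 <= y -> pw (x + y) <= pw x + pw y.
Proof.
move=> x0 y0; have [->|xy0] := eqVneq (x + y) 0.
  by rewrite pw0 addr_ge0// pw_ge0.
have s0 : 0 < x + y by rewrite lt_def xy0 addr_ge0.
have H z : 0 <= z <= x + y -> z / (x + y) * pw (x + y) <= pw z.
  move=> /andP[z0 zs].
  rewrite -[X in _ <= pw X](divfK xy0 z) (@pwM (z / (x + y)) _ (divr_ge0 z0 (ltW s0)) (ltW s0)).
  rewrite ler_wpM2r ?pw_ge0// pw_le_self// (divr_ge0 z0 (ltW s0))/=.
  by rewrite ler_pdivrMr// mul1r.
have := lerD (H x _) (H y _); rewrite -mulrDl -mulrDl divff// mul1r; apply.
  by rewrite x0 lerDl.
by rewrite y0 lerDr.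
Qed.

Lemma pw_dist x y : `|pw x - pw y| <= pw `|x - y|.
Proof.
wlog xy : x y / y <= x.
  move=> H; have [|/ltW] := leP y x; first exact: H.
  by move=> /H; rewrite distrC [`|x - y|]distrC.
rewrite !ger0_norm ?subr_ge0 ?pw_mono//.
have [y0|y0] := leP y 0.
  by rewrite (pw_le0 y0) subr0 pw_mono// lerDl oppr_ge0.
rewrite lerBlDr -[X in pw X <= _](subrK y) pw_subadd ?subr_ge0//.
exact: ltW.
Qed.

(** Turns the growth (x + y)^l of the kernel times the gain min(x^l, y^l) of [coag_op] into a
    product; this is why the coagulation term is finite with the moment of order l alone. *)
Lemma pw_add_min x y : 0 <= x -> 0 <= y ->
  pw (x + y) * Num.min (pw x) (pw y) <= 2 * (pw x * pw y).
Proof.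
move=> x0 y0; have := pw_subadd x0 y0; have := pw_ge0 x; have := pw_ge0 y.
move: (pw x) (pw y) (pw (x + y)) => a b s b0 a0 sab.
have [ab|/ltW ba] := leP a b.
  apply: (@le_trans _ _ ((a + b) * a)); first exact: ler_wpM2r.
  by have := ler_wpM2l a0 ab; nra.
apply: (@le_trans _ _ ((a + b) * b)); first exact: ler_wpM2r.
by have := ler_wpM2l b0 ba; nra.
Qed.

Lemma cvg_pw0 : pw z @[z --> (0 : R)] --> (0 : R).
Proof.
apply/cvgrPdist_le => e e0.
have d0 : 0 < e `^ ((l : R)^-1) by rewrite powR_gt0.
have c0 : (z : R) @[z --> (0 : R)] --> (0 : R) by exact: cvg_id.
have /cvgrPdist_le/(_ _ d0) h := c0.
near=> z; rewrite sub0r normrN ger0_norm ?pw_ge0//.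
have ze : z <= e `^ ((l : R)^-1).
  rewrite (le_trans (ler_norm _))// -normrN -sub0r; near: z.
by rewrite (le_trans (pw_mono ze))// pwE ?powR_ge0// -powRrM mulVf ?exponent_neq0// powRr1// ltW.
Unshelve. all: by end_near. Qed.

Lemma cvg_norm_sub (x : R) : `|x - z| @[z --> x] --> (0 : R).
Proof.
have -> : (0 : R) = `|x - x| by rewrite subrr normr0.
by apply: cvg_norm; apply: cvgB; [exact: cvg_cst|exact: cvg_id].
Qed.

Lemma holder_continuous (f : R -> R) (B : R) :
  (forall x y, `|f x - f y| <= B * pw `|x - y|) -> continuous f.
Proof.
move=> fB x; apply/cvgrPdist_le => e e0.
have c0 : B * pw `|x - z| @[z --> x] --> (0 : R).
  rewrite -(mulr0 B); apply: cvgMr.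
  exact: (cvg_comp _ _ (cvg_norm_sub x) cvg_pw0).
have /cvgrPdist_le/(_ _ e0) := c0.
apply: filterS => z; rewrite sub0r normrN => h.
exact: le_trans (fB _ _) (le_trans (ler_norm _) h).
Qed.

Lemma continuous_pw : continuous pw.
Proof. by apply: (@holder_continuous _ 1) => x y; rewrite mul1r pw_dist. Qed.

Lemma measurable_pw : measurable_fun setT pw.
Proof. by apply: continuous_measurable_fun; exact: continuous_pw. Qed.

End weight.

Section moments.
Context {R : realType} (l : exponent R).
Implicit Types (c : {measure set R -> \bar R}) (f g phi : R -> R) (B : R).
Notation pw := (pw l).

(** Sigma-finiteness does not follow from the moment, since [pw] vanishes on ]-oo, 0]. That
    half-line may be charged here: an Euler step puts fragments of size 0 at the origin. *)
Definition has_moment c :=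
  sigma_finite setT c /\ c.-integrable setT (EFin \o pw).

Definition mass c : R := \int[c]_x pw x.

(* In particular [g] vanishes on ]-oo, 0], so that its integrals over R and over
   ]0, +oo[ coincide. *)
Definition pw_bounded B g := measurable_fun setT g /\ forall x, `|g x| <= B * pw x.

Definition holder B phi :=
  (forall x, x <= 0 -> phi x = 0) /\
  forall x y, `|phi x - phi y| <= B * pw `|x - y|.

Lemma holder_pw_bounded B phi : holder B phi -> pw_bounded B phi.
Proof.
move=> [p0 pB]; split.
  by apply: continuous_measurable_fun; exact: (holder_continuous pB).
move=> x; have [x0|x0] := leP x 0; first by rewrite p0// normr0 pw_le0 ?mulr0.
by have := pB x 0; rewrite (p0 0)// !subr0 (gtr0_norm x0).
Qed.

Lemma pw_boundedM B k f : pw_bounded B f -> pw_bounded (`|k| * B) (fun x => k * f x).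
Proof.
move=> [mf fB]; split; first exact: measurable_funM.
by move=> x; rewrite normrM -mulrA ler_wpM2l.
Qed.

Lemma pw_boundedB B1 B2 f g : pw_bounded B1 f -> pw_bounded B2 g ->
  pw_bounded (B1 + B2) (fun x => f x - g x).
Proof.
move=> [mf fB] [mg gB]; split; first exact: measurable_funB.
by move=> x; rewrite mulrDl (le_trans (ler_normB _ _))// lerD.
Qed.

Lemma pw_bounded_pw : pw_bounded 1 pw.
Proof.
by split; [exact: measurable_pw|move=> x; rewrite mul1r ger0_norm// pw_ge0].
Qed.

Lemma pw_bounded_integrable c B g : has_moment c -> pw_bounded B g ->
  c.-integrable setT (EFin \o g).
Proof.
move=> [_ ic] [mg gB].
apply: (@integrable_le _ _ _ c g (fun x => B * pw x)) => //.
by rewrite (_ : _ \o _ = (fun x => B%:E * (EFin \o pw) x)%E) //; apply: integrableZl.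
Qed.

Lemma mass_ge0 c : 0 <= mass c.
Proof. by apply: Rintegral_ge0 => x _; exact: pw_ge0. Qed.

Lemma pairingB c B1 B2 f g : has_moment c -> pw_bounded B1 f -> pw_bounded B2 g ->
  \int[c]_x (f x - g x) = \int[c]_x f x - \int[c]_x g x.
Proof.
by move=> mc bf bg; rewrite RintegralB//; [exact: pw_bounded_integrable bf|exact: pw_bounded_integrable bg].
Qed.

Lemma pairingZ c B k f : has_moment c -> pw_bounded B f ->
  \int[c]_x (k * f x) = k * \int[c]_x f x.
Proof.
by move=> mc bf; rewrite RintegralZl//; exact: pw_bounded_integrable bf.
Qed.

Lemma pairing_le c B1 B2 f g : has_moment c -> pw_bounded B1 f -> pw_bounded B2 g ->
  (forall x, f x <= g x) -> \int[c]_x f x <= \int[c]_x g x.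
Proof.
by move=> mc bf bg fg; apply: le_Rintegral_setT => //; [exact: pw_bounded_integrable bf|exact: pw_bounded_integrable bg].
Qed.

Lemma pairing_bound c B f : has_moment c -> pw_bounded B f ->
  `|\int[c]_x f x| <= B * mass c.
Proof.
move=> mc bf; apply: (le_trans (le_normr_Rintegral _ _)) => //.
  exact: pw_bounded_integrable bf.
rewrite -(pairingZ B mc pw_bounded_pw).
apply: (@pairing_le c B B) => //.
- by case: bf => mf fB; split; [exact: measurableT_comp|move=> x; rewrite normr_id].
- have [mf fB] := bf; split; first exact: measurable_funM (measurable_cst _) (measurable_pw l).
  move=> x; rewrite ger0_norm// (le_trans _ (fB x))//.
- by case: bf.
Qed.

End moments.

(** * Tails and the distance between measures *)

Section tails.
Context {R : realType} (l : exponent R).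
Notation mu := (@lebesgue_measure R).
Implicit Types (c d : {measure set R -> \bar R}) (x y z : R).
Notation pw := (pw l).
Notation lam := (exponent_val l).

(** The derivative of [pw]. Its value 0 on ]-oo, 0] discards the points where a tail may be
    infinite, and its real-valued integral a default value. *)
Definition dpw (z : R) : R := if 0 < z then lam * z `^ (lam - 1) else 0.

Lemma dpw_ge0 z : 0 <= dpw z.
Proof.
rewrite /dpw; case: ifP => // _.
by rewrite mulr_ge0 ?powR_ge0// ltW// exponent_gt0.
Qed.

Lemma measurable_dpw : measurable_fun [set: measurableTypeR R] dpw.
Proof.
apply: measurable_fun_ifT => //.
  apply: measurable_fun_ltr => //.
by apply: measurable_funM => //; exact: measurable_powR.
Qed.

Lemma is_derive_pw z : 0 < z -> is_derive z 1 pw (dpw z).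
Proof.
move=> z0.
have nE : {near z, (@powR R ^~ lam) =1 pw}.
  near=> y; rewrite pwE//; apply: ltW; near: y; exact: lt_nbhsr.
have zi : z \in `]0, +oo[ by rewrite in_itv/= z0.
have dz := @derivable_powR R 1 lam z zi.
apply: DeriveDef; first exact: near_eq_derivable nE _.
rewrite -(near_eq_derive _ nE)// -derive1E powR_derive1//.
by rewrite /dpw z0.
Unshelve. all: by end_near. Qed.

Lemma integral_dpw_itv (a y : R) : 0 < a -> a < y ->
  (\int[mu]_(z in `[a, y]) (dpw z)%:E = (pw y - pw a)%:E)%E.
Proof.
move=> a0 ay; rewrite (@continuous_FTC2 R dpw pw a y) //.
- apply: (@continuous_in_subspaceT _ _ `[a, y]%classic) => z /set_mem/=; rewrite in_itv/= => /andP[az zy].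
  have z0 := lt_le_trans a0 az.
  have nE : {near z, (fun z => lam * z `^ (lam - 1)) =1 dpw}.
    near=> t; rewrite /dpw ifT//; near: t; exact: lt_nbhsr.
  have zi : z \in `]0, +oo[ by rewrite in_itv/= z0.
  apply: (@cvg_trans _ (nbhs (dpw z))) => //.
  rewrite -(nbhs_singleton nE); apply: cvg_trans.
    apply: near_eq_cvg; exact: nE.
  apply: cvgMr.
  have : {for z, continuous (@powR R ^~ (lam - 1))}.
    apply: differentiable_continuous; apply/derivable1_diffP.
    exact: derivable_powR.
  exact.
- split.
  + move=> z; rewrite in_itv/= => /andP[az _].
    by have [] := is_derive_pw (lt_trans a0 az).
  + by apply: cvg_at_right_filter; exact: continuous_pw.
  + by apply: cvg_at_left_filter; exact: continuous_pw.
- move=> z; rewrite in_itv/= => /andP[az _].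
  rewrite derive1E.
  by have [_ ->] := is_derive_pw (lt_trans a0 az).
Unshelve. all: by end_near. Qed.

Definition lt01 (x y : R) : R := (x < y)%R%:R.

(** [dpw] may blow up at 0, so the fundamental theorem of calculus is applied on [y / (n + 2), y]
    and n is sent to infinity by monotone convergence. *)
Lemma integral_dpw (y : R) :
  (\int[mu]_z (dpw z * lt01 z y)%:E = (pw y)%:E)%E.
Proof.
have [y0|y0] := leP y 0.
  rewrite pw_le0// integral0_eq// => z _; rewrite /dpw /lt01; case: ifPn; rewrite ?mul0r// => z0.
  by rewrite ltNge (le_trans y0 (ltW z0)) mulr0.
pose F n := `[y / n.+2%:R, y]%classic : set (measurableTypeR R).
have yn n : 0 < y / n.+2%:R < y.
  by rewrite divr_gt0//= ltr_pdivrMr// ltr_pMr// ltr1n.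
have FU : \bigcup_n F n = `]0, y]%classic.
  apply/seteqP; split => z.
    move=> [n _]; rewrite /F /= !in_itv/= => /andP[h ->]; rewrite andbT.
    by apply: lt_le_trans h; case/andP: (yn n).
  rewrite /= in_itv/= => /andP[z0 zy].
  exists (Num.truncn (y / z)) => //; rewrite /F/= in_itv/= zy andbT.
  rewrite ler_pdivrMr// mulrC -ler_pdivrMr// ltW//.
  apply: lt_le_trans (truncnS_gt _) _ => //.
  by rewrite ler_nat.
have mw : measurable_fun setT (fun z => (dpw z)%:E) by apply/measurable_EFinP; exact: measurable_dpw.
have := @ge0_nondecreasing_set_cvg_integral _ _ _ F (fun z => (dpw z)%:E) mu.
rewrite FU => H.
transitivity (\int[mu]_(z in `]0%R, y]) (dpw z)%:E)%E.
  rewrite -integral_itv_bndo_bndc; last exact: measurable_funTS.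
  rewrite [RHS]integral_mkcond; apply: eq_integral => z _.
  rewrite patchE /lt01; case: ifPn => [/set_mem|/negP h].
    by rewrite /= in_itv/= => /andP[_ ->]; rewrite mulr1.
   have [zy|] := ltP z y; last by rewrite mulr0.
  rewrite /dpw; case: ifPn => // z0; last by rewrite mul0r.
  by exfalso; apply: h; apply/mem_set; rewrite /= in_itv/= z0.
have {}H : (\int[mu]_(z in F n) (dpw z)%:E @[n --> \oo] -->
    \int[mu]_(z in `]0%R, y]) (dpw z)%:E)%E.
  apply: H.
  - move=> n m nm; apply/subsetPset => z; rewrite /F/= !in_itv/= => /andP[h ->].
    rewrite andbT (le_trans _ h)// ler_pM2l// lef_pV2 ?posrE//.
    by rewrite ler_nat !ltnS.
  - by move=> n; exact: measurable_itv.
  - by move=> n; exact: measurable_funTS.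
  - by move=> n z _; rewrite lee_fin dpw_ge0.
rewrite -(cvg_lim _ H)//; apply/cvg_lim => //.
have -> : (fun n => \int[mu]_(z in F n) (dpw z)%:E)%E =
    (fun n : nat => (pw y - pw (y / n.+2%:R))%:E).
  apply/funext => n; have /andP[h1 h2] := yn n.
  by rewrite (integral_dpw_itv h1 h2).
apply/fine_cvgP; split; first by near=> n.
rewrite /comp/= -[X in _ --> X]subr0; apply: cvgB; first exact: cvg_cst.
have n0 : y / n.+2%:R @[n --> \oo] --> (0 : R).
  rewrite -(mulr0 y); apply: cvgMr.
  have := @cvg_harmonic R; rewrite -(cvg_shiftS) /=; exact.
exact: (cvg_comp _ _ n0 (cvg_pw0 l)).
Unshelve. all: by end_near. Qed.

Definition tail c z : R := \int[c]_y lt01 z y.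

Lemma measurable_lt_prod : measurable_fun [set: measurableTypeR R * R]
  (fun p : measurableTypeR R * R => lt01 p.1 p.2).
Proof.
have -> : (fun p : measurableTypeR R * R => lt01 p.1 p.2) =
   (fun p => if (p.1 : R) < p.2 then 1 else 0 : R).
  by apply/funext => p; rewrite /lt01; case: ifP.
apply: measurable_fun_ifT => //; apply: measurable_fun_ltr.
  exact: measurable_fst.
exact: measurable_snd.
Qed.

Lemma measurable_gt z : measurable_fun setT (fun y : R => lt01 z y).
Proof.
by apply: (measurable_fun_pair2 (f := fun p : measurableTypeR R * R => lt01 p.1 p.2)); exact: measurable_lt_prod.
Qed.

Lemma integrable_gt c z : 0 < z -> has_moment l c ->
  c.-integrable setT (fun y => (lt01 z y)%:E).
Proof.
move=> z0 mc; apply: (@pw_bounded_integrable _ l _ ((pw z)^-1) (fun y => lt01 z y)) => //.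
split; first exact: measurable_gt.
move=> x; rewrite /lt01 ger0_norm// mulrC ler_pdivlMr ?pw_gt0//.
by case: ltP => zx; rewrite ?mul1r ?mul0r ?pw_ge0// pw_mono// ltW.
Qed.

Lemma tail_ge0 c z : 0 <= tail c z.
Proof. by apply: Rintegral_ge0 => y _. Qed.

Lemma tailE c z : 0 < z -> has_moment l c -> (tail c z)%:E = c `]z, +oo[%classic.
Proof.
move=> z0 mc; rewrite /tail Rintegral_EFin; last exact: integrable_gt.
rewrite -[X in _ = c X]setIT -integral_indic//.
apply: eq_integral => y _; congr _%:E; rewrite indicE /lt01.
have [zy|zy] := ltP z y; first by rewrite mem_set//= in_itv/= zy.
by rewrite memNset//= in_itv/= ltNge zy.
Qed.

(** Fubini for the primitive of [g]. That [g] vanishes below a > 0 provides the product bound |g z|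
    1(a < y), integrable even when [c] has infinite mass near 0. *)
Lemma pairing_tail c (g : R -> R) (a : R) : has_moment l c -> 0 < a ->
  mu.-integrable setT (EFin \o g) -> (forall z, z <= a -> g z = 0) ->
  mu.-integrable setT (EFin \o (fun z => g z * tail c z)) /\
  \int[c]_y \int[mu]_z (g z * lt01 z y) = \int[mu]_z (g z * tail c z).
Proof.
move=> mc a0 ig g0.
have [sc _] := mc.
have smu : sigma_finite setT mu by exact: sigma_finiteT.
pose f (p : measurableTypeR R * R) := g p.1 * lt01 p.1 p.2.
have mf : measurable_fun setT f.
  apply: measurable_funM; last exact: measurable_lt_prod.
  apply: measurableT_comp; last exact: measurable_fst.
  by apply/measurable_EFinP; case/integrableP: ig.
have ign : mu.-integrable setT (EFin \o (fun z => `|g z|)) by exact: integrable_norm.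
have iv := integrable_gt a0 mc.
have fuv (z : measurableTypeR R) (y : R) : `|f (z, y)| <= `|g z| * lt01 a y.
  rewrite /f /= normrM; have [za|az] := leP z a; first by rewrite g0// normr0 !mul0r.
  rewrite ler_wpM2l// /lt01 ger0_norm//.
  by case: ltP => // zy; rewrite (lt_trans az zy).
have tE z : \int[c]_y f (z, y) = g z * tail c z.
  have [za|az] := leP z a.
    rewrite /f /= g0// mul0r; under eq_Rintegral do rewrite mul0r.
    by rewrite /Rintegral integral0.
  rewrite /f /= RintegralZl//; apply: integrable_gt => //.
  exact: lt_trans az.
split.
  have := @fubini_integrable_Rl _ _ _ _ R mu c smu sc f _ _ mf ign iv fuv.
  by apply: eq_integrable => // z _; rewrite /= tE.
rewrite -(@fubini_dominated _ _ _ _ R mu c smu sc f _ _ mf ign iv fuv).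
by apply: eq_Rintegral => z _; rewrite tE.
Qed.

(** Layer-cake formula: by Tonelli, the integral of [dpw] times the tail is that of [pw] against
    [c], hence finite. *)
Lemma integral_dpw_tail c : has_moment l c ->
  mu.-integrable setT (EFin \o (fun z => dpw z * tail c z)).
Proof.
move=> mc.
have [sc ic] := mc.
have smu : sigma_finite setT mu by exact: sigma_finiteT.
pose f (p : measurableTypeR R * R) := (dpw p.1 * lt01 p.1 p.2)%:E.
have f0 p : (0 <= f p)%E by rewrite lee_fin mulr_ge0 ?dpw_ge0 /lt01.
have mf : measurable_fun setT f.
  apply/measurable_EFinP/measurable_funM; last exact: measurable_lt_prod.
  by apply: measurableT_comp; [exact: measurable_dpw|exact: measurable_fst].
have tE z : (\int[c]_y f (z, y) = (dpw z * tail c z)%:E)%E.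
  rewrite /f /=; under eq_integral do rewrite EFinM.
  have [z0|z0] := leP z 0.
    rewrite /dpw ltNge z0/= mul0r; under eq_integral do rewrite mul0e.
    exact: integral0.
  rewrite integralZl//; last exact: integrable_gt.
  by rewrite EFinM /tail Rintegral_EFin//; exact: integrable_gt.
have := @fubini_tonelli _ _ _ _ R (sigma_finite_pack smu) (sigma_finite_pack sc) f mf f0.
have mF : measurable_fun setT (fubini_F (sigma_finite_pack sc) f) :=
  @measurable_fun_fubini_tonelli_F _ _ _ _ R (sigma_finite_pack sc) f mf f0.
have FE : fubini_F (sigma_finite_pack sc) f = (fun z => (dpw z * tail c z)%:E).
  by apply/funext => z; rewrite /fubini_F -tE.
rewrite FE in mF; move=> H; apply/integrableP; split; first exact: mF.
rewrite (_ : (\int[mu]_x `|_| = \int[mu]_x \int[c]_y f (x, y))%E); last first.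
  apply: eq_integral => z _; rewrite tE gee0_abs// lee_fin.
  by rewrite mulr_ge0 ?dpw_ge0 ?tail_ge0.
rewrite [X in (X < _)%E]H.
under eq_integral do rewrite integral_dpw.
by rewrite ltey_eq; apply/orP; left; exact: (integrable_fin_num measurableT ic).
Qed.

End tails.

Section gap.
Context {R : realType} (l : exponent R).
Notation mu := (@lebesgue_measure R).
Implicit Types (c d : {measure set R -> \bar R}) (x y z : R).
Notation pw := (pw l).
Notation dpw := (dpw l).

Definition gap c d z : R := tail c z - tail d z.

Definition dist c d : R := \int[mu]_z (dpw z * `|gap c d z|).

Definition locally_lipschitz (G : R -> R) := forall a b, 0 < a < b ->
  exists L, forall x y, a <= x <= b -> a <= y <= b -> `|G x - G y| <= L * `|x - y|.

Lemma integrable_gap c d : has_moment l c -> has_moment l d ->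
  mu.-integrable setT (EFin \o (fun z => dpw z * gap c d z)).
Proof.
move=> mc md.
rewrite (_ : _ \o _ = ((EFin \o (fun z => (dpw z * tail c z)%R)) \-
   (EFin \o (fun z => (dpw z * tail d z)%R)))%E); last first.
  by apply/funext => z; rewrite /= -EFinB /gap mulrBr.
by apply: integrableB => //; exact: integral_dpw_tail.
Qed.

Lemma integrable_abs_gap c d : has_moment l c -> has_moment l d ->
  mu.-integrable setT (EFin \o (fun z => dpw z * `|gap c d z|)).
Proof.
move=> mc md; have := integrable_norm (integrable_gap mc md).
apply: eq_integrable => // z _ /=; congr _%:E.
by rewrite normrM (ger0_norm (dpw_ge0 _ _)).
Qed.

Lemma dist_ge0 c d : 0 <= dist c d.
Proof. by apply: Rintegral_ge0 => z _; rewrite mulr_ge0// dpw_ge0. Qed.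

Lemma dist_sym c d : dist c d = dist d c.
Proof. by apply: eq_Rintegral => z _; rewrite /gap distrC. Qed.

Lemma dist_triangle c d e : has_moment l c -> has_moment l d -> has_moment l e ->
  dist c e <= dist c d + dist d e.
Proof.
move=> mc md me; rewrite /dist -RintegralD//; try exact: integrable_abs_gap.
apply: le_Rintegral_setT.
- exact: integrable_abs_gap.
- rewrite (_ : _ \o _ = ((EFin \o (fun z => (dpw z * `|gap c d z|)%R)) \+
     (EFin \o (fun z => (dpw z * `|gap d e z|)%R)))%E) //.
  by apply: integrableD => //; exact: integrable_abs_gap.
- move=> z; rewrite -mulrDr ler_wpM2l ?dpw_ge0//.
  by rewrite (le_trans _ (ler_normD _ _))// /gap subrKA.
Qed.

Definition oc01 (a b x : R) : R := (a < x <= b)%R%:R.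

Lemma measurable_oc01 a b : measurable_fun [set: measurableTypeR R] (oc01 a b).
Proof.
have -> : oc01 a b = \1_(`]a, b]%classic).
  apply/funext => z; rewrite indicE /oc01.
  case: (boolP (a < z <= b)) => h; first by rewrite mem_set//= in_itv.
  by rewrite memNset//= in_itv; exact/negP.
exact: measurable_indic.
Qed.

(** On [[a, b]] the function is the integral of its derivative [g], so that its pairing with c - d
    is the integral of [g] against the difference of the tails, to which the almost everywhere bound
    applies. *)
Lemma pairing_gap_le_itv c d (G : R -> R) (a b C : R) :
  has_moment l c -> has_moment l d -> 0 < a < b -> locally_lipschitz G ->
  {ae mu, forall y, 0 < y -> derivable G y 1 ->
     derive1 G y * gap c d y <= C * (dpw y * `|gap c d y|)} ->
  \int[c]_y (G (clamp a b y) - G a) - \int[d]_y (G (clamp a b y) - G a) <=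
  \int[mu]_z (C * (dpw z * `|gap c d z|) * oc01 a b z).
Proof.
move=> mc md ab lG aeG.
have [L lipG] := lG _ _ ab.
have /andP[a0 a_b] := ab.
have [g [mg ig gE aeg]] := lipschitz_ftc a_b lipG.
pose h z := g z * oc01 a b z.
have mh : measurable_fun [set: measurableTypeR R] h.
  by apply: measurable_funM => //; exact: measurable_oc01.
have ih : mu.-integrable setT (EFin \o h).
  apply: (@integrable_le _ _ _ mu h (fun z => `|g z|)) => //.
    exact: integrable_norm.
  move=> z; rewrite /h normrM -[leRHS]mulr1 ler_wpM2l// /oc01.
  by case: (_ && _); rewrite ?normr1 ?normr0.
have h0 z : z <= a -> h z = 0 by move=> za; rewrite /h /oc01 ltNge za mulr0.
have hE y : G (clamp a b y) - G a = \int[mu]_z (h z * lt01 z y).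
  have [yb|by_] := leP y b.
    rewrite gE -Rintegral_itv_bndo_bndc; last exact: integrableS ig.
    rewrite Rintegral_mkcond; apply: eq_Rintegral => z _.
    rewrite patchE /h /oc01 /lt01; case: ifPn => [/set_mem|/negP zn].
      by rewrite /= in_itv/= => /andP[az zy]; rewrite az zy (le_trans (ltW zy) yb) !mulr1.
    case: (boolP (a < z <= b)); case: (boolP (z < y)); rewrite ?mulr0 ?mul0r// => zy /andP[az zb].
    by exfalso; apply: zn; apply/mem_set; rewrite /= in_itv/= az.
  have -> : clamp a b y = clamp a b b.
    by rewrite /clamp (min_idPr (ltW by_)) minxx.
  rewrite gE Rintegral_mkcond; apply: eq_Rintegral => z _.
  rewrite patchE /h /oc01 /lt01; case: ifPn => [/set_mem|/negP zn].
    by rewrite /= in_itv/= => /andP[az zy]; rewrite az zy (le_lt_trans zy by_) !mulr1.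
  case: (boolP (a < z <= b)); rewrite ?mulr0 ?mul0r// => azb.
  by exfalso; apply: zn; apply/mem_set; rewrite /= in_itv.
have [ic ->] : mu.-integrable setT (EFin \o (fun z => h z * tail c z)) /\
    \int[c]_y (G (clamp a b y) - G a) = \int[mu]_z (h z * tail c z).
  have [ic <-] := pairing_tail mc a0 ih h0; split => //.
  by apply: eq_Rintegral => y _; rewrite hE.
have [id ->] : mu.-integrable setT (EFin \o (fun z => h z * tail d z)) /\
    \int[d]_y (G (clamp a b y) - G a) = \int[mu]_z (h z * tail d z).
  have [id <-] := pairing_tail md a0 ih h0; split => //.
  by apply: eq_Rintegral => y _; rewrite hE.
rewrite -RintegralB//.
have il : mu.-integrable setT (EFin \o (fun z => h z * tail c z - h z * tail d z)).
  rewrite (_ : _ \o _ = ((EFin \o (fun z => (h z * tail c z)%R)) \-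
     (EFin \o (fun z => (h z * tail d z)%R)))%E) //.
  exact: integrableB.
have igap := integrable_abs_gap mc md.
have mgap : measurable_fun setT (fun z : measurableTypeR R => dpw z * `|gap c d z|).
  by apply/measurable_EFinP; case/integrableP: igap.
have ir : mu.-integrable setT (EFin \o (fun z => C * (dpw z * `|gap c d z|) * oc01 a b z)).
  apply: (@integrable_le _ _ _ mu (fun z => C * (dpw z * `|gap c d z|) * oc01 a b z) (fun z => `|C| * (dpw z * `|gap c d z|))).
  - apply: measurable_funM; last exact: measurable_oc01.
    exact: measurable_funM.
  - rewrite (_ : _ \o _ = (fun z => `|C|%:E * (EFin \o (fun z => (dpw z * `|gap c d z|)%R)) z)%E) //.
    exact: integrableZl.
  - move=> z; rewrite !normrM normr_id (ger0_norm (dpw_ge0 _ _)) -[leRHS]mulr1 ler_wpM2l//.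
      by rewrite !mulr_ge0// dpw_ge0.
    by rewrite /oc01; case: (_ && _); rewrite ?normr1 ?normr0.
apply: le_Rintegral_ae => //.
have FF := ae_filter_ringOfSetsType mu.
(* The derivative of [G] is identified on the open interval only. *)
have aeb : {ae mu, forall z, z != b}.
  exists [set b]; split => //; first exact: lebesgue_measure_set1.
  by move=> z /= /negP; rewrite negbK => /eqP.
apply: filterS3 aeb aeg aeG => z zb g1 g2; rewrite -mulrBr /h /oc01.
case: (boolP (a < z <= b)) => [/andP[az]|_]; last by rewrite !mulr0 mul0r.
rewrite le_eqVlt !mulr1 (negPf zb)/= => zltb.
have zab : a < z < b by rewrite az.
by have [dz <-] := g1 zab; apply: g2 => //; exact: lt_trans az.
Qed.

Let cutoff (n : nat) : 0 < (n.+2%:R : R)^-1 < n.+2%:R.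
Proof.
rewrite invr_gt0 ltr0n/= (@lt_trans _ _ 1)//; last by rewrite ltr1n.
by rewrite invf_lt1 ?ltr0n// ltr1n.
Qed.

Let near_cutoff (y : R) : 0 < y ->
  \forall n \near \oo, (n.+2%:R : R)^-1 < y < n.+2%:R.
Proof.
move=> y0; near=> n; apply/andP; split.
  rewrite -[ltRHS]invrK ltf_pV2 ?posrE ?invr_gt0 ?ltr0n//.
  apply: (@lt_trans _ _ n%:R); last by rewrite ltr_nat -addn2 -[ltnLHS]addn0 ltn_add2l.
  by near: n; exact: nbhs_infty_gtr.
apply: (@lt_trans _ _ n%:R); last by rewrite ltr_nat -addn2 -[ltnLHS]addn0 ltn_add2l.
by near: n; exact: nbhs_infty_gtr.
Unshelve. all: by end_near. Qed.

(** Subtracting the value at the lower cutoff makes the clamped function vanish below it. This gives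
    the majorant [2 B pw], uniform in n, although constants need not be integrable against [c]. *)
Let pairing_cutoff c (G : R -> R) B : has_moment l c -> pw_bounded l B G ->
  \int[c]_y (G (clamp n.+2%:R^-1 n.+2%:R y) - G n.+2%:R^-1) @[n --> \oo] --> \int[c]_y G y.
Proof.
move=> mc [mG GB].
have mpw : measurable_fun setT (fun y : R => 2 * B * pw y).
  by apply: measurable_funM => //; exact: measurable_pw.
have B0 : 0 <= B by have := GB 1; rewrite pw1 mulr1; apply: le_trans.
have ib : c.-integrable setT (EFin \o (fun y => 2 * B * pw y)).
  apply: (@pw_bounded_integrable _ l _ (2 * B)) => //; split => // x.
  by rewrite ger0_norm// !mulr_ge0// pw_ge0.
have mclamp a b : measurable_fun setT (fun y : R => clamp a b y).
  by apply: measurable_maxr => //; exact: measurable_minr.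
apply: (proj2 (@Rintegral_dct _ _ _ c _ _ (fun y => 2 * B * pw y) _ _ _ _ _)) => //.
- by move=> n; apply: measurable_funB => //; exact: measurableT_comp.
- apply: aeW => y; have [y0|y0] := leP y 0.
    have -> : G y = 0.
      by apply/eqP; rewrite -normr_le0 (le_trans (GB y))// pw_le0// mulr0.
    under eq_fun => n.
      have /andP[n0 n1] := cutoff n.
      rewrite /clamp (min_idPl _) ?(le_trans y0 (ltW (lt_trans n0 n1)))//.
      rewrite (max_idPl _) ?(le_trans y0 (ltW n0))// subrr.
      over.
    exact: cvg_cst.
  rewrite -[X in _ --> X]subr0; apply: cvgB.
    apply: cvg_near_cst; have := near_cutoff y0; apply: filterS => n /andP[h1 h2].
    by rewrite clamp_id// (ltW h1) (ltW h2).
  have c0 : B * pw n.+2%:R^-1 @[n --> \oo] --> (0 : R).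
    rewrite -(mulr0 B); apply: cvgMr.
    have n0 : (n.+2%:R)^-1 @[n --> \oo] --> (0 : R).
      have := @cvg_harmonic R; rewrite -(cvg_shiftS) /=; exact.
    exact: (cvg_comp _ _ n0 (cvg_pw0 l)).
  apply/cvgrPdist_le => e e0; have /cvgrPdist_le/(_ _ e0) := c0.
  apply: filterS => n; rewrite !sub0r !normrN => h.
  exact: le_trans (GB _) (le_trans (ler_norm _) h).
- apply: aeW => y n; have /andP[n0 n1] := cutoff n.
  have [yn|ny] := leP y n.+2%:R^-1.
    rewrite /clamp (min_idPl _) ?(le_trans yn (ltW n1))// (max_idPl _)// subrr normr0.
    by rewrite !mulr_ge0// pw_ge0.
  rewrite (le_trans (ler_normB _ _))// -mulrA mulr_natl mulr2n lerD//.
    rewrite (le_trans (GB _))// ler_wpM2l// pw_mono// /clamp ge_max (ltW ny)/=.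
    by rewrite ge_min lexx.
  by rewrite (le_trans (GB _))// ler_wpM2l// pw_mono// ltW.
Qed.

(* Integration by parts against the difference of tails, as an inequality: only
   the sign of [G' (c - d)(]y, oo[)] matters, which is what makes the estimate
   usable for kernels growing at infinity. *)
Lemma pairing_gap_le c d (G : R -> R) (B C : R) :
  has_moment l c -> has_moment l d -> pw_bounded l B G -> locally_lipschitz G ->
  {ae mu, forall y, 0 < y -> derivable G y 1 ->
     derive1 G y * gap c d y <= C * (dpw y * `|gap c d y|)} ->
  \int[c]_y G y - \int[d]_y G y <= C * dist c d.
Proof.
move=> mc md bG lG aeG.
have igap := integrable_abs_gap mc md.
have mgap : measurable_fun setT (fun z : measurableTypeR R => dpw z * `|gap c d z|).
  by apply/measurable_EFinP; case/integrableP: igap.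
have lim1 : \int[c]_y (G (clamp n.+2%:R^-1 n.+2%:R y) - G n.+2%:R^-1) -
    \int[d]_y (G (clamp n.+2%:R^-1 n.+2%:R y) - G n.+2%:R^-1) @[n --> \oo]
    --> \int[c]_y G y - \int[d]_y G y.
  by apply: cvgB; [exact: pairing_cutoff mc bG|exact: pairing_cutoff md bG].
have lim2 : \int[mu]_z (C * (dpw z * `|gap c d z|) * oc01 n.+2%:R^-1 n.+2%:R z) @[n --> \oo]
    --> \int[mu]_z (C * (dpw z * `|gap c d z|)).
  apply: (proj2 (@Rintegral_dct _ _ _ mu _ _ (fun z => `|C| * (dpw z * `|gap c d z|)) _ _ _ _ _)).
  - move=> n; apply: measurable_funM; last exact: measurable_oc01.
    exact: measurable_funM.
  - exact: measurable_funM.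
  - apply: aeW => z; have [z0|z0] := leP z 0.
      rewrite /dpw ltNge z0/= mul0r mulr0; under eq_fun do rewrite mul0r.
      exact: cvg_cst.
    apply: cvg_near_cst; have := near_cutoff z0; apply: filterS => n /andP[h1 h2].
    by rewrite /oc01 h1 (ltW h2) mulr1.
  - rewrite (_ : _ \o _ = (fun z => `|C|%:E * (EFin \o (fun z => (dpw z * `|gap c d z|)%R)) z)%E) //.
    exact: integrableZl.
  - apply: aeW => z n; rewrite !normrM normr_id (ger0_norm (dpw_ge0 _ _)) -[leRHS]mulr1 ler_wpM2l//.
      by rewrite !mulr_ge0// dpw_ge0.
    by rewrite /oc01; case: (_ && _); rewrite ?normr1 ?normr0.
rewrite -[leRHS]RintegralZl//.
have le12 := ler_cvg_to lim1 lim2.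
apply: le12; apply: nearW => n.
by apply: pairing_gap_le_itv => //; exact: cutoff.
Qed.

End gap.

(** * Primitives of signs and the optimal test function *)

Section primitive.
Context {R : realType} (l : exponent R).
Notation mu := (@lebesgue_measure R).
Implicit Types (c d : {measure set R -> \bar R}) (x y z : R).
Notation pw := (pw l).
Notation dpw := (dpw l).
Notation lam := (exponent_val l).

(** By uniqueness of Lebesgue measure, its image under the affine map, multiplied by [k], is
    Lebesgue measure again. The lemma serves to differentiate the optimal function at x + y and at
    theta_i x for almost every x. *)
Lemma ae_affine (P : R -> Prop) (k b : R) : 0 < k ->
  {ae mu, forall x, P x} -> {ae mu, forall x, P (k * x + b)}.
Proof.
move=> k0 [A [mA A0 PA]].
pose h (x : measurableTypeR R) : measurableTypeR R := k * x + b.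
have mh : measurable_fun setT h.
  by apply: measurable_funD => //; exact: measurable_funM.
have mhA B : measurable B -> measurable (h @^-1` B).
  by move=> mB; rewrite -[X in measurable X]setTI; exact: mh.
have [m [mE _]] := @ex_image_density _ _ _ _ R mu (cst k) h (measurable_cst _)
  (fun=> ltW k0) mh.
have {}mE B : measurable B -> m B = (k%:E * mu (h @^-1` B))%E.
  move=> mB; rewrite mE -[LHS]/(\int[mu]_(t in h @^-1` B) (cst k%:E) t)%E.
  by rewrite integral_cst//; exact: mhA.
have muE B : measurable B -> mu B = m B.
  apply: lebesgue_measure_unique => X [[u v] _ <-].
  rewrite mE//.
  have -> : h @^-1` `]u, v]%classic = `](u - b) / k, (v - b) / k]%classic.
    apply/seteqP; split => z; rewrite /h /= !in_itv/= ltr_pdivrMr// ler_pdivlMr//.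
      by move=> /andP[? ?]; apply/andP; split; lra.
    by move=> /andP[? ?]; apply/andP; split; lra.
  rewrite !lebesgue_measure_itv/= !lte_fin ltr_pM2r ?invr_gt0// ltrD2r.
  case: ifP => _; last by rewrite mule0.
  by rewrite -!EFinD -EFinM; congr _%:E; field; rewrite gt_eqF.
exists (h @^-1` A); split; first exact: mhA.
- have := muE _ mA; rewrite A0 mE// => /esym/eqP.
  by rewrite mule_eq0 /= eqe gt_eqF//= => /eqP.
- by move=> x /= Px; apply: PA.
Qed.

Lemma dpw_noninc x y : 0 < x -> x <= y -> dpw y <= dpw x.
Proof.
move=> x0 xy; rewrite /dpw x0 (lt_le_trans x0 xy) ler_pM2l ?exponent_gt0//.
have y0 := lt_le_trans x0 xy.
rewrite -opprB !powRN lef_pV2 ?posrE ?powR_gt0//.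
by apply: ge0_ler_powR => //; rewrite ?nnegrE ?subr_ge0 ?exponent_le1 ?(ltW x0) ?(ltW y0).
Qed.

Lemma pw_lip a b x y : 0 < a -> a <= x <= b -> a <= y <= b ->
  `|pw x - pw y| <= pw b / a * `|x - y|.
Proof.
move=> a0; wlog yx : x y / y <= x.
  move=> H xab yab; have [|/ltW] := leP y x; first by move=> /H; apply.
  by move=> /H; rewrite distrC [`|x - y|]distrC; apply.
move=> /andP[ax xb] /andP[ay yb].
have y0 := lt_le_trans a0 ay.
rewrite !ger0_norm ?subr_ge0 ?pw_mono//.
have -> : pw x = pw y * pw (x / y).
  by rewrite -pwM ?divr_ge0 ?(ltW y0) ?(le_trans (ltW a0) ax)// mulrC divfK// gt_eqF.
have h1 : pw (x / y) <= x / y.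
  by rewrite pwE ?ler1_powR ?divr_ge0 ?(ltW y0) ?(le_trans (ltW a0) ax)// ?exponent_le1// ler_pdivlMr// mul1r.
have -> : pw y * pw (x / y) - pw y = pw y * (pw (x / y) - 1) by ring.
apply: (@le_trans _ _ (pw y * ((x - y) / y))).
  rewrite ler_wpM2l ?pw_ge0//.
  have -> : (x - y) / y = x / y - 1 by field; rewrite gt_eqF.
  lra.
have -> : pw b / a * (x - y) = pw b * ((x - y) / a) by ring.
apply: ler_pM; rewrite ?pw_ge0 ?divr_ge0 ?subr_ge0 ?(ltW y0)//.
  exact: pw_mono.
by rewrite ler_wpM2l ?subr_ge0// lef_pV2 ?posrE.
Qed.

Section prim.
Variable s : R -> R.
Hypothesis ms : measurable_fun [set: measurableTypeR R] s.
Hypothesis s1 : forall z, `|s z| <= 1.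

Definition prim y : R := \int[mu]_z (dpw z * s z * lt01 z y).

Let mds : measurable_fun [set: measurableTypeR R] (fun z => dpw z * s z).
Proof. by apply: measurable_funM => //; exact: measurable_dpw. Qed.

Let mlt y : measurable_fun [set: measurableTypeR R] (fun z => lt01 z y).
Proof.
apply: (measurable_fun_pair1 (f := fun p : measurableTypeR R * R => lt01 p.1 p.2)).
exact: measurable_lt_prod.
Qed.

Let idpw y : mu.-integrable setT (EFin \o (fun z => dpw z * lt01 z y)).
Proof.
apply/integrableP; split.
  by apply/measurable_EFinP; apply: measurable_funM => //; exact: measurable_dpw.
under eq_integral => z _ do rewrite /= ger0_norm ?mulr_ge0 ?dpw_ge0 /lt01//.
by have := @integral_dpw _ l y; rewrite /lt01 => ->; rewrite ltry.
Qed.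

Let iprim y : mu.-integrable setT (EFin \o (fun z => dpw z * s z * lt01 z y)).
Proof.
apply: (@integrable_le _ _ _ mu (fun z => dpw z * s z * lt01 z y) (fun z => dpw z * lt01 z y)) => //.
  exact: measurable_funM.
move=> z; rewrite !normrM (ger0_norm (dpw_ge0 _ _)) /lt01 normr_nat ler_wpM2r//.
by rewrite -[leRHS]mulr1 ler_wpM2l// dpw_ge0.
Qed.

Lemma prim_le0 y : y <= 0 -> prim y = 0.
Proof.
move=> y0; rewrite /prim.
have -> : (fun z => dpw z * s z * lt01 z y) = cst 0.
  apply/funext => z; rewrite /dpw /lt01; case: ltP => z0; last by rewrite !mul0r.
  by rewrite ltNge (le_trans y0 (ltW z0)) mulr0.
by rewrite /Rintegral integral0.
Qed.

(** Stronger than the Hoelder bound, which it implies through [pw_dist]; the coupling inequality for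
    quantiles needs this form. *)
Lemma prim_dist x y : `|prim x - prim y| <= `|pw x - pw y|.
Proof.
wlog yx : x y / y <= x.
  move=> H; have [|/ltW] := leP y x; first by move=> /H; apply.
  by move=> /H; rewrite distrC [leRHS]distrC; apply.
rewrite (@ger0_norm _ (pw x - _)) ?subr_ge0 ?pw_mono//.
rewrite /prim -RintegralB//.
have pwI t : pw t = \int[mu]_z (dpw z * lt01 z t).
  by apply: EFin_inj; rewrite Rintegral_EFin// integral_dpw.
rewrite !pwI -RintegralB//.
apply: (le_trans (le_normr_Rintegral _ _)) => //.
  rewrite (_ : _ \o _ = ((EFin \o (fun z => (dpw z * s z * lt01 z x)%R)) \-
     (EFin \o (fun z => (dpw z * s z * lt01 z y)%R)))%E) //.
  exact: integrableB.
apply: le_Rintegral_setT.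
- rewrite (_ : _ \o _ = (abse \o (fun z => (dpw z * s z * lt01 z x - dpw z * s z * lt01 z y)%:E))) //.
  apply: integrable_abse.
  rewrite (_ : (fun z => _) = ((EFin \o (fun z => (dpw z * s z * lt01 z x)%R)) \-
     (EFin \o (fun z => (dpw z * s z * lt01 z y)%R)))%E) //.
  exact: integrableB.
- rewrite (_ : _ \o _ = ((EFin \o (fun z => (dpw z * lt01 z x)%R)) \-
     (EFin \o (fun z => (dpw z * lt01 z y)%R)))%E) //.
  exact: integrableB.
- move=> z; rewrite -!mulrBr !normrM (ger0_norm (dpw_ge0 _ _)).
  have h0 : 0 <= lt01 z x - lt01 z y.
    rewrite /lt01; case: (ltP z y) => zy; last by rewrite subr0.
    by rewrite (lt_le_trans zy yx) subrr.
  by rewrite (ger0_norm h0) ler_wpM2r// -[leRHS]mulr1 ler_wpM2l// dpw_ge0.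
Qed.

Lemma prim_holder : holder l 1 prim.
Proof.
split; first exact: prim_le0.
by move=> x y; rewrite mul1r (le_trans (prim_dist _ _))// pw_dist.
Qed.

Lemma prim_lipschitz : locally_lipschitz prim.
Proof.
move=> a b /andP[a0 _]; exists (pw b / a) => x y xab yab.
by apply: (le_trans (prim_dist _ _)); exact: pw_lip.
Qed.

Lemma prim_derive : {ae mu, forall y, derivable prim y 1 /\ derive1 prim y = dpw y * s y}.
Proof.
have lf : locally_integrable setT (fun z : measurableTypeR R => dpw z * s z).
  split; [exact: mds|exact: openT|].
  move=> K _ cK.
  have [M [_ HM]] := compact_bounded cK.
  pose b := `|M| + 1.
  have Kb z : K z -> z < b + 1.
    move=> Kz; apply: (@le_lt_trans _ _ b); last by rewrite ltrDl.
    apply: (le_trans (ler_norm _)); apply: (HM b) => //.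
    by rewrite /b (le_lt_trans (ler_norm M))// ltrDl.
  have := integrable_lty measurableT (integrable_abse (iprim (b + 1))).
  apply: le_lt_trans.
  rewrite [leLHS]integral_mkcond; apply: ge0_le_integral => //.
  - by move=> z _; rewrite patchE; case: ifP.
  - apply/(measurable_restrictT _ _).1; first exact: compact_measurable.
    by apply/measurable_EFinP; apply: measurableT_comp => //; exact: measurable_funTS.
  - by apply: measurableT_comp => //; apply/measurable_EFinP; exact: measurable_funM.
  - move=> z _; rewrite patchE; case: ifPn => [/set_mem Kz|_] /=; last by rewrite lee_fin.
    by rewrite /= /lt01 Kb// mulr1.
have := lebesgue_differentiation lf.
have FF := ae_filter_ringOfSetsType mu.
apply: filterS => y gy.
have iy u : mu.-integrable [set` Interval -oo%O (BRight u)] (EFin \o (fun z => dpw z * s z)).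
  apply: (@eq_integrable _ _ _ mu _ _ (EFin \o (fun z => dpw z * s z * lt01 z (u + 1)))) => //.
    move=> z /set_mem; rewrite /= in_itv/= => zu.
    by rewrite /lt01 (le_lt_trans zu) ?ltrDl// mulr1.
  exact: integrableS (iprim _).
have [//||dF dFE] := @FTC1_lebesgue_pt R (fun z => dpw z * s z) -oo%O y (y + 1) _ (iy _) _ gy.
  by rewrite ltrDl.
  exact: ltNyr.
suff -> : prim = (fun y => \int[mu]_(t in [set` Interval -oo%O (BRight y)]) (dpw t * s t)).
  by [].
apply/funext => t; rewrite /prim -Rintegral_itv_bndo_bndc; last first.
  by apply: (@integrableS _ _ _ mu [set` Interval -oo%O (BRight t)]) => //; apply: subset_itvl; rewrite bnd_simp.
rewrite [RHS]Rintegral_mkcond; apply: eq_Rintegral => z _.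
rewrite patchE /lt01; case: ifPn => [/set_mem|/negP zt].
  by rewrite /= in_itv/= => ->; rewrite mulr1.
case: ltP; rewrite ?mulr0// => zlt; exfalso; apply: zt; apply/mem_set.
by rewrite /= in_itv.
Qed.

(** Any [s] bounded by 1 yields a lower bound of the distance. It is applied with the sign taken at
    one time and the measures at an earlier one. *)
Lemma prim_pairing_le c d : has_moment l c -> has_moment l d ->
  \int[c]_y prim y - \int[d]_y prim y <= dist l c d.
Proof.
move=> mc md; rewrite -[leRHS]mul1r; apply: pairing_gap_le => //.
- exact: holder_pw_bounded prim_holder.
- exact: prim_lipschitz.
have FF := ae_filter_ringOfSetsType mu.
apply: filterS prim_derive => y [_ ->] y0 _; rewrite mul1r -mulrA ler_wpM2l ?dpw_ge0//.
rewrite (le_trans (ler_norm _))// normrM -[leRHS]mul1r ler_wpM2r//.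
Qed.

End prim.

Lemma measurable_gap_pos c d : has_moment l c -> has_moment l d ->
  measurable_fun [set: measurableTypeR R] (fun z => dpw z * gap c d z).
Proof.
by move=> mc md; apply/measurable_EFinP; case/integrableP: (integrable_gap mc md).
Qed.

(* The sign of [dpw * gap] is a measurable substitute for the sign of the gap of
   the tails, which may be infinite (hence junk) on ]-oo, 0]. *)
Definition optimal c d := prim (fun z => Num.sg (dpw z * gap c d z)).

Lemma measurable_sgr : measurable_fun setT (fun z : R => Num.sg z).
Proof.
have -> : (fun z : R => Num.sg z) =
    (fun z => if z == 0 then 0 else if z < 0 then -1 else 1).
  apply/funext => z; case: (ltgtP z 0) => [z0|z0|->].
  - by rewrite ltr0_sg.
  - by rewrite gtr0_sg.
  - by rewrite sgr0.
apply: measurable_fun_ifT => //; first exact: measurable_fun_eqr.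
by apply: measurable_fun_ifT => //; exact: measurable_fun_ltr.
Qed.

Lemma measurable_sg_gap c d : has_moment l c -> has_moment l d ->
  measurable_fun [set: measurableTypeR R] (fun z => Num.sg (dpw z * gap c d z)).
Proof.
move=> mc md.
exact: (measurableT_comp measurable_sgr (measurable_gap_pos mc md)).
Qed.

Lemma normr_sg_le1 x : `|Num.sg x| <= 1 :> R.
Proof. by rewrite normr_sg; case: (x != 0). Qed.

Lemma sg_gap_mul c d z : 0 < z ->
  Num.sg (dpw z * gap c d z) * gap c d z = `|gap c d z|.
Proof.
move=> z0; have w0 : 0 < dpw z.
  by rewrite /dpw z0 mulr_gt0 ?exponent_gt0// powR_gt0.
by rewrite sgrM (gtr0_sg w0) mul1r -normrEsg.
Qed.

(** The lower bound is [pairing_gap_le] for the opposite function with constant -1: the derivative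
    times the gap is then exactly -dpw |gap|. *)
Lemma optimal_pairing c d : has_moment l c -> has_moment l d ->
  \int[c]_y optimal c d y - \int[d]_y optimal c d y = dist l c d.
Proof.
move=> mc md; have ms := measurable_sg_gap mc md.
apply/eqP; rewrite eq_le; apply/andP; split.
  by apply: prim_pairing_le => // z; exact: normr_sg_le1.
have ho : holder l 1 (optimal c d) by apply: prim_holder => // z; exact: normr_sg_le1.
have bo := holder_pw_bounded ho.
have boN : pw_bounded l (`|-1| * 1) (fun y => -1 * optimal c d y) by exact: pw_boundedM.
have := @pairing_gap_le R l c d (fun y => -1 * optimal c d y) _ (-1) mc md boN.
rewrite !(pairingZ _ mc bo) !(pairingZ _ md bo) => H.
suff : -1 * \int[c]_y optimal c d y - -1 * \int[d]_y optimal c d y <= -1 * dist l c d by lra.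
apply: H.
- move=> a b ab; have [L HL] := prim_lipschitz ms (fun z => normr_sg_le1 _) ab.
  by exists L => x y xab yab; rewrite -mulrBr normrM normrN1 mul1r; exact: HL.
have FF := ae_filter_ringOfSetsType mu.
apply: filterS (prim_derive ms (fun z => normr_sg_le1 _)) => y [dy dyE] y0 _.
rewrite derive1E deriveZ// -derive1E dyE.
by rewrite -[_ *: _]/(_ * _) -!mulrA sg_gap_mul.
Qed.

Lemma optimal_holder c d : has_moment l c -> has_moment l d -> holder l 1 (optimal c d).
Proof.
move=> mc md; apply: prim_holder; first exact: measurable_sg_gap.
by move=> z; exact: normr_sg_le1.
Qed.

End primitive.

(** * Coagulation *)

Section kernels.
Context {R : realType} (l : exponent R).
Notation mu := (@lebesgue_measure R).
Implicit Types (c d : {measure set R -> \bar R}) (x y z : R).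
Notation pw := (pw l).
Notation lam := (exponent_val l).

(** The kernels are specified at positive arguments; the extension by 0 is measurable on the whole
    line and lets integrals against [c] run over R. *)
Definition pos_part1 (f : R -> R) x : R := if 0 < x then f x else 0.

Definition pos_part2 (k : R -> R -> R) x y : R :=
  if (0 < x) && (0 < y) then k x y else 0.

Lemma locally_lipschitz_continuous (f : R -> R) x : locally_lipschitz f -> 0 < x ->
  {for x, continuous f}.
Proof.
move=> lf x0.
have h : 0 < x / 2 < x + 1.
  by rewrite divr_gt0//= ltr_pdivrMr//; lra.
have [L HL] := lf _ _ h.
have xi : x \in `]x / 2, x + 1[.
  by rewrite in_itv/= ltr_pdivrMr// ltrDl ltr01 andbT; lra.
have xx : x / 2 <= x <= x + 1 by move: xi; rewrite in_itv/= => /andP[/ltW-> /ltW->].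
apply/cvgrPdist_le => e e0.
have c0 : `|L| * `|x - z| @[z --> x] --> (0 : R).
  rewrite -[X in _ --> X](mulr0 `|L|); apply: cvgMr.
  exact: cvg_norm_sub.
have /cvgrPdist_le/(_ _ e0) c1 := c0.
near=> z.
have zi : z \in `]x / 2, x + 1[ by near: z; exact: near_in_itvoo.
have zz : x / 2 <= z <= x + 1 by move: zi; rewrite in_itv/= => /andP[/ltW-> /ltW->].
apply: (le_trans (HL _ _ xx zz)).
apply: (@le_trans _ _ (`|L| * `|x - z|)); first by rewrite ler_wpM2r// ler_norm.
apply: (le_trans (ler_norm _)).
by rewrite -normrN -sub0r; near: z.
Unshelve. all: by end_near. Qed.

Lemma measurable_pos_part1 (f : R -> R) : locally_lipschitz f ->
  measurable_fun setT (pos_part1 f).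
Proof.
move=> lf.
have -> : pos_part1 f = f \_ `]0, +oo[%classic.
  apply/funext => x; rewrite patchE /pos_part1.
  case: ltP => x0; first by rewrite mem_set//= in_itv/= x0.
  by rewrite memNset//= in_itv/= ltNge x0.
apply/(measurable_restrictT _ _).1; first exact: measurable_itv.
apply: open_continuous_measurable_fun; first exact: interval_open.
move=> x /set_mem; rewrite /= in_itv/= andbT => x0.
exact: locally_lipschitz_continuous.
Qed.

(* A function of two variables, continuous in the first and measurable in the
   second, is the limit of its values at grid points of the first variable. *)
Lemma measurable_pos_part2 (k : R -> R -> R) :
  (forall x, 0 < x -> measurable_fun setT (pos_part1 (k x))) ->
  (forall x y, 0 < x -> 0 < y -> {for x, continuous (k ^~ y)}) ->
  measurable_fun setT (fun p : R * R => pos_part2 k p.1 p.2).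
Proof.
move=> mk ck.
(* Rounding up makes (N + 1) / (n + 1) a positive grid point even when [N] is 0. *)
pose N (n : nat) (p : R * R) : nat := Num.truncn (Num.max 0 (n.+1%:R * p.1)).
pose f (n : nat) (p : R * R) : R :=
  if 0 < p.1 then pos_part1 (k ((N n p).+1%:R / n.+1%:R)) p.2 else 0.
apply: (@measurable_fun_cvg _ _ _ setT f) => //.
- move=> n; apply: measurable_fun_ifT => //.
    by apply: measurable_fun_ltr => //; exact: measurable_fst.
  move=> _ B mB; rewrite setTI.
  have -> : (fun p : R * R => pos_part1 (k ((N n p).+1%:R / n.+1%:R)) p.2) @^-1` B =
     \bigcup_j ([set p | N n p = j] `&`
       (fun p : R * R => pos_part1 (k (j.+1%:R / n.+1%:R)) p.2) @^-1` B).
    apply/seteqP; split => p /=; first by move=> h; exists (N n p).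
    by move=> [j _ [<-]].
  apply: bigcup_measurable => j _; apply: measurableI.
    pose g (p : R * R) := Num.max 0 (n.+1%:R * p.1).
    have mg : measurable_fun setT g.
      apply: measurable_maxr => //; exact: measurable_funM.
    have -> : [set p | N n p = j] = g @^-1` `[j%:R, j.+1%:R[%classic.
      apply/seteqP; split => p; rewrite /= in_itv/= /N -/(g p).
        by move=> <-; apply/truncn_itv; rewrite /g le_max lexx.
      by move=> /truncn_def.
    by rewrite -[X in measurable X]setTI; apply: mg => //; exact: measurable_itv.
  have mf : measurable_fun setT (fun p : R * R => pos_part1 (k (j.+1%:R / n.+1%:R)) p.2).
    apply: measurableT_comp; last exact: measurable_snd.
    by apply: mk; rewrite divr_gt0.
  by rewrite -[X in measurable X]setTI; exact: mf.
- move=> [x y] _; rewrite /f /pos_part2 /=.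
  case: ifPn => [|]; last first.
    rewrite negb_and => /orP[/negPf ->|y0]; first exact: cvg_cst.
    by rewrite /pos_part1 (negPf y0) if_same; exact: cvg_cst.
  move=> /andP[x0 y0]; rewrite x0 /pos_part1 y0.
  apply: (cvg_comp (fun n => (N n (x, y)).+1%:R / n.+1%:R) (k ^~ y)); last exact: ck.
  apply/cvgrPdist_le => e e0; near=> n.
  have n0 : 0 < n.+1%:R :> R by rewrite ltr0n.
  have h1 : (N n (x, y))%:R <= n.+1%:R * x.
    by rewrite /N /= (max_idPr _) ?truncn_le// mulr_ge0// ltW.
  have h2 : n.+1%:R * x < (N n (x, y)).+1%:R.
    by rewrite /N /= (max_idPr _) ?truncnS_gt// mulr_ge0// ltW.
  have -> : x - (N n (x, y)).+1%:R / n.+1%:R = (n.+1%:R * x - (N n (x, y)).+1%:R) / n.+1%:R.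
    by field; rewrite addrC natr1 gt_eqF.
  rewrite normrM (gtr0_norm (_ : 0 < n.+1%:R^-1)) ?invr_gt0// ler_pdivrMr//.
  apply: (@le_trans _ _ 1).
    by move: h1 h2; rewrite -natr1 => h1 h2; rewrite ler_norml; apply/andP; split; lra.
  rewrite mulrC -ler_pdivrMr// div1r.
  apply: (@le_trans _ _ n%:R); last by rewrite ler_nat.
  by near: n; exact: nbhs_infty_ger.
Unshelve. all: by end_near. Qed.

End kernels.

Section bilinear.
Context {R : realType} (l : exponent R).
Implicit Types (c d : {measure set R -> \bar R}) (x y z : R) (H : R -> R -> R).
Notation pw := (pw l).

Definition pw_bounded2 (A : R) H :=
  measurable_fun setT (fun p : R * R => H p.1 p.2) /\
  forall x y, `|H x y| <= A * (pw x * pw y).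

Variables (A : R) (H : R -> R -> R).
Hypothesis bH : pw_bounded2 A H.

Lemma pw_bounded2_ge0 : 0 <= A.
Proof. by have := bH.2 1 1; rewrite pw1 !mulr1; apply: le_trans. Qed.

Lemma pw_bounded2_l y : pw_bounded l (A * pw y) (H ^~ y).
Proof.
case: bH => mH HB; split.
  exact: (measurable_fun_pair1 (f := fun p : R * R => H p.1 p.2)).
by move=> x; rewrite (le_trans (HB _ _))// [leRHS]mulrAC mulrA.
Qed.

Variables (c d : {measure set R -> \bar R}).
Hypotheses (mc : has_moment l c) (md : has_moment l d).

Let ipw (e : {measure set R -> \bar R}) (k : R) : has_moment l e ->
  e.-integrable setT (EFin \o (fun x => k * pw x)).
Proof.
move=> me; apply: (@pw_bounded_integrable _ l _ (`|k| * 1)) => //.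
exact: pw_boundedM (pw_bounded_pw l).
Qed.

Let HB12 x y : `|H x y| <= A * pw x * (1 * pw y).
Proof. by rewrite mul1r -mulrA; case: bH. Qed.

Lemma pw_bounded_inner_l : pw_bounded l (A * mass l c) (fun y => \int[c]_x H x y).
Proof.
case: bH => mH _; split.
  apply/measurable_EFinP.
  have := @fubini_integrable_Rr _ _ R R R c d (fun p => H p.1 p.2)
    (fun x => A * pw x) (fun y => 1 * pw y) mc.1 md.1 mH (ipw _ mc) (ipw _ md) HB12.
  by case/integrableP.
move=> y; apply: (le_trans (pairing_bound mc (pw_bounded2_l y))).
by rewrite mulrAC.
Qed.

Lemma bilinear_fubini :
  \int[d]_y \int[c]_x H x y = \int[c]_x \int[d]_y H x y.
Proof.
case: bH => mH _.
by have := @fubini_dominated _ _ R R R c d mc.1 md.1 (fun p => H p.1 p.2)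
  (fun x => A * pw x) (fun y => 1 * pw y) mH (ipw _ mc) (ipw _ md) HB12.
Qed.

Lemma bilinear_bound : `|\int[d]_y \int[c]_x H x y| <= A * mass l c * mass l d.
Proof. exact: pairing_bound pw_bounded_inner_l. Qed.

End bilinear.

Section bilinear_diff.
Context {R : realType} (l : exponent R).
Variables (c d : {measure set R -> \bar R}) (A : R) (H : R -> R -> R).
Hypotheses (mc : has_moment l c) (md : has_moment l d).
Hypothesis bH : pw_bounded2 l A H.
Hypothesis sH : forall x y, H x y = H y x.

(** For symmetric [H] the difference of the two quadratic forms factors as the pairing of [H] with
    (c - d) tensor (c + d). *)
Lemma bilinear_diff :
  \int[c]_y \int[c]_x H x y - \int[d]_y \int[d]_x H x y =
  \int[c]_y (\int[c]_x H x y - \int[d]_x H x y) +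
  \int[d]_y (\int[c]_x H x y - \int[d]_x H x y).
Proof.
rewrite (pairingB mc (pw_bounded_inner_l bH mc mc) (pw_bounded_inner_l bH md mc)).
rewrite (pairingB md (pw_bounded_inner_l bH mc md) (pw_bounded_inner_l bH md md)).
have -> : \int[d]_y \int[c]_x H x y = \int[c]_y \int[d]_x H x y.
  rewrite (bilinear_fubini bH mc md); apply: eq_Rintegral => x _.
  by apply: eq_Rintegral => y _; rewrite sH.
by rewrite addrA subrK.
Qed.

End bilinear_diff.

Section coagulation.
Context {R : realType} (l : exponent R).
Notation mu := (@lebesgue_measure R).
Implicit Types (c d : {measure set R -> \bar R}) (x y z : R).
Notation pw := (pw l).
Notation dpw := (dpw l).
Notation lam := (exponent_val l).
Variables (K : R -> R -> R) (F : R -> R).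
Hypothesis hKF : hypothesis_KF lam K F.

Lemma kernel_lipschitz_box a b : 0 < a < b -> exists2 L, 0 <= L &
  forall x x' y y', a <= x <= b -> a <= x' <= b -> a <= y <= b -> a <= y' <= b ->
  `|K x y - K x' y'| <= L * Num.max `|x - x'| `|y - y'|.
Proof.
move=> /andP[a0 ab]; have b0 := lt_trans a0 ab.
(* This [e] is below [a] and its inverse is above [b], so that [[a, b]] lies inside the open
   interval of the hypothesis. *)
pose e := (1 + b + a^-1)^-1.
have s0 : 1 < 1 + b + a^-1 by rewrite -addrA ltrDl addr_gt0// invr_gt0.
have e01 : 0 < e < 1.
  by rewrite /e invr_gt0 (lt_trans ltr01 s0) invf_lt1// (lt_trans ltr01 s0).
have ebox z : a <= z <= b -> e < z < e^-1.
  move=> /andP[az zb]; apply/andP; split.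
    apply: lt_le_trans az; rewrite /e -[ltRHS]invrK ltf_pV2 ?posrE ?invr_gt0 ?(lt_trans ltr01 s0)//.
    by rewrite ltrDr ltr_pwDl// ltW.
  apply: (le_lt_trans zb); rewrite /e invrK -addrA addrCA ltrDl addr_gt0// invr_gt0//.
have [M [_ HM]] := K_lip hKF e01.
exists (`|M| + 1); first by rewrite addr_ge0.
move=> x x' y y' xab x'ab yab y'ab.
have := HM (`|M| + 1) _ ((x, y), (x', y')).
rewrite /= /Num.norm /= /Num.max /=.
apply.
- by rewrite (le_lt_trans (ler_norm M))// ltrDl.
- by split; split; rewrite /= in_itv /=; apply: ebox.
Qed.

Lemma kernel_lipschitz_l y : 0 < y -> locally_lipschitz (K ^~ y).
Proof.
move=> y0 a b /andP[a0 ab].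
have h : 0 < Num.min a y < Num.max b y + 1.
  by rewrite lt_min a0 y0/= ltr_pwDr// le_max ge_min (ltW ab).
have [L L0 HL] := kernel_lipschitz_box h.
exists L => x x' /andP[ax xb] /andP[ax' xb'].
have yy : Num.min a y <= y <= Num.max b y + 1.
  by rewrite ge_min lexx orbT/= ler_wpDr// le_max lexx orbT.
have hx z : a <= z -> z <= b -> Num.min a y <= z <= Num.max b y + 1.
  by move=> az zb; rewrite ge_min az/= ler_wpDr// le_max zb.
have := HL x x' y y (hx _ ax xb) (hx _ ax' xb') yy yy.
by rewrite subrr normr0 (max_idPl _).
Qed.

Lemma kernel_lipschitz_r x : 0 < x -> locally_lipschitz (K x).
Proof.
move=> x0 a b ab; have [L HL] := kernel_lipschitz_l x0 ab.
have /andP[a0 _] := ab.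
exists L => y y' /[dup] /andP[ay yb] yab /[dup] /andP[ay' yb'] yab'.
rewrite (K_sym hKF x0 (lt_le_trans a0 ay)) (K_sym hKF x0 (lt_le_trans a0 ay')).
exact: HL.
Qed.

Lemma rate_lipschitz : locally_lipschitz F.
Proof.
move=> a b /andP[a0 ab]; have b0 := lt_trans a0 ab.
pose e := (1 + b + a^-1)^-1.
have s0 : 1 < 1 + b + a^-1 by rewrite -addrA ltrDl addr_gt0// invr_gt0.
have e01 : 0 < e < 1.
  by rewrite /e invr_gt0 (lt_trans ltr01 s0) invf_lt1// (lt_trans ltr01 s0).
have ebox z : a <= z <= b -> e < z < e^-1.
  move=> /andP[az zb]; apply/andP; split.
    apply: lt_le_trans az; rewrite /e -[ltRHS]invrK ltf_pV2 ?posrE ?invr_gt0 ?(lt_trans ltr01 s0)//.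
    by rewrite ltrDr ltr_pwDl// ltW.
  apply: (le_lt_trans zb); rewrite /e invrK -addrA addrCA ltrDl addr_gt0// invr_gt0//.
have [M [_ HM]] := F_lip hKF e01.
exists (`|M| + 1) => x x' xab x'ab.
have := HM (`|M| + 1) _ (x, x'); apply.
- by rewrite (le_lt_trans (ler_norm M))// ltrDl.
- by split; rewrite /= in_itv /=; apply: ebox.
Qed.

Definition Kp := pos_part2 K.
Definition Fp := pos_part1 F.

Lemma measurable_Kp : measurable_fun setT (fun p : R * R => Kp p.1 p.2).
Proof.
apply: measurable_pos_part2.
  by move=> x x0; apply: measurable_pos_part1; exact: kernel_lipschitz_r.
move=> x y x0 y0; apply: locally_lipschitz_continuous => //.
exact: kernel_lipschitz_l.
Qed.

Lemma measurable_Fp : measurable_fun setT Fp.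
Proof. by apply: measurable_pos_part1; exact: rate_lipschitz. Qed.

Lemma Kp_sym x y : Kp x y = Kp y x.
Proof.
rewrite /Kp /pos_part2 andbC; case: ifP => // /andP[y0 x0].
exact: (K_sym hKF).
Qed.

Lemma Kp_ge0 x y : 0 <= Kp x y.
Proof.
rewrite /Kp /pos_part2; case: ifP => // /andP[x0 y0].
exact: (K_ge0 hKF).
Qed.

Lemma Kp_bound : exists2 k0, 0 < k0 & forall x y, Kp x y <= k0 * pw (x + y).
Proof.
have [k0 k00 Hk] := K_bound hKF; exists k0 => // x y.
rewrite /Kp /pos_part2; case: ifP => [/andP[x0 y0]|_].
  by rewrite pwE ?addr_ge0 ?(ltW x0) ?(ltW y0)//; exact: Hk.
by rewrite mulr_ge0 ?pw_ge0// ltW.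
Qed.

Lemma Fp_bound : exists2 k2, 0 < k2 & forall x, 0 <= Fp x <= k2.
Proof.
have [k2 k20 Hk] := F_bound hKF; exists k2 => // x.
rewrite /Fp /pos_part1; case: ifP => [x0|_]; last by rewrite lexx ltW.
by rewrite (F_ge0 hKF)// Hk.
Qed.

(** [phi (x + y)] is compared with the value at the argument of larger weight; this difference and
    the remaining value are both controlled by the smaller weight. *)
Lemma coag_op_min (phi : R -> R) B x y : holder l B phi -> 0 <= x -> 0 <= y ->
  `|coag_op phi x y| <= 2 * B * Num.min (pw x) (pw y).
Proof.
move=> [p0 pB] x0 y0.
have hx : `|phi (x + y) - phi y| <= B * pw x.
  by have := pB (x + y) y; rewrite addrK (ger0_norm x0).
have hy : `|phi (x + y) - phi x| <= B * pw y.
  by have := pB (x + y) x; rewrite addrAC subrr add0r (ger0_norm y0).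
have gx : `|phi x| <= B * pw x.
  by have := pB x 0; rewrite !subr0 (p0 0)// subr0 (ger0_norm x0).
have gy : `|phi y| <= B * pw y.
  by have := pB y 0; rewrite !subr0 (p0 0)// subr0 (ger0_norm y0).
rewrite /coag_op; case: (leP (pw x) (pw y)) => _.
  have -> : phi (x + y) - phi x - phi y = (phi (x + y) - phi y) - phi x by ring.
  apply: (le_trans (ler_normB _ _)).
  have -> : 2 * B * pw x = B * pw x + B * pw x by ring.
  exact: lerD.
apply: (le_trans (ler_normB _ _)).
have -> : 2 * B * pw y = B * pw y + B * pw y by ring.
exact: lerD.
Qed.

Lemma measurable_coag_op (phi : R -> R) : measurable_fun setT phi ->
  measurable_fun setT (fun p : R * R => coag_op phi p.1 p.2).
Proof.
move=> mphi; rewrite /coag_op; apply: measurable_funB; first apply: measurable_funB.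
- apply: measurableT_comp => //; apply: measurable_funD.
    exact: measurable_fst.
  exact: measurable_snd.
- by apply: measurableT_comp => //; exact: measurable_fst.
- by apply: measurableT_comp => //; exact: measurable_snd.
Qed.

Lemma holder_ge0 B (phi : R -> R) : holder l B phi -> 0 <= B.
Proof.
by move=> /holder_pw_bounded[_ /(_ 1)]; rewrite pw1 mulr1; apply: le_trans.
Qed.

(** Stated for every kernel below [Kp], so that it also covers the truncated kernel and the part
    that truncation removes. The factor 4 is 2 from [coag_op_min] times 2 from [pw_add_min]. *)
Lemma coag_bounded : exists2 C, 0 < C &
  forall (k : R -> R -> R) phi B, measurable_fun setT (fun p : R * R => k p.1 p.2) ->
  (forall x y, 0 <= k x y <= Kp x y) -> holder l B phi ->
  pw_bounded2 l (C * B) (fun x y => k x y * coag_op phi x y).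
Proof.
have [k0 k00 Hk] := Kp_bound; exists (4 * k0); first by rewrite mulr_gt0.
move=> k phi B mk kK hphi; split.
  by apply: measurable_funM => //; apply: measurable_coag_op; case: (holder_pw_bounded hphi).
move=> x y; have B0 := holder_ge0 hphi.
have /andP[kxy0 kxyK] := kK x y.
rewrite normrM (ger0_norm kxy0).
case: (boolP ((0 < x) && (0 < y))) => [/andP[x0 y0]|nxy]; last first.
  have K0 : k x y = 0.
    by apply/eqP; rewrite eq_le kxy0 andbT (le_trans kxyK)// /Kp /pos_part2 (negPf nxy).
  by rewrite K0 mul0r !mulr_ge0 ?pw_ge0// ltW.
have h1 := coag_op_min hphi (ltW x0) (ltW y0).
have h2 := pw_add_min l (ltW x0) (ltW y0).
apply: (@le_trans _ _ (k0 * pw (x + y) * (2 * B * Num.min (pw x) (pw y)))).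
  by apply: ler_pM => //; exact: le_trans (Hk _ _).
have -> : k0 * pw (x + y) * (2 * B * Num.min (pw x) (pw y)) =
  (2 * k0 * B) * (pw (x + y) * Num.min (pw x) (pw y)) by ring.
have -> : 4 * k0 * B * (pw x * pw y) = 2 * k0 * B * (2 * (pw x * pw y)) by ring.
by rewrite ler_wpM2l// !mulr_ge0// ltW.
Qed.

End coagulation.

Section ae_derive.
Context {R : realType} (l : exponent R).
Notation mu := (@lebesgue_measure R).
Implicit Types (x y z k b : R) (f g : R -> R).

Lemma is_derive_affine f k b x df : is_derive (k * x + b) 1 f df ->
  is_derive x 1 (fun t : R => f (k * t + b)) (k * df).
Proof.
move=> [df1 dfE].
have hk : is_derive x 1 (fun t : R => k * t + b) k.
  have -> : (fun t : R => k * t + b) = (k *: id + cst b) by apply/funext.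
  by apply: is_derive_eq; rewrite scaler1 addr0.
have [hk1 hkE] := hk.
have d1 : derivable (f \o (fun t : R => k * t + b)) x 1.
  apply/derivable1_diffP; apply: differentiable_comp; apply/derivable1_diffP => //.
apply: DeriveDef; first exact: d1.
have := derive1_comp hk1 df1.
by rewrite !derive1E dfE hkE mulrC.
Qed.

Lemma ae_derivable f : locally_lipschitz f ->
  {ae mu, forall x, 0 < x -> derivable f x 1}.
Proof.
move=> lf.
have FF := ae_filter_ringOfSetsType mu.
have c2 (n : nat) : 0 < (n.+2%:R : R)^-1 < n.+2%:R.
  rewrite invr_gt0 ltr0n/= (@lt_trans _ _ 1)//; last by rewrite ltr1n.
  by rewrite invf_lt1 ?ltr0n// ltr1n.
have : {ae mu, forall x, forall n : nat, n.+2%:R^-1 < x < n.+2%:R -> derivable f x 1}.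
  apply/ae_foralln => n; have [L HL] := lf _ _ (c2 n).
  have /andP[_ c3] := c2 n.
  have [g [_ _ _]] := lipschitz_ftc c3 HL.
  by apply: filterS => x gx xn; case: (gx xn).
apply: filterS => x Hx x0.
pose n := Num.truncn (x + x^-1).
have xx : x + x^-1 < n.+1%:R by rewrite truncnS_gt.
have xi0 : 0 < x^-1 by rewrite invr_gt0.
apply: (Hx n); apply/andP; split.
  rewrite -[ltRHS]invrK ltf_pV2 ?posrE//.
  apply: (@lt_trans _ _ n.+1%:R); last by rewrite ltr_nat.
  by apply: lt_trans xx; rewrite ltrDr.
apply: (@lt_trans _ _ n.+1%:R); last by rewrite ltr_nat.
by apply: lt_trans xx; rewrite ltrDl.
Qed.

Lemma locally_lipschitz_bounded f a b : locally_lipschitz f -> 0 < a < b ->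
  exists2 M, 0 <= M & forall x, a <= x <= b -> `|f x| <= M.
Proof.
move=> lf ab; have [L HL] := lf _ _ ab; have /andP[a0 ab'] := ab.
exists (`|f a| + `|L| * (b - a)).
  by rewrite addr_ge0// mulr_ge0// subr_ge0 ltW.
move=> x /andP[ax xb].
have := HL x a; rewrite ax xb lexx (ltW ab') => /(_ isT isT) h.
rewrite -[f x](subrK (f a)) addrC (le_trans (ler_normD _ _))// lerD2l.
apply: (le_trans h); rewrite ger0_norm ?subr_ge0//.
apply: (@le_trans _ _ (`|L| * (x - a))); first by rewrite ler_wpM2r ?subr_ge0// ler_norm.
by rewrite ler_wpM2l// lerD2r.
Qed.

Lemma locally_lipschitzM f g : locally_lipschitz f -> locally_lipschitz g ->
  locally_lipschitz (fun x => f x * g x).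
Proof.
move=> lf lg a b ab.
have [M1 M10 H1] := locally_lipschitz_bounded lf ab.
have [M2 M20 H2] := locally_lipschitz_bounded lg ab.
have [L1 HL1] := lf _ _ ab; have [L2 HL2] := lg _ _ ab.
exists (L1 * M2 + M1 * L2) => x y xab yab.
have -> : f x * g x - f y * g y = (f x - f y) * g x + f y * (g x - g y) by ring.
rewrite (le_trans (ler_normD _ _))// !normrM.
have -> : (L1 * M2 + M1 * L2) * `|x - y| =
  L1 * `|x - y| * M2 + M1 * (L2 * `|x - y|) by ring.
by apply: lerD; apply: ler_pM => //; [exact: HL1|exact: H2|exact: H1|exact: HL2].
Qed.

Lemma locally_lipschitzD f g : locally_lipschitz f -> locally_lipschitz g ->
  locally_lipschitz (fun x => f x + g x).
Proof.
move=> lf lg a b ab.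
have [L1 HL1] := lf _ _ ab; have [L2 HL2] := lg _ _ ab.
exists (L1 + L2) => x y xab yab; rewrite opprD addrACA mulrDl.
by rewrite (le_trans (ler_normD _ _))// lerD//; [exact: HL1|exact: HL2].
Qed.

Lemma locally_lipschitz_cst (r : R) : locally_lipschitz (fun _ : R => r).
Proof. by move=> a b _; exists 0 => x y _ _; rewrite subrr normr0 mul0r. Qed.

Lemma locally_lipschitz_affine f k b : 0 < k -> 0 <= b -> locally_lipschitz f ->
  locally_lipschitz (fun x => f (k * x + b)).
Proof.
move=> k0 b0 lf u v /andP[u0 uv].
have h : 0 < k * u < k * v + b by rewrite mulr_gt0//= ltr_wpDr// ltr_pM2l.
have [L HL] := lf _ _ h; exists (L * k) => x y /andP[ux xv] /andP[uy yv].
have hx z : u <= z -> z <= v -> k * u <= k * z + b <= k * v + b.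
  by move=> uz zv; rewrite ler_wpDr ?ler_pM2l//= lerD2r ler_pM2l.
have := HL _ _ (hx _ ux xv) (hx _ uy yv).
rewrite opprD addrACA subrr addr0 -mulrBr normrM (gtr0_norm k0).
by rewrite mulrA.
Qed.

Lemma eq_locally_lipschitz f g : (forall x, 0 < x -> f x = g x) ->
  locally_lipschitz f -> locally_lipschitz g.
Proof.
move=> fg lf a b ab; have [L HL] := lf _ _ ab; have /andP[a0 _] := ab.
exists L => x y xab yab; rewrite -!fg; first exact: HL.
  by case/andP: yab => ay _; exact: lt_le_trans ay.
by case/andP: xab => ax _; exact: lt_le_trans ax.
Qed.

End ae_derive.

Section coag_stability.
Context {R : realType} (l : exponent R).
Notation mu := (@lebesgue_measure R).
Implicit Types (c d : {measure set R -> \bar R}) (x y z : R).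
Notation pw := (pw l).
Notation dpw := (dpw l).
Notation lam := (exponent_val l).
Variables (K : R -> R -> R) (F : R -> R).
Hypothesis hKF : hypothesis_KF lam K F.
Notation Kp := (Kp K).

Variables (c d : {measure set R -> \bar R}).
Hypotheses (mc : has_moment l c) (md : has_moment l d).
Let r := optimal l c d.
Let s z := Num.sg (dpw z * gap c d z).

Let ms : measurable_fun [set: measurableTypeR R] s.
Proof. exact: measurable_sg_gap. Qed.

Let s1 z : `|s z| <= 1. Proof. exact: normr_sg_le1. Qed.

Let hr : holder l 1 r. Proof. exact: optimal_holder. Qed.

Let lr : locally_lipschitz r. Proof. exact: (@prim_lipschitz R l s ms s1). Qed.

(** Differentiating the integrand in x gives two terms. The one containing the derivative of [r],
    times the gap, is nonpositive because [dpw] is nonincreasing. In the other, [coag_op r] is at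
    most 2 min(x^l, y^l), which is the factor in front of the derivative of [K] in the hypothesis;
    the product is at most 2 k1 x^(l-1) y^l, that is (2 k1 / l) y^l dpw x. *)
Lemma coag_gap_le (C0 k1 y : R) : 0 < y -> 0 < k1 ->
  (forall x y : R, 0 < x -> 0 < y -> derivable (K ^~ y) x 1 ->
      Num.min (x `^ lam) (y `^ lam) * `|derive1 (K ^~ y) x|
        <= k1 * x `^ (lam - 1) * y `^ lam) ->
  pw_bounded2 l C0 (fun x y => Kp x y * coag_op r x y) ->
  \int[c]_x (Kp x y * coag_op r x y) - \int[d]_x (Kp x y * coag_op r x y) <=
  2 * k1 / lam * pw y * dist l c d.
Proof.
move=> y0 k10 HK bH.
apply: (pairing_gap_le mc md (pw_bounded2_l bH y)).
  apply: (@eq_locally_lipschitz _ (fun x => K x y * coag_op r x y)).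
    by move=> x x0; rewrite /Submission.Kp /pos_part2 x0 y0.
  apply: locally_lipschitzM; first exact: (kernel_lipschitz_l hKF y0).
  apply: (@eq_locally_lipschitz _ (fun x => (r (1 * x + y) + -1 * r (1 * x + 0)) + - r y)).
    by move=> x x0; rewrite /coag_op !mul1r addr0 mulN1r.
  apply: locally_lipschitzD; last exact: locally_lipschitz_cst.
  apply: locally_lipschitzD; first by apply: locally_lipschitz_affine => //; exact: ltW.
  apply: locally_lipschitzM; first exact: locally_lipschitz_cst.
  exact: locally_lipschitz_affine.
have FF := ae_filter_ringOfSetsType mu.
have aer : {ae mu, forall y, derivable r y 1 /\ derive1 r y = dpw y * s y} :=
  @prim_derive R l s ms s1.
have aery := ae_affine y ltr01 aer.
have aeK := ae_derivable (kernel_lipschitz_l hKF y0).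
apply: filterS3 aer aery aeK => x [drx drxE] [drxy drxyE] /[swap] x0 /(_ x0) dK _.
have nE : {near x, (fun x => K x y * (r (1 * x + y) - r x - r y)) =1
    (fun x => Kp x y * coag_op r x y)}.
  near=> t; rewrite /Submission.Kp /pos_part2 /coag_op y0 mul1r.
  by rewrite (_ : 0 < t)//; near: t; exact: lt_nbhsr.
have d1 : is_derive x 1 (K ^~ y) (derive1 (K ^~ y) x).
  by apply: DeriveDef; [exact: dK|rewrite derive1E].
have d2 : is_derive x 1 r (dpw x * s x).
  by apply: DeriveDef; [exact: drx|rewrite -derive1E; exact: drxE].
have d3 : is_derive x 1 (fun t : R => r (1 * t + y)) (1 * (dpw (1 * x + y) * s (1 * x + y))).
  apply: is_derive_affine.
  by apply: DeriveDef; [exact: drxy|rewrite -derive1E; exact: drxyE].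
have [_ dE] : is_derive x 1 (fun x => Kp x y * coag_op r x y)
   (K x y * (dpw (x + y) * s (x + y) - dpw x * s x) +
    (r (x + y) - r x - r y) * derive1 (K ^~ y) x).
  apply: (near_eq_is_derive nE).
  have -> : (fun x => K x y * (r (1 * x + y) - r x - r y)) =
    (K ^~ y) * ((fun t : R => r (1 * t + y)) - r - cst (r y)) by apply/funext.
  apply: is_derive_eq.
  rewrite subr0 !mul1r; congr (_ + _).
  by rewrite -[LHS]/((r (1 * x + y) - r x - r y) * derive1 (K ^~ y) x) mul1r.
rewrite derive1E dE {dE}.
have xy0 : 0 < x + y by rewrite addr_gt0.
have wx : 0 <= dpw x by exact: dpw_ge0.
have hA := coag_op_min hr (ltW x0) (ltW y0).
have hK := HK x y x0 y0 dK.
have K0 : 0 <= K x y by exact: (K_ge0 hKF).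
rewrite mulrDl -lerBrDl.
(* The sign times the gap is |gap| at x and at most |gap| at x + y, and dpw (x + y) <= dpw x. *)
have h1 : K x y * (dpw (x + y) * s (x + y) - dpw x * s x) * gap c d x <= 0.
  rewrite -mulrA mulr_ge0_le0// mulrBl -[dpw x * s x * _]mulrA (sg_gap_mul l c d x0).
  rewrite subr_le0 -mulrA.
  apply: (@le_trans _ _ (dpw (x + y) * `|gap c d x|)).
    rewrite ler_wpM2l ?dpw_ge0// (le_trans (ler_norm _))// normrM -[leRHS]mul1r.
    by rewrite ler_wpM2r.
  by rewrite ler_wpM2r// dpw_noninc// lerDl ltW.
have h2 : (r (x + y) - r x - r y) * derive1 (K ^~ y) x * gap c d x <=
    2 * k1 / lam * pw y * (dpw x * `|gap c d x|).
  rewrite (le_trans (ler_norm _))// normrM [leRHS]mulrA ler_wpM2r//.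
  rewrite normrM.
  apply: (@le_trans _ _ (2 * 1 * Num.min (pw x) (pw y) * `|derive1 (K ^~ y) x|)).
    by rewrite ler_wpM2r.
  rewrite /dpw x0 !pwE ?(ltW x0) ?(ltW y0)// mulr1 -mulrA.
  have -> : 2 * k1 / lam * y `^ lam * (lam * x `^ (lam - 1)) =
    2 * (k1 * x `^ (lam - 1) * y `^ lam).
    by field; exact: exponent_neq0.
  by rewrite ler_wpM2l.
by lra.
Unshelve. all: by end_near. Qed.

End coag_stability.

(** [bilinear_diff] integrates the inner difference against c + d, and [coag_gap_le] bounds that
    difference by a multiple of [pw y]. *)
Lemma coag_stability {R : realType} (l : exponent R) (K : R -> R -> R)
    (F : R -> R) : hypothesis_KF l K F ->
  exists2 C, 0 <= C & forall c d : {measure set R -> \bar R},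
    has_moment l c -> has_moment l d ->
    \int[c]_y \int[c]_x (Kp K x y * coag_op (optimal l c d) x y) -
    \int[d]_y \int[d]_x (Kp K x y * coag_op (optimal l c d) x y) <=
    C * (mass l c + mass l d) * dist l c d.
Proof.
move=> hKF.
have [k1 k10 HK] := K_deriv hKF.
have [C0 C00 HC0] := coag_bounded hKF.
have lp := exponent_gt0 l.
exists (2 * k1 / (l : R)); first by rewrite divr_ge0 ?mulr_ge0// ltW.
move=> c d mc md; set r := optimal l c d.
have hr : holder l 1 r by exact: optimal_holder.
have bH := HC0 (Kp K) r 1 (measurable_Kp hKF)
  (fun x y => introT andP (conj (Kp_ge0 hKF x y) (lexx _))) hr.
have sH x y : Kp K x y * coag_op r x y = Kp K y x * coag_op r y x.
  by rewrite (Kp_sym hKF x y) /coag_op (addrC x y); ring.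
rewrite (bilinear_diff mc md bH sH).
set C := 2 * k1 / (l : R); set D := dist l c d.
have hy y : \int[c]_x (Kp K x y * coag_op r x y) - \int[d]_x (Kp K x y * coag_op r x y) <=
    C * D * pw l y.
  have [y0|y0] := leP y 0.
    have K0 x : Kp K x y * coag_op r x y = 0.
      by rewrite /Kp /pos_part2 (ltNge 0 y) y0 andbF mul0r.
    have I0 (e : {measure set R -> \bar R}) : \int[e]_x (Kp K x y * coag_op r x y) = 0.
      by under eq_Rintegral do rewrite K0; rewrite /Rintegral integral0.
    by rewrite !I0 subrr pw_le0// mulr0.
  have := coag_gap_le hKF mc md y0 k10 HK bH.
  by rewrite -/r -/D mulrAC.
have bd := pw_boundedB (pw_bounded_inner_l bH mc mc) (pw_bounded_inner_l bH md mc).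
have bp : pw_bounded l (`|C * D| * 1) (fun y => C * D * pw l y).
  exact: pw_boundedM (pw_bounded_pw l).
have e e' : has_moment l e' -> \int[e']_y (C * D * pw l y) = C * D * mass l e'.
  by move=> me; rewrite (pairingZ _ me (pw_bounded_pw l)).
have -> : C * (mass l c + mass l d) * D = C * D * mass l c + C * D * mass l d by ring.
by rewrite -!e//; apply: lerD; apply: (pairing_le _ bd bp hy).
Qed.

(** * Fragmentation *)

Section measurable_limn.
Context d (T : measurableType d) {R : realType}.

Lemma cvg_limn_esup_einf (u : nat -> \bar R) (a : \bar R) :
  limn_esup u = a -> limn_einf u = a -> u @ \oo --> a.
Proof.
rewrite limn_esup_lim limn_einf_lim => <- h.
have c1 : esups u @ \oo --> limn (esups u) by exact: is_cvg_esups.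
have c2 : einfs u @ \oo --> limn (esups u) by rewrite -h; exact: is_cvg_einfs.
apply: (squeeze_cvge _ c2 c1); near=> n; apply/andP; split.
  by apply: ereal_inf_lbound; exists n => /=.
by apply: ereal_sup_ubound; exists n => /=.
Unshelve. all: by end_near. Qed.

(** [limn] returns the default [point] where the sequence diverges, so the limit function is split
    according to whether the upper and lower limits agree and are finite. *)
Lemma measurable_limn (f : nat -> T -> R) :
  (forall n, measurable_fun setT (f n)) ->
  measurable_fun setT (fun x => limn (f ^~ x)).
Proof.
move=> mf.
pose s x := limn_esup (EFin \o f ^~ x).
have iE x : limn_einf (EFin \o f ^~ x) = (- limn_esup (fun n => - (f n x)%:E))%E.
  rewrite -(limn_einfN (fun n => - (f n x)%:E)%E); congr limn_einf.
  by apply/funext => n; rewrite /comp oppeK.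
have ms : measurable_fun setT s.
  by apply: measurable_fun_limn_esup => n; exact/measurable_EFinP.
have mi : measurable_fun setT (fun x => limn_einf (EFin \o f ^~ x)).
  under eq_fun do rewrite iE.
  apply: measurableT_comp => //; apply: measurable_fun_limn_esup => n.
  by apply: measurableT_comp => //; exact/measurable_EFinP.
have -> : (fun x => limn (f ^~ x)) = (fun x =>
    if (s x == limn_einf (EFin \o f ^~ x)) && (s x \is a fin_num) then fine (s x) else point).
  apply/funext => x; case: ifPn => [/andP[/eqP si sf]|/negP nh].
    apply/cvg_lim => //.
    have : EFin \o f ^~ x @ \oo --> s x by exact: cvg_limn_esup_einf.
    by rewrite -(fineK sf) => /fine_cvgP[_]; exact.
  have [cf|/dvgP ->//] := pselect (cvgn (f ^~ x)).
  exfalso; apply: nh.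
  have h : (EFin \o f ^~ x) @ \oo --> (limn (f ^~ x))%:E by apply: cvg_EFin => //; near=> n.
  have [h1 h2] := cvg_limn_einf_sup h.
  by rewrite /s h2 h1 eqxx.
apply: measurable_fun_ifT => //; last exact: measurableT_comp.
apply: measurable_and; first exact: measurable_fun_eqe.
apply: (measurable_fun_bool true).
rewrite setTI (_ : _ @^-1` _ = [set x | s x \is a fin_num]); last first.
  by apply/seteqP; split => x /=.
by have := emeasurable_fin_num measurableT ms; rewrite setTI.
Unshelve. all: by end_near. Qed.

End measurable_limn.

Section fragments.
Context {R : realType} (l : exponent R).
Implicit Types (x y z : R) (th : Theta R) (phi : R -> R) (m n : nat).
Notation pw := (pw l).
Notation lam := (exponent_val l).

Lemma measurable_theta k : measurable_fun setT (fun th : Theta R => th k).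
Proof.
move=> _ B mB; apply: sub_sigma_algebra.
by exists k => //; exists B.
Qed.

Lemma theta_le1 th k : th k <= 1.
Proof.
elim: k => [|k IH]; first exact/ltW/theta_lt1.
exact: le_trans (theta_noninc _ _) IH.
Qed.

Definition frag_fin m phi th x : R := \sum_(i < m) phi (th i * x) - phi x.

(** Partial sums of the integrand of [C_beta]. Fragment 0 enters through 1 - theta_0 because it is
    compared with its parent. *)
Definition frag_weight m th : R := \sum_(1 <= i < m) pw (th i) + pw (1 - th 0%N).

Definition frag_total th : \bar R :=
  (\sum_(1 <= k <oo) ((th k) `^ lam)%:E + ((1 - th 0%N) `^ lam)%:E)%E.

Lemma measurable_frag_weight m : measurable_fun setT (frag_weight m).
Proof.
apply: measurable_funD.
  apply: measurable_sum => i; apply: measurableT_comp; first exact: measurable_pw.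
  exact: measurable_theta.
apply: measurableT_comp; first exact: measurable_pw.
by apply: measurable_funB => //; exact: measurable_theta.
Qed.

Lemma frag_weight_ge0 m th : 0 <= frag_weight m th.
Proof. by rewrite addr_ge0 ?pw_ge0// sumr_ge0// => i _; exact: pw_ge0. Qed.

Lemma frag_weight_gt0 m th : 0 < frag_weight m th.
Proof.
rewrite ltr_wpDl// ?sumr_ge0// => [i _|]; first exact: pw_ge0.
by rewrite pw_gt0// subr_gt0 theta_lt1.
Qed.

Lemma frag_weight_le_total m th : ((frag_weight m th)%:E <= frag_total th)%E.
Proof.
rewrite /frag_weight /frag_total EFinD; apply: leeD; last first.
  by rewrite pwE// subr_ge0 ltW// theta_lt1.
have e : (\sum_(1 <= i < m) pw (th i))%:E = (\sum_(1 <= i < m) ((th i) `^ lam)%:E)%E.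
  by rewrite sumEFin; congr EFin; apply: eq_bigr => i _; rewrite pwE// theta_ge0.
rewrite e; apply: nneseries_lim_ge => k _ _.
by rewrite lee_fin powR_ge0.
Qed.

Lemma cvg_frag_weight th : (frag_weight m th)%:E @[m --> \oo] --> frag_total th.
Proof.
pose u m := (\sum_(1 <= i < m) ((th i) `^ lam)%:E)%E.
have e m : (frag_weight m th)%:E = (u m + ((1 - th 0%N) `^ lam)%:E)%E.
  rewrite /frag_weight EFinD pwE; last by rewrite subr_ge0 ltW// theta_lt1.
  congr (_ + _)%E; rewrite /u sumEFin; congr EFin; apply: eq_bigr => i _.
  by rewrite pwE// theta_ge0.
under eq_fun do rewrite e.
apply: cvgeD; last exact: cvg_cst.
  by rewrite fin_num_adde_defl.
by apply: is_cvg_nneseries => n _ _; rewrite lee_fin powR_ge0.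
Qed.

Lemma measurable_frag_total : measurable_fun setT frag_total.
Proof.
apply: (emeasurable_fun_cvg (fun m th => (frag_weight m th)%:E)).
  by move=> m; apply/measurable_EFinP; exact: measurable_frag_weight.
by move=> th _; exact: cvg_frag_weight.
Qed.

Lemma measurable_frag_fin m phi : measurable_fun setT phi ->
  measurable_fun setT (fun p : Theta R * R => frag_fin m phi p.1 p.2).
Proof.
move=> mphi; apply: measurable_funB; last first.
  by apply: measurableT_comp => //; exact: measurable_snd.
apply: measurable_sum => i; apply: measurableT_comp => //.
apply: measurable_funM; last exact: measurable_snd.
exact: (measurableT_comp (measurable_theta i) measurable_fst).
Qed.

Lemma frag_fin_le0 m phi th x : (forall x, x <= 0 -> phi x = 0) -> x <= 0 ->
  frag_fin m phi th x = 0.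
Proof.
move=> p0 x0; rewrite /frag_fin p0// subr0 big1// => i _.
by rewrite p0// mulr_ge0_le0// theta_ge0.
Qed.

(** Fragment 0 is paired with the parent: their values differ by at most B ((1 - theta_0) x)^l. The
    index [m.+1] ensures that fragment 0 is among those kept. *)
Lemma frag_fin_bound m phi B th x : holder l B phi ->
  `|frag_fin m.+1 phi th x| <= B * frag_weight m.+1 th * pw x.
Proof.
move=> hphi; have [p0 pB] := hphi; have B0 := holder_ge0 hphi.
have [x0|/ltW x0] := leP x 0.
  by rewrite frag_fin_le0// normr0 !mulr_ge0// ?pw_ge0// frag_weight_ge0.
have -> : frag_fin m.+1 phi th x = \sum_(1 <= i < m.+1) phi (th i * x) +
    (phi (th 0%N * x) - phi x).
  rewrite /frag_fin -(big_mkord xpredT (fun i => phi (th i * x))) big_nat_recl//.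
  by rewrite big_add1 addrAC addrC.
rewrite (le_trans (ler_normD _ _))// /frag_weight mulrDr mulrDl; apply: lerD.
  rewrite (le_trans (ler_norm_sum _ _ _))// mulr_sumr mulr_suml; apply: ler_sum => i _.
  have [_ pb] := holder_pw_bounded hphi.
  by rewrite (le_trans (pb _))// pwM ?theta_ge0// mulrA.
have := pB (th 0%N * x) x; rewrite -mulrA -pwM ?subr_ge0 ?theta_le1//.
have -> : `|th 0%N * x - x| = (1 - th 0%N) * x; last by [].
by rewrite distrC -{1}[x]mul1r -mulrBl ger0_norm// mulr_ge0// subr_ge0 theta_le1.
Qed.

(** [frag_op] is defined through [limn], a default value unless the series converges; a finite
    [frag_total] makes it absolutely convergent. *)
Lemma frag_op_cvg phi B th x : holder l B phi -> (frag_total th < +oo)%E ->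
  frag_fin m.+1 phi th x @[m --> \oo] --> frag_op phi th x.
Proof.
move=> hphi thoo.
pose M := fine (frag_total th).
have wM n : frag_weight n th <= M.
  rewrite -lee_fin fineK ?frag_weight_le_total// ge0_fin_numE//.
  by apply: le_trans (frag_weight_le_total 0 th); rewrite lee_fin frag_weight_ge0.
have [_ pb] := holder_pw_bounded hphi; have B0 := holder_ge0 hphi.
suff cv : cvgn (series (fun i => phi (th i * x))).
  have : frag_fin m phi th x @[m --> \oo] --> frag_op phi th x.
    apply: cvgB; last exact: cvg_cst.
    under eq_fun => m do rewrite -(big_mkord xpredT (fun i => phi (th i * x))).
    exact: cv.
  by rewrite -cvg_shiftS.
have [x0|/ltW x0] := leP x 0.
  have -> : series (fun i => phi (th i * x)) = cst 0.
    apply/funext => n; rewrite /series /= big1// => i _.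
    by apply: hphi.1; rewrite mulr_ge0_le0// theta_ge0.
  exact: is_cvg_cst.
apply: normed_cvg; apply: (@nondecreasing_is_cvgn _ (series (fun i => `|phi (th i * x)|))).
  by apply: nondecreasing_series => // n _ _; exact: normr_ge0.
(* The 1 bounds the weight of fragment 0, which [M] leaves out. *)
exists (B * pw x * (1 + M)) => _ [n _ <-].
apply: (@le_trans _ _ (\sum_(0 <= i < n) B * pw x * pw (th i))).
  rewrite /series /=; apply: ler_sum => i _; rewrite (le_trans (pb _))//.
  by rewrite pwM ?theta_ge0// -mulrA [pw (th i) * _]mulrC.
rewrite -mulr_sumr ler_wpM2l ?mulr_ge0 ?pw_ge0//.
case: n => [|n].
  by rewrite big_geq// addr_ge0// (le_trans (frag_weight_ge0 0 th)).
rewrite big_nat_recl// lerD//.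
  by rewrite -(pw1 l) pw_mono// theta_le1.
rewrite -(big_add1 _ _ 0 n.+1 xpredT (fun i => pw (th i))).
by apply: le_trans (wM n.+1); rewrite /frag_weight lerDl pw_ge0.
Qed.

End fragments.

(** Markov's inequality; the sigma-finiteness of [beta] and of measures with a moment is derived
    from it. *)
Lemma level_set_lty d (T : measurableType d) (R : realType)
    (m : {measure set T -> \bar R}) (g : T -> R) (a : R) : 0 < a ->
  m.-integrable setT (EFin \o g) -> (m [set x | (a <= `|g x|)%R] < +oo)%E.
Proof.
move=> a0 ig.
have mg : measurable_fun setT g by apply/measurable_EFinP; case/integrableP: ig.
set A := [set x | _].
have mA : measurable A.
  have -> : A = (fun x => `|g x|) @^-1` `[a, +oo[%classic.
    by apply/seteqP; split => x; rewrite /A /= in_itv/= andbT.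
  rewrite -[X in measurable X]setTI.
  have mng : measurable_fun setT (fun x => `|g x|) by exact: measurableT_comp.
  by apply: mng => //; exact: measurable_itv.
have h : (a%:E * m A <= \int[m]_x `|(g x)%:E|)%E.
  have -> : (a%:E * m A = \int[m]_x (a * \1_A x)%:E)%E.
    under eq_integral do rewrite EFinM.
    rewrite ge0_integralZl//; last 2 first.
    - exact/measurable_EFinP.
    - by rewrite lee_fin ltW.
    by rewrite integral_indic// setIT.
  apply: ge0_le_integral => //.
  - by move=> x _; rewrite lee_fin mulr_ge0// ltW.
  - by apply/measurable_EFinP; apply: measurable_funM.
  - by apply/measurable_EFinP; exact: measurableT_comp.
  - move=> x _; rewrite lee_fin indicE; have [|] := boolP (x \in A); last by rewrite mulr0.
    by move=> /set_mem; rewrite mulr1.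
have h2 : (a%:E * m A < +oo)%E.
  exact: le_lt_trans h (integrable_lty measurableT (integrable_abse ig)).
rewrite ltNge leye_eq; apply/negP => /eqP moo.
by move: h2; rewrite moo gt0_muley ?lte_fin.
Qed.

Section fragment_measure.
Context {R : realType} (l : exponent R).
Implicit Types (x y z : R) (th : Theta R) (phi : R -> R) (m n : nat).
Notation pw := (pw l).
Notation lam := (exponent_val l).
Variable beta : {measure set (Theta R) -> \bar R}.
Hypothesis hC : (C_beta lam beta < +oo)%E.

Definition fragC : R := fine (C_beta lam beta).

Let total_ge0 th : (0 <= frag_total l th)%E.
Proof. by apply: le_trans (frag_weight_le_total l 0 th); rewrite lee_fin frag_weight_ge0. Qed.

Lemma integrable_frag_total : beta.-integrable setT (frag_total l).
Proof.
apply/integrableP; split; first exact: measurable_frag_total.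
by under eq_integral do rewrite gee0_abs//; exact: hC.
Qed.

Lemma ae_frag_total : {ae beta, forall th, (frag_total l th < +oo)%E}.
Proof.
have := integrable_ae measurableT integrable_frag_total.
by apply: filterS => th /(_ I); rewrite ge0_fin_numE.
Qed.

Lemma integrable_frag_weight m : beta.-integrable setT (EFin \o frag_weight l m).
Proof.
apply: le_integrable integrable_frag_total => //.
  by apply/measurable_EFinP; exact: measurable_frag_weight.
move=> th _ /=; rewrite gee0_abs// ger0_norm ?frag_weight_ge0//.
exact: frag_weight_le_total.
Qed.

Lemma integrable_fine_frag_total : beta.-integrable setT (EFin \o (fine \o frag_total l)).
Proof.
apply: le_integrable integrable_frag_total => //.
  apply/measurable_EFinP; apply: measurableT_comp => //.
  exact: measurable_frag_total.
move=> th _ /=; rewrite gee0_abs//.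
have [h|h] := boolP (frag_total l th \is a fin_num).
  by rewrite -{2}(fineK h) lee_fin ger0_norm ?fine_ge0.
move: h; rewrite ge0_fin_numE// -leNgt leye_eq => /eqP ->.
by rewrite /= normr0 leey.
Qed.

Lemma fragC_ge0 : 0 <= fragC.
Proof. by apply: fine_ge0; apply: integral_ge0 => th _; exact: total_ge0. Qed.

Lemma int_frag_weight m : \int[beta]_th frag_weight l m th <= fragC.
Proof.
rewrite -lee_fin Rintegral_EFin; last exact: integrable_frag_weight.
rewrite /fragC fineK; last first.
  by rewrite ge0_fin_numE//; apply: integral_ge0 => th _; exact: total_ge0.
apply: ge0_le_integral => //.
- by move=> th _; rewrite lee_fin frag_weight_ge0.
- by apply/measurable_EFinP; exact: measurable_frag_weight.
- exact: measurable_frag_total.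
- by move=> th _; exact: frag_weight_le_total.
Qed.

(** [frag_weight l 0] is (1 - theta_0)^l, which is integrable and positive everywhere since theta_0
    < 1. Its superlevel sets have finite measure and exhaust [Theta], even if [beta] is infinite
    near theta_0 = 1. *)
Lemma beta_sigma_finite : sigma_finite setT beta.
Proof.
pose A n := [set th : Theta R | n.+1%:R^-1 <= frag_weight l 0 th].
have mA n : measurable (A n).
  have -> : A n = frag_weight l 0 @^-1` `[n.+1%:R^-1, +oo[%classic.
    by apply/seteqP; split => th; rewrite /A /= in_itv/= andbT.
  by rewrite -[X in measurable X]setTI; apply: measurable_frag_weight.
exists A.
  apply/esym/seteqP; split => // th _.
  exists (Num.truncn (frag_weight l 0 th)^-1) => //; rewrite /A/=.
  rewrite -[leRHS]invrK lef_pV2 ?posrE ?invr_gt0 ?frag_weight_gt0//.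
  exact/ltW/truncnS_gt.
move=> n; split => //.
have -> : A n = [set th | n.+1%:R^-1 <= `|frag_weight l 0 th|].
  by apply/funext => th; rewrite /A /= ger0_norm// frag_weight_ge0.
by apply: level_set_lty; [rewrite invr_gt0|exact: integrable_frag_weight].
Qed.

Definition frag_int m phi x := \int[beta]_th frag_fin m.+1 phi th x.

Definition frag_lim phi x := \int[beta]_th frag_op phi th x.

Lemma frag_fin_integrable m phi B x : holder l B phi ->
  beta.-integrable setT (EFin \o (fun th => frag_fin m.+1 phi th x)).
Proof.
move=> hphi; have [mphi _] := holder_pw_bounded hphi.
apply: (@integrable_le _ _ _ beta (fun th => frag_fin m.+1 phi th x)
   (fun th => B * pw x * frag_weight l m.+1 th)).
- exact: (measurable_fun_pair1 (f := fun p : Theta R * R => frag_fin m.+1 phi p.1 p.2) x (measurable_frag_fin m.+1 mphi)).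
- rewrite (_ : _ \o _ = (fun th => (B * pw x)%:E * (EFin \o frag_weight l m.+1) th)%E) //.
  by apply: integrableZl => //; exact: integrable_frag_weight.
- by move=> th; rewrite (le_trans (frag_fin_bound _ _ _ hphi))// mulrAC.
Qed.

Section frag_fubini.
Variables (m : nat) (phi : R -> R) (B : R) (hphi : holder l B phi).
Variables (rate : R -> R) (k2 : R).
Hypothesis mrate : measurable_fun setT rate.
Hypothesis rateb : forall x, `|rate x| <= k2.
Variable c : {measure set R -> \bar R}.
Hypothesis mc : has_moment l c.

Let f (p : Theta R * R) := rate p.2 * frag_fin m.+1 phi p.1 p.2.

Let mf : measurable_fun setT f.
Proof.
have [mphi _] := holder_pw_bounded hphi.
apply: measurable_funM; last exact: measurable_frag_fin.
exact: (measurableT_comp mrate measurable_snd).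
Qed.

Let iu : beta.-integrable setT (EFin \o (fun th => k2 * B * frag_weight l m.+1 th)).
Proof.
rewrite (_ : _ \o _ = (fun th => (k2 * B)%:E * (EFin \o frag_weight l m.+1) th)%E) //.
by apply: integrableZl => //; exact: integrable_frag_weight.
Qed.

Let iv : c.-integrable setT (EFin \o pw). Proof. by case: mc. Qed.

Let k20 : 0 <= k2. Proof. exact: le_trans (rateb 0). Qed.

Let fuv th x : `|f (th, x)| <= k2 * B * frag_weight l m.+1 th * pw x.
Proof.
rewrite /f normrM -!mulrA; apply: ler_pM => //=.
by rewrite (le_trans (frag_fin_bound _ _ _ hphi))// mulrA.
Qed.

Let fE x : rate x * frag_int m phi x = \int[beta]_th f (th, x).
Proof. by rewrite /f /= RintegralZl//; exact: (frag_fin_integrable m x hphi). Qed.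

Lemma frag_int_bounded : pw_bounded l (k2 * B * fragC) (fun x => rate x * frag_int m phi x).
Proof.
split.
  apply/measurable_EFinP.
  have := @fubini_integrable_Rr _ _ _ _ _ beta c f _ _ beta_sigma_finite mc.1 mf iu iv fuv.
  case/integrableP => + _.
  by under eq_fun do rewrite -fE.
move=> x; rewrite fE.
have fi := fubini_integrable_l mf iu fuv x.
apply: (le_trans (le_normr_Rintegral _ _)) => //.
have iw : beta.-integrable setT (EFin \o (fun th => k2 * B * pw x * frag_weight l m.+1 th)).
  rewrite (_ : _ \o _ = (fun th => (k2 * B * pw x)%:E * (EFin \o frag_weight l m.+1) th)%E) //.
  by apply: integrableZl => //; exact: integrable_frag_weight.
apply: (@le_trans _ _ (\int[beta]_th (k2 * B * pw x * frag_weight l m.+1 th))).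
  apply: le_Rintegral_setT => //; first exact: integrable_norm fi.
  by move=> th; rewrite (le_trans (fuv th x))// mulrAC.
rewrite RintegralZl//; last exact: integrable_frag_weight.
rewrite [leRHS]mulrAC ler_wpM2l ?int_frag_weight//.
by rewrite !mulr_ge0 ?pw_ge0//; exact: holder_ge0 hphi.
Qed.

Lemma frag_int_fubini :
  \int[c]_x (rate x * frag_int m phi x) =
  \int[beta]_th \int[c]_x (rate x * frag_fin m.+1 phi th x).
Proof.
under eq_Rintegral do rewrite fE.
by rewrite -(fubini_dominated beta_sigma_finite mc.1 mf iu iv fuv).
Qed.

Lemma frag_int_fubini_integrable :
  beta.-integrable setT (fun th => (\int[c]_x (rate x * frag_fin m.+1 phi th x))%:E).
Proof. exact: (fubini_integrable_Rl beta_sigma_finite mc.1 mf iu iv fuv). Qed.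

End frag_fubini.

Lemma frag_lim_cvg phi B x : holder l B phi ->
  frag_int m phi x @[m --> \oo] --> frag_lim phi x.
Proof.
move=> hphi; have [mphi _] := holder_pw_bounded hphi; have B0 := holder_ge0 hphi.
have mfrag m : measurable_fun setT (fun th => frag_fin m phi th x).
  exact: (measurable_fun_pair1 (f := fun p : Theta R * R => frag_fin m phi p.1 p.2) x (measurable_frag_fin m mphi)).
apply: (proj2 (@Rintegral_dct _ _ _ beta (fun m th => frag_fin m.+1 phi th x)
  (fun th => frag_op phi th x) (fun th => B * pw x * fine (frag_total l th)) _ _ _ _ _)).
- by move=> m; exact: mfrag.
- rewrite /frag_op; apply: measurable_funB => //.
  apply: measurable_limn => n; rewrite /series /=.
  apply: measurable_sum => i; apply: measurableT_comp => //.
  apply: measurable_funM => //; exact: measurable_theta.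
- apply: filterS ae_frag_total => th hth.
  have := frag_op_cvg (x := x) hphi hth.
  exact.
- rewrite (_ : _ \o _ = (fun th => (B * pw x)%:E * (EFin \o (fine \o frag_total l)) th)%E) //.
  by apply: integrableZl => //; exact: integrable_fine_frag_total.
- apply: filterS ae_frag_total => th hth n.
  rewrite (le_trans (frag_fin_bound _ _ _ hphi))// mulrAC ler_wpM2l//.
    by rewrite mulr_ge0 ?pw_ge0.
  by rewrite -lee_fin fineK ?frag_weight_le_total// ge0_fin_numE.
Qed.

Lemma frag_lim_pairing phi B (rate : R -> R) k2 (c : {measure set R -> \bar R}) :
  holder l B phi -> measurable_fun setT rate -> (forall x, `|rate x| <= k2) ->
  has_moment l c ->
  pw_bounded l (k2 * B * fragC) (fun x => rate x * frag_lim phi x) /\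
  \int[c]_x (rate x * frag_int m phi x) @[m --> \oo] --> \int[c]_x (rate x * frag_lim phi x).
Proof.
move=> hphi mrate rateb mc.
have bfi m := frag_int_bounded m hphi mrate rateb mc.
have cv x : rate x * frag_int m phi x @[m --> \oo] --> rate x * frag_lim phi x.
  by apply: cvgMr; exact: frag_lim_cvg hphi.
have ml : measurable_fun setT (fun x => rate x * frag_lim phi x).
  apply: (measurable_fun_cvg (h := fun m x => rate x * frag_int m phi x)) => //.
  by move=> m; case: (bfi m).
split.
  split => // x.
  apply: (cvgr_to_le (F := \oo) (f := fun m => `|rate x * frag_int m phi x|)).
    by apply: cvg_norm; exact: cv.
  by apply: nearW => m; case: (bfi m).
apply: (proj2 (@Rintegral_dct _ _ _ c (fun m x => rate x * frag_int m phi x)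
  (fun x => rate x * frag_lim phi x) (fun x => k2 * B * fragC * pw x) _ _ _ _ _)) => //.
- by move=> m; case: (bfi m).
- by apply: aeW => x; exact: cv.
- apply: (@pw_bounded_integrable _ l _ (`|k2 * B * fragC| * 1)) => //.
  exact: pw_boundedM (pw_bounded_pw l).
- by apply: aeW => x m; case: (bfi m).
Qed.


End fragment_measure.

(** * Stability of the fragmentation term *)

Section frag_stability.
Context {R : realType} (l : exponent R).
Notation mu := (@lebesgue_measure R).
Implicit Types (x y z : R).
Notation pw := (pw l).
Notation dpw := (dpw l).
Notation lam := (exponent_val l).

Lemma locally_lipschitz_sum n (f : nat -> R -> R) :
  (forall i, locally_lipschitz (f i)) ->
  locally_lipschitz (fun x => \sum_(i < n) f i x).
Proof.
move=> lf; elim: n => [|n IH].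
  by under eq_fun do rewrite big_ord0; exact: locally_lipschitz_cst.
under eq_fun do rewrite big_ord_recr/=.
exact: locally_lipschitzD.
Qed.

Lemma is_derive_sum_ord n (f : nat -> R -> R) (df : nat -> R) x :
  (forall i, (i < n)%N -> is_derive x 1 (f i) (df i)) ->
  is_derive x 1 (fun t => \sum_(i < n) f i t) (\sum_(i < n) df i).
Proof.
elim: n => [|n IH] H.
  under eq_fun do rewrite big_ord0.
  by rewrite big_ord0; exact: is_derive_cst.
under eq_fun do rewrite big_ord_recr/=.
rewrite big_ord_recr/=.
have h1 := IH (fun i h => H i (ltnW h)).
have h2 := H n (ltnSn n).
exact: is_deriveD.
Qed.

(** The scaling by which the derivative of r(theta_i x) is theta_i^l dpw x times a sign. *)
Lemma dpw_scale k x : 0 <= k -> 0 < x -> k * dpw (k * x) = pw k * dpw x.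
Proof.
rewrite le_eqVlt => /predU1P[<- _|k0 x0]; first by rewrite pw0 !mul0r.
rewrite /dpw x0 mulr_gt0// powRM ?(ltW k0) ?(ltW x0)// (pwE _ (ltW k0)).
have -> : k `^ lam = k * k `^ (lam - 1) by rewrite mulr_powRB1 ?(ltW k0)// exponent_gt0.
ring.
Qed.

Lemma pw_div x : 0 < x -> pw x * x^-1 = dpw x / lam.
Proof.
move=> x0; rewrite /dpw x0 (pwE _ (ltW x0)) mulrAC divff ?exponent_neq0// mul1r.
have -> : x `^ lam = x * x `^ (lam - 1) by rewrite mulr_powRB1 ?(ltW x0)// exponent_gt0.
by rewrite mulrC mulKf// gt_eqF.
Qed.

Variables (K : R -> R -> R) (F : R -> R).
Hypothesis hKF : hypothesis_KF lam K F.
Notation Fp := (Fp F).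
Variables (k2 k3 : R).
Hypothesis Fp2 : forall x, 0 <= Fp x <= k2.
Hypothesis HF : forall x : R, 0 < x -> derivable F x 1 -> `|derive1 F x| <= k3 * x^-1.

Section one_vector.
Variables (c d : {measure set R -> \bar R}).
Hypotheses (mc : has_moment l c) (md : has_moment l d).
Let r := optimal l c d.
Let s z := Num.sg (dpw z * gap c d z).

Let ms : measurable_fun [set: measurableTypeR R] s.
Proof. exact: measurable_sg_gap. Qed.

Let s1 z : `|s z| <= 1. Proof. exact: normr_sg_le1. Qed.

Let hr : holder l 1 r. Proof. exact: optimal_holder. Qed.

Let lr : locally_lipschitz r. Proof. exact: (@prim_lipschitz R l s ms s1). Qed.

Let lscale (k : R) : 0 <= k -> locally_lipschitz (fun x => r (k * x)).
Proof.
rewrite le_eqVlt => /predU1P[<-|k0].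
  by under eq_fun do rewrite mul0r; exact: locally_lipschitz_cst.
apply: (@eq_locally_lipschitz _ (fun x => r (k * x + 0))).
  by move=> x _; rewrite addr0.
exact: locally_lipschitz_affine.
Qed.

(** The derivative in x, times the gap, has two terms. Where [r] is differentiated, fragment i
    contributes at most theta_i^l dpw |gap| and the parent exactly -dpw |gap|. Where [F] is
    differentiated, the bound of [frag_fin] by the weight times x^l meets k3 / x, and x^l / x is dpw
    x / l. *)
Lemma frag_gap_le m (th : Theta R) :
  \int[c]_x (Fp x * frag_fin m.+1 r th x) - \int[d]_x (Fp x * frag_fin m.+1 r th x) <=
  (k2 + k3 / lam) * frag_weight l m.+1 th * dist l c d.
Proof.
have mFp := measurable_Fp hKF.
have [mr _] := holder_pw_bounded hr.
have k20 : 0 <= k2 by have /andP[h1 h2] := Fp2 0; exact: le_trans h2.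
have lp := exponent_gt0 l.
apply: (@pairing_gap_le _ _ _ _ _ (k2 * frag_weight l m.+1 th)) => //.
- split.
    apply: measurable_funM => //.
    exact: (measurable_fun_pair2 (f := fun p : Theta R * R => frag_fin m.+1 r p.1 p.2) th (measurable_frag_fin m.+1 mr)).
  move=> x; rewrite normrM -mulrA; apply: ler_pM => //.
    by have /andP[h1 h2] := Fp2 x; rewrite ger0_norm.
  by have := frag_fin_bound m th x hr; rewrite mul1r.
- apply: (@eq_locally_lipschitz _ (fun x => F x * (\sum_(i < m.+1) r (th i * x) + -1 * r (1 * x)))).
    by move=> x x0; rewrite /Submission.Fp /pos_part1 x0 /frag_fin mul1r mulN1r.
  apply: locally_lipschitzM; first exact: (rate_lipschitz hKF).
  apply: locally_lipschitzD.
    apply: (@locally_lipschitz_sum m.+1 (fun i x => r (th i * x))) => i.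
    by apply: lscale; exact: theta_ge0.
  apply: locally_lipschitzM; first exact: locally_lipschitz_cst.
  exact: lscale.
have FF := ae_filter_ringOfSetsType mu.
have aer : {ae mu, forall y, derivable r y 1 /\ derive1 r y = dpw y * s y} :=
  @prim_derive R l s ms s1.
(* The affine change of variable needs theta_i > 0; for theta_i = 0 the summand is constant. *)
have aes : {ae mu, forall y, forall i : nat, 0 < th i ->
    derivable r (th i * y + 0) 1 /\ derive1 r (th i * y + 0) = dpw (th i * y + 0) * s (th i * y + 0)}.
  apply/ae_foralln => i; have := theta_ge0 th i; rewrite le_eqVlt => /predU1P[<-|ti].
    by apply: aeW => y; rewrite ltxx.
  by have := ae_affine 0 ti aer; apply: filterS => y h _.
have aeF := ae_derivable (rate_lipschitz hKF).
apply: filterS3 aer aes aeF => x [drx drxE] hi /[swap] x0 /(_ x0) dF _.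
have nE : {near x, (fun x => F x * ((\sum_(i < m.+1) r (th i * x)) - r x)) =1
    (fun x => Fp x * frag_fin m.+1 r th x)}.
  near=> t; rewrite /Submission.Fp /pos_part1 /frag_fin.
  by rewrite (_ : 0 < t)//; near: t; exact: lt_nbhsr.
have d1 : is_derive x 1 F (derive1 F x).
  by apply: DeriveDef; [exact: dF|rewrite derive1E].
have d2 : is_derive x 1 r (dpw x * s x).
  by apply: DeriveDef; [exact: drx|rewrite -derive1E; exact: drxE].
have d3 : is_derive x 1 (fun t : R => \sum_(i < m.+1) r (th i * t))
    (\sum_(i < m.+1) pw (th i) * dpw x * s (th i * x)).
  apply: (@is_derive_sum_ord m.+1 (fun i t => r (th i * t)) (fun i => pw (th i) * dpw x * s (th i * x))) => i _.
  have := theta_ge0 th i; rewrite le_eqVlt => /predU1P[<-|ti].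
    rewrite pw0 !mul0r; under eq_fun do rewrite mul0r.
    exact: is_derive_cst.
  have [h1 h2] := hi i ti.
  have h3 : is_derive (th i * x + 0) 1 r (dpw (th i * x + 0) * s (th i * x + 0)).
    by apply: DeriveDef; [exact: h1|rewrite -derive1E; exact: h2].
  have -> : pw (th i) * dpw x * s (th i * x) = th i * (dpw (th i * x + 0) * s (th i * x + 0)).
    by rewrite addr0 mulrA (dpw_scale (ltW ti) x0).
  have -> : (fun t : R => r (th i * t)) = (fun t : R => r (th i * t + 0)).
    by apply/funext => t; rewrite addr0.
  exact: is_derive_affine h3.
have [_ dE] : is_derive x 1 (fun x => Fp x * frag_fin m.+1 r th x)
   (F x * ((\sum_(i < m.+1) pw (th i) * dpw x * s (th i * x)) - dpw x * s x) +
    frag_fin m.+1 r th x * derive1 F x).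
  apply: (near_eq_is_derive nE).
rewrite derive1E dE {dE}.
have wx : 0 <= dpw x by exact: dpw_ge0.
have fwx := frag_weight_ge0 l m.+1 th.
have /andP[F0 F2] : 0 <= F x <= k2 by have := Fp2 x; rewrite /Submission.Fp /pos_part1 x0.
have sgx := sg_gap_mul l c d x0.
set g := gap c d x.
have h1 : F x * ((\sum_(i < m.+1) pw (th i) * dpw x * s (th i * x)) - dpw x * s x) * g <=
    k2 * frag_weight l m.+1 th * (dpw x * `|g|).
  have h11 : ((\sum_(i < m.+1) pw (th i) * dpw x * s (th i * x)) - dpw x * s x) * g <=
     frag_weight l m.+1 th * (dpw x * `|g|).
    rewrite mulrBl -[dpw x * s x * _]mulrA sgx lerBlDr mulr_suml.
    apply: (@le_trans _ _ (\sum_(i < m.+1) pw (th i) * (dpw x * `|g|))).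
      apply: ler_sum => i _; rewrite -!mulrA ler_wpM2l ?pw_ge0// ler_wpM2l//.
      by rewrite (le_trans (ler_norm _))// normrM -[leRHS]mul1r ler_wpM2r.
    rewrite -mulr_suml -(big_mkord xpredT (fun i => pw (th i))) big_nat_recl//.
    rewrite -[X in _ <= _ + X]mul1r -mulrDl ler_wpM2r ?mulr_ge0//.
    (* The contribution of the parent absorbs fragment 0, whose weight is at most 1. *)
    rewrite /frag_weight big_add1 /= addrC -!addrA lerD2l.
    rewrite (@le_trans _ _ 1)//; last by rewrite lerDr pw_ge0.
    by rewrite -(pw1 l) pw_mono// theta_le1.
  rewrite -[X in X <= _]mulrA.
  apply: (@le_trans _ _ (F x * (frag_weight l m.+1 th * (dpw x * `|g|)))).
    by rewrite ler_wpM2l.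
  by rewrite -[leRHS]mulrA ler_wpM2r// !mulr_ge0.
have h2 : frag_fin m.+1 r th x * derive1 F x * g <=
    k3 / lam * frag_weight l m.+1 th * (dpw x * `|g|).
  rewrite (le_trans (ler_norm _))// !normrM [leRHS]mulrA ler_wpM2r//.
  have b1 := frag_fin_bound m th x hr.
  have b2 := HF x0 dF.
  apply: (@le_trans _ _ (1 * frag_weight l m.+1 th * pw x * (k3 * x^-1))).
    exact: ler_pM.
  have -> : 1 * frag_weight l m.+1 th * pw x * (k3 * x^-1) =
    k3 * frag_weight l m.+1 th * (pw x * x^-1) by ring.
  rewrite pw_div// [leLHS]mulrA.
  by rewrite le_eqVlt; apply/orP; left; apply/eqP; ring.
rewrite [X in X <= _]mulrDl; apply: (le_trans (lerD h1 h2)).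
by rewrite le_eqVlt; apply/orP; left; apply/eqP; ring.
Unshelve. all: by end_near. Qed.

End one_vector.

End frag_stability.

Lemma integrable_subR d (T : measurableType d) (R : realType)
    (m : {measure set T -> \bar R}) (f g : T -> R) :
  m.-integrable setT (EFin \o f) -> m.-integrable setT (EFin \o g) ->
  m.-integrable setT (EFin \o (fun x => f x - g x)).
Proof.
move=> fi gi; rewrite (_ : _ \o _ = ((EFin \o f) \- (EFin \o g))%E) //.
exact: integrableB.
Qed.

(** [frag_gap_le] holds for fixed theta and finitely many fragments. The integral over [beta] is
    therefore exchanged with the one over the sizes before it is applied, and the number of
    fragments tends to infinity last. *)
Lemma frag_stability {R : realType} (l : exponent R) (K : R -> R -> R)
    (F : R -> R) (beta : {measure set (Theta R) -> \bar R}) :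
  hypothesis_KF l K F -> (C_beta l beta < +oo)%E ->
  exists2 C, 0 <= C & forall c d : {measure set R -> \bar R},
    has_moment l c -> has_moment l d ->
    \int[c]_x (Fp F x * frag_lim beta (optimal l c d) x) -
    \int[d]_x (Fp F x * frag_lim beta (optimal l c d) x) <= C * dist l c d.
Proof.
move=> hKF hC.
have [k2 k20 Fp2] := Fp_bound hKF.
have [k3 k30 HF] := F_deriv hKF.
have lp := exponent_gt0 l.
have C1 : 0 <= k2 + k3 / (l : R) by rewrite addr_ge0 ?divr_ge0// ltW.
exists ((k2 + k3 / (l : R)) * fragC l beta).
  by rewrite mulr_ge0// fragC_ge0.
move=> c d mc md; set r := optimal l c d.
have hr : holder l 1 r by exact: optimal_holder.
have mFp := measurable_Fp hKF.
have Fb x : `|Fp F x| <= k2 by have /andP[h1 h2] := Fp2 x; rewrite ger0_norm.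
have [_ c1] := frag_lim_pairing hC hr mFp Fb mc.
have [_ c2] := frag_lim_pairing hC hr mFp Fb md.
apply: (cvgr_to_le (F := \oo) (f := fun m => \int[c]_x (Fp F x * frag_int beta m r x) -
   \int[d]_x (Fp F x * frag_int beta m r x))).
  exact: cvgB c1 c2.
apply: nearW => m.
rewrite !(frag_int_fubini hC m hr mFp Fb)//.
have i1 := frag_int_fubini_integrable hC m hr mFp Fb mc.
have i2 := frag_int_fubini_integrable hC m hr mFp Fb md.
rewrite -RintegralB//.
have iw : beta.-integrable setT (EFin \o (fun th => (k2 + k3 / (l : R)) * dist l c d * frag_weight l m.+1 th)).
  rewrite (_ : _ \o _ = (fun th => ((k2 + k3 / (l : R)) * dist l c d)%:E * (EFin \o frag_weight l m.+1) th)%E) //.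
  by apply: integrableZl => //; exact: integrable_frag_weight.
apply: (@le_trans _ _ (\int[beta]_th ((k2 + k3 / (l : R)) * dist l c d * frag_weight l m.+1 th))).
  apply: le_Rintegral_setT => //; first exact: integrable_subR.
  move=> th; apply: (le_trans (frag_gap_le hKF Fp2 HF mc md m th)).
  by rewrite mulrAC.
rewrite RintegralZl//; last exact: integrable_frag_weight.
by rewrite [leRHS]mulrAC ler_wpM2l ?int_frag_weight// mulr_ge0// dist_ge0.
Qed.

(** * Stability *)

Section comparison.
Context {R : realType}.
Implicit Types (a b s t e : R) (f g : R -> R).

Definition cont_on a b g := forall t, a <= t <= b -> forall e, 0 < e ->
  exists2 d, 0 < d & forall s, a <= s <= b -> `|s - t| < d -> `|g s - g t| <= e.

Lemma cont_onB a b f g : cont_on a b f -> cont_on a b g ->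
  cont_on a b (fun t => f t - g t).
Proof.
move=> cf cg t tab e e0; have e2 : 0 < e / 2 by rewrite divr_gt0.
have [d1 d10 H1] := cf _ tab _ e2; have [d2 d20 H2] := cg _ tab _ e2.
exists (Num.min d1 d2); first by rewrite lt_min d10.
move=> s sab; rewrite lt_min => /andP[sd1 sd2].
have -> : f s - g s - (f t - g t) = (f s - f t) - (g s - g t) by ring.
rewrite (le_trans (ler_normB _ _))// [leRHS](splitr e).
by apply: lerD; [exact: H1|exact: H2].
Qed.

Lemma lipschitz_cont_on a b L g :
  (forall s t, a <= s <= b -> a <= t <= b -> `|g s - g t| <= L * `|s - t|) ->
  cont_on a b g.
Proof.
move=> lg t tab e e0; exists (e / (`|L| + 1)).
  by rewrite divr_gt0// ltr_pwDr.
move=> s sab; rewrite ltr_pdivlMr ?ltr_pwDr// => h.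
apply: (le_trans (lg _ _ sab tab)); apply: le_trans (ltW h).
rewrite mulrC ler_wpM2l// (le_trans (ler_norm L))// lerDl//.
Qed.

(* At the first contact time [t] of [g] with the barrier [B], one has
   [g t - g s > B t - B s] for all [s < t]. *)
Lemma comparison a b g B : cont_on a b g -> cont_on a b B -> g a < B a ->
  (forall t, a < t <= b -> g t = B t ->
    exists2 s, a <= s < t & g t - g s <= B t - B s) ->
  forall t, a <= t <= b -> g t < B t.
Proof.
move=> cg cB gBa H t1 /andP[at1 t1b].
rewrite ltNge; apply/negP => Bg1.
pose A := [set t | a <= t <= b /\ B t <= g t].
have A1 : A t1 by split=> //; rewrite at1.
have lbA : lbound A a by move=> t [/andP[]].
have hA : has_inf A by split; [exists t1|exists a].
pose t := inf A.
have atb : a <= t <= b.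
  apply/andP; split; first by apply: lb_le_inf => //; exists t1.
  by apply: le_trans t1b; apply: ge_inf => //; exists a.
have /andP[a_t t_b] := atb.
have cgB := cont_onB cB cg.
have below s : a <= s -> s < t -> g s < B s.
  move=> as_ st; rewrite ltNge; apply/negP => Bs.
  have : t <= s.
    apply: ge_inf; first by exists a.
    by split => //; rewrite as_ (le_trans (ltW st)).
  by rewrite leNgt st.
have Bgt : B t <= g t.
  rewrite leNgt; apply/negP => gBt.
  have e0 : 0 < (B t - g t) / 2 by rewrite divr_gt0// subr_gt0.
  have [d d0 Hd] := cgB t atb _ e0.
  have [s [/andP[as_ sb] Bs] st] : exists2 s, A s & s < t + d.
    by apply: inf_adherent.
  have ts : t <= s by apply: ge_inf; [exists a|split => //; rewrite as_].
  have := Hd s; rewrite as_ sb ger0_norm ?subr_ge0// => /(_ isT).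
  rewrite ltrBlDl => /(_ st); rewrite ler_norml => /andP[h _].
  lra.
have at_ : a < t.
  rewrite lt_def a_t andbT; apply/negP => /eqP ta.
  by move: gBa; rewrite -ta ltNge Bgt.
have gBt : g t = B t.
  apply/eqP; rewrite eq_le Bgt andbT leNgt; apply/negP => Blt.
  have e0 : 0 < (g t - B t) / 2 by rewrite divr_gt0// subr_gt0.
  have [d d0 Hd] := cgB t atb _ e0.
  pose s := Num.max a (t - d / 2).
  have st : s < t by rewrite /s gt_max at_/= ltrBlDr ltrDl divr_gt0.
  have as_ : a <= s by rewrite /s le_max lexx.
  have gBs := below _ as_ st.
  have := Hd s; rewrite as_ (le_trans (ltW st) t_b) => /(_ isT).
  rewrite ltr0_norm ?subr_lt0// opprB ltrBlDr => h.
  have /h : t < d + s.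
    have : t - d / 2 <= s by rewrite /s le_max lexx orbT.
    lra.
  rewrite ler_norml => /andP[_ h2]; lra.
have tab : a < t <= b by rewrite at_.
have [s /andP[as_ st] h] := H t tab gBt.
have := below _ as_ st; lra.
Qed.

(** A mean value inequality for left increments: [g] stays below the line of slope e + h that starts
    h above [g a]. With the chosen [h] the total excess at [b] is the arbitrary [h0]. *)
Lemma left_derivative_le a b g e : a <= b -> cont_on a b g ->
  (forall t, a < t <= b -> forall h, 0 < h ->
     exists2 d, 0 < d & forall s, a <= s < t -> t - s < d -> g t - g s <= (e + h) * (t - s)) ->
  g b - g a <= e * (b - a).
Proof.
move=> ab cg H.
apply/ler_addgt0Pr => h0 h00.
pose h := h0 / (1 + (b - a)).
have ba : 0 < 1 + (b - a) by rewrite ltr_pwDl// subr_ge0.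
have h_0 : 0 < h by rewrite divr_gt0.
pose B t := (e + h) * (t - a) + (g a + h).
suff : g b < B b.
  rewrite /B => hb.
  have h1 : h + h * (b - a) = h0.
    by rewrite -{1}[h]mulr1 -mulrDr /h divfK// gt_eqF.
  have : g b < e * (b - a) + h * (b - a) + (g a + h) by rewrite -mulrDl.
  lra.
apply: (@comparison a b g B) => //; last by rewrite ab lexx.
- apply: (@lipschitz_cont_on _ _ `|e + h|) => s t _ _; rewrite /B.
  have -> : (e + h) * (s - a) + (g a + h) - ((e + h) * (t - a) + (g a + h)) = (e + h) * (s - t) by ring.
  by rewrite normrM.
- by rewrite /B subrr mulr0 add0r ltrDl.
move=> t /[dup] tab /andP[at_ tb] _.
have [d d0 Hd] := H t tab h h_0.
exists (Num.max a (t - d / 2)).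
  by rewrite le_max lexx/= gt_max at_/= ltrBlDr ltrDl divr_gt0.
set s := Num.max _ _.
have st : s < t by rewrite /s gt_max at_/= ltrBlDr ltrDl divr_gt0.
apply: (le_trans (Hd s _ _)).
- by rewrite st /s le_max lexx.
- have : t - d / 2 <= s by rewrite /s le_max lexx orbT.
  lra.
- by rewrite /B; lra.
Qed.

Lemma left_derivative_norm a b g q e : a <= b -> cont_on a b g ->
  (forall t, a < t <= b -> forall h, 0 < h ->
     exists2 d, 0 < d & forall s, a <= s < t -> t - s < d ->
       `|g t - g s - q * (t - s)| <= (e + h) * (t - s)) ->
  `|g b - g a - q * (b - a)| <= e * (b - a).
Proof.
move=> ab cg H; rewrite ler_norml; apply/andP; split.
  have cN : cont_on a b (fun t => - g t).
    move=> t tab h h0; have [d d0 Hd] := cg t tab h h0.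
    by exists d => // s sab sd; rewrite -opprD normrN; exact: Hd.
  suff : - g b - - g a <= (e - q) * (b - a) by rewrite mulrBl; lra.
  apply: (@left_derivative_le a b (fun t => - g t)) => // t tab h h0.
  have [d d0 Hd] := H t tab h h0; exists d => // s sab sd.
  have := Hd s sab sd; rewrite ler_norml => /andP[h1 h2].
  by move: h1; rewrite !mulrDl mulNr; lra.
suff : g b - g a <= (e + q) * (b - a) by rewrite mulrDl; lra.
apply: left_derivative_le => // t tab h h0.
have [d d0 Hd] := H t tab h h0; exists d => // s sab sd.
have := Hd s sab sd; rewrite ler_norml => /andP[h1 h2].
by move: h2; rewrite !mulrDl; lra.
Qed.

(** The exponent L + 1 in place of L provides the slack that a barrier argument needs. At a contact
    point the slope of the barrier is (L + 1) B >= L B + e + h, while left increments of [g] have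
    slope at most L g + e + h / 2. *)
Lemma gronwall_left T g L e : 0 <= T -> 0 <= L -> 0 <= e -> 0 <= g 0 -> cont_on 0 T g ->
  (forall t, 0 < t <= T -> forall h, 0 < h -> exists2 d, 0 < d &
     forall s, 0 <= s < t -> t - s < d -> g t - g s <= (L * g t + e + h) * (t - s)) ->
  forall t, 0 <= t <= T -> g t <= (g 0 + e) * expR ((L + 1) * t).
Proof.
move=> T0 L0 e0 g0 cg H t /[dup] tT /andP[t0 t_T].
apply/ler_addgt0Pr => h00 h0_.
pose E := expR ((L + 1) * t).
have E0 : 0 < E by exact: expR_gt0.
pose h := h00 / E.
have h_0 : 0 < h by rewrite divr_gt0.
have -> : (g 0 + e) * expR ((L + 1) * t) + h00 = (g 0 + e + h) * expR ((L + 1) * t).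
  by rewrite [RHS]mulrDl -/E /h divfK// gt_eqF.
pose A := g 0 + e + h.
have A0 : 0 < A by rewrite ltr_wpDl// addr_ge0.
pose B t := A * expR ((L + 1) * t).
have L1 : 0 < L + 1 by rewrite ltr_wpDl.
apply: ltW; apply: (@comparison 0 T g B) => //.
- move=> u uT x x0.
  have cB : {for u, continuous B}.
    apply: cvgMr; apply: (continuous_comp (f := fun z => (L + 1) * z)).
      by apply: cvgMr; exact: cvg_id.
    exact: continuous_expR.
  have /cvgrPdist_le/(_ _ x0)[d /= d0 Hd] := cB.
  exists d => // s _ sd; rewrite distrC; apply: Hd => /=.
  by rewrite distrC.
- by rewrite /B mulr0 expR0 mulr1 /A -addrA ltrDl ltr_wpDl.
move=> u /[dup] uT /andP[u0 u_T] gB.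
have h2 : 0 < h / 2 by rewrite divr_gt0.
have [d d0 Hd] := H u uT _ h2.
have AB : A <= B u.
  rewrite /B -[leLHS]mulr1 ler_wpM2l ?(ltW A0)// -[leLHS]expR0 ler_expR.
  by rewrite mulr_ge0 ?(ltW L1) ?(ltW u0).
have Bu0 : 0 < B u by exact: lt_le_trans AB.
(* The step back is small enough to stay in the interval and within [d], and to make the
   second-order term of the exponential at most h / 2. *)
pose k := Num.min (Num.min (u / 2) (d / 2)) (h / 2 / (B u * (L + 1) * (L + 1))).
have D0 : 0 < B u * (L + 1) * (L + 1).
  exact: mulr_gt0 (mulr_gt0 Bu0 L1) L1.
have k0 : 0 < k.
  by rewrite !lt_min (divr_gt0 u0 (ltr0Sn _ 1)) (divr_gt0 d0 (ltr0Sn _ 1)) (divr_gt0 h2 D0).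
have ku : k <= u / 2 by rewrite /k !ge_min lexx.
have kd : k <= d / 2 by rewrite /k !ge_min lexx orbT.
have kh : k * (B u * (L + 1) * (L + 1)) <= h / 2.
  by rewrite -(ler_pdivlMr _ _ D0) /k !ge_min lexx orbT.
have su : 0 <= u - k < u by apply/andP; split; lra.
exists (u - k) => //.
have su2 : u - (u - k) < d by lra.
apply: (le_trans (Hd _ su su2)).
have -> : u - (u - k) = k by ring.
have -> : B u - B (u - k) = B u * (1 - expR (- ((L + 1) * k))).
  have -> : B (u - k) = B u * expR (- ((L + 1) * k)).
    by rewrite /B -mulrA -expRD; congr (_ * expR _); ring.
  ring.
have ex : 1 - expR (- ((L + 1) * k)) >= (L + 1) * k - (L + 1) * (L + 1) * k * k.
  set x := (L + 1) * k.
  have x0 : 0 < x by rewrite mulr_gt0.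
  have -> : (L + 1) * (L + 1) * k * k = x * x by rewrite /x; ring.
  have : expR (- x) <= (1 + x)^-1.
    rewrite expRN lef_pV2 ?posrE ?expR_gt0 ?addr_gt0//.
    exact: expR_ge1Dx.
  have : (1 + x)^-1 <= 1 - x + x * x.
    rewrite -[leLHS]mul1r ler_pdivrMr ?addr_gt0//.
    have -> : (1 - x + x * x) * (1 + x) = 1 + x * x * x by ring.
    by rewrite lerDl !mulr_ge0// ltW.
  lra.
apply: (@le_trans _ _ (B u * ((L + 1) * k - (L + 1) * (L + 1) * k * k))); last first.
  by rewrite ler_wpM2l// ltW.
rewrite gB.
have -> : B u * ((L + 1) * k - (L + 1) * (L + 1) * k * k) =
  ((L + 1) * B u - k * (B u * (L + 1) * (L + 1))) * k by ring.
rewrite ler_wpM2r ?(ltW k0)//.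
move: AB; rewrite /A mulrDl mul1r; lra.
Qed.

End comparison.

(** * The weak right-hand side and approximate solutions *)

Section weak_form.
Context {R : realType} (l : exponent R).
Implicit Types (c d : {measure set R -> \bar R}) (x y z t s e : R) (phi : R -> R).
Notation pw := (pw l).
Notation lam := (exponent_val l).
Variables (K : R -> R -> R) (F : R -> R) (beta : {measure set (Theta R) -> \bar R}).

Definition rhs c phi : R :=
  2^-1 * \int[c]_y \int[c]_x (Kp K x y * coag_op phi x y) +
  \int[c]_x (Fp F x * frag_lim beta phi x).

Hypothesis hKF : hypothesis_KF lam K F.
Hypothesis hC : (C_beta lam beta < +oo)%E.

Lemma rhs_bound : exists2 C, 0 <= C & forall c phi B, has_moment l c ->
  holder l B phi -> `|rhs c phi| <= C * B * (mass l c ^+ 2 + mass l c).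
Proof.
have [C0 C00 HC0] := coag_bounded hKF.
have [k2 k20 Fp2] := Fp_bound hKF.
have C1 : 0 <= k2 * fragC l beta by rewrite mulr_ge0 ?fragC_ge0// ltW.
exists (C0 + k2 * fragC l beta); first by rewrite addr_ge0// ltW.
move=> c phi B mc hphi.
have B0 := holder_ge0 hphi.
have m0 := mass_ge0 l c.
have bH := HC0 (Kp K) phi B (measurable_Kp hKF)
  (fun x y => introT andP (conj (Kp_ge0 hKF x y) (lexx _))) hphi.
have Fb x : `|Fp F x| <= k2 by have /andP[h1 h2] := Fp2 x; rewrite ger0_norm.
have [bF _] := frag_lim_pairing hC hphi (measurable_Fp hKF) Fb mc.
have h1 := bilinear_bound bH mc mc.
have h2 := pairing_bound mc bF.
rewrite /rhs (le_trans (ler_normD _ _))// normrM ger0_norm ?invr_ge0//.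
have h3 : 2^-1 * `|\int[c]_y \int[c]_x (Kp K x y * coag_op phi x y)| <= C0 * B * mass l c ^+ 2.
  by rewrite expr2 mulrA; apply: le_trans h1; rewrite ler_piMl// invf_le1// ler1n.
have h4 : 0 <= C0 * B * mass l c by rewrite !mulr_ge0// ltW.
have h5 : 0 <= k2 * fragC l beta * B * mass l c ^+ 2.
  by apply: mulr_ge0; [exact: mulr_ge0|exact: exprn_ge0].
apply: (le_trans (lerD h3 h2)); rewrite -subr_ge0.
have -> : (C0 + k2 * fragC l beta) * B * (mass l c ^+ 2 + mass l c) -
  (C0 * B * mass l c ^+ 2 + k2 * B * fragC l beta * mass l c) =
  C0 * B * mass l c + k2 * fragC l beta * B * mass l c ^+ 2 by ring.
exact: addr_ge0.
Qed.

Lemma rhs_stability : exists2 C, 0 <= C & forall c d, has_moment l c -> has_moment l d ->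
  rhs c (optimal l c d) - rhs d (optimal l c d) <=
  C * (1 + mass l c + mass l d) * dist l c d.
Proof.
have [C1 C10 H1] := coag_stability hKF.
have [C2 C20 H2] := frag_stability hKF hC.
exists (C1 + C2); first exact: addr_ge0.
move=> c d mc md; have := H1 c d mc md; have := H2 c d mc md.
have D0 := dist_ge0 l c d; have := mass_ge0 l c; have := mass_ge0 l d.
rewrite /rhs; set r := optimal l c d; set D := dist l c d in D0 *.
set A1 := \int[c]_x _; set A2 := \int[d]_x _; set B1 := Rintegral _ _ _; set B2 := Rintegral _ _ _.
move=> md0 mc0 h2 h1.
have : 2^-1 * (B1 - B2) <= C1 * (mass l c + mass l d) * D.
  apply: (@le_trans _ _ (2^-1 * (C1 * (mass l c + mass l d) * D))).
    by rewrite ler_wpM2l// invr_ge0.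
  by rewrite ler_piMl ?invf_le1 ?ler1n// !mulr_ge0// addr_ge0.
have h3 : 0 <= C1 * D by rewrite mulr_ge0.
have h4 : 0 <= C2 * D * (mass l c + mass l d) by rewrite !mulr_ge0// addr_ge0.
have -> : (C1 + C2) * (1 + mass l c + mass l d) * D = C1 * D + C2 * D * (mass l c + mass l d)
  + C1 * (mass l c + mass l d) * D + C2 * D by ring.
by lra.
Qed.

(** Solutions up to an error rate [e], tested with Hoelder constant 1. Only left increments are
    constrained, with the rate taken at their right end: exact solutions satisfy this with e = 0,
    interpolated Euler schemes with a small [e]. *)
Record approx_sol T e M (c : R -> {measure set R -> \bar R}) : Prop := ApproxSol {
  as_moment : forall t, 0 <= t <= T -> has_moment l (c t);
  as_mass : forall t, 0 <= t <= T -> mass l (c t) <= M;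
  as_cont : forall phi, holder l 1 phi -> cont_on 0 T (fun t => \int[c t]_x phi x);
  as_left : forall phi, holder l 1 phi -> forall t, 0 < t <= T -> forall h, 0 < h ->
    exists2 d, 0 < d & forall s, 0 <= s < t -> t - s < d ->
      `|\int[c t]_x phi x - \int[c s]_x phi x - rhs (c t) phi * (t - s)|
        <= (e + h) * (t - s) }.

Lemma approx_sol_le (T' T : R) e M (c : R -> {measure set R -> \bar R}) : 0 <= T' <= T -> approx_sol T e M c -> approx_sol T' e M c.
Proof.
move=> /andP[T0 TT] [h1 h2 h3 h4].
have tT t : t <= T' -> t <= T by move=> h; exact: le_trans TT.
split=> [t /andP[t0 /tT t1]|t /andP[t0 /tT t1]|phi hphi t /andP[t0 /tT t1] h h0|
  phi hphi t /andP[t0 /tT t1] h h0].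
- by apply: h1; rewrite t0.
- by apply: h2; rewrite t0.
- have [|d d0 Hd] := h3 phi hphi t _ h h0; first by rewrite t0.
  by exists d => // s /andP[s0 /tT s1] sd; apply: Hd => //; rewrite s0.
- by apply: h4 => //; rewrite t0.
Qed.

(** [left_derivative_norm] with slope 0: left increments have speed at most |rhs| + e, and [rhs] is
    bounded in terms of the mass bound alone. *)
Lemma approx_sol_lipschitz M : 0 <= M -> exists2 C, 0 <= C & forall T e (c : R -> {measure set R -> \bar R}), 0 <= e ->
  approx_sol T e M c -> forall phi, holder l 1 phi -> forall s t, 0 <= s <= t -> t <= T ->
  `|\int[c t]_x phi x - \int[c s]_x phi x| <= (C + e) * (t - s).
Proof.
move=> M0; have [C C0 HC] := rhs_bound.
have C1 : 0 <= C * (M ^+ 2 + M) by rewrite mulr_ge0// addr_ge0// exprn_ge0.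
exists (C * (M ^+ 2 + M)) => // T e c e0 H phi hphi s t /andP[s0 st] tT.
have -> : \int[c t]_x phi x - \int[c s]_x phi x =
  \int[c t]_x phi x - \int[c s]_x phi x - 0 * (t - s) by rewrite mul0r subr0.
apply: (@left_derivative_norm _ s t (fun t => \int[c t]_x phi x)) => //.
  move=> u /andP[su ut] h h0; have [|d d0 Hd] := as_cont H hphi _ h0 (t := u).
    by rewrite (le_trans s0 su) (le_trans ut tT).
  exists d => // v /andP[sv vt]; apply: Hd.
  by rewrite (le_trans s0 sv) (le_trans vt tT).
move=> u /andP[su ut] h h0.
have uT : 0 <= u <= T by rewrite (ltW (le_lt_trans s0 su)) (le_trans ut tT).
have [|d d0 Hd] := as_left H hphi _ h0 (t := u).
  by rewrite (le_lt_trans s0 su) (le_trans ut tT).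
exists d => // v /andP[sv vu] vd; rewrite mul0r subr0.
have v0 : 0 <= v < u by rewrite (le_trans s0 sv) vu.
have h1 := Hd v v0 vd.
have uv : 0 <= u - v by rewrite subr_ge0 ltW.
have h2 : `|rhs (c u) phi| <= C * (M ^+ 2 + M).
  apply: (le_trans (HC _ _ _ (as_moment H uT) hphi)).
  have m1 := as_mass H uT; have m0 := mass_ge0 l (c u).
  rewrite mulr1 ler_wpM2l//; apply: lerD => //.
  by rewrite ler_sqr ?nnegrE.
have h3 : `|rhs (c u) phi * (u - v)| <= C * (M ^+ 2 + M) * (u - v).
  by rewrite normrM (ger0_norm uv) ler_wpM2r.
have := ler_normD (\int[c u]_x phi x - \int[c v]_x phi x - rhs (c u) phi * (u - v))
  (rhs (c u) phi * (u - v)).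
rewrite subrK; set A := C * _ in h3 *.
by lra.
Qed.

(** The increment is tested with the function optimal for the pair of times. *)
Lemma dist_lipschitz T (c : R -> {measure set R -> \bar R}) L :
  (forall t, 0 <= t <= T -> has_moment l (c t)) ->
  (forall phi, holder l 1 phi -> forall s t, 0 <= s <= t -> t <= T ->
    `|\int[c t]_x phi x - \int[c s]_x phi x| <= L * (t - s)) ->
  forall s t, 0 <= s <= T -> 0 <= t <= T -> dist l (c s) (c t) <= L * `|s - t|.
Proof.
move=> mc H s t.
wlog st : s t / s <= t.
  move=> W hs ht; have [st|/ltW ts] := leP s t; first exact: W.
  by rewrite dist_sym distrC; exact: W.
move=> /[dup] hs /andP[s0 sT] /[dup] ht /andP[t0 tT].
have ms := mc _ hs; have mt := mc _ ht.
rewrite distrC ger0_norm ?subr_ge0// dist_sym -optimal_pairing//.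
rewrite (le_trans (ler_norm _))// H ?s0//.
exact: optimal_holder.
Qed.

Theorem approx_stability M : 0 <= M -> exists2 L, 0 <= L & forall T e1 e2
  (c d : R -> {measure set R -> \bar R}),
  0 <= T -> 0 <= e1 -> 0 <= e2 -> approx_sol T e1 M c -> approx_sol T e2 M d ->
  forall t, 0 <= t <= T ->
  dist l (c t) (d t) <= (dist l (c 0) (d 0) + (e1 + e2)) * expR (L * t).
Proof.
move=> M0; have [C C0 HC] := rhs_stability.
have [A A0 HA] := approx_sol_lipschitz M0.
have L0 : 0 <= C * (1 + M + M) by rewrite mulr_ge0// !addr_ge0.
(* The final [+ 1] is that of the exponent in [gronwall_left]. *)
exists (C * (1 + M + M) + 1); first exact: addr_ge0.
move=> T e1 e2 c d T0 e10 e20 Hc Hd.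
have dc := dist_lipschitz (as_moment Hc) (HA _ _ _ e10 Hc).
have dd := dist_lipschitz (as_moment Hd) (HA _ _ _ e20 Hd).
apply: (@gronwall_left _ T (fun t => dist l (c t) (d t)) (C * (1 + M + M)) (e1 + e2)) => //.
- exact: addr_ge0.
- exact: dist_ge0.
- apply: (@lipschitz_cont_on _ _ _ ((A + e1) + (A + e2))) => s t sT tT.
  have mcs := as_moment Hc sT; have mct := as_moment Hc tT.
  have mds := as_moment Hd sT; have mdt := as_moment Hd tT.
  have h1 := dc s t sT tT; have h2 := dd s t sT tT.
  have t1 := dist_triangle mcs mct mds; have t2 := dist_triangle mct mdt mds.
  have t3 := dist_triangle mct mcs mdt; have t4 := dist_triangle mcs mds mdt.
  rewrite (dist_sym l (d t) (d s)) in t2; rewrite (dist_sym l (c t) (c s)) in t3.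
  rewrite mulrDl; move: h1 h2 t1 t2 t3 t4.
  move: (dist l (c s) (c t)) (dist l (d s) (d t)) (dist l (c s) (d t)) (dist l (c t) (d s))
    (dist l (c t) (d t)) (dist l (c s) (d s)) ((A + e1) * _) ((A + e2) * _).
  by move=> *; rewrite ler_norml; apply/andP; split; lra.
move=> t /[dup] tT1 /andP[t0 tT] h h0.
have tT2 : 0 <= t <= T by rewrite ltW.
have mct := as_moment Hc tT2; have mdt := as_moment Hd tT2.
set r := optimal l (c t) (d t).
have hr : holder l 1 r by exact: optimal_holder.
have h20 : 0 < h / 2 by rewrite divr_gt0.
have [d1 d10 H1] := as_left Hc hr tT1 h20.
have [d2 d20 H2] := as_left Hd hr tT1 h20.
exists (Num.min d1 d2); first by rewrite lt_min d10.
move=> s /[dup] st1 /andP[s0 st]; rewrite lt_min => /andP[sd1 sd2].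
have sT : 0 <= s <= T by rewrite s0 (le_trans (ltW st)).
have := H1 s st1 sd1; have := H2 s st1 sd2.
rewrite !ler_norml => /andP[a1 a2] /andP[b1 b2].
(* At the earlier time [r] is not optimal; the resulting inequality goes in the favourable
   direction. *)
have p1 : \int[c s]_x r x - \int[d s]_x r x <= dist l (c s) (d s).
  apply: prim_pairing_le; [exact: measurable_sg_gap|by move=> z; exact: normr_sg_le1| |].
    exact: (as_moment Hc).
  exact: (as_moment Hd).
have p2 : \int[c t]_x r x - \int[d t]_x r x = dist l (c t) (d t) by exact: optimal_pairing.
have p3 := HC _ _ mct mdt; rewrite -/r in p3.
have ts : 0 <= t - s by rewrite subr_ge0 ltW.
have p4 : (rhs (c t) r - rhs (d t) r) * (t - s) <= C * (1 + M + M) * dist l (c t) (d t) * (t - s).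
  rewrite ler_wpM2r// (le_trans p3)// ler_wpM2r ?dist_ge0// ler_wpM2l//.
  by apply: lerD; [apply: lerD => //; exact: as_mass Hc _ tT2|exact: as_mass Hd _ tT2].
have -> : (C * (1 + M + M) * dist l (c t) (d t) + (e1 + e2) + h) * (t - s) =
  C * (1 + M + M) * dist l (c t) (d t) * (t - s) + (e1 + h / 2) * (t - s) + (e2 + h / 2) * (t - s) by field.
rewrite mulrBl in p4; move: a1 a2 b1 b2 p1 p2 p4.
move: (rhs (c t) r) (rhs (d t) r) (Rintegral (c t) _ _) (Rintegral (c s) _ _)
  (Rintegral (d t) _ _) (Rintegral (d s) _ _) (dist l (c t) (d t)) (dist l (c s) (d s)).
by move=> *; lra.
Qed.

End weak_form.

(** * Uniqueness *)

Section separation.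
Context {R : realType} (l : exponent R).
Notation mu := (@lebesgue_measure R).
Implicit Types (c d : {measure set R -> \bar R}) (x y z : R).

Lemma ae_dense (P : R -> Prop) a b : a < b -> {ae mu, forall x, P x} ->
  exists2 x, a < x < b & P x.
Proof.
move=> ab [N [mN N0 PN]]; apply: contrapT => h.
have : (mu `]a, b[%classic <= mu N)%E.
  apply: le_measure; rewrite ?inE//.
  move=> x /=; rewrite in_itv/= => xab; apply: PN => Px; apply: h; exists x => //.
rewrite N0 lebesgue_measure_itv/= lte_fin ab.
by rewrite -EFinD lee_fin subr_le0 leNgt ab.
Qed.

Lemma tail_right_cvg c z (u : nat -> R) : has_moment l c -> 0 < z ->
  (forall n, z < u n) -> u @ \oo --> z -> tail c (u n) @[n --> \oo] --> tail c z.
Proof.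
move=> mc z0 zu uz.
apply: (proj2 (@Rintegral_dct _ _ _ c (fun n y => lt01 (u n) y) (lt01 z) (lt01 z) _ _ _ _ _)).
- by move=> n; exact: measurable_gt.
- exact: measurable_gt.
- apply: aeW => y; have [yz|zy] := leP y z.
    have E n : lt01 (u n) y = lt01 z y.
      by rewrite /lt01 !ltNge yz (le_trans yz (ltW (zu n))).
    by under eq_cvg do rewrite E; exact: cvg_cst.
  apply: cvg_near_cst; near=> n; rewrite /lt01 zy.
  by rewrite (_ : u n < y)//; near: n; exact: (cvgr_lt _ uz).
- exact: (integrable_gt z0 mc).
- apply: aeW => y n; rewrite /lt01 ger0_norm ?ler0n// ler_nat.
  by have [h|h] := ltP (u n) y => //=; rewrite (lt_trans (zu n) h).
Unshelve. all: by end_near. Qed.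

(** The tails agree almost everywhere, hence at points tending to z from the right, and both are
    right-continuous. *)
Lemma dist0_tail c d z : has_moment l c -> has_moment l d -> dist l c d = 0 -> 0 < z ->
  tail c z = tail d z.
Proof.
move=> mc md D0 z0.
have ig := integrable_abs_gap mc md.
have ae0 : {ae mu, forall z, 0 < z -> gap c d z = 0}.
  have h : (\int[mu]_x `|(dpw l x * `|gap c d x|)%:E| = 0)%E.
    under eq_integral do rewrite gee0_abs ?lee_fin ?mulr_ge0 ?dpw_ge0//.
    rewrite -Rintegral_EFin//; by congr EFin.
  have /(ae_eq_integral_abs mu measurableT (measurable_int _ ig)) h1 := h.
  have FF := ae_filter_ringOfSetsType mu.
  apply: filterS h1 => x /= /(_ I) [/eqP]; rewrite mulf_eq0 normr_eq0.
  move=> /orP[|/eqP//] /[swap] x0; rewrite /dpw x0 mulf_eq0 (negbTE (exponent_neq0 l)).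
  by rewrite gt_eqF// powR_gt0.
have hn n : exists x, z < x < z + n.+1%:R^-1 /\ gap c d x = 0.
  have [|x /andP[h1 h2] h3] := ae_dense (a := z) (b := z + n.+1%:R^-1) _ ae0.
    by rewrite ltrDl.
  by exists x; split; [rewrite h1|apply: h3; exact: lt_trans h1].
have [u hu] := choice hn.
have zu n : z < u n by have [/andP[]] := hu n.
have uz : u @ \oo --> z.
  apply: (@squeeze_cvgr _ _ _ _ (fun=> z) (fun n => z + n.+1%:R^-1)).
  - by near=> n; have [/andP[h1 h2] _] := hu n; rewrite !ltW.
  - exact: cvg_cst.
  - rewrite -[X in _ --> X]addr0; apply: cvgD; [exact: cvg_cst|exact: cvg_harmonic].
have c1 := tail_right_cvg mc z0 zu uz; have c2 := tail_right_cvg md z0 zu uz.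
have E n : tail c (u n) = tail d (u n) by have [_ /eqP] := hu n; rewrite subr_eq0 => /eqP.
rewrite -(cvg_lim _ c1)// -(cvg_lim _ c2)//.
by congr (lim _); under eq_fun do rewrite E.
Unshelve. all: by end_near. Qed.

(** For a > 0 both measures are finite on ]a, oo[ and have the same tails; rays form a pi-system, so
    the measures agree there. The bound a is then sent to 0, since the mass near 0 may be
    infinite. *)
Lemma dist0_measure c d : has_moment l c -> has_moment l d -> dist l c d = 0 ->
  c `]-oo, 0]%classic = 0%E -> d `]-oo, 0]%classic = 0%E ->
  forall A, measurable A -> c A = d A.
Proof.
move=> mc md D0 c0 d0.
have itvI (z a : R) : `]z, +oo[%classic `&` `]a, +oo[%classic = `]Num.max z a, +oo[%classic.
  apply/seteqP; split=> x /=; rewrite !in_itv/= !andbT gt_max; first by move=> [-> ->].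
  by move=> /andP[].
have Pos (A : set R) (a : R) : 0 < a -> measurable A ->
    c (A `&` `]a, +oo[) = d (A `&` `]a, +oo[).
  move=> a0 mA; have ma : measurable (`]a, +oo[%classic : set R) by exact: measurable_itv.
  have E (z : R) : c (`]z, +oo[ `&` `]a, +oo[) = d (`]z, +oo[ `&` `]a, +oo[).
    have m0 : 0 < Num.max z a by rewrite lt_max a0 orbT.
    by rewrite itvI -(tailE m0 mc) -(tailE m0 md) (dist0_tail mc md D0).
  pose c' := [the measure _ _ of mrestr c ma].
  pose d' := [the measure _ _ of mrestr d ma].
  apply: (@measure_unique _ _ _ (@RGenOInfty.G R) (fun k => `]- k%:R, +oo[%classic) _ _ _ _ c' d') => //.
  - exact: RGenOInfty.measurableE.
  - move=> _ _ [x ->] [y ->]; exists (Num.max x y); exact: itvI.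
  - by move=> k; exists (- k%:R).
  - apply/seteqP; split=> // x _; exists (Num.trunc `|x|).+1 => //=.
    rewrite in_itv/= andbT ltrNl (le_lt_trans (ler_norm (- x)))// normrN.
    exact: truncnS_gt.
  - by move=> _ [x ->]; exact: E.
  - move=> k; rewrite /c' /= /mrestr itvI -(tailE (l := l))// ?ltry//.
    by rewrite lt_max a0 orbT.
move=> A mA.
have mle : measurable (`]-oo, 0]%classic : set R) by exact: measurable_itv.
have split0 (e : {measure set R -> \bar R}) : e `]-oo, 0]%classic = 0%E ->
    e (A `&` `]n.+1%:R^-1, +oo[%classic) @[n --> \oo] --> e A.
  move=> e0.
  have AE : A = (A `&` `]-oo, 0]) `|` \bigcup_n (A `&` `]n.+1%:R^-1, +oo[%classic).
    apply/seteqP; split=> [x Ax|x [[]//|[n _ []//]]].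
    have [x0|x0] := leP x 0; first by left; split=> //=; rewrite in_itv/=.
    right; exists (Num.trunc x^-1) => //; split=> //=; rewrite in_itv/= andbT.
    by rewrite invf_plt ?posrE// truncnS_gt.
  have mb n : measurable (A `&` `]n.+1%:R^-1, +oo[%classic).
    by apply: measurableI => //; exact: measurable_itv.
  have mU : measurable (\bigcup_n (A `&` `]n.+1%:R^-1, +oo[%classic)).
    by apply: bigcup_measurable => n _; exact: mb.
  have mA0 : measurable (A `&` `]-oo, 0]%classic) by exact: measurableI.
  have e00 : e (A `&` `]-oo, 0]%classic) = 0%E.
    apply/eqP; rewrite eq_le measure_ge0 andbT -e0.
    by apply: le_measure; rewrite ?inE//; exact: subIsetr.
  have -> : e A = e (\bigcup_n (A `&` `]n.+1%:R^-1, +oo[%classic)).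
    set U := \bigcup_n _ in AE mU *.
    apply/eqP; rewrite eq_le; apply/andP; split; last first.
      by apply: le_measure; rewrite ?inE// => x [n _ []].
    have : (e A <= e (A `&` `]-oo, 0%R]%classic) + e U)%E.
      by rewrite {1}AE; exact: measureU2.
    by rewrite e00 add0e.
  apply: nondecreasing_cvg_mu => // n m nm; apply/subsetPset => x [Ax] /=.
  rewrite !in_itv/= !andbT => h; split=> //; apply: le_lt_trans h.
  by rewrite lef_pV2 ?posrE// ler_nat.
have h1 := split0 c c0; have h2 := split0 d d0.
rewrite -(cvg_lim _ h1)// -(cvg_lim _ h2)//; congr (lim _).
by congr (_ @ \oo); apply/funext => n; apply: Pos => //; rewrite invr_gt0.
Qed.
End separation.

(** * From the half-line of the statement to integrals over the whole line *)

Section statement_bridge.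
Context {R : realType} (l : exponent R).
Implicit Types (c d : {measure set R -> \bar R}) (x y z t s : R) (phi f : R -> R).
Notation pw := (pw l).
Notation lam := (exponent_val l).

Lemma momentE c : moment lam c = (\int[c]_x (pw x)%:E)%E.
Proof.
rewrite /moment integral_mkcond; apply: eq_integral => x _; rewrite /patch mem_setE in_itv/= andbT.
by case: ltP => x0; [rewrite pwE// ltW|rewrite pw_le0].
Qed.

Lemma moment_mass c : has_moment l c -> moment lam c = (mass l c)%:E.
Proof. by move=> [_ ic]; rewrite momentE /mass Rintegral_EFin. Qed.

(** The sets where [pw] is at least 1 / (n + 1) have finite measure by Markov's inequality and
    exhaust ]0, oo[; on the rest, where [pw] vanishes, the measure is 0 by hypothesis. *)
Lemma moment_has_moment c : c `]-oo, 0]%classic = 0%E -> (moment lam c < +oo)%E ->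
  has_moment l c.
Proof.
move=> c0; rewrite momentE => cM.
have ip : c.-integrable setT (EFin \o pw).
  apply/integrableP; split; first by apply/measurable_EFinP; exact: measurable_pw.
  apply: le_lt_trans cM; apply: ge0_le_integral => //.
  - by apply: measurableT_comp => //; apply/measurable_EFinP; exact: measurable_pw.
  - by apply/measurable_EFinP; exact: measurable_pw.
  - by move=> x _ /=; rewrite lee_fin ger0_norm// pw_ge0.
split=> //.
pose S n : set R := [set x | n.+1%:R^-1 <= `|pw x|].
have mS n : measurable (S n).
  rewrite -[S n]setTI; apply: measurable_fun_le => //.
  by apply: measurableT_comp => //; exact: measurable_pw.
exists (fun n => `]-oo, 0]%classic `|` S n).
  apply/seteqP; split=> // x _; have [x0|x0] := leP x 0.
    by exists 0%N => //; left; rewrite /= in_itv.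
  exists (Num.trunc (pw x)^-1) => //; right.
  rewrite /S/= ger0_norm ?pw_ge0// invf_ple ?posrE// ?pw_gt0//.
  by rewrite ltW// truncnS_gt.
have mI : measurable (`]-oo, 0]%classic : set R) by exact: measurable_itv.
move=> n; split; first exact: measurableU.
have : (c (`]-oo, 0%R]%classic `|` S n) <= c `]-oo, 0%R]%classic + c (S n))%E.
  exact: measureU2.
move=> /le_lt_trans; apply; rewrite c0 add0e; apply: level_set_lty ip; rewrite invr_gt0//.
Qed.

Lemma has_moment_radon c : has_moment l c -> c `]-oo, 0]%classic = 0%E -> radon_pos c.
Proof.
move=> mc c0; split=> // C cC C0.
have mC : measurable C by apply: closed_measurable; apply: compact_closed => //; exact: Rhausdorff.
have [->|/set0P C1] := eqVneq C set0; first by rewrite measure0.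
have [a /set_mem Ca ha] := compact_EVT_min (f := idfun) C1 cC (continuous_subspaceT (fun x : R => (cvg_id : idfun y @[y --> x] --> x))).
have a0 : 0 < a by have := C0 a Ca; rewrite /= in_itv/= andbT.
have a2 : 0 < a / 2 by rewrite divr_gt0.
apply: (@le_lt_trans _ _ (c `]a / 2, +oo[%classic)).
  apply: le_measure; rewrite ?inE//.
  move=> x Cx /=; rewrite in_itv/= andbT; apply: lt_le_trans (ha x (mem_set Cx)).
  by rewrite ltr_pdivrMr// ltr_pMr// ltr1n.
by rewrite -(tailE a2 mc) ltry.
Qed.

Lemma pairingE c phi : phi 0 = 0 -> pairing c phi = \int[c]_x phi (Num.max x 0).
Proof.
move=> p0; rewrite /pairing Rintegral_mkcond; apply: eq_Rintegral => x _; rewrite /patch mem_setE in_itv/= andbT.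
by case: ltP => x0; rewrite ?p0.
Qed.

Lemma holder_class_holder phi : holder_class lam phi ->
  exists B, holder l B (fun x => phi (Num.max x 0)).
Proof.
move=> [_ p0 [M hM]]; exists (Num.max M 0); split=> [x x0|x y].
  by rewrite max_r.
have h u v : 0 <= u -> 0 <= v -> `|phi u - phi v| <= Num.max M 0 * pw `|u - v|.
  move=> u0 v0; have [->|uv] := eqVneq u v.
    by rewrite !subrr normr0 mulr_ge0 ?pw_ge0// le_max lexx orbT.
  rewrite -ler_pdivrMr ?pw_gt0 ?normr_gt0 ?subr_eq0//.
  rewrite le_max; apply/orP; left; apply: hM; exists u, v; split=> //.
  by rewrite pwE.
apply: (le_trans (h _ _ _ _)); rewrite ?le_max ?lexx ?orbT//.
rewrite ler_wpM2l ?le_max ?lexx ?orbT//; apply: pw_mono.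
have [x0|x0] := leP x 0; have [y0|y0] := leP y 0.
- by rewrite subrr normr0.
- rewrite sub0r normrN gtr0_norm// distrC ger0_norm; first lra.
  by rewrite subr_ge0; lra.
- rewrite subr0 gtr0_norm// ger0_norm; first lra.
  by rewrite subr_ge0; lra.
- by [].
Qed.

Lemma holder_holder_class B phi : holder l B phi -> holder_class lam phi.
Proof.
move=> [p0 hp]; split; last 1 first.
- exists B => _ [x [y [x0 y0 xy ->]]].
  by rewrite ler_pdivrMr ?powR_gt0 ?normr_gt0 ?subr_eq0// -(pwE l)// hp.
- by apply: continuous_subspaceT => x; exact: holder_continuous hp x.
- exact: p0.
Qed.

Variables (K : R -> R -> R) (F : R -> R) (beta : {measure set (Theta R) -> \bar R}).

Lemma weak_rhsE c phi : phi 0 = 0 ->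
  weak_rhs K F beta c phi = rhs K F beta c (fun x => phi (Num.max x 0)).
Proof.
move=> p0.
have E1 : \int[c]_(y in `]0, +oo[) \int[c]_(x in `]0, +oo[) (K x y * coag_op phi x y) =
    \int[c]_y \int[c]_x (Kp K x y * coag_op (fun x => phi (Num.max x 0)) x y).
  rewrite Rintegral_mkcond; apply: eq_Rintegral => y _; rewrite /patch mem_setE in_itv/= andbT.
  rewrite /Kp /pos_part2; case: ltP => y0; last first.
    rewrite /Rintegral integral0_eq// => x _; by rewrite andbF mul0r.
  rewrite Rintegral_mkcond; apply: eq_Rintegral => x _; rewrite /patch mem_setE in_itv/= andbT.
  case: ltP => x0; last by rewrite mul0r.
  by rewrite /coag_op !max_l// ?addr_ge0// ltW.
have E2 : \int[c]_(x in `]0, +oo[) (F x * \int[beta]_th frag_op phi th x) =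
    \int[c]_x (Fp F x * frag_lim beta (fun x => phi (Num.max x 0)) x).
  rewrite Rintegral_mkcond; apply: eq_Rintegral => x _; rewrite /patch mem_setE in_itv/= andbT.
  rewrite /Fp /pos_part1; case: ltP => x0; last by rewrite mul0r.
  congr (_ * _); apply: eq_Rintegral => th _.
  rewrite /frag_op max_l ?(ltW x0)//; congr (limn (series _) - _).
  by apply/funext => i; rewrite max_l// mulr_ge0 ?(ltW x0)// theta_ge0.
by rewrite /weak_rhs /rhs E1 E2.
Qed.

End statement_bridge.

Section halfline.
Context {R : realType}.
Implicit Types (t s q e : R) (g : R -> R).

Definition halfline_derivative g t q := forall e, 0 < e -> exists2 d, 0 < d &
  forall s, 0 <= s -> `|s - t| < d -> `|g s - g t - q * (s - t)| <= e * `|s - t|.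

Lemma halfline_filter t : 0 <= t -> ProperFilter (within [set s : R | 0 <= s] t^').
Proof.
move=> t0; apply: Build_ProperFilter.
move=> /nbhs_ballP [d /= d0 /(_ (t + d / 2))]; apply.
- by rewrite /ball/= opprD addrA subrr sub0r normrN gtr0_norm; lra.
- by rewrite gt_eqF//; lra.
- by lra.
Qed.

Lemma halfline_derivativeP g t q : 
  ((fun s => (s - t)^-1 * (g s - g t)) @ within [set s | 0 <= s] t^' --> q) <->
  halfline_derivative g t q.
Proof.
have E s : s - t != 0 -> (s - t)^-1 * (g s - g t) - q = (g s - g t - q * (s - t)) / (s - t).
  by move=> st; field.
split=> [/cvgrPdist_le h e e0|h].
  have := h e e0; rewrite !near_withinE => /nbhs_ballP [d /= d0 hd].
  exists d => // s s0 sd; have [->|st] := eqVneq s t; first by rewrite !subrr mulr0 subr0 normr0 mulr0.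
  have st0 : s - t != 0 by rewrite subr_eq0.
  have := hd s; rewrite /ball/= distrC => /(_ sd st s0).
  by rewrite distrC E// normf_div ler_pdivrMr ?normr_gt0.
apply/cvgrPdist_le => e e0; have [d d0 hd] := h e e0.
rewrite !near_withinE; apply/nbhs_ballP; exists d => //= s; rewrite /ball/= distrC => sd st s0.
have st0 : s - t != 0 by rewrite subr_eq0.
by rewrite distrC E// normf_div ler_pdivrMr ?normr_gt0//; exact: hd.
Qed.

(** [lim] is a default value without convergence, so existence and value of the derivative are
    characterised together. *)
Lemma derive_halflineP g t q : 0 <= t ->
  (derivable_halfline g t /\ derive_halfline g t = q) <-> halfline_derivative g t q.
Proof.
move=> t0; have PF := halfline_filter t0.
split=> [[h1 h2]|/halfline_derivativeP h].
  by apply/halfline_derivativeP; rewrite -h2; exact: h1.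
split; last by exact: cvg_lim h.
by apply/cvg_ex; exists q.
Qed.

Lemma halfline_derivative_cont g T (q : R -> R) : (forall t, 0 <= t <= T -> halfline_derivative g t (q t)) ->
  cont_on 0 T g.
Proof.
move=> H t tT e e0; have [d d0 hd] := H t tT 1 ltr01.
have A0 : 0 < 1 + `|q t| by rewrite ltr_pwDl.
exists (Num.min d (e / (1 + `|q t|))); first by rewrite lt_min d0 divr_gt0.
move=> s /andP[s0 sT]; rewrite lt_min => /andP[sd]; rewrite ltr_pdivlMr// => se.
have := hd s s0 sd; have := ler_normD (g s - g t - q t * (s - t)) (q t * (s - t)).
by rewrite subrK (normrM (q t)); lra.
Qed.

End halfline.

Section uniqueness.
Context {R : realType} (l : exponent R).
Implicit Types (t s : R) (phi : R -> R).
Notation lam := (exponent_val l).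
Variables (K : R -> R -> R) (F : R -> R) (beta : {measure set (Theta R) -> \bar R}).
Variable cin : {measure set R -> \bar R}.

Section weak_solution_props.
Variable c : R -> {measure set R -> \bar R}.
Hypothesis wc : weak_solution cin K F beta lam c.

Lemma weak_solution_moment t : 0 <= t -> has_moment l (c t).
Proof.
move=> t0; have [c0 _] := ws_radon wc t0; apply: moment_has_moment => //.
apply: le_lt_trans (ws_moment wc t0); apply: ereal_sup_ubound.
by exists t => //=; rewrite in_itv/= t0 lexx.
Qed.

Lemma weak_solution_mass T : exists M, forall t, 0 <= t <= T -> mass l (c t) <= M.
Proof.
have [T0|T0] := leP 0 T; last first.
  by exists 0 => t /andP[t0 tT]; have := lt_le_trans T0 (le_trans t0 tT); rewrite ltxx.
have := ws_moment wc T0.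
set S := ereal_sup _ => Soo.
exists (fine S) => t tT; have t0 : 0 <= t by case/andP: tT.
have h : ((mass l (c t))%:E <= S)%E.
  rewrite -moment_mass; last exact: weak_solution_moment.
  by apply: ereal_sup_ubound; exists t.
have fS : S \is a fin_num by rewrite fin_real// Soo andbT (lt_le_trans _ h)// ltNyr.
by rewrite -lee_fin [leRHS]fineK.
Qed.

Lemma weak_solution_approx T M : (forall t, 0 <= t <= T -> mass l (c t) <= M) ->
  approx_sol l K F beta T 0 M c.
Proof.
move=> hM.
have D phi t : holder l 1 phi -> 0 <= t ->
    halfline_derivative (fun s => \int[c s]_x phi x) t (rhs K F beta (c t) phi).
  move=> hphi t0; have hc := holder_holder_class hphi.
  have p0 : phi 0 = 0 by case: hc.
  have E : (fun x => phi (Num.max x 0)) = phi.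
    apply/funext => x; have [x0|x0] := leP x 0; last by rewrite ?p0.
    by rewrite p0; case: hphi => -> .
  have := derive_halflineP (fun s => pairing (c s) phi) (weak_rhs K F beta (c t) phi) t0.
  move=> [+ _] => /(_ (conj (ws_derivable wc hc t0) (ws_eq wc hc t0))).
  rewrite (weak_rhsE K F beta (c t) p0) E.
  by under eq_fun do rewrite pairingE// E.
split=> //.
- by move=> t /andP[t0 _]; exact: weak_solution_moment.
- move=> phi hphi; apply: (@halfline_derivative_cont _ _ _ (fun t => rhs K F beta (c t) phi)).
  by move=> t /andP[t0 _]; exact: D.
move=> phi hphi t /andP[t0 tT] h h0; have [d d0 hd] := D phi t hphi (ltW t0) h h0.
exists d => // s /andP[s0 st] ts; rewrite add0r.
have tsE : `|s - t| = t - s by rewrite distrC gtr0_norm// subr_gt0.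
have := hd s s0; rewrite tsE => /(_ ts); apply: le_trans.
have X (a b r : R) : `|a - b - r * (t - s)| = `|b - a - r * (s - t)|.
  by rewrite -normrN; congr (`|_|); ring.
by rewrite X.
Qed.

End weak_solution_props.

Theorem weak_solution_unique c c' : hypothesis_KF lam K F -> (C_beta lam beta < +oo)%E ->
  weak_solution cin K F beta lam c -> weak_solution cin K F beta lam c' ->
  forall t, 0 <= t -> forall A, measurable A -> c t A = c' t A.
Proof.
move=> hKF hC wc wc' t t0.
have mc := weak_solution_moment wc t0; have mc' := weak_solution_moment wc' t0.
apply: (dist0_measure mc mc'); last 2 first.
- by case: (ws_radon wc t0).
- by case: (ws_radon wc' t0).
have [M hM] := weak_solution_mass wc t; have [M' hM'] := weak_solution_mass wc' t.
(* A mass bound common to both solutions, so that one stability constant serves. *)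
pose N := Num.max 0 (Num.max M M').
have N0 : 0 <= N by rewrite le_max lexx.
have [L L0 HL] := approx_stability hKF hC N0.
have a1 : approx_sol l K F beta t 0 N c.
  by apply: (@weak_solution_approx c wc t N) => s /hM h; rewrite !le_max h !orbT.
have a2 : approx_sol l K F beta t 0 N c'.
  by apply: (@weak_solution_approx c' wc' t N) => s /hM' h; rewrite !le_max h !orbT.
have tt : 0 <= t <= t by rewrite t0 lexx.
have := HL t 0 0 c c' t0 (lexx 0) (lexx 0) a1 a2 t tt.
have -> : dist l (c 0) (c' 0) = 0.
  have mc0 := weak_solution_moment wc (lexx 0).
  have mc0' := weak_solution_moment wc' (lexx 0).
  rewrite /dist /Rintegral integral0_eq// => z _; congr EFin.
  rewrite /dpw; case: ifPn => z0; last by rewrite mul0r.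
  have : tail (c 0) z = tail (c' 0) z.
    apply: EFin_inj; rewrite (tailE z0 mc0) (tailE z0 mc0').
    by rewrite (ws_init wc)// (ws_init wc').
  by rewrite /gap => ->; rewrite subrr normr0 mulr0.
rewrite !addr0 mul0r => h; apply/eqP; rewrite eq_le h.
exact: dist_ge0.
Qed.

End uniqueness.

(** * The truncated operators and the Euler step *)

Section dominated_integral.
Context d (T : measurableType d) {R : realType}.
Variables (w : T -> R) (m : {measure set T -> \bar R}).
Implicit Types (f g : T -> R) (A B : R).

(** The analogue of [pw_bounded] for an arbitrary weight; on products the weights are [wt], [pw],
    [chi] and [frag_weight] of either variable. *)
Definition dominated A f := measurable_fun setT f /\ forall x, `|f x| <= A * w x.

Hypothesis iw : m.-integrable setT (EFin \o w).

Lemma dominated_integrable A f : dominated A f -> m.-integrable setT (EFin \o f).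
Proof.
move=> [mf fA]; apply: (@integrable_le _ _ _ m f (fun x => A * w x)) => //.
by rewrite (_ : _ \o _ = (fun x => A%:E * (EFin \o w) x)%E) //; apply: integrableZl.
Qed.

Lemma dominatedD A B f g : dominated A f -> dominated B g ->
  dominated (A + B) (fun x => f x + g x).
Proof.
move=> [mf fA] [mg gB]; split; first exact: measurable_funD.
by move=> x; rewrite (le_trans (ler_normD _ _))// mulrDl lerD.
Qed.

Lemma dominatedZ A k f : dominated A f -> dominated (`|k| * A) (fun x => k * f x).
Proof.
move=> [mf fA]; split; first exact: measurable_funM.
by move=> x; rewrite normrM -mulrA ler_wpM2l.
Qed.

Lemma dominated_bound A f : dominated A f -> `|\int[m]_x f x| <= A * \int[m]_x w x.
Proof.
move=> hf; have fi := dominated_integrable hf.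
rewrite (le_trans (le_normr_Rintegral _ _))//.
rewrite -RintegralZl//; apply: le_Rintegral_setT; last by case: hf.
  exact: (@integrable_norm _ _ _ _ _ _ fi).
by rewrite (_ : _ \o _ = (fun x => A%:E * (EFin \o w) x)%E) //; apply: integrableZl.
Qed.

End dominated_integral.

Section double_integral.
Context d1 d2 (T1 : measurableType d1) (T2 : measurableType d2) {R : realType}.
Variables (m1 : {measure set T1 -> \bar R}) (m2 : {measure set T2 -> \bar R}).
Hypotheses (s1 : sigma_finite setT m1) (s2 : sigma_finite setT m2).
Variables (u : T1 -> R) (v : T2 -> R).
Hypothesis iu : m1.-integrable setT (EFin \o u).
Hypothesis iv : m2.-integrable setT (EFin \o v).
Implicit Types (f g : T1 * T2 -> R) (A B : R).

Definition dominated2 A f := dominated (fun p => u p.1 * v p.2) A f.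

Definition dint f : R := \int[m1]_a \int[m2]_b f (a, b).

Let iAu A : m1.-integrable setT (EFin \o (fun a => A * u a)).
Proof. by rewrite (_ : _ \o _ = (fun x => A%:E * (EFin \o u) x)%E) //; apply: integrableZl. Qed.

Let bnd A f : dominated2 A f -> forall a b, `|f (a, b)| <= A * u a * v b.
Proof. by move=> [_ fA] a b; rewrite -mulrA; exact: fA. Qed.

Lemma dominated2_r A f a : dominated2 A f -> m2.-integrable setT (fun b => (f (a, b))%:E).
Proof. by move=> hf; exact: (fubini_integrable_r hf.1 iv (bnd hf)). Qed.

Lemma dominated2_inner A f : dominated2 A f ->
  m1.-integrable setT (fun a => (\int[m2]_b f (a, b))%:E).
Proof. by move=> hf; exact: (fubini_integrable_Rl s1 s2 hf.1 (iAu A) iv (bnd hf)). Qed.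

Lemma dintB A B f g : dominated2 A f -> dominated2 B g ->
  dint (fun p => f p - g p) = dint f - dint g.
Proof.
move=> hf hg; rewrite /dint -RintegralB//; last 2 first.
- exact: dominated2_inner hf.
- exact: dominated2_inner hg.
by apply: eq_Rintegral => a _; rewrite RintegralB//; [exact: dominated2_r hf|exact: dominated2_r hg].
Qed.

Lemma dintD A B f g : dominated2 A f -> dominated2 B g ->
  dint (fun p => f p + g p) = dint f + dint g.
Proof.
move=> hf hg; rewrite /dint -RintegralD//; last 2 first.
- exact: dominated2_inner hf.
- exact: dominated2_inner hg.
by apply: eq_Rintegral => a _; rewrite RintegralD//; [exact: dominated2_r hf|exact: dominated2_r hg].
Qed.

Lemma dintZ A k f : dominated2 A f -> dint (fun p => k * f p) = k * dint f.
Proof.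
move=> hf; rewrite /dint -RintegralZl//; last exact: dominated2_inner hf.
by apply: eq_Rintegral => a _; rewrite RintegralZl//; exact: dominated2_r hf.
Qed.

Lemma dint_sum n A (f : nat -> T1 * T2 -> R) : (forall i, dominated2 A (f i)) ->
  (exists B, dominated2 B (fun p => \sum_(i < n) f i p)) /\
  dint (fun p => \sum_(i < n) f i p) = \sum_(i < n) dint (f i).
Proof.
move=> hf; elim: n => [|n [[B hB] IH]].
  have E : (fun p => \sum_(i < 0) f i p) = (fun=> 0) by apply/funext => p; rewrite big_ord0.
  rewrite E big_ord0; split; last first.
    rewrite /dint /Rintegral integral0_eq// => x _; rewrite integral0_eq//.
  by exists 0; split => // p; rewrite normr0 mul0r.
have E : (fun p => \sum_(i < n.+1) f i p) = (fun p => \sum_(i < n) f i p + f n p).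
  by apply/funext => p; rewrite big_ord_recr.
rewrite E; split; first by exists (B + A); exact: dominatedD hB (hf n).
by rewrite (dintD hB (hf n)) IH big_ord_recr.
Qed.

Lemma le_dint A B f g : dominated2 A f -> dominated2 B g -> (forall p, f p <= g p) ->
  dint f <= dint g.
Proof.
move=> hf hg fg; apply: le_Rintegral_setT; first exact: dominated2_inner hf.
  exact: dominated2_inner hg.
move=> a; apply: le_Rintegral_setT; last by move=> b; exact: fg.
  exact: dominated2_r hf.
exact: dominated2_r hg.
Qed.

Lemma dint_prod A : dint (fun p => A * (u p.1 * v p.2)) = A * (\int[m1]_a u a) * \int[m2]_b v b.
Proof.
rewrite /dint; under eq_Rintegral => a _.
  under eq_Rintegral do rewrite /= mulrA.
  rewrite RintegralZl//; over.
rewrite RintegralZr//.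
by rewrite RintegralZl.
Qed.

(** Realises the gain terms as measures: a pair (x, y) is sent to x + y, a pair (x, theta) to
    theta_i x. *)
Lemma ex_image_product (rho X : T1 * T2 -> R) : measurable_fun setT rho ->
  (forall p, 0 <= rho p) -> measurable_fun setT X ->
  exists nu : {measure set R -> \bar R}, forall A (g : R -> R), measurable_fun setT g ->
    (forall x, 0 <= g x) -> dominated2 A (fun p => g (X p) * rho p) ->
    (\int[nu]_x (g x)%:E)%E = (dint (fun p => g (X p) * rho p))%:E.
Proof.
move=> mrho rho0 mX.
pose n1 := sigma_finite_pack s1; pose n2 := sigma_finite_pack s2.
have [nu [_ H]] := @ex_image_density _ _ _ _ R (n1 \x n2)%E rho X mrho rho0 mX.
exists nu => A g mg g0 dg; rewrite H//; last exact/measurable_EFinP.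
rewrite fubini_tonelli1//=; last 2 first.
- by rewrite (_ : (fun _ => _) = EFin \o (fun p => g (X p) * rho p))//; apply/measurable_EFinP; case: dg.
- by move=> p; rewrite -EFinM lee_fin mulr_ge0.
rewrite /dint Rintegral_EFin; last exact: dominated2_inner dg.
apply: eq_integral => a _; rewrite Rintegral_EFin//; exact: dominated2_r dg.
Qed.

Lemma dint_bound A f : dominated2 A f ->
  `|dint f| <= A * (\int[m1]_a u a) * \int[m2]_b v b.
Proof.
move=> hf; have hr := dominated2_inner hf.
rewrite (le_trans (le_normr_Rintegral _ _))// mulrAC -RintegralZl//.
apply: le_Rintegral_setT.
- exact: (@integrable_norm _ _ _ _ _ _ hr).
- by rewrite (_ : _ \o _ = (fun x => (A * \int[m2]_b v b)%:E * (EFin \o u) x)%E) //; apply: integrableZl.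
move=> a; have := @dominated_bound _ _ _ v m2 iv (A * u a) (fun b => f (a, b)).
rewrite mulrAC; apply; split; first exact: measurable_fun_pair2 hf.1.
by move=> b; rewrite (le_trans (bnd hf _ _)).
Qed.

End double_integral.

Section energy_weight.
Context {R : realType} (l : exponent R).
Implicit Types (c d : {measure set R -> \bar R}) (x y z t s : R) (phi g : R -> R).
Notation pw := (pw l).

(** The constant 1 makes the measures finite, so that a bounded kernel has a bounded loss rate; the
    square of [pw] pays for the truncation of the kernel. *)
Definition wt x : R := 1 + pw x ^+ 2.

Lemma wt_ge1 x : 1 <= wt x. Proof. by rewrite lerDl sqr_ge0. Qed.

Lemma wt_ge0 x : 0 <= wt x. Proof. exact: le_trans (wt_ge1 x). Qed.

Lemma pw_le_wt x : pw x <= wt x.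
Proof. by have := sqr_ge0 (pw x - 1); rewrite /wt; have := pw_ge0 l x; nra. Qed.

Lemma sqr_pw_le_wt x : pw x ^+ 2 <= wt x. Proof. by rewrite lerDr. Qed.

Lemma measurable_wt : measurable_fun setT wt.
Proof. by apply: measurable_funD => //; apply: measurable_funX; exact: measurable_pw. Qed.

Lemma pw_addr_le x y : pw (x + y) <= pw x + pw y.
Proof.
have [x0|/ltW x0] := leP x 0.
  by rewrite (pw_le0 _ x0) add0r pw_mono// gerDr.
have [y0|/ltW y0] := leP y 0; last exact: pw_subadd.
by rewrite (pw_le0 _ y0) addr0 pw_mono// gerDl.
Qed.

Lemma wt_add x y : wt (x + y) <= 2 * (wt x * wt y).
Proof.
have h : pw (x + y) ^+ 2 <= (pw x + pw y) ^+ 2.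
  by rewrite ler_sqr ?nnegrE ?addr_ge0 ?pw_ge0// pw_addr_le.
have := sqr_ge0 (pw x - pw y); have := sqr_ge0 (pw x * pw y).
by move: h; rewrite /wt; nra.
Qed.

Lemma wt_scale k x : 0 <= k <= 1 -> wt (k * x) <= wt x.
Proof.
move=> /andP[k0 k1]; rewrite lerD2l ler_sqr ?nnegrE ?pw_ge0//.
have [x0|/ltW x0] := leP x 0; first by rewrite !pw_le0// mulr_ge0_le0.
by apply: pw_mono; rewrite ler_piMl.
Qed.

Definition admissible c := c.-integrable setT (EFin \o wt).

Definition energy c : R := \int[c]_x wt x.

Lemma admissible_finite c : admissible c -> (c setT < +oo)%E.
Proof.
move=> ac; have -> : [set: R] = [set x | 1 <= `|wt x|].
  by apply/seteqP; split=> // x _ /=; rewrite ger0_norm ?wt_ge0// wt_ge1.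
exact: level_set_lty ac.
Qed.

Lemma admissible_sigma_finite c : admissible c -> sigma_finite setT c.
Proof.
move=> ac; exists (fun=> setT); first by apply/seteqP; split=> // x _; exists 0%N.
by move=> _; split=> //; exact: admissible_finite.
Qed.

Lemma pw_bounded_dominated A g : 0 <= A -> pw_bounded l A g -> dominated wt A g.
Proof.
move=> A0 [mg gA]; split=> // x; apply: (le_trans (gA x)).
by rewrite ler_wpM2l// pw_le_wt.
Qed.

Lemma admissible_moment c : admissible c -> has_moment l c.
Proof.
move=> ac; split; first exact: admissible_sigma_finite.
by apply: (dominated_integrable ac (pw_bounded_dominated _ (pw_bounded_pw l))).
Qed.

Lemma energy_ge0 c : 0 <= energy c.
Proof. by apply: Rintegral_ge0 => x _; exact: wt_ge0. Qed.

End energy_weight.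

(** * Truncated operators and positivity of one Euler step *)

Section truncated.
Context {R : realType} (l : exponent R).
Implicit Types (c d : {measure set R -> \bar R}) (x y z t s : R) (phi g : R -> R).
Notation pw := (pw l).
Notation wt := (wt l).
Notation lam := (exponent_val l).
Variables (K : R -> R -> R) (F : R -> R) (beta : {measure set (Theta R) -> \bar R}).
Hypothesis hKF : hypothesis_KF lam K F.
Hypothesis hC : (C_beta lam beta < +oo)%E.
Variables (k0 k2 : R).
Hypothesis k0_ge0 : 0 <= k0.
Hypothesis Kp_le : forall x y, Kp K x y <= k0 * pw (x + y).
Hypothesis Fp_le : forall x, 0 <= Fp F x <= k2.
Variables (N : R) (m : nat).

Definition cut x : R := (x <= N)%R%:R.
Definition KN x y := Kp K x y * (cut x * cut y).
(** Splittings that hardly change the largest fragment may have an infinite total rate; discarding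
    them makes the rate finite. *)
Definition chi (th : Theta R) : R := (th 0%N <= 1 - m.+1%:R^-1)%R%:R.

Lemma cut01 x : 0 <= cut x <= 1.
Proof. by rewrite /cut; case: (x <= N)%R; rewrite ?lexx ?ler01. Qed.

Lemma measurable_cut : measurable_fun setT cut.
Proof.
rewrite (_ : cut = \1_([set x | (x <= N)%R])); last first.
  by apply/funext => x; rewrite indicE /cut; have [h|h] := boolP (x <= N)%R; [rewrite mem_set|rewrite memNset//; exact/negP].
apply: measurable_indic.
rewrite -[X in measurable X]setTI; apply: measurable_fun_le => //.
Qed.

Lemma chi01 th : 0 <= chi th <= 1.
Proof. by rewrite /chi; case: (th 0%N <= _)%R; rewrite ?lexx ?ler01. Qed.

Lemma measurable_chi : measurable_fun setT chi.
Proof.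
rewrite (_ : chi = \1_([set th : Theta R | (th 0%N <= 1 - m.+1%:R^-1)%R])); last first.
  by apply/funext => th; rewrite indicE /chi; have [h|h] := boolP (th 0%N <= _)%R; [rewrite mem_set|rewrite memNset//; exact/negP].
apply: measurable_indic.
rewrite -[X in measurable X]setTI; apply: measurable_fun_le => //.
exact: measurable_theta.
Qed.

(** Where [chi] is 1, one has 1 - theta_0 >= 1 / (m + 1), hence (m + 1) (1 - theta_0)^l >= 1. *)
Lemma integrable_chi : beta.-integrable setT (EFin \o chi).
Proof.
apply: (@integrable_le _ _ _ beta chi (fun th => m.+1%:R * frag_weight l 0 th)).
- exact: measurable_chi.
- rewrite (_ : _ \o _ = (fun th => (m.+1%:R : R)%:E * (EFin \o frag_weight l 0) th)%E) //.
  by apply: integrableZl => //; exact: integrable_frag_weight.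
move=> th; have /andP[h0 _] := chi01 th; rewrite ger0_norm//.
have wge := frag_weight_ge0 l 0 th.
rewrite /chi; case: (leP (th 0%N)) => [h|_]; last by rewrite mulr_ge0.
rewrite -ler_pdivrMl ?ltr0n// mulr1 /frag_weight big_geq// add0r.
have th1 := theta_le1 th 0%N; have th0 := theta_ge0 th 0%N.
have h1 : m.+1%:R^-1 <= 1 - th 0%N by rewrite lerBrDr addrC -lerBrDr.
by apply: (le_trans h1); apply: pw_le_self; apply/andP; split; lra.
Qed.

Lemma KN_ge0 x y : 0 <= KN x y.
Proof.
have /andP[a _] := cut01 x; have /andP[b _] := cut01 y.
by rewrite !mulr_ge0// (Kp_ge0 hKF).
Qed.

Lemma KN_le x y : KN x y <= Kp K x y.
Proof.
have /andP[a a1] := cut01 x; have /andP[b b1] := cut01 y.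
by rewrite ler_piMr ?mulr_ile1// (Kp_ge0 hKF).
Qed.

Lemma KN_sym x y : KN x y = KN y x.
Proof. by rewrite /KN (Kp_sym hKF) (mulrC (cut x)). Qed.

Definition CN := k0 * pw (N + N).

Lemma CN_ge0 : 0 <= CN. Proof. by rewrite mulr_ge0// pw_ge0. Qed.

Lemma KN_bound x y : KN x y <= CN.
Proof.
rewrite /KN /cut; case: (leP x N) => [xN|_]; last by rewrite mul0r mulr0 CN_ge0.
case: (leP y N) => [yN|_]; last by rewrite !mulr0 CN_ge0.
by rewrite !mulr1 (le_trans (Kp_le _ _))// ler_wpM2l// pw_mono// lerD.
Qed.

Lemma measurable_KN : measurable_fun setT (fun p : R * R => KN p.1 p.2).
Proof.
apply: measurable_funM; first exact: (measurable_Kp hKF).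
apply: measurable_funM.
  exact: (measurableT_comp measurable_cut measurable_fst).
exact: (measurableT_comp measurable_cut measurable_snd).
Qed.

Definition total_chi := \int[beta]_th chi th.

Lemma total_chi_ge0 : 0 <= total_chi.
Proof. by apply: Rintegral_ge0 => th _; case/andP: (chi01 th). Qed.

(** The rate at which particles of size x disappear. The coagulation part carries no factor 1/2,
    since both members of a pair are lost. *)
Definition loss c x := \int[c]_y KN x y + Fp F x * total_chi.

Definition Qcoag c g := dint c c (fun p : R * R => KN p.1 p.2 * coag_op g p.1 p.2).
Definition Qfrag c g := dint c beta (fun p : R * Theta R =>
  Fp F p.1 * (chi p.2 * frag_fin m.+1 g p.2 p.1)).
Definition Qtrunc c g := 2^-1 * Qcoag c g + Qfrag c g.

Section one_measure.
Variable c : {measure set R -> \bar R}.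
Hypothesis ac : admissible l c.
Let sc := admissible_sigma_finite ac.
Let sb := beta_sigma_finite hC.
Let ic := integrable_chi.

Lemma loss_bound x : 0 <= loss c x <= CN * energy l c + k2 * total_chi.
Proof.
have /andP[F0 F2] := Fp_le x; have b0 := total_chi_ge0.
have h0 : 0 <= \int[c]_y KN x y by apply: Rintegral_ge0 => y _; exact: KN_ge0.
have dK : dominated wt CN (KN x).
  split; first by apply: (measurable_fun_pair2 (f := fun p : R * R => KN p.1 p.2)); exact: measurable_KN.
  move=> y; rewrite ger0_norm ?KN_ge0// (le_trans (KN_bound _ _))//.
  by rewrite ler_peMr ?CN_ge0// wt_ge1.
have h1 := dominated_bound ac dK; rewrite ger0_norm// in h1.
rewrite /loss addr_ge0 ?mulr_ge0//=; apply: lerD => //.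
by rewrite ler_wpM2r.
Qed.

Let dgain A g : 0 <= A -> dominated wt A g ->
  dominated2 wt wt (CN * (2 * A)) (fun p : R * R => KN p.1 p.2 * g (p.1 + p.2)).
Proof.
move=> A0 [mg gA]; split.
  apply: measurable_funM; first exact: measurable_KN.
  by apply: measurableT_comp => //; exact: measurable_funD.
move=> p; rewrite normrM ger0_norm ?KN_ge0// -mulrA.
apply: ler_pM => //; [exact: KN_ge0|exact: KN_bound|].
rewrite (le_trans (gA _))// -mulrA [leRHS]mulrCA ler_wpM2l//.
exact: wt_add.
Qed.

Let dl A g : 0 <= A -> dominated wt A g ->
  dominated2 wt wt (CN * A) (fun p : R * R => KN p.1 p.2 * g p.1).
Proof.
move=> A0 [mg gA]; split.
  apply: measurable_funM; first exact: measurable_KN.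
  exact: (measurableT_comp mg measurable_fst).
move=> p; rewrite normrM ger0_norm ?KN_ge0// -mulrA.
apply: ler_pM => //; [exact: KN_ge0|exact: KN_bound|].
rewrite (le_trans (gA _))// ler_wpM2l// ler_peMr ?wt_ge0//.
exact: wt_ge1.
Qed.

Let dr A g : 0 <= A -> dominated wt A g ->
  dominated2 wt wt (CN * A) (fun p : R * R => KN p.1 p.2 * g p.2).
Proof.
move=> A0 [mg gA]; split.
  apply: measurable_funM; first exact: measurable_KN.
  exact: (measurableT_comp mg measurable_snd).
move=> p; rewrite normrM ger0_norm ?KN_ge0// -mulrA.
apply: ler_pM => //; [exact: KN_ge0|exact: KN_bound|].
rewrite (le_trans (gA _))// ler_wpM2l// ler_peMl ?wt_ge0//.
exact: wt_ge1.
Qed.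

Let dfr A g (k : Theta R -> R) : 0 <= A -> measurable_fun setT k ->
  (forall th, 0 <= k th <= 1) -> dominated wt A g ->
  dominated2 wt chi (k2 * A) (fun p : R * Theta R => Fp F p.1 * (chi p.2 * g (k p.2 * p.1))).
Proof.
move=> A0 mk k01 [mg gA]; split.
  apply: measurable_funM; first exact: (measurableT_comp (measurable_Fp hKF) measurable_fst).
  apply: measurable_funM; first exact: (measurableT_comp measurable_chi measurable_snd).
  apply: measurableT_comp => //; apply: measurable_funM => //.
  exact: (measurableT_comp mk measurable_snd).
move=> p; have /andP[F0 F2] := Fp_le p.1; have /andP[h0 h1] := chi01 p.2.
rewrite !normrM (ger0_norm F0) (ger0_norm h0) -mulrA; apply: ler_pM => //.
  by rewrite mulr_ge0.
have -> : A * (wt p.1 * chi p.2) = chi p.2 * (A * wt p.1) by ring.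
apply: ler_wpM2l => //.
rewrite (le_trans (gA _))// ler_wpM2l// wt_scale//.
Qed.

(** Gains and losses of the two operators. The truncation makes each of them absolutely convergent,
    so that they can be separated. *)
Let Gc g := dint c c (fun p : R * R => KN p.1 p.2 * g (p.1 + p.2)).
Let Lc g := dint c c (fun p : R * R => KN p.1 p.2 * g p.1).
Let Gf i g := dint c beta (fun p : R * Theta R => Fp F p.1 * (chi p.2 * g (p.2 i * p.1))).
(** The factor 1 gives the loss the shape of a fragment, so that the domination [dfr] covers it
    too. *)
Let Lf g := dint c beta (fun p : R * Theta R => Fp F p.1 * (chi p.2 * g (1 * p.1))).

Let swap A g : 0 <= A -> dominated wt A g ->
  dint c c (fun p : R * R => KN p.1 p.2 * g p.2) = Lc g.
Proof.
move=> A0 hg; have [mf fb] := dr A0 hg.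
have iA : c.-integrable setT (EFin \o (fun a => CN * A * wt a)).
  by rewrite (_ : _ \o _ = (fun x => (CN * A)%:E * (EFin \o wt) x)%E) //; apply: integrableZl.
rewrite /Lc /dint (fubini_dominated sc sc mf iA ac); last first.
  by move=> a b; rewrite -mulrA; exact: fb.
by apply: eq_Rintegral => a _; apply: eq_Rintegral => b _ /=; rewrite KN_sym.
Qed.

Let QcoagE A g : 0 <= A -> dominated wt A g -> Qcoag c g = Gc g - 2 * Lc g.
Proof.
move=> A0 hg; have h1 := dgain A0 hg; have h2 := dl A0 hg; have h3 := dr A0 hg.
rewrite /Qcoag /coag_op.
have -> : (fun p : R * R => KN p.1 p.2 * (g (p.1 + p.2) - g p.1 - g p.2)) =
  (fun p => KN p.1 p.2 * g (p.1 + p.2) - (KN p.1 p.2 * g p.1 + KN p.1 p.2 * g p.2)).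
  by apply/funext => p; ring.
rewrite (dintB sc sc ac ac h1 (dominatedD h2 h3)) (dintD sc sc ac ac h2 h3) (swap A0 hg).
by rewrite -/(Gc g) -/(Lc g); ring.
Qed.

Let dGf A g i : 0 <= A -> dominated wt A g -> dominated2 wt chi (k2 * A)
  (fun p : R * Theta R => Fp F p.1 * (chi p.2 * g (p.2 i * p.1))).
Proof.
move=> A0 hg; apply: (dfr A0 (measurable_theta i) _ hg) => th.
by rewrite theta_ge0 theta_le1.
Qed.

Let dLf A g : 0 <= A -> dominated wt A g -> dominated2 wt chi (k2 * A)
  (fun p : R * Theta R => Fp F p.1 * (chi p.2 * g (1 * p.1))).
Proof.
move=> A0 hg; apply: (@dfr A g (fun=> 1) A0 _ _ hg) => // th.
by rewrite ler01 lexx.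
Qed.

Let QfragE A g : 0 <= A -> dominated wt A g ->
  Qfrag c g = \sum_(i < m.+1) Gf i g - Lf g.
Proof.
move=> A0 hg.
have [[B hB] <-] := dint_sum sc sb ac ic m.+1 (fun i => dGf i A0 hg).
rewrite -(dintB sc sb ac ic hB (dLf A0 hg)); congr dint; apply/funext => p.
by rewrite /frag_fin mulrBr mulrBr mul1r !mulr_sumr.
Qed.

Let lossE A g : 0 <= A -> dominated wt A g ->
  c.-integrable setT (EFin \o (fun x => g x * loss c x)) /\
  \int[c]_x (g x * loss c x) = Lc g + Lf g.
Proof.
move=> A0 hg; have h1 := dl A0 hg; have h2 := dLf A0 hg.
have i1 := dominated2_inner sc sc ac ac h1; have i2 := dominated2_inner sc sb ac ic h2.
have E : (fun x => g x * loss c x) = (fun x => \int[c]_y (KN x y * g x) +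
    \int[beta]_th (Fp F x * (chi th * g (1 * x)))).
  apply/funext => x; rewrite /loss mulrDr; congr (_ + _).
    rewrite mulrC -RintegralZr//.
    apply: (dominated_integrable (A := CN) ac); split.
      by apply: (measurable_fun_pair2 (f := fun p : R * R => KN p.1 p.2)); exact: measurable_KN.
    move=> y; rewrite ger0_norm ?KN_ge0// (le_trans (KN_bound _ _))//.
    by rewrite ler_peMr ?CN_ge0// wt_ge1.
  under [RHS]eq_Rintegral do rewrite mulrCA.
  by rewrite RintegralZr// /total_chi mul1r; ring.
rewrite E; split; last by rewrite RintegralD.
rewrite (_ : _ \o _ = (fun x => (\int[c]_y (KN x y * g x))%:E +
  (\int[beta]_th (Fp F x * (chi th * g (1 * x))))%:E)%E) //.
exact: integrableD.
Qed.

Lemma QtruncD A B f g : 0 <= A -> 0 <= B -> dominated wt A f -> dominated wt B g ->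
  Qtrunc c (fun x => f x + g x) = Qtrunc c f + Qtrunc c g.
Proof.
move=> A0 B0 hf hg; have hfg := dominatedD hf hg; have AB0 := addr_ge0 A0 B0.
rewrite /Qtrunc !(QcoagE _ hf, QcoagE _ hg, QcoagE _ hfg)// !(QfragE _ hf, QfragE _ hg, QfragE _ hfg)//.
have -> : Gc (fun x => f x + g x) = Gc f + Gc g.
  rewrite -(dintD sc sc ac ac (dgain A0 hf) (dgain B0 hg)); congr dint.
  by apply/funext => p; rewrite mulrDr.
have -> : Lc (fun x => f x + g x) = Lc f + Lc g.
  rewrite -(dintD sc sc ac ac (dl A0 hf) (dl B0 hg)); congr dint.
  by apply/funext => p; rewrite mulrDr.
have -> : Lf (fun x => f x + g x) = Lf f + Lf g.
  rewrite -(dintD sc sb ac ic (dLf A0 hf) (dLf B0 hg)); congr dint.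
  by apply/funext => p; rewrite !mulrDr.
have -> : \sum_(i < m.+1) Gf i (fun x => f x + g x) = \sum_(i < m.+1) Gf i f + \sum_(i < m.+1) Gf i g.
  rewrite -big_split; apply: eq_bigr => i _ /=.
  rewrite -(dintD sc sb ac ic (dGf i A0 hf) (dGf i B0 hg)); congr dint.
  by apply/funext => p; rewrite !mulrDr.
move: (Gc f) (Gc g) (Lc f) (Lc g) (Lf f) (Lf g) (\sum_(i < m.+1) Gf i f) (\sum_(i < m.+1) Gf i g).
by move=> *; field.
Qed.

Lemma Qtrunc_bound A g : 0 <= A -> dominated wt A g ->
  `|Qtrunc c g| <= A * (2 * CN * energy l c ^+ 2 + (m.+2)%:R * k2 * total_chi * energy l c).
Proof.
move=> A0 hg; rewrite /Qtrunc (QcoagE A0 hg) (QfragE A0 hg).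
have b1 := dint_bound sc sc ac ac (dgain A0 hg).
have b2 := dint_bound sc sc ac ac (dl A0 hg).
have b3 i := dint_bound sc sb ac ic (dGf i A0 hg).
have b4 := dint_bound sc sb ac ic (dLf A0 hg).
have b5 : `|\sum_(i < m.+1) Gf i g| <= m.+1%:R * (k2 * A * energy l c * total_chi).
  rewrite (le_trans (ler_norm_sum _ _ _))//.
  apply: (@le_trans _ _ (\sum_(i < m.+1) (k2 * A * energy l c * total_chi))).
    by apply: ler_sum => i _; exact: b3.
  by rewrite sumr_const card_ord mulr_natl.
rewrite -/(Gc g) -/(energy l c) in b1; rewrite -/(Lc g) -/(energy l c) in b2.
rewrite -/(Lf g) -/(energy l c) -/total_chi in b4.
rewrite (_ : m.+2%:R = m.+1%:R + 1); last by rewrite -natr1.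
move: b1 b2 b4 b5.
move: (\sum_(i < m.+1) Gf i g) (Gc g) (Lc g) (Lf g) (energy l c) total_chi CN m.+1%:R.
move=> x1 x2 x3 x4 E ch C mm.
by rewrite !ler_norml => *; apply/andP; split; lra.
Qed.

(** The new measure is the sum of [c] with density 1 - s loss, the image of (s / 2) [KN] under
    addition, and the images of s [Fp] [chi] under x |-> theta_i x for i <= m. The bound on [s]
    keeps the first density nonnegative. *)
Theorem euler_step s : 0 <= s -> s * (CN * energy l c + k2 * total_chi) <= 1 ->
  exists c' : {measure set R -> \bar R}, admissible l c' /\
  forall A g, 0 <= A -> dominated wt A g -> \int[c']_x g x = \int[c]_x g x + s * Qtrunc c g.
Proof.
move=> s0 s1.
pose J g := \int[c]_x (g x * (1 - s * loss c x)) + s / 2 * Gc g + s * \sum_(i < m.+1) Gf i g.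
have JE A g : 0 <= A -> dominated wt A g -> J g = \int[c]_x g x + s * Qtrunc c g.
  move=> A0 hg; have [il iE] := lossE A0 hg; have ig := dominated_integrable ac hg.
  rewrite /Qtrunc (QcoagE A0 hg) (QfragE A0 hg) /J.
  have -> : \int[c]_x (g x * (1 - s * loss c x)) = \int[c]_x g x - s * (Lc g + Lf g).
    rewrite -iE -RintegralZl// -RintegralB//; last first.
      rewrite (_ : _ \o _ = (fun x => s%:E * (EFin \o (fun x => (g x * loss c x)%R)) x)%E) //.
      by apply: integrableZl.
    by apply: eq_Rintegral => x _; ring.
  by field.
have lb x := loss_bound x.
have mloss : measurable_fun setT (loss c).
  have h1 : dominated wt 1 (fun=> 1 : R).
    by split=> // x; rewrite mul1r normr1 wt_ge1.
  have [/measurable_int/measurable_EFinP + _] := lossE ler01 h1.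
  by under eq_fun do rewrite mul1r.
have rho0_ge0 x : 0 <= 1 - s * loss c x.
  have /andP[_ h] := lb x; rewrite subr_ge0 (le_trans _ s1)// ler_wpM2l//.
have rho0_le1 x : `|1 - s * loss c x| <= 1.
  by rewrite ger0_norm// lerBlDr lerDl mulr_ge0//; case/andP: (lb x).
have mrho0 : measurable_fun setT (fun x => 1 - s * loss c x).
  by apply: measurable_funB => //; exact: measurable_funM.
have [nu0 [_ H0]] := @ex_image_density _ _ _ _ R c (fun x => 1 - s * loss c x) id
  mrho0 rho0_ge0 (@measurable_id _ _ setT).
have s20 : 0 <= s / 2 by rewrite divr_ge0.
have mrho1 : measurable_fun setT (fun p : R * R => s / 2 * KN p.1 p.2).
  by apply: measurable_funM => //; exact: measurable_KN.
have mX1 : measurable_fun setT (fun p : R * R => p.1 + p.2) by exact: measurable_funD.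
have [nu1 H1] := ex_image_product sc sc ac ac mrho1
  (fun p => mulr_ge0 s20 (KN_ge0 p.1 p.2)) mX1.
have mrho2 : measurable_fun setT (fun p : R * Theta R => s * (Fp F p.1 * chi p.2)).
  apply: measurable_funM => //; apply: measurable_funM.
    exact: (measurableT_comp (measurable_Fp hKF) measurable_fst).
  exact: (measurableT_comp measurable_chi measurable_snd).
have rho2_ge0 (p : R * Theta R) : 0 <= s * (Fp F p.1 * chi p.2).
  have /andP[F0 _] := Fp_le p.1; have /andP[h0 _] := chi01 p.2.
  by rewrite !mulr_ge0.
have mX2 i : measurable_fun setT (fun p : R * Theta R => p.2 i * p.1).
  by apply: measurable_funM => //; exact: (measurableT_comp (measurable_theta i) measurable_snd).
have [nu2 H2] := choice (fun i => ex_image_product sc sb ac ic mrho2 rho2_ge0 (mX2 i)).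
pose c' := measure_add nu0 (measure_add nu1 (msum nu2 m.+1)).
have HP A g : 0 <= A -> dominated wt A g -> (forall x, 0 <= g x) ->
    (\int[c']_x (g x)%:E)%E = (\int[c]_x g x + s * Qtrunc c g)%:E.
  move=> A0 hg g0; rewrite -(JE A g A0 hg) /J.
  have mg : measurable_fun setT (EFin \o g) by apply/measurable_EFinP; case: hg.
  have g0E x : [set: R] x -> (0 <= (g x)%:E)%E by rewrite lee_fin.
  rewrite ge0_integral_measure_add// ge0_integral_measure_add// ge0_integral_measure_sum//.
  have E0 : (\int[nu0]_x (g x)%:E)%E = (\int[c]_x (g x * (1 - s * loss c x)))%:E.
    rewrite (H0 (EFin \o g) mg (fun x => g0E x I)) Rintegral_EFin.
      by under [RHS]eq_integral do rewrite EFinM.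
    apply: (@dominated_integrable _ _ _ wt c ac A); case: hg => mg' gA; split.
      exact: measurable_funM.
    by move=> x; rewrite normrM (le_trans _ (gA x))// ler_piMr.
  have E1 : (\int[nu1]_x (g x)%:E)%E = (s / 2 * Gc g)%:E.
    have E : (fun p : R * R => g (p.1 + p.2) * (s / 2 * KN p.1 p.2)) =
      (fun p => s / 2 * (KN p.1 p.2 * g (p.1 + p.2))) by apply/funext => p; ring.
    rewrite (H1 (`|s / 2| * (CN * (2 * A))) g)//; last first.
    - by rewrite E; apply: dominatedZ; exact: dgain.
    - by case: hg.
    by rewrite E (dintZ sc sc ac ac _ (dgain A0 hg)).
  have E2 i : (\int[nu2 i]_x (g x)%:E)%E = (s * Gf i g)%:E.
    have E : (fun p : R * Theta R => g (p.2 i * p.1) * (s * (Fp F p.1 * chi p.2))) =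
      (fun p => s * (Fp F p.1 * (chi p.2 * g (p.2 i * p.1)))) by apply/funext => p; ring.
    rewrite (H2 i (`|s| * (k2 * A)) g)//; last first.
    - by rewrite E; apply: dominatedZ; exact: dGf.
    - by case: hg.
    by rewrite E (dintZ sc sb ac ic _ (dGf i A0 hg)).
  rewrite E0 E1 mulr_sumr !EFinD -sumEFin addeA.
  by under eq_bigr do rewrite E2.
have dwt : dominated wt 1 wt.
  by split; [exact: measurable_wt|move=> x; rewrite mul1r ger0_norm// wt_ge0].
have ac' : admissible l c'.
  apply/integrableP; split; first by apply/measurable_EFinP; exact: measurable_wt.
  under eq_integral do rewrite /= ger0_norm ?wt_ge0//.
  by rewrite (HP 1)// ?ltry// => x; exact: wt_ge0.
have HPR A g : 0 <= A -> dominated wt A g -> (forall x, 0 <= g x) ->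
    \int[c']_x g x = \int[c]_x g x + s * Qtrunc c g.
  by move=> A0 hg g0; rewrite {1}/Rintegral (HP A).
exists c'; split=> // A g A0 hg.
(* The identity is known for nonnegative functions; a signed [g] is the difference of [g + A wt] and
   [A wt]. *)
have dA : dominated wt (`|A| * 1) (fun x => A * wt x) by exact: dominatedZ.
have AA0 : 0 <= `|A| * 1 by rewrite mulr1.
have dg : dominated wt (A + `|A| * 1) (fun x => g x + A * wt x) by exact: dominatedD.
have h1 := HPR _ _ AA0 dA (fun x => mulr_ge0 A0 (wt_ge0 l x)).
have h2 : \int[c']_x (g x + A * wt x) = \int[c]_x (g x + A * wt x) + s * Qtrunc c (fun x => g x + A * wt x).
  apply: (HPR (A + `|A| * 1)) => //; first exact: addr_ge0.
  by move=> x; have := hg.2 x; rewrite ler_norml -subr_ge0 opprK => /andP[].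
have DD (e : {measure set R -> \bar R}) : admissible l e ->
    \int[e]_x (g x + A * wt x) = \int[e]_x g x + \int[e]_x (A * wt x).
  move=> ae; apply: RintegralD => //; first exact: (dominated_integrable ae hg).
  exact: (dominated_integrable ae dA).
rewrite (DD c' ac') (DD c ac) (QtruncD A0 AA0 hg dA) mulrDr in h2; move: h1 h2.
move: (\int[c']_x g x) (\int[c']_x (A * wt x)) (\int[c]_x g x) (\int[c]_x (A * wt x))
  (s * Qtrunc c g) (s * Qtrunc c _).
by move=> *; lra.
Qed.

End one_measure.
End truncated.

(** * Growth, continuity and consistency of the truncated operators *)

Section truncated_estimates.
Context {R : realType} (l : exponent R).
Implicit Types (c d : {measure set R -> \bar R}) (x y z t s : R) (phi g : R -> R).
Notation pw := (pw l).
Notation wt := (wt l).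
Notation lam := (exponent_val l).
Variables (K : R -> R -> R) (F : R -> R) (beta : {measure set (Theta R) -> \bar R}).
Hypothesis hKF : hypothesis_KF lam K F.
Hypothesis hC : (C_beta lam beta < +oo)%E.
Variables (k0 k2 C0 : R).
Hypothesis k0_ge0 : 0 <= k0.
Hypothesis Kp_le : forall x y, Kp K x y <= k0 * pw (x + y).
Hypothesis Fp_le : forall x, 0 <= Fp F x <= k2.
Hypothesis C0_ge0 : 0 <= C0.
Hypothesis coagC0 : forall (k : R -> R -> R) phi B,
  measurable_fun setT (fun p : R * R => k p.1 p.2) ->
  (forall x y, 0 <= k x y <= Kp K x y) -> holder l B phi ->
  pw_bounded2 l (C0 * B) (fun x y => k x y * coag_op phi x y).
Variables (N : R) (m : nat).
Hypothesis N_gt0 : 0 < N.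
Notation KN := (KN K N).
Notation chi := (chi m).
Notation Qcoag := (Qcoag K N).
Notation Qfrag := (Qfrag F beta m).
Notation Qtrunc := (Qtrunc K F beta N m).

Let k2_ge0 : 0 <= k2.
Proof. by have /andP[h1 h2] := Fp_le 0; exact: le_trans h2. Qed.

Let sb := beta_sigma_finite hC.

Let dfrag phi B : holder l B phi -> dominated2 pw (frag_weight l m.+1) (k2 * B)
  (fun p : R * Theta R => Fp F p.1 * (chi p.2 * frag_fin m.+1 phi p.2 p.1)).
Proof.
move=> hphi; have B0 := holder_ge0 hphi; split.
  apply: measurable_funM; first exact: (measurableT_comp (measurable_Fp hKF) measurable_fst).
  apply: measurable_funM; first exact: (measurableT_comp (measurable_chi m) measurable_snd).
  have h := measurable_frag_fin m.+1 (holder_pw_bounded hphi).1.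
  have sw : measurable_fun setT (fun p : R * Theta R => (p.2, p.1)).
    by apply/measurable_fun_pairP; split; [exact: measurable_snd|exact: measurable_fst].
  exact: (measurableT_comp h sw).
move=> p; have /andP[F0 F2] := Fp_le p.1; have /andP[h0 h1] := chi01 m p.2.
rewrite !normrM (ger0_norm F0) (ger0_norm h0) -mulrA; apply: ler_pM => //.
  by rewrite mulr_ge0.
apply: (@le_trans _ _ `|frag_fin m.+1 phi p.2 p.1|); first by rewrite ler_piMl.
by rewrite (le_trans (frag_fin_bound _ _ _ hphi))// -mulrA (mulrC (pw _)).
Qed.

Lemma Qfrag_bound c phi B : has_moment l c -> holder l B phi ->
  `|Qfrag c phi| <= k2 * B * fragC l beta * mass l c.
Proof.
move=> mc hphi; have B0 := holder_ge0 hphi.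
have := dint_bound mc.1 sb mc.2 (integrable_frag_weight hC m.+1) (dfrag hphi).
move=> /le_trans; apply; rewrite -/(mass l c) [leRHS]mulrAC ler_wpM2l ?mulr_ge0 ?mass_ge0//.
exact: int_frag_weight.
Qed.

Lemma holder_pw : holder l 1 pw.
Proof. by split=> [x|x y]; [exact: pw_le0|rewrite mul1r; exact: pw_dist]. Qed.

Let dcoag c phi B : has_moment l c -> holder l B phi -> dominated2 pw pw (C0 * B)
  (fun p : R * R => KN p.1 p.2 * coag_op phi p.1 p.2).
Proof.
move=> mc hphi.
have [mH HB] := coagC0 (measurable_KN hKF N)
  (fun x y => introT andP (conj (KN_ge0 hKF N x y) (KN_le hKF N x y))) hphi.
by split=> // p; exact: HB.
Qed.

(** [pw] is subadditive, so coagulation cannot increase this moment. Growth comes from fragmentation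
    alone, at a rate free of the truncation parameters. *)
Lemma Qtrunc_pw_le c : has_moment l c ->
  Qtrunc c pw <= k2 * fragC l beta * mass l c.
Proof.
move=> mc; have hp := holder_pw.
have h1 := ler_normlW (Qfrag_bound mc hp); rewrite mulr1 in h1.
have d0 : dominated2 pw pw 0 (fun _ : R * R => 0 : R).
  by split=> // p; rewrite normr0 mul0r.
have h2 : Qcoag c pw <= 0.
  have := le_dint mc.1 mc.1 mc.2 mc.2 (dcoag mc hp) d0.
  rewrite [X in _ <= X](_ : _ = 0); last first.
    by rewrite /dint /Rintegral integral0_eq// => x _; rewrite integral0_eq.
  apply => p; rewrite mulr_ge0_le0 ?(KN_ge0 hKF)// /coag_op.
  by have := pw_addr_le l p.1 p.2; lra.
by rewrite /Qtrunc; lra.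
Qed.

Let dwt : dominated wt 1 wt.
Proof. by split; [exact: measurable_wt|move=> x; rewrite mul1r ger0_norm// wt_ge0]. Qed.

Lemma int_sqr_pw c : admissible l c ->
  c.-integrable setT (EFin \o (fun x => pw x ^+ 2)) /\
  \int[c]_x pw x ^+ 2 <= energy l c.
Proof.
move=> ac.
have i2 : c.-integrable setT (EFin \o (fun x => pw x ^+ 2)).
  apply: (dominated_integrable (A := 1) ac); split.
    by apply: measurable_funX; exact: measurable_pw.
  by move=> x; rewrite mul1r ger0_norm ?sqr_ge0// sqr_pw_le_wt.
by split=> //; apply: le_Rintegral_setT => // x; exact: sqr_pw_le_wt.
Qed.

(** Coagulation increases [wt] by at most 2 x^l y^l, and [Kp] is at most k0 (x^l + y^l); each of the
    m + 1 fragments weighs at most its parent, which leaves the factor m. The resulting rate depends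
    on m but not on N. *)
Lemma Qtrunc_wt_le c : admissible l c ->
  Qtrunc c wt <= (2 * k0 * mass l c + k2 * m%:R * total_chi beta m) * energy l c.
Proof.
move=> ac; have sc := admissible_sigma_finite ac; have mc := admissible_moment ac.
have ic := integrable_chi hC m; have [i2 i2E] := int_sqr_pw ac; have ip := mc.2.
have m0 := mass_ge0 l c.
have P x : 0 <= pw x by exact: pw_ge0.
have S x : 0 <= pw x ^+ 2 by exact: sqr_ge0.
have mS : measurable_fun setT (fun x => pw x ^+ 2).
  by apply: measurable_funX; exact: measurable_pw.
have mpw := measurable_pw l.
have d1 : dominated2 wt wt (2 * k0) (fun p : R * R => 2 * k0 * (pw p.1 ^+ 2 * pw p.2)).
  split.
    apply: measurable_funM => //; apply: measurable_funM.
      exact: (measurableT_comp mS measurable_fst).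
    exact: (measurableT_comp mpw measurable_snd).
  move=> p; rewrite ger0_norm ?mulr_ge0// ler_wpM2l ?mulr_ge0//.
  by apply: ler_pM => //; [exact: sqr_pw_le_wt|exact: pw_le_wt].
have d2 : dominated2 wt wt (2 * k0) (fun p : R * R => 2 * k0 * (pw p.1 * pw p.2 ^+ 2)).
  split.
    apply: measurable_funM => //; apply: measurable_funM.
      exact: (measurableT_comp mpw measurable_fst).
    exact: (measurableT_comp mS measurable_snd).
  move=> p; rewrite ger0_norm ?mulr_ge0// ler_wpM2l ?mulr_ge0//.
  by apply: ler_pM => //; [exact: pw_le_wt|exact: sqr_pw_le_wt].
have CN0 := CN_ge0 l k0_ge0 N.
have d3 : dominated2 wt wt (CN l k0 N * 3) (fun p : R * R => KN p.1 p.2 * coag_op wt p.1 p.2).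
  split.
    apply: measurable_funM; first exact: (measurable_KN hKF).
    exact: measurable_coag_op (measurable_wt l).
  move=> p; rewrite normrM -mulrA; apply: ler_pM => //.
    by rewrite ger0_norm ?(KN_ge0 hKF)// (KN_bound k0_ge0 Kp_le).
  have := wt_add l p.1 p.2; have := wt_ge1 l p.1; have := wt_ge1 l p.2.
  have := wt_ge0 l (p.1 + p.2).
  by rewrite /coag_op ler_norml => *; apply/andP; split; nra.
have hc : Qcoag c wt <= 4 * k0 * mass l c * energy l c.
  have h := le_dint sc sc ac ac d3 (dominatedD d1 d2).
  have {h} h : Qcoag c wt <= dint c c (fun p : R * R => 2 * k0 * (pw p.1 ^+ 2 * pw p.2) +
     2 * k0 * (pw p.1 * pw p.2 ^+ 2)).
    apply: h => p.
    have K0 := KN_ge0 hKF N p.1 p.2.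
    have Kle : KN p.1 p.2 <= k0 * (pw p.1 + pw p.2).
      rewrite (le_trans (KN_le hKF _ _ _))// (le_trans (Kp_le _ _))// ler_wpM2l//.
      exact: pw_addr_le.
    have h1 : coag_op wt p.1 p.2 <= 2 * (pw p.1 * pw p.2).
      have : pw (p.1 + p.2) ^+ 2 <= (pw p.1 + pw p.2) ^+ 2.
        by rewrite ler_sqr ?nnegrE ?addr_ge0// pw_addr_le.
      by rewrite /coag_op /Submission.wt; nra.
    apply: (@le_trans _ _ (KN p.1 p.2 * (2 * (pw p.1 * pw p.2)))).
      by rewrite ler_wpM2l.
    apply: (@le_trans _ _ (k0 * (pw p.1 + pw p.2) * (2 * (pw p.1 * pw p.2)))).
      by rewrite ler_wpM2r ?mulr_ge0.
    by rewrite le_eqVlt; apply/orP; left; apply/eqP; ring.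
  rewrite (dintD sc sc ac ac d1 d2) in h.
  have e1 := @dint_prod _ _ _ _ R c c (fun x => pw x ^+ 2) pw i2 ip (2 * k0).
  have e2 := @dint_prod _ _ _ _ R c c pw (fun x => pw x ^+ 2) ip i2 (2 * k0).
  rewrite e1 e2 -/(mass l c) in h.
  apply: (le_trans h).
  have := ler_wpM2l (mulr_ge0 k0_ge0 m0) i2E.
  by move: (\int[c]_x pw x ^+ 2) => M2; lra.
have hf : Qfrag c wt <= k2 * m%:R * energy l c * total_chi beta m.
  have d4 : dominated2 wt chi (k2 * m.+2%:R) (fun p : R * Theta R =>
     Fp F p.1 * (chi p.2 * frag_fin m.+1 wt p.2 p.1)).
    split.
      apply: measurable_funM; first exact: (measurableT_comp (measurable_Fp hKF) measurable_fst).
      apply: measurable_funM; first exact: (measurableT_comp (measurable_chi m) measurable_snd).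
      have h := measurable_frag_fin m.+1 (measurable_wt l).
      have sw : measurable_fun setT (fun p : R * Theta R => (p.2, p.1)).
        by apply/measurable_fun_pairP; split; [exact: measurable_snd|exact: measurable_fst].
      exact: (measurableT_comp h sw).
    move=> p; have /andP[F0 F2] := Fp_le p.1; have /andP[h0 h1] := chi01 m p.2.
    rewrite !normrM (ger0_norm F0) (ger0_norm h0) -mulrA; apply: ler_pM => //.
      by rewrite mulr_ge0.
    rewrite mulrA mulrC; apply: ler_wpM2r => //.
    rewrite /frag_fin (le_trans (ler_normB _ _))// (ger0_norm (wt_ge0 _ _)).
    rewrite -natr1 mulrDl mul1r lerD2r (le_trans (ler_norm_sum _ _ _))//.
    apply: (@le_trans _ _ (\sum_(i < m.+1) wt p.1)).
      by apply: ler_sum => i _; rewrite ger0_norm ?wt_ge0// wt_scale// theta_ge0 theta_le1.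
    by rewrite sumr_const card_ord mulr_natl.
  have d5 : dominated2 wt chi (k2 * m%:R) (fun p : R * Theta R => k2 * m%:R * (wt p.1 * chi p.2)).
    split.
      apply: measurable_funM => //; apply: measurable_funM.
        exact: (measurableT_comp (measurable_wt l) measurable_fst).
      exact: (measurableT_comp (measurable_chi m) measurable_snd).
    move=> p; have /andP[h0 h1] := chi01 m p.2.
    by rewrite ger0_norm// !mulr_ge0// wt_ge0.
  have h := le_dint sc sb ac ic d4 d5.
  rewrite (dint_prod ac ic) in h; apply: h => p.
  have /andP[F0 F2] := Fp_le p.1; have /andP[h0 h1] := chi01 m p.2.
  apply: (@le_trans _ _ (Fp F p.1 * (chi p.2 * (m%:R * wt p.1)))).
    rewrite ler_wpM2l// ler_wpM2l// /frag_fin lerBlDr.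
    apply: (@le_trans _ _ (\sum_(i < m.+1) wt p.1)).
      by apply: ler_sum => i _; rewrite wt_scale// theta_ge0 theta_le1.
    by rewrite sumr_const card_ord mulrSr mulr_natl.
  have -> : k2 * m%:R * (wt p.1 * chi p.2) = k2 * (chi p.2 * (m%:R * wt p.1)) by ring.
  by rewrite ler_wpM2r// !mulr_ge0// wt_ge0.
rewrite /Qtrunc.
move: hc hf; move: (Qcoag c wt) (Qfrag c wt) (mass l c) (energy l c) (total_chi beta m) m%:R.
by move=> *; lra.
Qed.

Let KNC phi B := fun hphi : holder l B phi => coagC0 (measurable_KN hKF N)
  (fun x y => introT andP (conj (KN_ge0 hKF N x y) (KN_le hKF N x y))) hphi.

Let QcoagE c phi : Qcoag c phi = \int[c]_y \int[c]_x (KN x y * coag_op phi x y).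
Proof.
rewrite /Submission.Qcoag /dint; apply: eq_Rintegral => y _; apply: eq_Rintegral => x _ /=.
by rewrite (KN_sym hKF) /coag_op (addrC y); ring.
Qed.

Let inner_frag c phi B : has_moment l c -> holder l B phi ->
  pw_bounded l (k2 * B * fragC l beta)
    (fun x => \int[beta]_th (Fp F x * (chi th * frag_fin m.+1 phi th x))).
Proof.
move=> mc hphi; have B0 := holder_ge0 hphi; have iw := integrable_frag_weight hC m.+1.
split.
  have := dominated2_inner mc.1 sb mc.2 iw (dfrag hphi).
  by case/integrableP => /measurable_EFinP.
move=> x; have [mf fb] := dfrag hphi.
have := @dominated_bound _ _ _ (frag_weight l m.+1) beta iw (k2 * B * pw x)
  (fun th => Fp F x * (chi th * frag_fin m.+1 phi th x)).
move=> h; apply: (le_trans (h _)); last first.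
  rewrite -!mulrA; apply: ler_wpM2l => //; apply: ler_wpM2l => //.
  by rewrite mulrC ler_wpM2r ?pw_ge0// int_frag_weight.
split; first exact: (measurable_fun_pair2 (f := fun p : R * Theta R =>
  Fp F p.1 * (chi p.2 * frag_fin m.+1 phi p.2 p.1))).
by move=> th; rewrite (le_trans (fb (x, th)))// mulrA.
Qed.

(** The inner integrals are dominated by [pw], hence by [wt], so the closeness [delta] of the
    measures in the dual norm of [wt] applies to them; the coagulation part is first factored by
    [bilinear_diff]. *)
Lemma Qtrunc_cont c d delta phi B : admissible l c -> admissible l d ->
  (forall A g, 0 <= A -> dominated wt A g -> `|\int[c]_x g x - \int[d]_x g x| <= A * delta) ->
  holder l B phi ->
  `|Qtrunc c phi - Qtrunc d phi| <=
    B * (C0 * (mass l c + mass l d) + k2 * fragC l beta) * delta.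
Proof.
move=> ac ad hcd hphi; have B0 := holder_ge0 hphi.
have mc := admissible_moment ac; have md := admissible_moment ad.
have bH := KNC hphi.
have delta0 : 0 <= delta.
  have := hcd 1 (fun=> 0) ler01; rewrite mul1r => h; apply: le_trans (h _) => //.
  by split=> // x; rewrite normr0 mul1r wt_ge0.
have CB0 : 0 <= C0 * B by rewrite mulr_ge0.
have sH x y : KN x y * coag_op phi x y = KN y x * coag_op phi y x.
  by rewrite (KN_sym hKF) /coag_op (addrC y); ring.
have hH : pw_bounded l (C0 * B * delta) (fun y => \int[c]_x (KN x y * coag_op phi x y) -
    \int[d]_x (KN x y * coag_op phi x y)).
  split; first exact: (pw_boundedB (pw_bounded_inner_l bH mc mc) (pw_bounded_inner_l bH md mc)).1.
  move=> y; rewrite mulrAC; apply: hcd; first by rewrite mulr_ge0// pw_ge0.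
  by apply: pw_bounded_dominated (pw_bounded2_l bH y); rewrite mulr_ge0// pw_ge0.
have h1 : `|Qcoag c phi - Qcoag d phi| <= C0 * B * delta * (mass l c + mass l d).
  rewrite !QcoagE (bilinear_diff mc md bH sH) mulrDr (le_trans (ler_normD _ _))//.
  by apply: lerD; [exact: (pairing_bound mc hH)|exact: (pairing_bound md hH)].
have h2 : `|Qfrag c phi - Qfrag d phi| <= k2 * B * fragC l beta * delta.
  have kB0 : 0 <= k2 * B * fragC l beta by rewrite !mulr_ge0// fragC_ge0.
  by apply: hcd => //; apply: pw_bounded_dominated => //; exact: inner_frag mc hphi.
rewrite /Submission.Qtrunc; move: h1 h2.
move: (Qcoag c phi) (Qcoag d phi) (Qfrag c phi) (Qfrag d phi) (mass_ge0 l c) (mass_ge0 l d).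
move=> q1 q2 q3 q4 m1 m2 h1 h2.
have -> : 2^-1 * q1 + q3 - (2^-1 * q2 + q4) = 2^-1 * (q1 - q2) + (q3 - q4) by ring.
rewrite (le_trans (ler_normD _ _))// normrM ger0_norm ?invr_ge0//.
have : 2^-1 * `|q1 - q2| <= `|q1 - q2| by rewrite ler_piMl// invf_le1// ler1n.
by move=> h3; lra.
Qed.

(** The part of [C_beta] lost by keeping m + 1 fragments and discarding theta_0 close to 1. *)
Definition frag_rem : R := fragC l beta - \int[beta]_th (chi th * frag_weight l m.+1 th).

Lemma frag_fin_tail M phi B th x : (m <= M)%N -> holder l B phi ->
  `|frag_fin M.+1 phi th x - chi th * frag_fin m.+1 phi th x| <=
  B * pw x * (frag_weight l M.+1 th - chi th * frag_weight l m.+1 th).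
Proof.
move=> mM hphi; have B0 := holder_ge0 hphi; have [_ pb] := holder_pw_bounded hphi.
have /andP[h0 h1] := chi01 m th.
have E : frag_fin M.+1 phi th x - frag_fin m.+1 phi th x = \sum_(m.+1 <= i < M.+1) phi (th i * x).
  rewrite /frag_fin -!(big_mkord xpredT (fun i => phi (th i * x))).
  by rewrite (big_cat_nat (leq0n m.+1) (mM : (m < M.+1)%N))/=; ring.
have W : frag_weight l M.+1 th - frag_weight l m.+1 th = \sum_(m.+1 <= i < M.+1) pw (th i).
  by rewrite /frag_weight (big_cat_nat (ltn0Sn m) (mM : (m < M.+1)%N))/=; ring.
have -> : frag_fin M.+1 phi th x - chi th * frag_fin m.+1 phi th x =
  (frag_fin M.+1 phi th x - frag_fin m.+1 phi th x) + (1 - chi th) * frag_fin m.+1 phi th x by ring.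
have -> : frag_weight l M.+1 th - chi th * frag_weight l m.+1 th =
  (frag_weight l M.+1 th - frag_weight l m.+1 th) + (1 - chi th) * frag_weight l m.+1 th by ring.
rewrite E W [leRHS]mulrDr; apply: (le_trans (ler_normD _ _)); apply: lerD.
  rewrite (le_trans (ler_norm_sum _ _ _))// mulr_sumr; apply: ler_sum => i _.
  rewrite (le_trans (pb _))// -mulrA ler_wpM2l//.
  have [x0|/ltW x0] := leP x 0; last by rewrite pwM ?theta_ge0// mulrC.
  by rewrite (pw_le0 l x0) (pw_le0 l (mulr_ge0_le0 (theta_ge0 th i) x0)) mul0r.
rewrite normrM ger0_norm ?subr_ge0//.
have := frag_fin_bound m th x hphi => h.
apply: (@le_trans _ _ ((1 - chi th) * (B * frag_weight l m.+1 th * pw x))).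
  by rewrite ler_wpM2l// subr_ge0.
by rewrite le_eqVlt; apply/orP; left; apply/eqP; ring.
Qed.

Let i_chi_frag phi B x : holder l B phi ->
  beta.-integrable setT (EFin \o (fun th => chi th * frag_fin m.+1 phi th x)).
Proof.
move=> hphi; apply: le_integrable (frag_fin_integrable hC m x hphi) => //.
  apply/measurable_EFinP; apply: measurable_funM; first exact: measurable_chi.
  apply: (measurable_fun_pair1 (f := fun p : Theta R * R => frag_fin m.+1 phi p.1 p.2)).
  exact: measurable_frag_fin (holder_pw_bounded hphi).1.
move=> th _ /=; have /andP[h0 h1] := chi01 m th.
by rewrite lee_fin normrM (ger0_norm h0) ler_piMl.
Qed.

Let i_chi_weight : beta.-integrable setT (EFin \o (fun th => chi th * frag_weight l m.+1 th)).
Proof.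
apply: le_integrable (integrable_frag_weight hC m.+1) => //.
  apply/measurable_EFinP; apply: measurable_funM; first exact: measurable_chi.
  exact: measurable_frag_weight.
move=> th _ /=; have /andP[h0 h1] := chi01 m th.
by rewrite lee_fin normrM (ger0_norm h0) ler_piMl.
Qed.

(** [frag_fin_tail] compares with M + 1 fragments for any M >= m; its integral is bounded uniformly
    in M by [frag_rem], and M tends to infinity. *)
Lemma frag_lim_trunc phi B x : holder l B phi ->
  `|\int[beta]_th (chi th * frag_fin m.+1 phi th x) - frag_lim beta phi x| <=
  B * frag_rem * pw x.
Proof.
move=> hphi; have B0 := holder_ge0 hphi.
have cv := frag_lim_cvg hC (x := x) hphi.
have cv2 : `|frag_int beta M phi x - \int[beta]_th (chi th * frag_fin m.+1 phi th x)| @[M --> \oo]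
   --> `|frag_lim beta phi x - \int[beta]_th (chi th * frag_fin m.+1 phi th x)|.
  by apply: cvg_norm; apply: cvgB; [exact: cv|exact: cvg_cst].
rewrite distrC; apply: (cvgr_to_le cv2).
near=> M.
have mM : (m <= M)%N by near: M; exact: nbhs_infty_ge.
have i1 := frag_fin_integrable hC M x hphi; have i2 := i_chi_frag x hphi.
have i3 := integrable_frag_weight hC M.+1.
have i4 := integrable_subR i3 i_chi_weight.
rewrite /frag_int -RintegralB//.
rewrite (le_trans (le_normr_Rintegral _ _))//; first exact: integrable_subR.
apply: (@le_trans _ _ (\int[beta]_th (B * pw x * (frag_weight l M.+1 th - chi th * frag_weight l m.+1 th)))).
  apply: le_Rintegral_setT.
  - exact: (@integrable_norm _ _ _ _ _ _ (integrable_subR i1 i2)).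
  - rewrite (_ : _ \o _ = (fun th => (B * pw x)%:E * (EFin \o (fun th => (frag_weight l M.+1 th - chi th * frag_weight l m.+1 th)%R)) th)%E) //.
    exact: integrableZl.
  - by move=> th; exact: frag_fin_tail.
rewrite RintegralZl// RintegralB// mulrAC ler_wpM2r ?pw_ge0// ler_wpM2l//.
by rewrite lerD2r int_frag_weight.
Unshelve. all: by end_near. Qed.

Let far x y := Kp K x y - KN x y.

Let far_le x y : 0 <= far x y <= Kp K x y.
Proof.
rewrite /far subr_ge0 (KN_le hKF)/= lerBlDr lerDl; exact: (KN_ge0 hKF).
Qed.

(* The truncation removes only pairs with [x > N] or [y > N], where [x^l] is at
   most [N^-l x^(2 l)]. *)
Let far_bound phi B x y : holder l B phi ->
  `|far x y * coag_op phi x y| <= C0 * B / pw N * (pw x ^+ 2 * pw y + pw x * pw y ^+ 2).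
Proof.
move=> hphi; have B0 := holder_ge0 hphi.
have mfar : measurable_fun setT (fun p : R * R => far p.1 p.2).
  by apply: measurable_funB; [exact: (measurable_Kp hKF)|exact: (measurable_KN hKF)].
have [_ HB] := coagC0 mfar far_le hphi.
have pN : 0 < pw N by exact: pw_gt0.
have x0 := pw_ge0 l x; have y0 := pw_ge0 l y.
have big z : N < z -> 1 <= (pw N)^-1 * pw z.
  by move=> Nz; rewrite -ler_pdivrMl ?invr_gt0// mulr1 invrK pw_mono// ltW.
have r0 : 0 <= C0 * B / pw N * (pw x ^+ 2 * pw y + pw x * pw y ^+ 2).
  by rewrite mulr_ge0 ?divr_ge0 ?mulr_ge0 ?addr_ge0 ?mulr_ge0 ?sqr_ge0// ltW.
have H u v : 0 <= u -> 0 <= v -> 1 <= (pw N)^-1 * u ->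
    C0 * B * (u * v) <= C0 * B / pw N * (u ^+ 2 * v).
  move=> u0 v0 h; have -> : C0 * B / pw N * (u ^+ 2 * v) = C0 * B * ((pw N)^-1 * u * (u * v)) by ring.
  by rewrite ler_wpM2l ?mulr_ge0// ler_peMl ?mulr_ge0.
have s1 : 0 <= C0 * B / pw N * (pw x ^+ 2 * pw y).
  by apply: mulr_ge0; [rewrite divr_ge0 ?mulr_ge0// ltW|apply: mulr_ge0 => //; exact: sqr_ge0].
have s2 : 0 <= C0 * B / pw N * (pw y ^+ 2 * pw x).
  by apply: mulr_ge0; [rewrite divr_ge0 ?mulr_ge0// ltW|apply: mulr_ge0 => //; exact: sqr_ge0].
have [xN|Nx] := leP x N; last first.
  apply: (le_trans (HB _ _)); apply: (le_trans (H _ _ x0 y0 (big _ Nx))).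
  by rewrite mulrDr (mulrC (pw x) (_ ^+ 2)) lerDl.
have [yN|Ny] := leP y N; last first.
  apply: (le_trans (HB _ _)); rewrite (mulrC (pw x)); apply: (le_trans (H _ _ y0 x0 (big _ Ny))).
  by rewrite mulrDr (mulrC (pw x) (_ ^+ 2)) lerDr.
by rewrite /far /Submission.KN /cut xN yN !mulr1 subrr mul0r normr0.
Qed.

(** The two truncation errors: pairs beyond N, paid for by the energy through [far_bound], and
    neglected fragments, measured by [frag_rem]. *)
Lemma Qtrunc_rhs c phi B : admissible l c -> holder l B phi ->
  `|Qtrunc c phi - rhs K F beta c phi| <=
  C0 * B / pw N * energy l c * mass l c + k2 * (B * frag_rem) * mass l c.
Proof.
move=> ac hphi; have B0 := holder_ge0 hphi.
have sc := admissible_sigma_finite ac; have mc := admissible_moment ac.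
have [i2 i2E] := int_sqr_pw ac; have ip := mc.2; have m0 := mass_ge0 l c.
have pN : 0 < pw N by exact: pw_gt0.
have mfar : measurable_fun setT (fun p : R * R => far p.1 p.2).
  by apply: measurable_funB; [exact: (measurable_Kp hKF)|exact: (measurable_KN hKF)].
have bK := coagC0 (measurable_Kp hKF)
  (fun x y => introT andP (conj (Kp_ge0 hKF x y) (lexx _))) hphi.
have bH := KNC hphi.
have bfar := coagC0 mfar far_le hphi.
set D := \int[c]_y \int[c]_x (far x y * coag_op phi x y).
have DE : Qcoag c phi - \int[c]_y \int[c]_x (Kp K x y * coag_op phi x y) = - D.
  rewrite QcoagE -opprB; congr (- _); rewrite /D.
  rewrite -(pairingB mc (pw_bounded_inner_l bK mc mc) (pw_bounded_inner_l bH mc mc)).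
  apply: eq_Rintegral => y _; rewrite -(pairingB mc (pw_bounded2_l bK y) (pw_bounded2_l bH y)).
  by apply: eq_Rintegral => x _; rewrite /far mulrBl.
pose a := C0 * B / pw N; have a0 : 0 <= a by rewrite divr_ge0 ?mulr_ge0// ltW.
have hD : `|D| <= 2 * (a * energy l c * mass l c).
  have j1 : c.-integrable setT (EFin \o (fun x => a * mass l c * pw x ^+ 2)).
    by rewrite (_ : _ \o _ = (fun x => (a * mass l c)%:E * (EFin \o (fun x => (pw x ^+ 2)%R)) x)%E) //; apply: integrableZl.
  have inner y : `|\int[c]_x (far x y * coag_op phi x y)| <=
      a * pw y * (\int[c]_x pw x ^+ 2) + a * mass l c * pw y ^+ 2.
    have h1 : c.-integrable setT (EFin \o (fun x => a * pw y * pw x ^+ 2)).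
      by rewrite (_ : _ \o _ = (fun x => (a * pw y)%:E * (EFin \o (fun x => (pw x ^+ 2)%R)) x)%E) //; apply: integrableZl.
    have h2 : c.-integrable setT (EFin \o (fun x => a * pw y ^+ 2 * pw x)).
      by rewrite (_ : _ \o _ = (fun x => (a * pw y ^+ 2)%:E * (EFin \o pw) x)%E) //; apply: integrableZl.
    have hi := pw_bounded_integrable mc (pw_bounded2_l bfar y).
    rewrite (le_trans (le_normr_Rintegral _ _))//.
    apply: (@le_trans _ _ (\int[c]_x (a * pw y * pw x ^+ 2 + a * pw y ^+ 2 * pw x))).
      apply: le_Rintegral_setT.
      - exact: (@integrable_norm _ _ _ _ _ _ hi).
      - rewrite (_ : _ \o _ = (fun x => (EFin \o (fun x => (a * pw y * pw x ^+ 2)%R)) x +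
          (EFin \o (fun x => (a * pw y ^+ 2 * pw x)%R)) x)%E) //; exact: integrableD.
      - move=> x; rewrite (le_trans (far_bound _ _ hphi))// -/a.
        by rewrite le_eqVlt; apply/orP; left; apply/eqP; ring.
    rewrite RintegralD// !RintegralZl// -/(mass l c).
    by rewrite le_eqVlt; apply/orP; left; apply/eqP; ring.
  have bo := pw_bounded_inner_l bfar mc mc.
  have io := pw_bounded_integrable mc bo.
  rewrite (le_trans (le_normr_Rintegral _ _))//.
  have M20 : 0 <= \int[c]_x pw x ^+ 2 by apply: Rintegral_ge0 => x _; exact: sqr_ge0.
  set M2 := \int[c]_x pw x ^+ 2 in i2E M20 inner.
  have j2 : c.-integrable setT (EFin \o (fun x => a * M2 * pw x)).
    by rewrite (_ : _ \o _ = (fun x => (a * M2)%:E * (EFin \o pw) x)%E) //; apply: integrableZl.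
  apply: (@le_trans _ _ (\int[c]_y (a * M2 * pw y + a * mass l c * pw y ^+ 2))).
    apply: le_Rintegral_setT.
    - exact: (@integrable_norm _ _ _ _ _ _ io).
    - rewrite (_ : _ \o _ = (fun x => (EFin \o (fun x => (a * M2 * pw x)%R)) x +
        (EFin \o (fun x => (a * mass l c * pw x ^+ 2)%R)) x)%E) //; exact: integrableD.
    - by move=> y; rewrite (le_trans (inner y))// [a * pw y * _]mulrAC.
  rewrite RintegralD// !RintegralZl// -/(mass l c) -/M2.
  have am0 : 0 <= a * mass l c by rewrite mulr_ge0.
  have := ler_wpM2l am0 i2E.
  by lra.
have rem0 : 0 <= frag_rem.
  rewrite subr_ge0 (le_trans _ (int_frag_weight hC m.+1))//.
  apply: le_Rintegral_setT => //; first exact: integrable_frag_weight.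
  by move=> th; have /andP[h0 h1] := chi01 m th; rewrite ler_piMl ?frag_weight_ge0.
have Fb x : `|Fp F x| <= k2 by have /andP[h1 h2] := Fp_le x; rewrite ger0_norm.
have [bL _] := frag_lim_pairing hC hphi (measurable_Fp hKF) Fb mc.
have bG := inner_frag mc hphi.
have hfr : `|Qfrag c phi - \int[c]_x (Fp F x * frag_lim beta phi x)| <=
    k2 * (B * frag_rem) * mass l c.
  rewrite /Submission.Qfrag /dint -(pairingB mc bG bL); apply: (pairing_bound mc); split.
    exact: (pw_boundedB bG bL).1.
  move=> x; rewrite RintegralZl//; last exact: (i_chi_frag x hphi).
  rewrite -mulrBr normrM -mulrA; apply: ler_pM => //.
  exact: frag_lim_trunc.
move: DE hD hfr; rewrite /Submission.Qtrunc /rhs.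
move: (Qcoag c phi) (Qfrag c phi) (\int[c]_y \int[c]_x (Kp K x y * coag_op phi x y))
  (\int[c]_x (Fp F x * frag_lim beta phi x)) => q1 q2 q3 q4 DE hD hfr.
have -> : 2^-1 * q1 + q2 - (2^-1 * q3 + q4) = 2^-1 * (q1 - q3) + (q2 - q4) by ring.
rewrite DE; apply: (le_trans (ler_normD _ _)); apply: lerD => //.
by rewrite normrM normrN ger0_norm ?invr_ge0// -(ler_pM2l (_ : 0 < 2))// mulrA mulfV// mul1r.
Qed.

End truncated_estimates.

(** Since theta_0 < 1, [chi] is eventually 1 at each theta; the weights increase to [frag_total],
    which is also the majorant. *)
Lemma cvg_frag_rem (R : realType) (l : exponent R) (beta : {measure set (Theta R) -> \bar R}) :
  (C_beta l beta < +oo)%E -> frag_rem l beta m @[m --> \oo] --> (0 : R).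
Proof.
move=> hC; rewrite /frag_rem -[X in _ --> X](subrr (fragC l beta)).
apply: cvgB; first exact: cvg_cst.
have -> : fragC l beta = \int[beta]_th fine (frag_total l th).
  rewrite /fragC /Rintegral; congr fine; apply: ae_eq_integral => //.
  - exact: (measurable_int _ (integrable_frag_total hC)).
  - exact: (measurable_int _ (integrable_fine_frag_total hC)).
  - apply: filterS (ae_frag_total hC) => th h _ /=; rewrite fineK// ge0_fin_numE//.
    by apply: le_trans (frag_weight_le_total l 0 th); rewrite lee_fin frag_weight_ge0.
apply: (proj2 (@Rintegral_dct _ _ _ beta (fun m th => chi m th * frag_weight l m.+1 th)
  (fine \o frag_total l) (fine \o frag_total l) _ _ _ _ _)).
- by move=> m; apply: measurable_funM; [exact: measurable_chi|exact: measurable_frag_weight].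
- by have /integrableP[/measurable_EFinP] := integrable_fine_frag_total hC.
- apply: filterS (ae_frag_total hC) => th h.
  rewrite -[X in _ --> X]mul1r; apply: cvgM; last first.
    rewrite (cvg_shiftS (fun m => frag_weight l m th)); have h1 : frag_total l th = (fine (frag_total l th))%:E.
      rewrite fineK// ge0_fin_numE//; apply: le_trans (frag_weight_le_total l 0 th).
      by rewrite lee_fin frag_weight_ge0.
    by have := @cvg_frag_weight R l th; rewrite {1}h1 => /fine_cvg.
  apply: cvg_near_cst; near=> m; rewrite /chi.
  have : m.+1%:R^-1 <= 1 - th 0%N.
    near: m; have [_ /cvgrPdist_le H] := (conj I (@cvg_harmonic R)).
    have t1 : 0 < 1 - th 0%N by rewrite subr_gt0; case: th {h} => ? ? ?.
    near=> m; have : `|0 - m.+1%:R^-1| <= 1 - th 0%N.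
      by near: m; exact: H.
    by rewrite sub0r normrN ger0_norm ?invr_ge0.
  by move=> hm; rewrite (_ : (_ <= _)%R)// lerBrDr addrC -lerBrDr.
- exact: integrable_fine_frag_total.
- apply: filterS (ae_frag_total hC) => th h m; have /andP[h0 h1] := chi01 m th.
  have w0 := frag_weight_ge0 l m.+1 th.
  rewrite ger0_norm ?mulr_ge0// (@le_trans _ _ (frag_weight l m.+1 th)) ?ler_piMl//.
  rewrite -lee_fin /= fineK ?frag_weight_le_total// ge0_fin_numE//.
  by apply: le_trans (frag_weight_le_total l 0 th); rewrite lee_fin frag_weight_ge0.
Unshelve. all: by end_near. Qed.

(** * The Euler scheme *)

Section euler_scheme.
Context {R : realType} (l : exponent R).
Implicit Types (c d : {measure set R -> \bar R}) (x y z t s : R) (phi g : R -> R).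
Notation pw := (pw l).
Notation wt := (wt l).
Notation lam := (exponent_val l).
Variables (K : R -> R -> R) (F : R -> R) (beta : {measure set (Theta R) -> \bar R}).
Hypothesis hKF : hypothesis_KF lam K F.
Hypothesis hC : (C_beta lam beta < +oo)%E.
Variables (k0 k2 C0 : R).
Hypothesis k0_ge0 : 0 <= k0.
Hypothesis Kp_le : forall x y, Kp K x y <= k0 * pw (x + y).
Hypothesis Fp_le : forall x, 0 <= Fp F x <= k2.
Hypothesis C0_ge0 : 0 <= C0.
Hypothesis coagC0 : forall (k : R -> R -> R) phi B,
  measurable_fun setT (fun p : R * R => k p.1 p.2) ->
  (forall x y, 0 <= k x y <= Kp K x y) -> holder l B phi ->
  pw_bounded2 l (C0 * B) (fun x y => k x y * coag_op phi x y).
Variables (N : R) (m : nat) (c0 : {measure set R -> \bar R}).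
Hypothesis N_gt0 : 0 < N.
Hypothesis ac0 : admissible l c0.
Notation Qtrunc := (Qtrunc K F beta N m).

Variables (h : R) (n : nat).
Hypotheses (h_gt0 : 0 < h) (n_gt0 : (0 < n)%N).
Let T := n%:R * h.
(** [A] and [C] are the growth rates of mass and energy, [M] and [E] the resulting bounds over the
    horizon [T]. The step condition [h_small] presupposes the bound [E], which the scheme must be
    shown to respect. *)
Let A := k2 * fragC l beta.
Let M := mass l c0 * expR (A * T).
Let C := 2 * k0 * M + k2 * m%:R * total_chi beta m.
Let E := energy l c0 * expR (C * T).
Hypothesis h_small : h * (CN l k0 N * E + k2 * total_chi beta m) <= 1.

Let k2_ge0 : 0 <= k2.
Proof. by have /andP[h1 h2] := Fp_le 0; exact: le_trans h2. Qed.

Let A0 : 0 <= A. Proof. by rewrite mulr_ge0// fragC_ge0. Qed.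

Let M0 : 0 <= M. Proof. by rewrite mulr_ge0 ?mass_ge0// expR_ge0. Qed.

Let tc0 : 0 <= total_chi beta m. Proof. exact: total_chi_ge0. Qed.

Let C_ge0 : 0 <= C. Proof. by apply: addr_ge0; apply: mulr_ge0 => //; exact: mulr_ge0. Qed.

Let T0 : 0 <= T. Proof. by rewrite mulr_ge0// ltW. Qed.

(** Euler steps of all lengths up to [h] are packed into one function, which can be iterated and
    also used to interpolate within a cell. *)
Let step_ex : exists st : {measure set R -> \bar R} * R -> {measure set R -> \bar R},
  forall c s, admissible l c -> energy l c <= E -> 0 <= s <= h ->
    admissible l (st (c, s)) /\
    forall A g, 0 <= A -> dominated wt A g ->
      \int[st (c, s)]_x g x = \int[c]_x g x + s * Qtrunc c g.
Proof.
have H (p : {measure set R -> \bar R} * R) : exists c' : {measure set R -> \bar R},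
    admissible l p.1 -> energy l p.1 <= E -> 0 <= p.2 <= h ->
    admissible l c' /\ forall A g, 0 <= A -> dominated wt A g ->
      \int[c']_x g x = \int[p.1]_x g x + p.2 * Qtrunc p.1 g.
  have [[ac [eE /andP[s0 sh]]]|nh] :=
    pselect (admissible l p.1 /\ energy l p.1 <= E /\ 0 <= p.2 <= h); last first.
    by exists p.1 => a b c; exfalso; apply: nh.
  have cn := CN_ge0 l k0_ge0 N.
  have [|c' Hc'] := euler_step hKF hC k0_ge0 Kp_le Fp_le (N := N) (m := m) ac s0; last by exists c'.
  apply: le_trans h_small; apply: ler_pM => //.
    by rewrite addr_ge0// mulr_ge0// energy_ge0.
  by rewrite lerD2r ler_wpM2l.
have [st Hst] := choice H.
by exists st => c s; exact: (Hst (c, s)).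
Qed.

Let dpw1 : dominated wt 1 pw.
Proof. exact: pw_bounded_dominated ler01 (pw_bounded_pw l). Qed.

Let dwt1 : dominated wt 1 wt.
Proof. by split; [exact: measurable_wt|move=> x; rewrite mul1r ger0_norm// wt_ge0]. Qed.

Definition good t c := [/\ admissible l c, mass l c <= mass l c0 * expR (A * t) &
  energy l c <= energy l c0 * expR (C * t)].

Let good_le t c : 0 <= t <= T -> good t c -> [/\ admissible l c, mass l c <= M & energy l c <= E].
Proof.
move=> /andP[t0 tT] [ac h1 h2]; split=> //.
  by apply: (le_trans h1); rewrite ler_wpM2l ?mass_ge0// ler_expR ler_wpM2l.
by apply: (le_trans h2); rewrite ler_wpM2l ?energy_ge0// ler_expR ler_wpM2l.
Qed.

(** One step multiplies mass and energy by at most 1 + k s <= exp(k s), with k their rate; the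
    exponential bounds persist, and with them the validity of the step condition. *)
Let good_step t s c c' : good t c -> mass l c <= M -> 0 <= s -> admissible l c' ->
  (forall A g, 0 <= A -> dominated wt A g -> \int[c']_x g x = \int[c]_x g x + s * Qtrunc c g) ->
  good (t + s) c'.
Proof.
move=> [ac h1 h2] hM s0 ac' H.
have grow (a k x0 : R) : a <= x0 * expR (k * t) -> 0 <= a -> a + s * (k * a) <= x0 * expR (k * (t + s)).
  move=> ha a0; rewrite mulrDr expRD [leRHS]mulrA.
  have -> : a + s * (k * a) = a * (1 + k * s) by ring.
  apply: (@le_trans _ _ (a * expR (k * s))); first by rewrite ler_wpM2l// expR_ge1Dx.
  by rewrite ler_wpM2r// expR_ge0.
split=> //.
  have -> : mass l c' = mass l c + s * Qtrunc c pw by rewrite /mass (H 1).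
  apply: (le_trans _ (grow _ _ _ h1 (mass_ge0 _ _))); rewrite lerD2l ler_wpM2l//.
  exact: (Qtrunc_pw_le hKF hC Fp_le coagC0 N m (admissible_moment ac)).
have -> : energy l c' = energy l c + s * Qtrunc c wt by rewrite /energy (H 1).
apply: (le_trans _ (grow _ _ _ h2 (energy_ge0 _ _))); rewrite lerD2l ler_wpM2l//.
apply: (le_trans (Qtrunc_wt_le hKF hC k0_ge0 Kp_le Fp_le N m ac)).
by rewrite ler_wpM2r ?energy_ge0// lerD2r ler_wpM2l// mulr_ge0.
Qed.

Let kh k := k%:R * h.

Let kh_le k j : (k <= j)%N -> kh k <= kh j.
Proof. by move=> kj; rewrite ler_wpM2r ?ler_nat// ltW. Qed.

Let khS k : kh k.+1 = kh k + h.
Proof. by rewrite /kh -natr1 mulrDl mul1r. Qed.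

Let left_cell t : 0 < t <= T -> exists2 k, (k < n)%N & kh k < t <= kh k.+1.
Proof.
move=> /andP[t0 tT].
have ex : exists j, t <= kh j by exists n.
case: (ex_minnP ex) => -[|k] hk kmin.
  by move: hk; rewrite /kh mul0r leNgt t0.
exists k; first by apply: kmin.
by rewrite hk andbT ltNge; apply/negP => /kmin; rewrite ltnn.
Qed.

Let right_cell t : 0 <= t < T -> exists2 k, (k < n)%N & kh k <= t < kh k.+1.
Proof.
move=> /andP[t0 tT].
have ex : exists j, t < kh j by exists n.
case: (ex_minnP ex) => -[|k] hk kmin.
  by move: hk; rewrite /kh mul0r ltNge t0.
exists k; first by apply: kmin.
by rewrite hk andbT leNgt; apply/negP => /kmin; rewrite ltnn.
Qed.

(** Within a cell the interpolation is the Euler step of variable length from the left grid measure,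
    so that pairings are affine in time there. *)
Let path_ex : exists c : R -> {measure set R -> \bar R},
  (forall t, 0 <= t <= T -> good t (c t)) /\
  (forall A g, 0 <= A -> dominated wt A g -> \int[c 0]_x g x = \int[c0]_x g x) /\
  exists q : nat -> {measure set R -> \bar R}, forall k, (k < n)%N -> good (kh k) (q k) /\
    forall A g, 0 <= A -> dominated wt A g -> forall t, kh k <= t <= kh k.+1 ->
    \int[c t]_x g x = \int[q k]_x g x + (t - kh k) * Qtrunc (q k) g.
Proof.
have [st Hst] := step_ex.
pose q k := iter k (fun c => st (c, h)) c0.
have gq k : (k <= n)%N -> good (kh k) (q k).
  elim: k => [_|k IH kn].
    by split=> //; rewrite /kh mul0r mulr0 expR0 mulr1.
  have gk := IH (ltnW kn).
  have [|ac hM hE] := good_le _ gk.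
    by rewrite mulr_ge0 ?(ltW h_gt0)//=; exact: (kh_le (ltnW kn)).
  have [|ac' H] := Hst (q k) h ac hE; first by rewrite lexx ltW.
  by rewrite khS; apply: good_step gk hM (ltW h_gt0) ac' H.
have Hq k s : (k <= n)%N -> 0 <= s <= h -> admissible l (st (q k, s)) /\
    forall A g, 0 <= A -> dominated wt A g ->
      \int[st (q k, s)]_x g x = \int[q k]_x g x + s * Qtrunc (q k) g.
  move=> kn sh; have [|ac hM hE] := good_le _ (gq k kn); last exact: Hst.
  by rewrite mulr_ge0 ?(ltW h_gt0)//=; exact: kh_le.
have loc t : 0 <= t <= T -> exists k, [/\ (k <= n)%N, kh k <= t, t - kh k <= h &
    (k < n)%N -> t < kh k.+1].
  move=> /andP[t0 tT]; have [tT'|Tt] := ltP t T.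
    have [|k kn /andP[k1 k2']] := right_cell (t := t); first by rewrite t0.
    by exists k; split=> //; [exact: ltnW|rewrite lerBlDl -khS ltW].
  exists n; split=> //; last by rewrite ltnn.
  by rewrite lerBlDl (le_trans tT)// lerDl ltW.
have ct_ex t : exists c : {measure set R -> \bar R}, 0 <= t <= T -> good t c /\
    forall k, (k < n)%N -> kh k <= t <= kh k.+1 -> forall A g, 0 <= A -> dominated wt A g ->
    \int[c]_x g x = \int[q k]_x g x + (t - kh k) * Qtrunc (q k) g.
  have [tT|nT] := pselect (0 <= t <= T); last by exists c0.
  have [k1 [k1n k1t k1h k1S]] := loc t tT.
  have s0 : 0 <= t - kh k1 by rewrite subr_ge0.
  have [|ac' H] := Hq k1 (t - kh k1) k1n; first by rewrite s0.
  exists (st (q k1, t - kh k1)) => _; split.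
    rewrite (_ : t = kh k1 + (t - kh k1)); last by rewrite addrC subrK.
    have gk := gq k1 k1n; have [|ac hM hE] := good_le _ gk.
      by rewrite mulr_ge0 ?(ltW h_gt0)//=; exact: kh_le.
    apply: good_step gk hM s0 _ _; rewrite (addrC (kh k1)) subrK//.
  move=> k kn /andP[kt tk] B g B0 hg; rewrite (H B)//.
  have [kk1|kk1|->//] := ltngtP k k1; last first.
    have := k1S (leq_trans kk1 (ltnW kn)); rewrite ltNge (le_trans _ kt)//.
    exact: kh_le.
  (* Here [t] is the common end of the cells k and k + 1, reached from the left by a full step. *)
  have e1 : kh k1 = kh k.+1.
    by apply/eqP; rewrite eq_le (le_trans k1t tk) (kh_le kk1).
  have k1E : k1 = k.+1.
    by move/eqP: e1; rewrite /kh (inj_eq (mulIf (lt0r_neq0 h_gt0))) eqr_nat => /eqP.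
  have tE : t = kh k1 by apply/eqP; rewrite eq_le k1t e1 tk.
  have [|_ H'] := Hq k h (ltnW kn); first by rewrite lexx ltW.
  by rewrite tE subrr mul0r addr0 k1E khS addrAC subrr add0r; exact: (H' B g B0 hg).
have [c Hc] := choice ct_ex.
exists c; split; first by move=> t /Hc[].
have Hc0 : (0 : R) <= 0 <= T by rewrite lexx.
split.
  move=> B g B0 hg; have [_ H] := Hc 0 Hc0; rewrite (H 0%N n_gt0 _ B g B0 hg).
    by rewrite /kh mul0r subrr mul0r addr0.
  by rewrite /kh mul0r lexx mul1r ltW.
exists q => k kn; split; first exact/gq/ltnW.
move=> B g B0 hg t kt; have [|_ H] := Hc t; last exact: (H k kn kt B).
case/andP: kt => k1 k2'; rewrite (le_trans _ k1) ?mulr_ge0 ?(ltW h_gt0)//=.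
by rewrite (le_trans k2')//; exact: kh_le kn.
Qed.

(** Bounds the truncated operator against functions dominated by [wt], hence the speed of the
    interpolation in that dual norm. *)
Let Z := 2 * CN l k0 N * E ^+ 2 + m.+2%:R * k2 * total_chi beta m * E.

Let Qtrunc_Z c B g : admissible l c -> energy l c <= E -> 0 <= B -> dominated wt B g ->
  `|Qtrunc c g| <= B * Z.
Proof.
move=> ac hE B0 hg; apply: (le_trans (Qtrunc_bound hKF hC k0_ge0 Kp_le Fp_le N m ac B0 hg)).
have e0 := energy_ge0 l c; have cn := CN_ge0 l k0_ge0 N.
rewrite ler_wpM2l//; apply: lerD.
  by apply: ler_wpM2l; [exact: mulr_ge0|rewrite ler_sqr ?nnegrE// (le_trans e0)].
by apply: ler_wpM2l => //; apply: mulr_ge0 => //; exact: mulr_ge0.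
Qed.

(** Three errors: freezing the rate at the grid point over a step, truncating the kernel, truncating
    fragmentation. They are the three terms of the hypothesis on [eps], in this order. *)
Theorem euler_approx eps :
  (C0 * (M + M) + k2 * fragC l beta) * (Z * h) + C0 / pw N * E * M +
    k2 * frag_rem l beta m * M <= eps ->
  exists c : R -> {measure set R -> \bar R}, [/\ approx_sol l K F beta T eps M c,
  forall t, 0 <= t <= T -> mass l (c t) <= mass l c0 * expR (A * t) &
  forall A g, 0 <= A -> dominated wt A g -> \int[c 0]_x g x = \int[c0]_x g x].
Proof.
move=> heps; have [c [gc [H0 [q Hq]]]] := path_ex.
exists c; split=> //; last by move=> t tT; have [] := gc t tT.
have gc' t tT := good_le tT (gc t tT).
have cell k B g : (k < n)%N -> 0 <= B -> dominated wt B g ->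
    forall s t, kh k <= s <= kh k.+1 -> kh k <= t <= kh k.+1 ->
    \int[c t]_x g x - \int[c s]_x g x = (t - s) * Qtrunc (q k) g /\
    `|Qtrunc (q k) g| <= B * Z.
  move=> kn B0 hg s t sk tk; have [gk H] := Hq k kn.
  have kT : 0 <= kh k <= T by rewrite mulr_ge0 ?(ltW h_gt0)//=; exact/kh_le/ltnW.
  have [ak _ ek] := good_le kT gk; split; last exact: Qtrunc_Z.
  by rewrite (H B g B0 hg t tk) (H B g B0 hg s sk); ring.
have dphi phi : holder l 1 phi -> dominated wt 1 phi.
  by move=> hphi; apply: pw_bounded_dominated ler01 (holder_pw_bounded hphi).
split.
- by move=> t /gc'[ac _ _]; exact: admissible_moment.
- by move=> t /gc'[].
- move=> phi hphi t tT e e0; have hd := dphi _ hphi.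
  have Z0 : 0 <= Z.
    have [ac _ eE] := gc' t tT; have := Qtrunc_Z ac eE ler01 hd.
    by rewrite mul1r; apply: le_trans.
  have sl : exists2 d, 0 < d & forall s, 0 <= s <= t -> t - s < d ->
      `|\int[c s]_x phi x - \int[c t]_x phi x| <= Z * (t - s).
    have [t0|t0] := leP t 0.
      exists 1 => // s /andP[s0 st] _.
      have -> : s = t by apply/eqP; rewrite eq_le st (le_trans t0).
      by rewrite !subrr normr0 mulr0.
    have [|k kn /andP[k1 k2']] := left_cell (t := t); first by rewrite t0; case/andP: tT.
    exists (t - kh k); first by rewrite subr_gt0.
    move=> s /andP[s0 st]; rewrite ltrD2l ltrN2 => ks.
    have [||-> h1] := cell k 1 phi kn ler01 hd t s.
    - by rewrite (ltW k1).
    - by rewrite (ltW ks) (le_trans st).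
    have -> : Z * (t - s) = `|s - t| * Z by rewrite distrC ger0_norm ?subr_ge0// mulrC.
    by rewrite normrM ler_wpM2l// -[Z]mul1r.
  have sr : exists2 d, 0 < d & forall s, t <= s <= T -> s - t < d ->
      `|\int[c s]_x phi x - \int[c t]_x phi x| <= Z * (s - t).
    have [Tt|tT'] := leP T t.
      exists 1 => // s /andP[ts sT] _.
      have -> : s = t by apply/eqP; rewrite eq_le ts (le_trans sT).
      by rewrite !subrr normr0 mulr0.
    have [|k kn /andP[k1 k2']] := right_cell (t := t); first by rewrite tT' andbT; case/andP: tT.
    exists (kh k.+1 - t); first by rewrite subr_gt0.
    move=> s /andP[ts sT]; rewrite ltrD2r => sk.
    have [||-> h1] := cell k 1 phi kn ler01 hd t s.
    - by rewrite k1 ltW.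
    - by rewrite (le_trans k1 ts) ltW.
    have -> : Z * (s - t) = `|s - t| * Z by rewrite ger0_norm ?subr_ge0// mulrC.
    by rewrite normrM ler_wpM2l// -[Z]mul1r.
  have [d1 d10 h1] := sl; have [d2 d20 h2] := sr.
  have ZZ : 0 < Z + 1 by rewrite ltr_wpDl.
  exists (Num.min (Num.min d1 d2) (e / (Z + 1))); first by rewrite !lt_min d10 d20 divr_gt0.
  move=> s /andP[s0 sT]; rewrite !lt_min => /andP[/andP[sd1 sd2]]; rewrite ltr_pdivlMr// => se.
  have Zs : Z * `|s - t| <= e.
    by apply: le_trans (ltW se); rewrite mulrC ler_wpM2l// lerDl.
  have [st|ts] := leP s t.
    rewrite distrC ger0_norm ?subr_ge0// in sd1 Zs.
    by apply: (le_trans (h1 s _ sd1)); rewrite ?s0.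
  rewrite ger0_norm ?subr_ge0 ?(ltW ts)// in sd2 Zs.
  by apply: (le_trans (h2 s _ sd2)) => //; rewrite (ltW ts).
move=> phi hphi t tT h' h'0; have hd := dphi _ hphi.
have [k kn /andP[k1 k2']] := left_cell tT.
have tT' : 0 <= t <= T by case/andP: tT => a b; rewrite ltW.
exists (t - kh k); first by rewrite subr_gt0.
move=> s /andP[s0 st]; rewrite ltrD2l ltrN2 => ks.
have tk : kh k <= t <= kh k.+1 by rewrite ltW.
have sk : kh k <= s <= kh k.+1 by rewrite (ltW ks) (le_trans (ltW st)).
have [-> _] := cell k 1 phi kn ler01 hd s t sk tk.
have [gk _] := Hq k kn.
have kT : 0 <= kh k <= T by rewrite mulr_ge0 ?(ltW h_gt0)//=; exact/kh_le/ltnW.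
have [ak mk ek] := good_le kT gk; have [act mct ect] := gc' t tT'.
(* The grid measure of the cell is at dual distance at most Z h from the measure at time [t]. *)
have hdiff : forall A g, 0 <= A -> dominated wt A g ->
    `|\int[q k]_x g x - \int[c t]_x g x| <= A * (Z * h).
  move=> B g B0 hg; have [_ H] := Hq k kn; rewrite (H B g B0 hg t tk) opprD addNKr normrN normrM.
  have tk0 : 0 <= t - kh k by rewrite subr_ge0 ltW.
  rewrite ger0_norm// mulrA mulrC; apply: ler_pM => //; first exact: Qtrunc_Z.
  by rewrite lerBlDl -khS.
have c1 := Qtrunc_cont hKF hC Fp_le C0_ge0 coagC0 N m ak act hdiff hphi.
have c2 := Qtrunc_rhs hKF hC Fp_le C0_ge0 coagC0 m N_gt0 act hphi.
have Zh0 : 0 <= Z * h.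
  have := hdiff 1 phi ler01 hd; rewrite mul1r; exact: le_trans.
have ts : 0 <= t - s by rewrite subr_ge0 ltW.
have E0 : 0 <= E by rewrite mulr_ge0 ?energy_ge0 ?expR_ge0.
have pN : 0 <= (pw N)^-1 by rewrite invr_ge0 pw_ge0.
have m0 := mass_ge0 l (c t); have e0 := energy_ge0 l (c t).
have c3 : `|Qtrunc (q k) phi - Qtrunc (c t) phi| <= (C0 * (M + M) + k2 * fragC l beta) * (Z * h).
  by apply: (le_trans c1); rewrite mul1r ler_wpM2r// lerD2r ler_wpM2l// lerD.
have rem0 : 0 <= frag_rem l beta m.
  rewrite subr_ge0 (le_trans _ (int_frag_weight hC m.+1))//.
  apply: le_Rintegral_setT => //; last first.
  - by move=> th; have /andP[a0 a1] := chi01 m th; rewrite ler_piMl ?frag_weight_ge0.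
  - exact: integrable_frag_weight.
  apply: le_integrable (integrable_frag_weight hC m.+1) => //.
    apply/measurable_EFinP; apply: measurable_funM; first exact: measurable_chi.
    exact: measurable_frag_weight.
  move=> th _ /=; have /andP[a0 a1] := chi01 m th.
  by rewrite lee_fin normrM (ger0_norm a0) ler_piMl.
have c4 : `|Qtrunc (c t) phi - rhs K F beta (c t) phi| <=
    C0 / pw N * E * M + k2 * frag_rem l beta m * M.
  apply: (le_trans c2); rewrite mulr1 mul1r; apply: lerD.
    by apply: ler_pM => //; [rewrite !mulr_ge0|rewrite ler_wpM2l// mulr_ge0].
  by rewrite ler_wpM2l// mulr_ge0.
have -> : (t - s) * Qtrunc (q k) phi - rhs K F beta (c t) phi * (t - s) =
  ((Qtrunc (q k) phi - Qtrunc (c t) phi) + (Qtrunc (c t) phi - rhs K F beta (c t) phi)) * (t - s) by ring.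
rewrite normrM (ger0_norm ts) ler_wpM2r// (le_trans (ler_normD _ _))//.
by apply: (le_trans (lerD c3 c4)); rewrite addrA (le_trans heps)// lerDl ltW.
Qed.

End euler_scheme.

(** The order of the choices avoids circularity: m makes [frag_rem] small; this fixes the energy
    bound [E], which does not involve N; then N makes C0 E M / N^l small; the number of steps comes
    last. *)
Theorem approx_exists {R : realType} (l : exponent R) (K : R -> R -> R) (F : R -> R)
    (beta : {measure set (Theta R) -> \bar R}) :
  hypothesis_KF l K F -> (C_beta l beta < +oo)%E ->
  exists2 A, 0 <= A & forall T eps (c0 : {measure set R -> \bar R}),
    0 < T -> 0 < eps -> admissible l c0 ->
    exists c : R -> {measure set R -> \bar R},
      [/\ approx_sol l K F beta T eps (mass l c0 * expR (A * T)) c,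
      forall t, 0 <= t <= T -> mass l (c t) <= mass l c0 * expR (A * t) &
      forall A g, 0 <= A -> dominated (wt l) A g -> \int[c 0]_x g x = \int[c0]_x g x].
Proof.
move=> hKF hC.
have [k0 k0_gt0 Kp_le] := Kp_bound hKF.
have [k2 k2_gt0 Fp_le] := Fp_bound hKF.
have [C0 C0_gt0 coagC0] := coag_bounded hKF.
have k00 := ltW k0_gt0; have k20 := ltW k2_gt0; have C00 := ltW C0_gt0.
have fC := fragC_ge0 l beta.
exists (k2 * fragC l beta); first exact: mulr_ge0.
move=> T eps c0 T_gt0 eps0 ac0; set A := k2 * fragC l beta; set M := mass l c0 * expR (A * T).
have m0 := mass_ge0 l c0; have M0 : 0 <= M by rewrite mulr_ge0// expR_ge0.
have [m hm] : exists m, k2 * frag_rem l beta m * M <= eps / 4.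
  have d0 : 0 < eps / 4 / (k2 * M + 1).
    by rewrite !divr_gt0// ltr_wpDl// mulr_ge0.
  have /cvgrPdist_le /(_ _ d0) [m _ /(_ m (leqnn m))] := cvg_frag_rem hC.
  rewrite /= sub0r normrN ler_pdivlMr ?ltr_wpDl ?mulr_ge0// => hm; exists m.
  apply: le_trans hm; rewrite mulrAC mulrC.
  apply: (@le_trans _ _ (`|frag_rem l beta m| * (k2 * M))).
    by rewrite ler_wpM2r ?mulr_ge0// ler_norm.
  by rewrite ler_wpM2l// lerDl.
set C := 2 * k0 * M + k2 * m%:R * total_chi beta m.
set E := energy l c0 * expR (C * T).
have E0 : 0 <= E by rewrite mulr_ge0 ?energy_ge0 ?expR_ge0.
(* The value prescribed for N^l: it makes C0 E M / X at most eps / 4, and the 1 keeps it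
   positive. *)
pose X := 4 * C0 * E * M / eps + 1.
have X0 : 0 < X.
  rewrite ltr_wpDl//; apply: divr_ge0; last exact: ltW.
  by apply: mulr_ge0 => //; apply: mulr_ge0 => //; exact: mulr_ge0.
pose N := X `^ (l : R)^-1.
have N0 : 0 < N by exact: powR_gt0.
have pwN : pw l N = X.
  by rewrite pwE ?(ltW N0)// -powRrM mulVf ?exponent_neq0// powRr1// ltW.
have hN : C0 / pw l N * E * M <= eps / 4.
  have -> : C0 / pw l N * E * M = (C0 * E * M) / X by rewrite pwN; ring.
  rewrite ler_pdivrMr// /X mulrDr mulr1.
  have -> : eps / 4 * (4 * C0 * E * M / eps) = C0 * E * M by field; rewrite gt_eqF.
  by rewrite lerDl divr_ge0// ltW.
have CN0 := CN_ge0 l k00 N; have tc0 := total_chi_ge0 beta m.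
pose Y := CN l k0 N * E + k2 * total_chi beta m.
have Y0 : 0 <= Y by rewrite addr_ge0// mulr_ge0.
pose Z := 2 * CN l k0 N * E ^+ 2 + m.+2%:R * k2 * total_chi beta m * E.
have Z0 : 0 <= Z.
  apply: addr_ge0; apply: mulr_ge0 => //; [exact: mulr_ge0|exact: exprn_ge0|].
  by apply: mulr_ge0 => //; exact: mulr_ge0.
pose W := (C0 * (M + M) + k2 * fragC l beta) * Z.
have W0 : 0 <= W.
  by apply: mulr_ge0 => //; apply: addr_ge0; apply: mulr_ge0 => //; exact: addr_ge0.
(* Enough steps for both h Y <= 1, the positivity condition, and W h <= eps / 2, the freezing
   error. *)
pose n := (Num.truncn (T * Y + 2 * T * W / eps)).+1.
have nT : T * Y + 2 * T * W / eps <= n%:R by apply: ltW; exact: truncnS_gt.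
have TY : 0 <= T * Y by rewrite mulr_ge0// ltW.
have TW : 0 <= 2 * T * W / eps.
  apply: divr_ge0; last exact: ltW.
  by apply: mulr_ge0 => //; apply: mulr_ge0 => //; exact: ltW.
have n0 : 0 < n%:R :> R by rewrite ltr0n.
pose h := T / n%:R.
have h0 : 0 < h by rewrite divr_gt0.
have Tn : n%:R * h = T by rewrite /h mulrC divfK// gt_eqF.
have h1 : h * (CN l k0 N * (energy l c0 * expR ((2 * k0 * (mass l c0 * expR (k2 * fragC l beta * (n%:R * h)))
   + k2 * m%:R * total_chi beta m) * (n%:R * h))) + k2 * total_chi beta m) <= 1.
  rewrite Tn -/A -/M -/C -/E -/Y /h mulrAC ler_pdivrMr// mul1r.
  by apply: le_trans nT; rewrite lerDl.
have [|c [Hc cM c0E]] := euler_approx hKF hC k00 Kp_le Fp_le C00 coagC0 N0 ac0 h0 (ltn0Sn _) h1 (eps := eps).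
  rewrite Tn -/A -/M -/C -/E -/Z mulrA -/W.
  have hW : W * h <= eps / 2.
    rewrite /h mulrA ler_pdivrMr// -ler_pdivrMl ?divr_gt0//; apply: le_trans nT.
    have -> : (eps / 2)^-1 * (W * T) = 2 * T * W / eps by field; rewrite gt_eqF.
    by rewrite lerDr.
  by move: hW hm hN; move: (W * h) (C0 / pw l N * E * M) (k2 * frag_rem l beta m * M) => *; lra.
by exists c; rewrite Tn in Hc cM; split.
Qed.

(** * Quantiles and completeness *)

Lemma image_integral d1 d2 (T1 : measurableType d1) (T2 : measurableType d2) (R : realType)
    (m : {measure set T1 -> \bar R}) (nu : {measure set T2 -> \bar R})
    (X : T1 -> T2) (rho : T1 -> R) (g : T2 -> R) :
  (forall g : T2 -> \bar R, measurable_fun setT g -> (forall x, 0 <= g x)%E ->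
    (\int[nu]_x g x = \int[m]_t (g (X t) * (rho t)%:E))%E) ->
  (forall t, 0 <= rho t) -> measurable_fun setT g ->
  (\int[nu]_x (g x)%:E = \int[m]_t (g (X t) * rho t)%:E)%E.
Proof.
move=> H rho0 mg.
have mg' : measurable_fun setT (fun x => (g x)%:E) by apply/measurable_EFinP.
rewrite integralE [RHS]integralE; congr (_ - _)%E.
  rewrite H//; last exact: measurable_funepos.
  apply: eq_integral => t _; rewrite !funeposE.
  by rewrite -!EFin_max -EFinM maxr_pMl// mul0r.
rewrite H//; last exact: measurable_funeneg.
apply: eq_integral => t _; rewrite !funenegE.
by rewrite -!EFinN -!EFin_max -EFinM maxr_pMl// mul0r mulNr.
Qed.

(** * Approximation of the initial datum by admissible measures *)

Section density_of_data.
Context {R : realType} (l : exponent R).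
Implicit Types (c d : {measure set R -> \bar R}).

Lemma ex_restriction c (rho : R -> R) : has_moment l c -> measurable_fun setT rho ->
  (forall x, 0 <= rho x <= 1) ->
  exists d : {measure set R -> \bar R}, forall g : R -> R, measurable_fun setT g ->
    (\int[d]_x (g x)%:E = \int[c]_x (g x * rho x)%:E)%E.
Proof.
move=> mc mrho rho01; have rho0 x : 0 <= rho x by case/andP: (rho01 x).
have [d [_ H]] := @ex_image_density _ _ _ _ R c rho id mrho rho0 (@measurable_id _ _ setT).
by exists d => g mg; exact: (@image_integral _ _ _ _ _ c d id rho).
Qed.

Lemma cvg_int_cutoff c : has_moment l c ->
  \int[c]_x (pw l x * (1 - (n.+1%:R^-1 <= x <= n.+1%:R)%R%:R)) @[n --> \oo] --> (0 : R).
Proof.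
move=> mc; have [sc ic] := mc.
have -> : 0 = \int[c]_x (fun=> 0 : R) x by rewrite /Rintegral integral0_eq.
have mi n : measurable_fun setT (fun x : R => (n.+1%:R^-1 <= x <= n.+1%:R)%R%:R : R).
  rewrite (_ : (fun _ => _) = \1_(`[n.+1%:R^-1, n.+1%:R]%classic)).
    by apply: measurable_indic; exact: measurable_itv.
  by apply/funext => x; rewrite indicE mem_setE in_itv.
apply: (proj2 (@Rintegral_dct _ _ _ c _ (fun=> 0) (pw l) _ _ _ _ _)) => //.
- move=> n; apply: measurable_funM; first exact: measurable_pw.
  exact: measurable_funB.
- apply: aeW => x; have [x0|x0] := leP x 0.
    by under eq_cvg do rewrite pw_le0// mul0r; exact: cvg_cst.
  apply: cvg_near_cst; near=> n.
  have h1 : x <= n.+1%:R.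
    have : (Num.truncn x <= n)%N by near: n; exact: nbhs_infty_ge.
    move=> h; apply: ltW; apply: (lt_le_trans (truncnS_gt x)).
    by rewrite ler_nat.
  have h2 : n.+1%:R^-1 <= x.
    have : (Num.truncn x^-1 <= n)%N by near: n; exact: nbhs_infty_ge.
    move=> h; rewrite invf_ple ?posrE//; apply: ltW; apply: (lt_le_trans (truncnS_gt x^-1)).
    by rewrite ler_nat.
  by rewrite h1 h2 subrr mulr0.
- apply: aeW => x n; rewrite normrM ger0_norm ?pw_ge0// ler_piMr ?pw_ge0//.
  by case: (_ <= _ <= _)%R; rewrite ?subrr ?normr0 ?subr0 ?normr1.
Unshelve. all: by end_near. Qed.

(** On [1 / (n + 1), n + 1] the weight [wt] is at most a multiple of [pw], so the restriction of [c]
    is admissible. As the optimal function is bounded by [pw], the distance is at most the part of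
    the mass that is cut away. *)
Lemma admissible_dense c eps : has_moment l c -> 0 < eps ->
  exists d, [/\ admissible l d, mass l d <= mass l c & dist l c d <= eps].
Proof.
move=> mc eps0.
have [n hn] : exists n, \int[c]_x (pw l x * (1 - (n.+1%:R^-1 <= x <= n.+1%:R)%R%:R)) <= eps.
  have := cvg_int_cutoff mc => /cvgrPdist_le /(_ _ eps0) [n _ /(_ n (leqnn n))].
  by rewrite /= sub0r normrN => h; exists n; rewrite (le_trans (ler_norm _)).
pose rho (x : R) : R := (n.+1%:R^-1 <= x <= n.+1%:R)%R%:R.
have rho01 x : 0 <= rho x <= 1.
  by rewrite /rho; case: (n.+1%:R^-1 <= x <= _)%R; rewrite ?lexx ?ler01.
have mrho : measurable_fun setT rho.
  rewrite (_ : rho = \1_(`[n.+1%:R^-1, n.+1%:R]%classic)).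
    by apply: measurable_indic; exact: measurable_itv.
  by apply/funext => x; rewrite indicE mem_setE in_itv.
have [d H] := ex_restriction mc mrho rho01.
have dR g : measurable_fun setT g -> \int[d]_x g x = \int[c]_x (g x * rho x).
  by move=> mg; rewrite /Rintegral H.
pose k := pw l n.+1%:R^-1; pose A := (1 + pw l n.+1%:R ^+ 2) / k.
have k0 : 0 < k by exact: pw_gt0.
have bwt : pw_bounded l A (fun x => wt l x * rho x).
  split; first by apply: measurable_funM => //; exact: measurable_wt.
  move=> x; have /andP[r0 _] := rho01 x.
  rewrite normrM (ger0_norm (wt_ge0 l x)) (ger0_norm r0).
  rewrite /rho; case: (boolP (n.+1%:R^-1 <= x <= n.+1%:R)%R) => [/andP[h1 h2]|_]; last first.
    by rewrite mulr0 mulr_ge0 ?pw_ge0// divr_ge0 ?addr_ge0 ?sqr_ge0// ltW.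
  rewrite mulr1 /A mulrAC ler_pdivlMr//; apply: ler_pM => //; [exact: wt_ge0|exact: ltW| |exact: pw_mono].
  by rewrite lerD2l ler_sqr ?nnegrE ?pw_ge0// pw_mono.
have ad : admissible l d.
  apply/integrableP; split; first by apply/measurable_EFinP; exact: measurable_wt.
  under eq_integral do rewrite /= ger0_norm ?wt_ge0//.
  rewrite H; last exact: measurable_wt.
  by rewrite -Rintegral_EFin ?ltry//; exact: pw_bounded_integrable bwt.
have md := admissible_moment ad.
exists d; split=> //.
  rewrite /mass dR; last exact: measurable_pw.
  have b1 : pw_bounded l 1 (fun x => pw l x * rho x).
    split; first by apply: measurable_funM => //; exact: measurable_pw.
    move=> x; rewrite normrM ger0_norm ?pw_ge0// mul1r ler_piMr ?pw_ge0//.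
    by rewrite ger0_norm; case/andP: (rho01 x).
  apply: (pairing_le mc b1 (pw_bounded_pw l)) => x.
  by rewrite ler_piMr ?pw_ge0//; case/andP: (rho01 x).
rewrite -optimal_pairing//; set r := optimal l c d.
have hr : holder l 1 r by exact: optimal_holder.
have [mr br] := holder_pw_bounded hr.
rewrite dR//.
have b2 : pw_bounded l 1 (fun x => r x * rho x).
  split; first exact: measurable_funM.
  move=> x; rewrite normrM (le_trans _ (br x))// ler_piMr//.
  by rewrite ger0_norm; case/andP: (rho01 x).
rewrite -(pairingB mc (holder_pw_bounded hr) b2); apply: le_trans hn.
have b3 : pw_bounded l 1 (fun x => pw l x * (1 - rho x)).
  split; first by apply: measurable_funM; [exact: measurable_pw|exact: measurable_funB].
  move=> x; rewrite normrM ger0_norm ?pw_ge0// mul1r ler_piMr ?pw_ge0//.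
  have /andP[h1 h2] := rho01 x.
  by rewrite ger0_norm ?subr_ge0// lerBlDr lerDl.
apply: (pairing_le mc (pw_boundedB (holder_pw_bounded hr) b2) b3) => x.
have /andP[h1 h2] := rho01 x.
have -> : r x - r x * rho x = r x * (1 - rho x) by ring.
rewrite ler_wpM2r ?subr_ge0//; have := br x; rewrite mul1r; apply: le_trans.
exact: ler_norm.
Qed.

End density_of_data.

Section fast_convergence.
Context d (T : measurableType d) {R : realType}.
Variables (m : {measure set T -> \bar R}) (a : nat -> T -> R) (C : R).
Hypothesis ma : forall n, measurable_fun setT (a n).
Hypothesis a0 : forall n x, 0 <= a n x.
Hypothesis aC : forall n, (\int[m]_x (a n x)%:E <= (C * 2^-1 ^+ n)%:E)%E.

(** The integrals sum to at most 2 C, a geometric series, so that the sum [S] of all [a i] is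
    integrable and finite almost everywhere. *)
Lemma fast_dominated : exists2 S : T -> R, m.-integrable setT (EFin \o S) &
  {ae m, forall x n, \sum_(i < n) a i x <= S x}.
Proof.
pose S x : \bar R := (\sum_(0 <= k <oo) (a k x)%:E)%E.
have mS : measurable_fun setT S.
  by apply: ge0_emeasurable_sum => [k x _ _|k _]; [rewrite lee_fin|apply/measurable_EFinP].
have S0 x : (0 <= S x)%E by apply: nneseries_ge0 => k _ _; rewrite lee_fin.
have iS : (\int[m]_x S x <= (C * 2)%:E)%E.
  rewrite integral_nneseries//; last 2 first.
  - by move=> k; apply/measurable_EFinP.
  - by move=> k x _; rewrite lee_fin.
  apply: lime_le.
    by apply: is_cvg_nneseries => k _ _; apply: integral_ge0 => x _; rewrite lee_fin.
  apply: nearW => n.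
  apply: (@le_trans _ _ (\sum_(0 <= k < n) (C * 2^-1 ^+ k)%:E)%E).
    by apply: lee_sum => k _; exact: aC.
  rewrite sumEFin lee_fin -mulr_sumr.
  have C0 : 0 <= C.
    have := aC 0; rewrite expr0 mulr1 -lee_fin; apply: le_trans.
    by apply: integral_ge0 => x _; rewrite lee_fin.
  rewrite ler_wpM2l//.
  have -> : \sum_(0 <= k < n) (2^-1 : R) ^+ k = 2 - 2 * 2^-1 ^+ n.
    elim: n => [|n IH]; first by rewrite big_geq// expr0; ring.
    by rewrite big_nat_recr//= IH exprS; field.
  by rewrite lerBlDr lerDl mulr_ge0// exprn_ge0.
have iS' : m.-integrable setT S.
  apply/integrableP; split=> //.
  under eq_integral do rewrite gee0_abs//.
  exact: le_lt_trans iS (ltry _).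
have aeS : {ae m, forall x, (S x < +oo)%E}.
  have := integrable_ae measurableT iS'.
  by apply: filterS => x /(_ I) h; rewrite -ge0_fin_numE.
exists (fine \o S).
  have mfS : measurable_fun setT (EFin \o (fine \o S)).
    by apply/measurable_EFinP; apply: measurableT_comp.
  apply/integrableP; split=> //.
  apply: le_lt_trans (_ : (\int[m]_x S x < +oo)%E); last exact: le_lt_trans iS (ltry _).
  apply: ge0_le_integral => //; first exact: measurableT_comp.
  move=> x _ /=; rewrite ger0_norm ?fine_ge0//.
  by case: (S x) (S0 x) => //= r; rewrite leey.
apply: filterS aeS => x h n; rewrite -lee_fin /= fineK ?ge0_fin_numE//.
rewrite -sumEFin -(big_mkord xpredT (fun i => (a i x)%:E)).
by apply: nneseries_lim_ge => k _; rewrite lee_fin.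
Qed.

End fast_convergence.

(** * Quantile functions and couplings *)

Section quantile.
Context {R : realType} (l : exponent R).
Notation mu := (@lebesgue_measure R).
Implicit Types (c d : {measure set R -> \bar R}) (x y z u : R) (q : R -> R).
Notation pw := (pw l).
Notation dpw := (dpw l).

(** The generalised inverse of the tail, a nonincreasing rearrangement on the Lebesgue half-line.
    The set may be empty for large [u], and the value 0 of [sup] is then the intended one. *)
Definition quantile c u : R := if 0 < u then sup [set z | 0 < z /\ u < tail c z] else 0.

Lemma tail_noninc c y z : has_moment l c -> 0 < y -> y <= z -> tail c z <= tail c y.
Proof.
move=> mc y0 yz; apply: le_Rintegral_setT.
- exact: (integrable_gt (lt_le_trans y0 yz) mc).
- exact: (integrable_gt y0 mc).
- move=> x; rewrite /lt01 ler_nat; have [h|//] := ltP z x.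
  by rewrite (le_lt_trans yz h).
Qed.

Lemma tail_markov c z : has_moment l c -> 0 < z -> tail c z * pw z <= mass l c.
Proof.
move=> mc z0; rewrite /tail -RintegralZr//; last exact: (integrable_gt z0 mc).
apply: le_Rintegral_setT => //; last 2 first.
- by case: mc.
- move=> x; rewrite /lt01; case: (ltP z x) => h; last by rewrite mul0r pw_ge0.
  by rewrite mul1r pw_mono// ltW.
rewrite (_ : _ \o _ = (fun x => (lt01 z x)%:E * (pw z)%:E)%E) //.
by apply: integrableZr => //; exact: (integrable_gt z0 mc).
Qed.

Lemma quantile_ub c u : has_moment l c -> 0 < u ->
  has_ubound [set z | 0 < z /\ u < tail c z].
Proof.
move=> mc u0; exists ((mass l c / u + 1) `^ (l : R)^-1) => z [z0 uz].
have X0 : 0 < mass l c / u + 1 by rewrite ltr_wpDl// divr_ge0 ?mass_ge0// ltW.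
set N := _ `^ _; have N0 : 0 < N by exact: powR_gt0.
have pwN : pw N = mass l c / u + 1.
  by rewrite pwE ?(ltW N0)// -powRrM mulVf ?exponent_neq0// powRr1// ltW.
rewrite leNgt; apply/negP => Nz.
have h1 := tail_markov mc z0.
have h2 : pw N <= pw z by apply: pw_mono; exact: ltW.
have : u * pw N <= mass l c.
  apply: le_trans h1; apply: ler_pM => //; [exact: ltW|exact: pw_ge0|exact: ltW].
by rewrite pwN mulrDr mulrCA mulfV ?gt_eqF// !mulr1 gerDl leNgt u0.
Qed.

Lemma quantile_ge0 c u : 0 <= quantile c u.
Proof.
rewrite /quantile; case: ifPn => // u0.
have [->|/set0P [z hz]] := eqVneq [set z | 0 < z /\ u < tail c z] set0; first by rewrite sup0.
have [ub|nub] := pselect (has_ubound [set z | 0 < z /\ u < tail c z]); last first.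
  by rewrite sup_out// => -[].
by apply: (le_trans (ltW hz.1)); apply: ub_le_sup.
Qed.

(** The right-continuity of the tail makes this an equivalence between strict inequalities;
    measurability and level sets of the quantile are read off from it. *)
Lemma lt_quantile c u z : has_moment l c -> 0 < z ->
  (z < quantile c u) = (0 < u) && (u < tail c z).
Proof.
move=> mc z0; rewrite /quantile; case: ifPn => [u0|_]; last by rewrite ltNge (ltW z0).
apply/idP/idP => [zs|uz].
  rewrite ltNge; apply/negP => tu; move: zs; rewrite ltNge => /negP; apply.
  set S := [set z | 0 < z /\ u < tail c z].
  have [->|/set0P S0] := eqVneq S set0; first by rewrite sup0 ltW.
  apply: ge_sup => // w [w0 uw]; rewrite leNgt; apply/negP => zw.
  by have := lt_le_trans uw (le_trans (tail_noninc mc z0 (ltW zw)) tu); rewrite ltxx.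
have tc : tail c (z + n.+1%:R^-1) @[n --> \oo] --> tail c z.
  apply: (tail_right_cvg mc z0); first by move=> n; rewrite ltrDl.
  rewrite -[X in _ --> X]addr0; apply: cvgD; [exact: cvg_cst|exact: cvg_harmonic].
have [n _ /(_ n (leqnn n)) hn] := (cvgr_gt _ tc) _ uz.
apply: (@lt_le_trans _ _ (z + n.+1%:R^-1)); first by rewrite ltrDl.
apply: ub_le_sup; first exact: (quantile_ub mc).
by split=> //; rewrite addr_gt0.
Qed.

Lemma measurable_quantile c : has_moment l c ->
  measurable_fun [set: measurableTypeR R] (quantile c).
Proof.
move=> mc.
have H z : 0 < z -> measurable ((quantile c) @^-1` `]z, +oo[%classic : set (measurableTypeR R)).
  move=> z0; rewrite (_ : _ @^-1` _ = `]0, tail c z[%classic); first exact: measurable_itv.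
  by apply/seteqP; split=> u /=; rewrite !in_itv/= andbT lt_quantile.
apply: (measurability _ (@RGenOInfty.measurableE R)) => _ [_ [z ->] <-]; rewrite setTI.
have [z0|z0] := ltP 0 z; first exact: H.
have [zn|z0'] := ltP z 0.
  rewrite (_ : _ @^-1` _ = setT); first exact: measurableT.
  by apply/seteqP; split=> // u _ /=; rewrite in_itv/= andbT (lt_le_trans zn)// quantile_ge0.
have -> : z = 0 by apply/eqP; rewrite eq_le z0.
rewrite (_ : _ @^-1` _ = \bigcup_n ((quantile c) @^-1` `]n.+1%:R^-1, +oo[%classic)).
  by apply: bigcup_measurable => n _; exact: H.
apply/seteqP; split=> [u /=|u [n _] /=]; rewrite !in_itv/= !andbT => hq.
  exists (Num.truncn (quantile c u)^-1) => //=; rewrite in_itv/= andbT.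
  by rewrite invf_plt ?posrE// truncnS_gt.
by apply: lt_trans hq.
Qed.

Lemma integral_dpw_dist a b : 0 <= a -> 0 <= b ->
  (\int[mu]_z (dpw z * `|lt01 z a - lt01 z b|)%:E = (`|pw a - pw b|)%:E)%E.
Proof.
wlog ab : a b / a <= b.
  move=> W a0 b0; have [ab|/ltW ba] := leP a b; first exact: W.
  by under eq_integral do rewrite distrC; rewrite W// distrC.
move=> a0 b0.
have ml (y : R) : measurable_fun [set: measurableTypeR R] (fun z : measurableTypeR R => (dpw z * lt01 z y)%:E).
  apply/measurable_EFinP; apply: measurable_funM; first exact: measurable_dpw.
  exact: (measurable_fun_pair1 (f := fun p : measurableTypeR R * R => lt01 p.1 p.2) y (@measurable_lt_prod R)).
have il (y : R) : mu.-integrable setT (fun z => (dpw z * lt01 z y)%:E).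
  apply/integrableP; split; first exact: ml.
  under eq_integral do rewrite gee0_abs ?lee_fin ?mulr_ge0 ?dpw_ge0 ?ler0n//.
  by rewrite integral_dpw ltry.
have E z : (dpw z * `|lt01 z a - lt01 z b|)%:E = ((dpw z * lt01 z b)%:E - (dpw z * lt01 z a)%:E)%E.
  rewrite -EFinB -mulrBr distrC ger0_norm// subr_ge0 /lt01 ler_nat.
  by have [h|//] := ltP z a; rewrite (lt_le_trans h ab).
under eq_integral do rewrite E.
rewrite integralB// !integral_dpw -EFinB distrC ger0_norm//.
by rewrite subr_ge0 pw_mono.
Qed.

Definition quantile_graph c (p : measurableTypeR R * measurableTypeR R) : R := lt01 p.1 (quantile c p.2).

Lemma measurable_quantile_graph c : has_moment l c -> measurable_fun setT (quantile_graph c).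
Proof.
move=> mc; have h : measurable_fun setT (fun p : measurableTypeR R * measurableTypeR R => (p.1, quantile c p.2 : R)).
  apply/measurable_fun_pairP; split; first exact: measurable_fst.
  exact: (measurableT_comp (measurable_quantile mc) measurable_snd).
exact: (measurableT_comp (@measurable_lt_prod R) h).
Qed.

Lemma integral_quantile_graph c d z : has_moment l c -> has_moment l d -> 0 < z ->
  (\int[mu]_u (`|quantile_graph c (z, u) - quantile_graph d (z, u)|)%:E = (`|gap c d z|)%:E)%E.
Proof.
move=> mc md z0.
wlog ab : c d mc md / tail c z <= tail d z.
  move=> W; have [ab|/ltW ba] := leP (tail c z) (tail d z); first exact: W.
  by under eq_integral do rewrite distrC; rewrite W// /gap distrC.
have E e u : has_moment l e -> quantile_graph e (z, u) = \1_(`]0, tail e z[%classic) u.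
  by move=> me; rewrite /quantile_graph /lt01 /= lt_quantile// indicE mem_setE in_itv.
have li (a : R) : 0 <= a -> mu `]0, a[%classic = a%:E.
  move=> a0; rewrite lebesgue_measure_itv/= lte_fin; case: ltP => h; first by rewrite oppr0 adde0.
  by congr EFin; apply/eqP; rewrite eq_le a0.
have t0 e : 0 <= tail e z by exact: tail_ge0.
have ii e : mu.-integrable setT (fun u => (\1_(`]0, tail e z[%classic) u)%:E).
  apply/integrableP; split; first by apply/measurable_EFinP; apply: measurable_indic; exact: measurable_itv.
  under eq_integral do rewrite gee0_abs ?lee_fin//.
  rewrite integral_indic//.
  by rewrite setIT [X in (X < _)%E](li _ (t0 e)) ltry.
have E2 u : (`|quantile_graph c (z, u) - quantile_graph d (z, u)|)%:E =
    ((\1_(`]0, tail d z[%classic) u)%:E - (\1_(`]0, tail c z[%classic) u)%:E)%E.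
  rewrite !E// -EFinB distrC ger0_norm// subr_ge0 !indicE !mem_setE !in_itv/= ler_nat.
  by case: (0 < u) => //=; have [h|//] := ltP u (tail c z); rewrite (lt_le_trans h ab).
under eq_integral do rewrite E2.
rewrite integralB// !integral_indic//.
rewrite !setIT [X in (X - _)%E](li _ (t0 d)) [X in (_ - X)%E](li _ (t0 c)).
by rewrite -EFinB /gap distrC ger0_norm// subr_ge0.
Qed.

(** Tonelli on the region between the two quantile graphs, weighted by [dpw] in z: integration over
    u first gives |gap| at z, integration over z first gives the difference of the values of
    [pw]. *)
Lemma quantile_dist c d : has_moment l c -> has_moment l d ->
  (\int[mu]_u (`|pw (quantile c u) - pw (quantile d u)|)%:E = (dist l c d)%:E)%E.
Proof.
move=> mc md.
pose f (p : measurableTypeR R * measurableTypeR R) :=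
  (dpw p.1 * `|quantile_graph c p - quantile_graph d p|)%:E.
have mf : measurable_fun setT f.
  apply/measurable_EFinP; apply: measurable_funM.
    exact: (measurableT_comp (@measurable_dpw R l) measurable_fst).
  apply: measurableT_comp => //; apply: measurable_funB; exact: measurable_quantile_graph.
have f0 p : (0 <= f p)%E by rewrite lee_fin mulr_ge0// dpw_ge0.
transitivity (\int[mu]_u \int[mu]_z f (z, u))%E.
  by apply: eq_integral => u _; rewrite -integral_dpw_dist// quantile_ge0.
rewrite -(fubini_tonelli f mf f0).
rewrite /dist Rintegral_EFin; last exact: integrable_abs_gap.
apply: eq_integral => z _; rewrite /f.
have [z0|z0] := ltP 0 z; last first.
  rewrite integral0_eq; first by rewrite /dpw ltNge z0 mul0r.
  by move=> u _ /=; rewrite /dpw ltNge z0 mul0r.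
rewrite EFinM -integral_quantile_graph// -ge0_integralZl//.
- apply/measurable_EFinP; apply: measurableT_comp => //.
  apply: measurable_funB.
    exact: (measurable_fun_pair2 (f := quantile_graph c) z (measurable_quantile_graph mc)).
  exact: (measurable_fun_pair2 (f := quantile_graph d) z (measurable_quantile_graph md)).
- by rewrite lee_fin dpw_ge0.
Qed.

(** Away from 0, [c] is the image of Lebesgue measure under [q], as seen by functions dominated by
    [pw]. Monotonicity of [q] is not part of the notion, so limits of quantiles fit into it. *)
Definition represents q c := [/\ measurable_fun [set: measurableTypeR R] q,
  forall u, 0 <= q u, mu.-integrable setT (EFin \o (pw \o q)) &
  forall B g, pw_bounded l B g -> \int[c]_x g x = \int[mu]_u g (q u)].

Lemma quantile_integrable c : has_moment l c -> mu.-integrable setT (EFin \o (pw \o quantile c)).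
Proof.
move=> mc.
(* The zero measure has quantile 0, so the integral is the distance to it. *)
have m0 : has_moment l (mzero : {measure set R -> \bar R}).
  split; last by apply/integrableP; split; [apply/measurable_EFinP; exact: measurable_pw|rewrite integral_measure_zero ltry].
  exists (fun=> setT); first by apply/seteqP; split=> // x _; exists 0%N.
  by move=> _; split=> //; rewrite /mzero ltry.
apply/integrableP; split.
  apply/measurable_EFinP; apply: measurableT_comp; [exact: measurable_pw|exact: measurable_quantile].
have q0 u : quantile mzero u = 0.
  rewrite /quantile; case: ifPn => // u0.
  rewrite (_ : [set z | _] = set0) ?sup0//; apply/seteqP; split=> // z [z0].
  by rewrite /tail /Rintegral integral_measure_zero /= ltNge (ltW u0).
have := quantile_dist mc m0.
under eq_integral do rewrite q0 pw0 subr0.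
by move=> ->; rewrite ltry.
Qed.

Lemma dist_eq_tail c d : (forall z, 0 < z -> tail c z = tail d z) -> dist l c d = 0.
Proof.
move=> E; rewrite /dist /Rintegral integral0_eq// => z _; congr EFin.
by rewrite /Submission.dpw; case: ifPn => z0; rewrite ?mul0r// /gap E// subrr normr0 mulr0.
Qed.

Let Rpos (x : R) : R := (0 < x)%R%:R.

Let Rpos01 x : 0 <= Rpos x <= 1.
Proof. by rewrite /Rpos; case: (0 < x); rewrite ?lexx ?ler01. Qed.

Let mRpos : measurable_fun setT Rpos.
Proof. exact: (measurable_gt 0). Qed.

Let pw_bounded_pos B g x : pw_bounded l B g -> g x * Rpos x = g x.
Proof.
move=> [_ gB]; rewrite /Rpos; case: (ltP 0 x) => x0; first by rewrite mulr1.
by apply/esym/eqP; rewrite mulr0 -normr_eq0 eq_le normr_ge0 andbT (le_trans (gB x))// pw_le0// mulr0.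
Qed.

(** Only the points where [q] is positive are pushed forward: [q] may vanish on a set of infinite
    measure, which would put an infinite atom at 0. *)
Lemma ex_pushforward q : measurable_fun [set: measurableTypeR R] q -> (forall u, 0 <= q u) ->
  mu.-integrable setT (EFin \o (pw \o q)) ->
  exists nu : {measure set R -> \bar R}, [/\ has_moment l nu, nu `]-oo, 0]%classic = 0%E,
    forall z, 0 < z -> nu `]z, +oo[%classic = mu (q @^-1` `]z, +oo[%classic) &
    represents q nu].
Proof.
move=> mq q0 iq.
have mrho : measurable_fun [set: measurableTypeR R] (Rpos \o q) by exact: measurableT_comp.
have rho0 u : 0 <= (Rpos \o q) u by case/andP: (Rpos01 (q u)).
have [nu [nuE H]] := @ex_image_density _ _ (measurableTypeR R) _ R mu (Rpos \o q) q mrho rho0 mq.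
have nu0 : nu `]-oo, 0]%classic = 0%E.
  rewrite nuE integral0_eq// => u /=; rewrite in_itv/= => qu.
  by rewrite /Rpos ltNge qu.
have I B g : pw_bounded l B g -> (\int[nu]_x (g x)%:E = \int[mu]_u (g (q u))%:E)%E.
  move=> bg; rewrite (@image_integral _ _ _ _ _ mu nu q (Rpos \o q) g H rho0 bg.1).
  by apply: eq_integral => u _; rewrite /= (pw_bounded_pos _ bg).
have mnu : has_moment l nu.
  apply: moment_has_moment => //; rewrite momentE (I 1); last exact: pw_bounded_pw.
  have := integrable_fin_num measurableT iq => h.
  by rewrite ltey_eq h.
exists nu; split=> //; last first.
  by split=> // B g bg; rewrite /Rintegral (I B g bg).
move=> z z0; rewrite nuE.
under eq_integral => u.
  rewrite inE/= in_itv/= andbT => zu; rewrite /= /Rpos (lt_trans z0 zu); over.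
rewrite integral_cst ?mul1e//.
by rewrite -[X in measurable X]setTI; apply: mq => //; exact: measurable_itv.
Qed.

(** The image of Lebesgue measure under the quantile has the tails of [c]. As [c] may charge ]-oo,
    0], the comparison is made with its restriction [c'] to ]0, oo[. *)
Lemma quantile_represents c : has_moment l c -> represents (quantile c) c.
Proof.
move=> mc; have mq := measurable_quantile mc; have q0 := quantile_ge0 c.
have iq := quantile_integrable mc.
have [nu [mnu nu0 nuT [_ _ _ rep]]] := ex_pushforward mq q0 iq.
have [c' H] := ex_restriction mc mRpos Rpos01.
have c'E B g : pw_bounded l B g -> \int[c']_x g x = \int[c]_x g x.
  move=> bg; rewrite /Rintegral H; last exact: bg.1.
  by congr fine; apply: eq_integral => x _; rewrite (pw_bounded_pos _ bg).
have c'I A : measurable A -> c' A = (\int[c]_x (\1_A x * Rpos x)%:E)%E.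
  by move=> mA; rewrite -H ?integral_indic ?setIT.
have c'0 : c' `]-oo, 0]%classic = 0%E.
  rewrite c'I; last exact: measurable_itv.
  rewrite integral0_eq// => x _; rewrite indicE mem_setE in_itv/= /Rpos.
  by case: ltP; rewrite ?mulr0 ?mul0r.
have mc' : has_moment l c'.
  apply: moment_has_moment => //; rewrite momentE H; last exact: measurable_pw.
  have -> : (\int[c]_x (pw x * Rpos x)%:E = \int[c]_x (pw x)%:E)%E.
    by apply: eq_integral => x _; rewrite (pw_bounded_pos _ (pw_bounded_pw l)).
  by rewrite ltey_eq (integrable_fin_num measurableT mc.2).
have tE z : 0 < z -> tail nu z = tail c' z.
  move=> z0; apply: EFin_inj; rewrite (tailE z0 mnu) (tailE z0 mc') nuT//.
  have -> : quantile c @^-1` `]z, +oo[%classic = `]0, tail c z[%classic.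
    by apply/seteqP; split=> u /=; rewrite !in_itv/= andbT lt_quantile.
  have t0 := tail_ge0 c z.
  have -> : mu `]0, tail c z[%classic = (tail c z)%:E.
    rewrite lebesgue_measure_itv/= lte_fin; case: ltP => h; first by rewrite oppr0 adde0.
    by congr EFin; apply/eqP; rewrite eq_le t0.
  rewrite c'I; last exact: measurable_itv.
  rewrite (tailE z0 mc) -[X in c X]setIT -integral_indic//.
  apply: eq_integral => x _; rewrite indicE mem_setE in_itv/= andbT /Rpos.
  by have [h|h] := ltP z x; rewrite ?mul0r// (lt_trans z0 h) mulr1.
have nuc' := dist0_measure mnu mc' (dist_eq_tail tE) nu0 c'0.
split=> // B g bg; rewrite -(c'E B g bg) -(rep B g bg) /Rintegral; congr fine.
by apply/esym; apply: eq_measure_integral => A mA _; exact: nuc'.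
Qed.

(** Any two representations bound the distance from above, since an optimal function varies no more
    than [pw]; for quantiles equality holds. *)
Lemma dist_coupling qc qd c d : has_moment l c -> has_moment l d ->
  represents qc c -> represents qd d ->
  dist l c d <= \int[mu]_u `|pw (qc u) - pw (qd u)|.
Proof.
move=> mc md [mqc qc0 ic repc] [mqd qd0 id repd].
rewrite -optimal_pairing//; set r := optimal l c d.
have hr : holder l 1 r by exact: optimal_holder.
have br := holder_pw_bounded hr.
have dr x y : `|r x - r y| <= `|pw x - pw y|.
  by apply: prim_dist; [exact: measurable_sg_gap|move=> z; exact: normr_sg_le1].
have ir q : measurable_fun [set: measurableTypeR R] q -> mu.-integrable setT (EFin \o (pw \o q)) ->
    mu.-integrable setT (EFin \o (r \o q)).
  move=> mq iq; apply: (@integrable_le _ _ _ mu (r \o q) (pw \o q)) => //.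
    by apply: measurableT_comp => //; case: br.
  by move=> u; rewrite -[leRHS]mul1r; exact: br.2.
rewrite (repc _ _ br) (repd _ _ br) -RintegralB//; [|exact: (ir qc)|exact: (ir qd)].
apply: le_Rintegral_setT.
- exact: (integrable_subR (ir _ mqc ic) (ir _ mqd id)).
- exact: (@integrable_norm _ _ _ _ _ _ (integrable_subR ic id)).
- by move=> u; rewrite (le_trans (ler_norm _)).
Qed.

End quantile.

Lemma telescope_ord (V : zmodType) (f : nat -> V) n :
  f n = f 0%N - \sum_(i < n) (f i - f i.+1).
Proof.
elim: n => [|n IH]; first by rewrite big_ord0 subr0.
by rewrite big_ord_recr/= opprD addrA -IH subKr.
Qed.

(** * Dominated convergence of quantiles *)

Section quantile_convergence.
Context {R : realType} (l : exponent R).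
Notation mu := (@lebesgue_measure R).
Implicit Types (c : {measure set R -> \bar R}) (x y z u : R).
Notation pw := (pw l).

Lemma pw_lt x y : 0 <= x -> x < y -> pw x < pw y.
Proof.
move=> x0 xy; have y0 := le_lt_trans x0 xy.
by rewrite !pwE ?(ltW y0)// gt0_ltr_powR ?nnegrE ?(ltW y0)// exponent_gt0.
Qed.

Lemma pw_cvg_inv (v : nat -> R) x : (forall n, 0 <= v n) -> 0 <= x ->
  pw (v n) @[n --> \oo] --> pw x -> v @ \oo --> x.
Proof.
move=> v0 x0 h; apply/cvgrPdist_lt => e e0.
have h1 : \forall n \near \oo, pw (v n) < pw (x + e).
  by apply: (cvgr_lt _ h); apply: pw_lt => //; rewrite ltrDl.
have h2 : \forall n \near \oo, x - e < v n.
  have [xe|xe] := ltP (x - e) 0; first by apply: nearW => n; exact: lt_le_trans xe (v0 n).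
  have : \forall n \near \oo, pw (x - e) < pw (v n).
    by apply: (cvgr_gt _ h); apply: pw_lt => //; rewrite ltrBlDr ltrDl.
  apply: filterS => n; apply: contraTT; rewrite -!leNgt => vn; exact: pw_mono.
near=> n.
have h3 : x - e < v n by near: n.
have h4 : v n < x + e.
  have : pw (v n) < pw (x + e) by near: n.
  apply: contraTT; rewrite -!leNgt => vn; exact: pw_mono.
by rewrite ltr_norml; apply/andP; split; lra.
Unshelve. all: by end_near. Qed.

(** Almost everywhere convergence of representatives with an integrable majorant: under it even the
    bilinear part of the equation passes to the limit by dominated convergence. *)
Definition quantile_cvg (d : nat -> {measure set R -> \bar R}) c :=
  exists (q_ : nat -> R -> R) (q G : R -> R),
  [/\ forall n, represents l (q_ n) (d n), represents l q c,
      mu.-integrable setT (EFin \o G),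
      {ae mu, forall u, q_ n u @[n --> \oo] --> q u} &
      {ae mu, forall u n, pw (q_ n u) <= G u}].

Lemma fast_quantile_cvg (d : nat -> {measure set R -> \bar R}) c C :
  (forall n, has_moment l (d n)) -> has_moment l c ->
  (forall n, dist l (d n) c <= C * 2^-1 ^+ n) -> quantile_cvg d c.
Proof.
move=> md mc hd.
have rc := quantile_represents mc; have rd n := quantile_represents (md n).
have [mq q0 iq _] := rc.
pose a n (u : measurableTypeR R) := `|pw (quantile (d n) u) - pw (quantile c u)|.
have ma n : measurable_fun setT (a n).
  apply: measurableT_comp => //; apply: measurable_funB.
    by apply: measurableT_comp; [exact: measurable_pw|case: (rd n)].
  by apply: measurableT_comp; [exact: measurable_pw|].
have a0 n u : 0 <= a n u by exact: normr_ge0.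
have aC n : (\int[mu]_x (a n x)%:E <= (C * 2^-1 ^+ n)%:E)%E.
  by rewrite (quantile_dist (md n) mc) lee_fin.
have [S iS hS] := fast_dominated ma a0 aC.
exists (fun n => quantile (d n)), (quantile c), (fun u => pw (quantile c u) + S u).
have FF := ae_filter_ringOfSetsType mu.
split=> //.
- rewrite (_ : _ \o _ = (fun u => (EFin \o (pw \o quantile c)) u + (EFin \o S) u)%E) //.
  exact: integrableD.
- apply: filterS hS => u hu; apply: pw_cvg_inv.
  + by move=> n; case: (rd n).
  + exact: q0.
  have cs : cvgn (series (a ^~ u)).
    apply: nondecreasing_is_cvgn.
      by apply: nondecreasing_series => *; exact: normr_ge0.
    by exists (S u) => _ [n _ <-]; rewrite /series/= big_mkord; exact: hu.
  have := cvg_series_cvg_0 cs => h0.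
  apply/cvgrPdist_le => e e0; move/cvgrPdist_le : h0 => /(_ e e0).
  apply: filterS => n; rewrite sub0r normrN => h; rewrite distrC.
  exact: le_trans (ler_norm (a n u)) h.
- apply: filterS hS => u hu n; have := hu n.+1; rewrite big_ord_recr/= => h.
  have h1 : a n u <= S u by apply: le_trans h; rewrite lerDr sumr_ge0.
  rewrite -lerBlDl; apply: le_trans h1; exact: ler_norm.
Qed.

(** The increments of [pw] of the quantiles are summable almost everywhere, so these powers converge
    to some p >= 0 and the quantiles to p^(1/l). The limit measure is the image of Lebesgue measure
    under the limit function. *)
Lemma fast_cauchy_quantile_cvg (d : nat -> {measure set R -> \bar R}) C :
  (forall n, has_moment l (d n)) ->
  (forall n, dist l (d n) (d n.+1) <= C * 2^-1 ^+ n) ->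
  exists c : {measure set R -> \bar R}, [/\ has_moment l c, c `]-oo, 0]%classic = 0%E & quantile_cvg d c].
Proof.
move=> md hd.
have rd n := quantile_represents (md n).
pose p n (u : measurableTypeR R) := pw (quantile (d n) u).
pose a n (u : measurableTypeR R) := `|p n u - p n.+1 u|.
have mq n : measurable_fun [set: measurableTypeR R] (quantile (d n)) by case: (rd n).
have q0 n u : 0 <= quantile (d n) u by case: (rd n).
have mp n : measurable_fun setT (p n).
  by apply: measurableT_comp; [exact: measurable_pw|].
have ma n : measurable_fun setT (a n).
  by apply: measurableT_comp => //; exact: measurable_funB.
have a0 n u : 0 <= a n u by exact: normr_ge0.
have aC n : (\int[mu]_x (a n x)%:E <= (C * 2^-1 ^+ n)%:E)%E.
  by rewrite (quantile_dist (md n) (md n.+1)) lee_fin.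
have [S iS hS] := fast_dominated ma a0 aC.
pose G u := p 0%N u + S u.
have FF := ae_filter_ringOfSetsType mu.
have iG : mu.-integrable setT (EFin \o G).
  rewrite (_ : _ \o _ = (fun u => (EFin \o (pw \o quantile (d 0%N))) u + (EFin \o S) u)%E) //.
  by apply: integrableD => //; case: (rd 0%N).
have pE n u : p n u = p 0%N u - \sum_(i < n) (p i u - p i.+1 u) := telescope_ord (p^~ u) n.
have bG : {ae mu, forall u n, p n u <= G u}.
  apply: filterS hS => u hu n; rewrite pE lerD2l.
  apply: le_trans (hu n); rewrite -sumrN; apply: ler_sum => i _.
  by rewrite (le_trans (ler_norm _))// normrN.
(* On the exceptional null set [limn] may be a default value; the maximum keeps [q] nonnegative
   everywhere. *)
pose q u := Num.max 0 (limn (fun n => quantile (d n) u)).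
have cq : {ae mu, forall u, quantile (d n) u @[n --> \oo] --> q u}.
  apply: filterS hS => u hu.
  have cs : cvgn (series (fun n => p n u - p n.+1 u)).
    apply: normed_cvg; apply: nondecreasing_is_cvgn.
      by apply: nondecreasing_series => *; exact: normr_ge0.
    exists (S u) => _ [n _ <-].
    have : \sum_(0 <= k < n) a k u <= S u by rewrite big_mkord; exact: hu.
    by [].
  have /cvg_ex [s hs] := cs.
  have cp : p n u @[n --> \oo] --> p 0%N u - s.
    under eq_cvg do rewrite pE.
    apply: cvgB; first exact: cvg_cst.
    by apply: cvg_trans hs; apply: near_eq_cvg; near=> n; rewrite /series/= big_mkord.
  have s0 : 0 <= p 0%N u - s.
    by apply: (cvgr_to_ge cp); apply: nearW => n; exact: pw_ge0.
  set x := (p 0%N u - s) `^ (l : R)^-1; have x0 : 0 <= x by exact: powR_ge0.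
  have px : pw x = p 0%N u - s.
    by rewrite pwE// -powRrM mulVf ?exponent_neq0// powRr1.
  have qx : quantile (d n) u @[n --> \oo] --> x.
    by apply: pw_cvg_inv => //; rewrite px.
  by rewrite /q (cvg_lim _ qx)// max_r.
have mqq : measurable_fun [set: measurableTypeR R] q.
  apply: measurable_maxr => //; exact: (@measurable_limn _ (measurableTypeR R) R _ mq).
have qq0 u : 0 <= q u by rewrite le_max lexx.
have iq : mu.-integrable setT (EFin \o (pw \o q)).
  apply: (proj1 (@Rintegral_dct _ (measurableTypeR R) R mu p (pw \o q) G mp _ _ iG _)).
  - by apply: measurableT_comp; [exact: measurable_pw|].
  - apply: filterS cq => u hu; apply: continuous_cvg hu; exact: continuous_pw.
  - by apply: filterS bG => u hu n; rewrite ger0_norm ?pw_ge0.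
have [c [mc c0 _ rc]] := ex_pushforward mqq qq0 iq.
by exists c; split=> //; exists (fun n => quantile (d n)), q, G; split.
Unshelve. all: by end_near. Qed.

Section consequences.
Variables (d : nat -> {measure set R -> \bar R}) (c : {measure set R -> \bar R}).
Hypotheses (md : forall n, has_moment l (d n)) (mc : has_moment l c).
Hypothesis dc : quantile_cvg d c.

Lemma quantile_cvg_dist : dist l (d n) c @[n --> \oo] --> (0 : R).
Proof.
have [q_ [q [G [rd rc iG cq bG]]]] := dc.
have FF := ae_filter_ringOfSetsType mu.
have [mq q0 iq _] := rc.
have h : \int[mu]_u `|pw (q_ n u) - pw (q u)| @[n --> \oo] --> (0 : R).
  have -> : 0 = \int[mu]_u (fun=> 0 : R) u by rewrite /Rintegral integral0_eq.
  apply: (proj2 (@Rintegral_dct _ (measurableTypeR R) R mu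
    (fun n u => `|pw (q_ n u) - pw (q u)|) (fun=> 0) (fun u => G u + pw (q u)) _ _ _ _ _)).
  - move=> n; apply: measurableT_comp => //; have [mqn _ _ _] := rd n.
    by apply: measurable_funB; apply: measurableT_comp => //; exact: measurable_pw.
  - exact: measurable_cst.
  - apply: filterS cq => u hu; rewrite -(normr0 R) -(subrr (pw (q u))).
    apply: cvg_norm; apply: cvgB; last exact: cvg_cst.
    by apply: continuous_cvg hu; exact: continuous_pw.
  - rewrite (_ : _ \o _ = (fun u => (EFin \o G) u + (EFin \o (pw \o q)) u)%E) //.
    exact: integrableD.
  - apply: filterS bG => u hu n; rewrite normr_id (le_trans (ler_normB _ _))//.
    by rewrite !ger0_norm ?pw_ge0// lerD2r.
apply: (squeeze_cvgr (f := fun=> 0) _ (cvg_cst _) h).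
by near=> n; rewrite dist_ge0/=; apply: dist_coupling.
Unshelve. all: by end_near. Qed.

Lemma quantile_cvg_pairing (g : R -> R) B : pw_bounded l B g ->
  (forall (v : nat -> R) x, (forall n, 0 <= v n) -> v @ \oo --> x -> g (v n) @[n --> \oo] --> g x) ->
  \int[d n]_x g x @[n --> \oo] --> \int[c]_x g x.
Proof.
move=> bg cg; have [q_ [q [G [rd rc iG cq bG]]]] := dc.
have FF := ae_filter_ringOfSetsType mu.
have [mq q0 iq rep] := rc.
have B0 : 0 <= B by have := bg.2 1; rewrite pw1 mulr1; apply: le_trans.
rewrite (rep B g bg).
have E n : \int[d n]_x g x = \int[mu]_u g (q_ n u) by have [_ _ _ h] := rd n; exact: h bg.
under eq_cvg do rewrite E.
apply: (proj2 (@Rintegral_dct _ (measurableTypeR R) R mu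
    (fun n u => g (q_ n u)) (fun u => g (q u)) (fun u => B * G u) _ _ _ _ _)).
- by move=> n; have [mqn _ _ _] := rd n; apply: measurableT_comp => //; case: bg.
- by apply: measurableT_comp => //; case: bg.
- by apply: filterS cq => u hu; apply: cg => // n; have [_ ? _ _] := rd n.
- by rewrite (_ : _ \o _ = (fun u => B%:E * (EFin \o G) u)%E) //; apply: integrableZl.
- by apply: filterS bG => u hu n; rewrite (le_trans (bg.2 _))// ler_wpM2l.
Qed.

(** Dominated convergence twice: for almost every v the inner integrals converge with majorant A (G
    v) G, and they are themselves dominated by A times the integral of G, times G v. *)
Lemma quantile_cvg_bilinear (H : R -> R -> R) A : pw_bounded2 l A H ->
  (forall (v w : nat -> R) x y, (forall n, 0 <= v n) -> (forall n, 0 <= w n) ->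
    v @ \oo --> x -> w @ \oo --> y -> H (v n) (w n) @[n --> \oo] --> H x y) ->
  \int[d n]_y \int[d n]_x H x y @[n --> \oo] --> \int[c]_y \int[c]_x H x y.
Proof.
move=> bH cH; have [q_ [q [G [rd rc iG cq bG]]]] := dc.
have FF := ae_filter_ringOfSetsType mu.
have [mq q0 iq rep] := rc.
have A0 := pw_bounded2_ge0 bH.
have inner e qe y : has_moment l e -> represents l qe e ->
    \int[e]_x H x y = \int[mu]_u H (qe u) y.
  by move=> me [_ _ _ h]; exact: h (pw_bounded2_l bH y).
have outer e qe : has_moment l e -> represents l qe e ->
    \int[e]_y \int[e]_x H x y = \int[mu]_v \int[mu]_u H (qe u) (qe v).
  move=> me re; have [_ _ _ h] := re; rewrite (h _ _ (pw_bounded_inner_l bH me me)).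
  by apply: eq_Rintegral => v _; exact: inner.
rewrite (outer c q mc rc).
under eq_cvg do rewrite (outer _ _ (md _) (rd _)).
have mi e qe : has_moment l e -> represents l qe e ->
    measurable_fun [set: measurableTypeR R] (fun v => \int[mu]_u H (qe u) (qe v)).
  move=> me re; have [mqe _ _ _] := re.
  rewrite (_ : (fun v => _) = (fun y => \int[e]_x H x y) \o qe).
    by apply: measurableT_comp => //; exact: (pw_bounded_inner_l bH me me).1.
  by apply/funext => v /=; rewrite (inner e qe).
have IG0 : mu.-integrable setT (EFin \o (fun u => A * G u)).
  by rewrite (_ : _ \o _ = (fun u => A%:E * (EFin \o G) u)%E) //; apply: integrableZl.
have IGk (k : R) : mu.-integrable setT (EFin \o (fun u => A * k * G u)).
  by rewrite (_ : _ \o _ = (fun u => (A * k)%:E * (EFin \o G) u)%E) //; apply: integrableZl.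
have mH1 y : measurable_fun setT (H ^~ y) by exact: (pw_bounded2_l bH y).1.
apply: (proj2 (@Rintegral_dct _ (measurableTypeR R) R mu
    (fun n v => \int[mu]_u H (q_ n u) (q_ n v)) (fun v => \int[mu]_u H (q u) (q v))
    (fun v => A * (\int[mu]_u G u) * G v) _ _ _ _ _)).
- by move=> n; exact: (mi _ _ (md n) (rd n)).
- exact: (mi _ _ mc rc).
- have cq' := cq; have bG' := bG; apply: filterS2 cq bG => v hv gv.
  apply: (proj2 (@Rintegral_dct _ (measurableTypeR R) R mu
    (fun n u => H (q_ n u) (q_ n v)) (fun u => H (q u) (q v)) (fun u => A * G v * G u) _ _ _ _ _)).
  + by move=> n; have [mqn _ _ _] := rd n; exact: (measurableT_comp (mH1 _) mqn).
  + exact: (measurableT_comp (mH1 _) mq).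
  + by apply: filterS cq' => u hu; apply: cH => // n; have [_ h _ _] := rd n; exact: h.
  + exact: IGk.
  + apply: filterS bG' => u gu n; rewrite (le_trans (bH.2 _ _))// -!mulrA ler_wpM2l//.
    by rewrite mulrC; apply: ler_pM => //; exact: pw_ge0.
- exact: IGk.
- have bG' := bG; apply: filterS bG => v gv n; have [mqn qn0 iqn repn] := rd n.
  have gv0 : 0 <= G v by apply: le_trans (gv n); exact: pw_ge0.
  have iHn : mu.-integrable setT (EFin \o (fun u => H (q_ n u) (q_ n v))).
    apply: (@integrable_le _ _ _ mu _ (fun u => A * pw (q_ n v) * pw (q_ n u))).
    + exact: (measurableT_comp (mH1 _) mqn).
    + rewrite (_ : _ \o _ = (fun u => (A * pw (q_ n v))%:E * (EFin \o (pw \o q_ n)) u)%E) //.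
      exact: integrableZl.
    + by move=> u; rewrite (le_trans (bH.2 _ _))// -!mulrA ler_wpM2l// mulrC.
  rewrite (le_trans (le_normr_Rintegral _ _))//.
  rewrite mulrAC -RintegralZl//.
  apply: le_Rintegral_ae; [exact: (@integrable_norm _ _ _ _ _ _ iHn)|exact: IGk|].
  apply: filterS bG' => u gu; rewrite (le_trans (bH.2 _ _))// -!mulrA ler_wpM2l//.
  by rewrite mulrC; apply: ler_pM => //; exact: pw_ge0.
Qed.

End consequences.
End quantile_convergence.

(** * Existence *)

Section rhs_continuity.
Context {R : realType} (l : exponent R).
Implicit Types (c d : {measure set R -> \bar R}) (x y z t s : R) (phi g : R -> R).
Notation pw := (pw l).
Notation lam := (exponent_val l).
Variables (K : R -> R -> R) (F : R -> R) (beta : {measure set (Theta R) -> \bar R}).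
Hypothesis hKF : hypothesis_KF lam K F.
Hypothesis hC : (C_beta lam beta < +oo)%E.

(** The truncated integral is Hoelder with a constant proportional to m + 2, the m + 1 fragments and
    the parent; the remainder is controlled by [frag_rem]. Continuity of [frag_lim phi] follows by
    choosing m first. *)
Lemma frag_lim_modulus m phi B x y : holder l B phi ->
  `|frag_lim beta phi x - frag_lim beta phi y| <=
  B * frag_rem l beta m * (pw x + pw y) + m.+2%:R * B * total_chi beta m * pw `|x - y|.
Proof.
move=> hphi; have B0 := holder_ge0 hphi.
have t1 := frag_lim_trunc hC m x hphi; have t2 := frag_lim_trunc hC m y hphi.
have i1 z : beta.-integrable setT (EFin \o (fun th => chi m th * frag_fin m.+1 phi th z)).
  apply: le_integrable (frag_fin_integrable hC m z hphi) => //.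
    apply/measurable_EFinP; apply: measurable_funM; first exact: measurable_chi.
    apply: (measurable_fun_pair1 (f := fun p : Theta R * R => frag_fin m.+1 phi p.1 p.2)).
    exact: measurable_frag_fin (holder_pw_bounded hphi).1.
  move=> th _ /=; have /andP[h0 h1] := chi01 m th.
  by rewrite lee_fin normrM (ger0_norm h0) ler_piMl.
have h : `|\int[beta]_th (chi m th * frag_fin m.+1 phi th x) -
    \int[beta]_th (chi m th * frag_fin m.+1 phi th y)| <=
    m.+2%:R * B * total_chi beta m * pw `|x - y|.
  rewrite -RintegralB// (le_trans (le_normr_Rintegral _ _))//; first exact: integrable_subR.
  rewrite mulrAC -RintegralZl//; last exact: (integrable_chi hC).
  apply: le_Rintegral_setT.
  - exact: (@integrable_norm _ _ _ _ _ _ (integrable_subR (i1 x) (i1 y))).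
  - rewrite (_ : _ \o _ = (fun th => (m.+2%:R * B * pw `|x - y|)%:E * (EFin \o chi m) th)%E) //.
    by apply: integrableZl => //; exact: (integrable_chi hC).
  move=> th; have /andP[h0 h1] := chi01 m th.
  rewrite -mulrBr normrM (ger0_norm h0) mulrC ler_wpM2r//.
  rewrite /frag_fin.
  have -> : \sum_(i < m.+1) phi (th i * x) - phi x - (\sum_(i < m.+1) phi (th i * y) - phi y) =
    \sum_(i < m.+1) (phi (th i * x) - phi (th i * y)) + (phi y - phi x).
    by rewrite sumrB; ring.
  rewrite (le_trans (ler_normD _ _))// -[m.+2]addn1 natrD !mulrDl mul1r; apply: lerD; last first.
    by rewrite distrC; exact: hphi.2.
  rewrite (le_trans (ler_norm_sum _ _ _))//.
  apply: (@le_trans _ _ (\sum_(i < m.+1) (B * pw `|x - y|))).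
    apply: ler_sum => i _; rewrite (le_trans (hphi.2 _ _))// ler_wpM2l// pw_mono//.
    by rewrite -mulrBr normrM ger0_norm ?theta_ge0// ler_piMl// theta_le1.
  by rewrite sumr_const card_ord -mulrA mulr_natl.
move: t1 t2 h.
move: (\int[beta]_th (chi m th * frag_fin m.+1 phi th x)) (\int[beta]_th (chi m th * frag_fin m.+1 phi th y))
  (frag_lim beta phi x) (frag_lim beta phi y) (m.+2%:R * B * total_chi beta m * pw `|x - y|) => a b u v w.
rewrite mulrDr; move: (B * frag_rem l beta m * pw x) (B * frag_rem l beta m * pw y) => p q.
by rewrite !ler_norml => /andP[? ?] /andP[? ?] /andP[? ?]; apply/andP; split; lra.
Qed.

Lemma frag_lim_cont phi B (v : nat -> R) x : holder l B phi -> v @ \oo --> x ->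
  frag_lim beta phi (v n) @[n --> \oo] --> frag_lim beta phi x.
Proof.
move=> hphi vx; have B0 := holder_ge0 hphi.
have pv : pw (v n) @[n --> \oo] --> pw x by apply: continuous_cvg vx; exact: continuous_pw.
apply/cvgrPdist_le => e e0.
(* [pw x + 1] is an upper bound of [pw (v n)] for large n. *)
have [m hm] : exists m, B * frag_rem l beta m * (pw x + (pw x + 1)) <= e / 2.
  have px := pw_ge0 l x.
  have W0 : 0 < B * (pw x + (pw x + 1)) + 1 by rewrite ltr_wpDl// mulr_ge0// !addr_ge0.
  have d0 : 0 < e / 2 / (B * (pw x + (pw x + 1)) + 1) by rewrite !divr_gt0.
  have /cvgrPdist_le /(_ _ d0) [m _ /(_ m (leqnn m))] := cvg_frag_rem hC.
  rewrite /= sub0r normrN ler_pdivlMr// => hm; exists m; apply: le_trans hm.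
  rewrite mulrAC mulrC; apply: (@le_trans _ _ (`|frag_rem l beta m| * (B * (pw x + (pw x + 1))))).
    by rewrite ler_wpM2r ?ler_norm// mulr_ge0// !addr_ge0.
  by rewrite ler_wpM2l// lerDl.
pose D := m.+2%:R * B * total_chi beta m.
have D0 : 0 <= D by rewrite mulr_ge0 ?total_chi_ge0// mulr_ge0.
have pd : D * pw `|x - v n| @[n --> \oo] --> (0 : R).
  rewrite -(mulr0 D); apply: cvgM; first exact: cvg_cst.
  rewrite -(pw0 l); apply: continuous_cvg; first exact: continuous_pw.
  rewrite -(normr0 R) -(subrr x); apply: cvg_norm; apply: cvgB => //; exact: cvg_cst.
near=> n.
have h1 : pw (v n) < pw x + 1.
  by near: n; apply: (cvgr_lt _ pv); rewrite ltrDl.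
have h2 : D * pw `|x - v n| <= e / 2.
  have : `|0 - D * pw `|x - v n| | <= e / 2.
    by near: n; move/cvgrPdist_le : pd; apply; rewrite divr_gt0.
  by rewrite sub0r normrN; apply: le_trans; exact: ler_norm.
have hmod := frag_lim_modulus m x (v n) hphi.
apply: (le_trans hmod); rewrite -/D [leRHS](splitr e); apply: lerD => //.
have rem0 : 0 <= B * frag_rem l beta m.
  have [r0|r0] := leP 0 (frag_rem l beta m); first exact: mulr_ge0.
  (* At x = y = 1 with the test function [pw], the modulus estimate reads 0 <= 2 [frag_rem]. *)
  exfalso; have := frag_lim_modulus m 1 1 (holder_pw l).
  rewrite !subrr !normr0 pw0 mulr0 addr0 pw1 mul1r => h.
  by lra.
apply: le_trans hm; rewrite ler_wpM2l// lerD2l ltW//.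
Unshelve. all: by end_near. Qed.

Lemma kernel_cont (v w : nat -> R) x y : 0 < x -> 0 < y -> v @ \oo --> x -> w @ \oo --> y ->
  K (v n) (w n) @[n --> \oo] --> K x y.
Proof.
move=> x0 y0 vx wy.
pose a := Num.min x y / 2; pose b := x + y.
have m0 : 0 < Num.min x y by rewrite lt_min x0.
have mx : Num.min x y <= x by rewrite ge_min lexx.
have my : Num.min x y <= y by rewrite ge_min lexx orbT.
have ab : 0 < a < b by apply/andP; split; rewrite /a /b; lra.
have [L L0 HL] := kernel_lipschitz_box hKF ab.
have d0 : L * (`|x - v n| + `|y - w n|) @[n --> \oo] --> (0 : R).
  rewrite -(mulr0 L); apply: cvgM; first exact: cvg_cst.
  rewrite -[X in _ --> X](addr0 0); apply: cvgD.
    rewrite -(normr0 R) -(subrr x); apply: cvg_norm; apply: cvgB => //; exact: cvg_cst.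
  rewrite -(normr0 R) -(subrr y); apply: cvg_norm; apply: cvgB => //; exact: cvg_cst.
apply/cvgrPdist_le => e e0; near=> n.
have h1 : a < v n by near: n; apply: (cvgr_gt _ vx); rewrite /a; lra.
have h2 : v n < b by near: n; apply: (cvgr_lt _ vx); rewrite /b; lra.
have h3 : a < w n by near: n; apply: (cvgr_gt _ wy); rewrite /a; lra.
have h4 : w n < b by near: n; apply: (cvgr_lt _ wy); rewrite /b; lra.
have h5 : L * (`|x - v n| + `|y - w n|) <= e.
  have : `|0 - L * (`|x - v n| + `|y - w n|)| <= e.
    by near: n; move/cvgrPdist_le : d0; apply.
  by rewrite sub0r normrN; apply: le_trans; exact: ler_norm.
apply: le_trans h5; apply: (le_trans (HL x (v n) y (w n) _ _ _ _)); rewrite ?(ltW h1) ?(ltW h2) ?(ltW h3) ?(ltW h4)//.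
- by apply/andP; split; rewrite /a /b; lra.
- by apply/andP; split; rewrite /a /b; lra.
rewrite ler_wpM2l// ge_max; apply/andP; split; first by rewrite lerDl.
by rewrite lerDr.
Unshelve. all: by end_near. Qed.

(* Where [x = 0] or [y = 0], the integrand is squeezed to [0] by its bound
   [C x^l y^l]. *)
Lemma coag_integrand_cont phi B (v w : nat -> R) x y : holder l B phi ->
  (forall n, 0 <= v n) -> (forall n, 0 <= w n) -> v @ \oo --> x -> w @ \oo --> y ->
  Kp K (v n) (w n) * coag_op phi (v n) (w n) @[n --> \oo] --> Kp K x y * coag_op phi x y.
Proof.
move=> hphi v0 w0 vx wy.
have x0 : 0 <= x by apply: (cvgr_to_ge vx); exact: nearW.
have y0 : 0 <= y by apply: (cvgr_to_ge wy); exact: nearW.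
have [C0 C00 HC0] := coag_bounded hKF.
have bH := HC0 (Kp K) phi B (measurable_Kp hKF)
  (fun x y => introT andP (conj (Kp_ge0 hKF x y) (lexx _))) hphi.
have [xy|xy] := boolP ((0 < x) && (0 < y)); last first.
  have p0 : pw x * pw y = 0.
    move: xy; rewrite negb_and -!leNgt => /orP[h|h]; first by rewrite (pw_le0 l h) mul0r.
    by rewrite (pw_le0 l h) mulr0.
  have z0 : Kp K x y * coag_op phi x y = 0.
    by apply/eqP; rewrite -normr_eq0 eq_le normr_ge0 andbT (le_trans (bH.2 x y))// p0 mulr0.
  rewrite z0; apply/cvgrPdist_le => e e0.
  have h0 : C0 * B * (pw (v n) * pw (w n)) @[n --> \oo] --> (0 : R).
    rewrite -(mulr0 (C0 * B)) -p0; apply: cvgM; first exact: cvg_cst.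
    by apply: cvgM; [apply: continuous_cvg vx|apply: continuous_cvg wy]; exact: continuous_pw.
  move/cvgrPdist_le : h0 => /(_ e e0); apply: filterS => n.
  rewrite !sub0r !normrN; apply: le_trans; apply: (le_trans (bH.2 _ _)); exact: ler_norm.
have /andP[x1 y1] := xy.
have cphi (z : nat -> R) z0 : z @ \oo --> z0 -> phi (z n) @[n --> \oo] --> phi z0.
  by move=> hz; apply: continuous_cvg hz; exact: holder_continuous hphi.2 z0.
rewrite /Kp /pos_part2 xy; apply: cvg_trans (_ : K (v n) (w n) * coag_op phi (v n) (w n) @[n --> \oo] --> _).
  apply: near_eq_cvg; near=> n.
  rewrite (_ : 0 < v n); last by near: n; exact: (cvgr_gt _ vx).
  by rewrite (_ : 0 < w n)//; near: n; exact: (cvgr_gt _ wy).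
apply: cvgM; first exact: kernel_cont.
rewrite /coag_op; apply: cvgB; last exact: cphi.
by apply: cvgB; apply: cphi => //; exact: cvgD.
Unshelve. all: by end_near. Qed.

(** The extension of [F] may jump at 0, but it is bounded and [frag_lim phi] tends to 0 there. *)
Lemma frag_integrand_cont phi B (v : nat -> R) x : holder l B phi ->
  (forall n, 0 <= v n) -> v @ \oo --> x ->
  Fp F (v n) * frag_lim beta phi (v n) @[n --> \oo] --> Fp F x * frag_lim beta phi x.
Proof.
move=> hphi v0 vx.
have x0 : 0 <= x by apply: (cvgr_to_ge vx); exact: nearW.
have cl := frag_lim_cont hphi vx.
have [x1|x1] := ltP 0 x; last first.
  have xE : x = 0 by apply/eqP; rewrite eq_le x1.
  have fl0 : frag_lim beta phi x = 0.
    have := frag_lim_cvg hC (x := x) hphi => h; rewrite -(cvg_lim _ h)//.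
    rewrite (_ : (fun m => _) = fun=> 0); first exact: lim_cst.
    apply/funext => m; rewrite /frag_int /Rintegral integral0_eq// => th _.
    by rewrite frag_fin_le0//; case: hphi.
  rewrite fl0 mulr0; have [k2 k20 Fp2] := Fp_bound hKF.
  apply/cvgrPdist_le => e e0.
  have h0 : k2 * `|frag_lim beta phi (v n)| @[n --> \oo] --> (0 : R).
    rewrite -(mulr0 k2) -(normr0 R) -fl0; apply: cvgM; first exact: cvg_cst.
    exact: cvg_norm.
  move/cvgrPdist_le : h0 => /(_ e e0); apply: filterS => n.
  rewrite !sub0r !normrN; apply: le_trans; rewrite !normrM normr_id ler_wpM2r//.
  by have /andP[h1 h2] := Fp2 (v n); rewrite !ger0_norm// ltW.
apply: cvgM => //.
apply: cvg_trans (_ : F (v n) @[n --> \oo] --> _).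
  apply: near_eq_cvg; near=> n; rewrite /Fp /pos_part1.
  by rewrite (_ : 0 < v n)//; near: n; exact: (cvgr_gt _ vx).
rewrite /Fp /pos_part1 x1; apply: continuous_cvg vx.
exact: (locally_lipschitz_continuous (rate_lipschitz hKF) x1).
Unshelve. all: by end_near. Qed.

Lemma rhs_cvg (d : nat -> {measure set R -> \bar R}) c phi B : holder l B phi ->
  (forall n, has_moment l (d n)) -> has_moment l c -> quantile_cvg l d c ->
  rhs K F beta (d n) phi @[n --> \oo] --> rhs K F beta c phi.
Proof.
move=> hphi md mc dc.
have [C0 C00 HC0] := coag_bounded hKF.
have bH := HC0 (Kp K) phi B (measurable_Kp hKF)
  (fun x y => introT andP (conj (Kp_ge0 hKF x y) (lexx _))) hphi.
have [k2 k20 Fp2] := Fp_bound hKF.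
have Fb x : `|Fp F x| <= k2 by have /andP[h1 h2] := Fp2 x; rewrite ger0_norm.
have [bF _] := frag_lim_pairing hC hphi (measurable_Fp hKF) Fb mc.
rewrite /rhs; apply: cvgD.
  apply: cvgM; first exact: cvg_cst.
  apply: (quantile_cvg_bilinear md mc dc bH) => v w x y.
  by move=> v0 w0 vx wy; exact: (coag_integrand_cont hphi v0 w0 vx wy).
by apply: (quantile_cvg_pairing dc bF) => v x v0 vx; exact: (frag_integrand_cont hphi v0 vx).
Qed.

Lemma holder_pairing_cvg (d : nat -> {measure set R -> \bar R}) c phi B : holder l B phi ->
  quantile_cvg l d c -> \int[d n]_x phi x @[n --> \oo] --> \int[c]_x phi x.
Proof.
move=> hphi dc; apply: (quantile_cvg_pairing dc (holder_pw_bounded hphi)) => v x _ vx.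
by apply: continuous_cvg vx; exact: holder_continuous hphi.2 x.
Qed.

(** Homogeneity carries the equation from test functions of Hoelder constant 1 to all of them. *)
Lemma rhsZ c phi B k : has_moment l c -> holder l B phi ->
  rhs K F beta c (fun x => k * phi x) = k * rhs K F beta c phi.
Proof.
move=> mc hphi.
have [C0 C00 HC0] := coag_bounded hKF.
have bH := HC0 (Kp K) phi B (measurable_Kp hKF)
  (fun x y => introT andP (conj (Kp_ge0 hKF x y) (lexx _))) hphi.
have [k2 k20 Fp2] := Fp_bound hKF.
have Fb x : `|Fp F x| <= k2 by have /andP[h1 h2] := Fp2 x; rewrite ger0_norm.
have [bF _] := frag_lim_pairing hC hphi (measurable_Fp hKF) Fb mc.
have fl x : frag_lim beta (fun x => k * phi x) x = k * frag_lim beta phi x.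
  have hk : holder l (`|k| * B) (fun x => k * phi x).
    split=> [z z0|y z]; first by rewrite hphi.1// mulr0.
    by rewrite -mulrBr normrM -mulrA ler_wpM2l// hphi.2.
  have c1 := frag_lim_cvg hC (x := x) hk; have c2 := frag_lim_cvg hC (x := x) hphi.
  have c3 : frag_int beta m (fun x => k * phi x) x @[m --> \oo] --> k * frag_lim beta phi x.
    rewrite (_ : (fun m => _) = (fun m => k * frag_int beta m phi x)).
      by apply: cvgM => //; exact: cvg_cst.
    apply/funext => m; rewrite /frag_int -RintegralZl//; last exact: (frag_fin_integrable hC m x hphi).
    by apply: eq_Rintegral => th _; rewrite /frag_fin mulrBr mulr_sumr.
  by rewrite -(cvg_lim _ c1)// -(cvg_lim _ c3).
have e1 : \int[c]_y \int[c]_x (Kp K x y * coag_op (fun x => k * phi x) x y) =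
    k * \int[c]_y \int[c]_x (Kp K x y * coag_op phi x y).
  rewrite -(pairingZ _ mc (pw_bounded_inner_l bH mc mc)); apply: eq_Rintegral => y _.
  rewrite -(pairingZ _ mc (pw_bounded2_l bH y)); apply: eq_Rintegral => x _.
  by rewrite /coag_op; ring.
have e2 : \int[c]_x (Fp F x * frag_lim beta (fun x => k * phi x) x) =
    k * \int[c]_x (Fp F x * frag_lim beta phi x).
  by rewrite -(pairingZ _ mc bF); apply: eq_Rintegral => x _; rewrite fl mulrCA.
by rewrite /rhs e1 e2; ring.
Qed.

End rhs_continuity.

(** * Passage to the limit in the approximations *)

Section existence.
Context {R : realType} (l : exponent R).
Implicit Types (d : {measure set R -> \bar R}) (x y z t s : R) (phi g : R -> R).
Notation pw := (pw l).
Notation lam := (exponent_val l).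
Notation dist := (dist l).
Variables (K : R -> R -> R) (F : R -> R) (beta : {measure set (Theta R) -> \bar R}).
Hypothesis hKF : hypothesis_KF lam K F.
Hypothesis hC : (C_beta lam beta < +oo)%E.
Variable cin : {measure set R -> \bar R}.
Hypothesis mcin : has_moment l cin.
Hypothesis cin0 : cin `]-oo, 0]%classic = 0%E.
Notation eps n := ((2^-1 : R) ^+ n).
Notation rhs := (rhs K F beta).

Let eps_gt0 n : 0 < eps n. Proof. by rewrite exprn_gt0// invr_gt0. Qed.

Let epsS n : eps n.+1 <= eps n.
Proof. by rewrite exprS ler_piMl ?(ltW (eps_gt0 n))// invf_le1// ler1n. Qed.

Let eps_le m n : (m <= n)%N -> eps n <= eps m.
Proof. by move=> /subnK <-; elim: (n - m)%N => // k; exact: le_trans (epsS _). Qed.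

Let eps_le1 n : eps n <= 1. Proof. by rewrite -(expr0 2^-1) eps_le. Qed.

Let eps_cvg : eps n @[n --> \oo] --> (0 : R).
Proof. by apply: cvg_expr; rewrite ger0_norm ?invr_ge0// invf_lt1// ltr1n. Qed.

Section limit.
Variables (A : R) (C : nat -> R -> {measure set R -> \bar R}).
(** The n-th approximation lives on [0, n + 1] with error 2^-n. Its mass bound on [0, T] does not
    depend on n, and so neither do the stability constants. *)
Hypothesis C_sol : forall n T, 0 <= T <= n.+1%:R ->
  approx_sol l K F beta T (eps n) (mass l cin * expR (A * T)) (C n).
Hypothesis C_init : forall n, dist (C n 0) cin <= eps n.

Let M T := mass l cin * expR (A * T).
Let M0 T : 0 <= M T. Proof. by rewrite mulr_ge0 ?mass_ge0 ?expR_ge0. Qed.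

Let C_mom n t : 0 <= t <= n.+1%:R -> has_moment l (C n t).
Proof.
move=> /andP[t0 tn]; apply: (as_moment (C_sol (T := t) (n := n) _)); rewrite t0 ?tn ?lexx//.
Qed.

Let C_cauchy T : 0 <= T -> exists2 D, 0 <= D & forall t n, 0 <= t <= T -> T <= n.+1%:R ->
  dist (C n t) (C n.+1 t) <= D * eps n.
Proof.
move=> T0; have [L L0 HL] := approx_stability hKF hC (M0 T).
(* Of the factor 4, one half bounds the distance of the initial values and the other the two error
   rates. *)
exists (4 * expR (L * T)); first by rewrite mulr_ge0// expR_ge0.
move=> t n tT Tn; have Tn1 : T <= n.+2%:R by rewrite (le_trans Tn)// ler_nat.
have s1 : approx_sol l K F beta T (eps n) (M T) (C n) by apply: C_sol; rewrite T0.
have s2 : approx_sol l K F beta T (eps n.+1) (M T) (C n.+1) by apply: C_sol; rewrite T0.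
have := HL T (eps n) (eps n.+1) _ _ T0 (ltW (eps_gt0 n)) (ltW (eps_gt0 n.+1)) s1 s2 t tT.
move=> /le_trans; apply.
have z1 : 0 <= (0 : R) <= (n.+1%:R : R) by rewrite lexx /=.
have z2 : 0 <= (0 : R) <= (n.+2%:R : R) by rewrite lexx /=.
have h1 := dist_triangle (C_mom z1) mcin (C_mom z2).
rewrite (dist_sym l cin) in h1.
have h2 := C_init n; have h3 := C_init n.+1; have h4 := epsS n.
have e0 := ltW (eps_gt0 n).
rewrite mulrAC; apply: ler_pM.
- by rewrite addr_ge0 ?dist_ge0// addr_ge0// ltW.
- exact: expR_ge0.
- move: h1 h2 h3 h4 e0.
  by move: (dist (C n 0) (C n.+1 0)) (dist (C n 0) cin) (dist (C n.+1 0) cin) (eps n) (eps n.+1) => *; lra.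
- by rewrite ler_expR ler_wpM2l//; case/andP: tT.
Qed.

Let C_cauchy2 T : 0 <= T -> exists2 D, 0 <= D & forall t n k, 0 <= t <= T -> T <= n.+1%:R ->
  dist (C n t) (C (n + k)%N t) <= D * eps n.
Proof.
move=> T0; have [D D0 HD] := C_cauchy T0; exists (2 * D); first exact: mulr_ge0.
move=> t n k tT Tn; have Tk j : T <= (n + j).+1%:R.
  by rewrite (le_trans Tn)// ler_nat ltnS leq_addr.
have tk j : 0 <= t <= (n + j).+1%:R by case/andP: tT => -> h; exact: le_trans (Tk j).
(* The telescoping form closes the induction: [eps j - eps j.+1] is half of [eps j]. *)
suff : dist (C n t) (C (n + k)%N t) <= 2 * D * (eps n - eps (n + k)).
  by move=> /le_trans; apply; rewrite ler_wpM2l ?mulr_ge0// gerDl oppr_le0 ltW.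
elim: k => [|k IH].
  rewrite addn0 subrr mulr0 dist_eq_tail//.
have mn : has_moment l (C n t) by have := tk 0%N; rewrite addn0; exact: C_mom.
have h1 := dist_triangle mn (C_mom (tk k)) (C_mom (tk k.+1)).
apply: (le_trans h1); have h2 := HD t (n + k)%N tT (Tk k).
rewrite addnS in h1 *; rewrite [eps _.+1]exprS.
move: h1 IH h2; move: (eps n) (eps (n + k)) (dist (C n t) (C (n + k)%N t))
  (dist (C (n + k)%N t) (C (n + k).+1 t)) => *; lra.
Qed.

(** [C n] is controlled at time [t] only when t <= n + 1; the shift by [truncn t] starts the
    sequence there. *)
Definition converges_along (d : {measure set R -> \bar R}) t :=
  dist (C (Num.truncn t + k)%N t) d @[k --> \oo] --> (0 : R).

Lemma limit_exists : exists c : R -> {measure set R -> \bar R}, forall t, 0 <= t ->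
  [/\ has_moment l (c t), c t `]-oo, 0]%classic = 0%E & converges_along (c t) t].
Proof.
have H t : exists d, 0 <= t -> [/\ has_moment l d, d `]-oo, 0]%classic = 0%E & converges_along d t].
  have [t0|t0] := boolP (0 <= t); last by exists cin.
  have [D D0 HD] := C_cauchy t0.
  have tk k : t <= (Num.truncn t + k).+1%:R.
    by rewrite (le_trans (ltW (truncnS_gt t)))// ler_nat ltnS leq_addr.
  have tt : 0 <= t <= t by rewrite t0 lexx.
  have md k : has_moment l (C (Num.truncn t + k)%N t) by apply: C_mom; rewrite t0 tk.
  have [|d [md' d0 qd]] := fast_cauchy_quantile_cvg (C := D) md.
    move=> k; rewrite addnS; apply: (le_trans (HD t _ tt (tk k))).
    by rewrite ler_wpM2l// eps_le// leq_addl.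
  by exists d => _; split=> //; exact: (quantile_cvg_dist md md' qd).
by have [c Hc] := choice H; exists c.
Qed.

Variable c : R -> {measure set R -> \bar R}.
Hypothesis Hc : forall t, 0 <= t ->
  [/\ has_moment l (c t), c t `]-oo, 0]%classic = 0%E & converges_along (c t) t].

Let c_mom t : 0 <= t -> has_moment l (c t). Proof. by move=> /Hc[]. Qed.

Let C_lim T : 0 <= T -> exists2 D, 0 <= D & forall t n, 0 <= t <= T -> T <= n.+1%:R ->
  dist (C n t) (c t) <= D * eps n.
Proof.
move=> T0; have [D D0 HD] := C_cauchy2 T0.
exists D => // t n /[dup] tT /andP[t0 tT'] Tn; have [mc c0 cv] := Hc t0.
have tn : 0 <= t <= n.+1%:R by rewrite t0 (le_trans tT').
have h : D * eps n + dist (C (Num.truncn t + k)%N t) (c t) @[k --> \oo] --> D * eps n + 0.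
  by apply: cvgD => //; exact: cvg_cst.
rewrite addr0 in h; apply: (cvgr_to_ge h); near=> k.
have nk : (n <= Num.truncn t + k)%N.
  by rewrite (leq_trans _ (leq_addl _ _))//; near: k; exact: nbhs_infty_ge.
have tk : 0 <= t <= (Num.truncn t + k).+1%:R.
  by rewrite t0 (le_trans (ltW (truncnS_gt t)))// ler_nat ltnS leq_addr.
apply: (le_trans (dist_triangle (C_mom tn) (C_mom tk) mc)); rewrite lerD2r.
by rewrite -(subnKC nk); exact: HD.
Unshelve. all: by end_near. Qed.

Let C_lim0 : c 0 `]-oo, 0]%classic = 0%E. Proof. by have [] := Hc (lexx 0). Qed.

Let c_init B : measurable B -> c 0 B = cin B.
Proof.
move=> mB; apply: (dist0_measure (c_mom (lexx 0)) mcin) => //.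
have [D D0 HD] := C_lim (lexx 0).
apply/eqP; rewrite eq_le dist_ge0 andbT.
have h : (D + 1) * eps n @[n --> \oo] --> (D + 1) * (0 : R).
  by apply: cvgM => //; exact: cvg_cst.
rewrite mulr0 in h; apply: (cvgr_to_ge h); apply: nearW => n.
have z : 0 <= (0 : R) <= (n.+1%:R : R) by rewrite lexx /=.
apply: (le_trans (dist_triangle (c_mom (lexx 0)) (C_mom z) mcin)).
rewrite dist_sym mulrDl mul1r; apply: lerD; last exact: C_init.
by apply: HD; rewrite ?lexx.
Qed.

Let fast T n t : 0 <= t <= T -> T <= n.+1%:R ->
  quantile_cvg l (fun k => C (n + k)%N t) (c t).
Proof.
move=> /[dup] tT /andP[t0 tT'] Tn; have [D D0 HD] := C_lim (le_trans t0 tT').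
have Tk k : T <= (n + k).+1%:R by rewrite (le_trans Tn)// ler_nat ltnS leq_addr.
apply: (@fast_quantile_cvg _ _ _ _ D); [|exact: c_mom|].
  by move=> k; apply: C_mom; rewrite t0 (le_trans tT').
move=> k; apply: (le_trans (HD t _ tT (Tk k))).
by rewrite ler_wpM2l// eps_le// leq_addl.
Qed.

Let c_mass T t : 0 <= t <= T -> mass l (c t) <= M T.
Proof.
move=> /[dup] tT /andP[t0 tT']; pose n := Num.truncn T.
have Tn : T <= n.+1%:R by exact/ltW/truncnS_gt.
have cv := holder_pairing_cvg (holder_pw l) (fast tT Tn).
apply: (cvgr_to_le cv); apply: nearW => k.
have h : approx_sol l K F beta T (eps (n + k)) (M T) (C (n + k)%N).
  by apply: C_sol; rewrite (le_trans t0 tT') (le_trans Tn)// ler_nat ltnS leq_addr.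
exact: (as_mass h tT).
Qed.

(** By contradiction: otherwise there are indices n_k >= n0 + k and times s_k with |s_k - t| < 2^-k
    that violate the bound. Regularity in time and the rate of convergence put [C n_k s_k] at
    distance at most (L + 1 + D) 2^-k from [c t], fast enough for [rhs] to converge along this
    sequence. *)
Let rhs_near phi t eta : holder l 1 phi -> 0 <= t -> 0 < eta ->
  exists2 dn : R * nat, 0 < dn.1 & forall n s, (dn.2 <= n)%N -> 0 <= s <= t + 1 ->
    `|s - t| < dn.1 -> `|rhs (C n s) phi - rhs (c t) phi| <= eta.
Proof.
move=> hphi t0 eta0; apply: contrapT => nex.
pose T := t + 1; have T0 : 0 <= T by rewrite addr_ge0.
pose n0 := Num.truncn T; have Tn0 : T <= n0.+1%:R by exact/ltW/truncnS_gt.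
have ex k : exists p : nat * R, [/\ (n0 + k <= p.1)%N, 0 <= p.2 <= T, `|p.2 - t| < eps k &
    eta < `|rhs (C p.1 p.2) phi - rhs (c t) phi|].
  apply: contrapT => h; apply: nex; exists (eps k, (n0 + k)%N) => //= n s nk sT st.
  by rewrite leNgt; apply/negP => hs; apply: h; exists (n, s).
have [p Hp] := choice ex.
have [L L0 HL] := approx_sol_lipschitz hKF hC (M0 T).
have [D D0 HD] := C_lim T0.
have tT : 0 <= t <= T by rewrite t0 /T lerDl ler01.
have pn k : (n0 + k <= (p k).1)%N by case: (Hp k).
have pT k : 0 <= (p k).2 <= T by case: (Hp k).
have Tp k : T <= (p k).1.+1%:R.
  by rewrite (le_trans Tn0)// ler_nat ltnS (leq_trans _ (pn k))// leq_addr.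
have inC k s : 0 <= s <= T -> 0 <= s <= (p k).1.+1%:R.
  by move=> /andP[-> sT]; exact: le_trans (Tp k).
have md k : has_moment l (C (p k).1 (p k).2) by apply: C_mom; exact: inC.
have qc : quantile_cvg l (fun k => C (p k).1 (p k).2) (c t).
  apply: (@fast_quantile_cvg _ _ _ _ (L + 1 + D)) => //; first exact: c_mom.
  move=> k; have mt : has_moment l (C (p k).1 t) by apply: C_mom; exact: inC.
  apply: (le_trans (dist_triangle (md k) mt (c_mom t0))); rewrite [leRHS]mulrDl.
  have pk : (k <= (p k).1)%N by apply: leq_trans (pn k); exact: leq_addl.
  apply: lerD; last first.
    by apply: (le_trans (HD t _ tT (Tp k))); rewrite ler_wpM2l// eps_le.
  have sol : approx_sol l K F beta T (eps (p k).1) (M T) (C (p k).1).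
    by apply: C_sol; rewrite T0 Tp.
  have := dist_lipschitz (as_moment sol) (HL _ _ _ (ltW (eps_gt0 _)) sol) (pT k) tT.
  move=> /le_trans; apply; apply: ler_pM => //.
  - by rewrite addr_ge0// ltW.
  - by rewrite lerD2l.
  - by have [_ _ h _] := Hp k; exact: ltW.
have := rhs_cvg hKF hC hphi md (c_mom t0) qc => /cvgrPdist_le /(_ _ eta0) [k _ /(_ k (leqnn k))].
rewrite /= distrC leNgt => /negP; apply.
by case: (Hp k).
Qed.

(** For [C n], [left_derivative_norm] is applied on segments near [t] with the constant slope
    [rhs (c t) phi], which [rhs_near] allows for all large n. The inequality survives the limit, and
    segments on either side of [t] give the two-sided derivative. *)
Let c_derivative phi t : holder l 1 phi -> 0 <= t ->
  halfline_derivative (fun s => \int[c s]_x phi x) t (rhs (c t) phi).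
Proof.
move=> hphi t0 eta eta0; have eta2 : 0 < eta / 2 by rewrite divr_gt0.
have [[dl n1] /= dl0 Hdl] := rhs_near hphi t0 eta2.
pose T := t + 1; have T0 : 0 <= T by rewrite addr_ge0.
pose n0 := Num.truncn T; have Tn0 : T <= n0.+1%:R by exact/ltW/truncnS_gt.
set q := rhs (c t) phi.
have Tk k : T <= (n0 + k).+1%:R by rewrite (le_trans Tn0)// ler_nat ltnS leq_addr.
have key a b : 0 <= a -> a <= b -> b <= T -> (forall s, a <= s <= b -> `|s - t| < dl) ->
    `|\int[c b]_x phi x - \int[c a]_x phi x - q * (b - a)| <= eta * (b - a).
  move=> a0 ab bT near_t.
  have aT : 0 <= a <= T by rewrite a0 (le_trans ab).
  have bT' : 0 <= b <= T by rewrite (le_trans a0).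
  have ca := holder_pairing_cvg hphi (fast aT Tn0).
  have cb := holder_pairing_cvg hphi (fast bT' Tn0).
  have cv : `|\int[C (n0 + k)%N b]_x phi x - \int[C (n0 + k)%N a]_x phi x - q * (b - a)| @[k --> \oo]
      --> `|\int[c b]_x phi x - \int[c a]_x phi x - q * (b - a)|.
    by apply: cvg_norm; apply: cvgB; [apply: cvgB|exact: cvg_cst].
  apply: (cvgr_to_le cv); near=> k; set n := (n0 + k)%N.
  have n1n : (n1 <= n)%N.
    by rewrite (leq_trans _ (leq_addl _ _))//; near: k; exact: nbhs_infty_ge.
  have en : eps n <= eta / 2.
    apply: (@le_trans _ _ (eps k)); first by apply: eps_le; exact: leq_addl.
    have : `|0 - eps k| <= eta / 2 by near: k; move/cvgrPdist_le : eps_cvg; exact.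
    by rewrite sub0r normrN ger0_norm// ltW.
  have sol : approx_sol l K F beta T (eps n) (M T) (C n).
    by apply: C_sol; rewrite T0 Tk.
  apply: (@left_derivative_norm _ a b (fun s => \int[C n s]_x phi x)) => //.
    move=> s /andP[as_ sb] h h0; have [|r r0 Hr] := as_cont sol hphi _ h0 (t := s).
      by rewrite (le_trans a0 as_) (le_trans sb bT).
    exists r => // v /andP[av vb]; apply: Hr.
    by rewrite (le_trans a0 av) (le_trans vb bT).
  move=> s /andP[as_ sb] h h0.
  have sT : 0 < s <= T by rewrite (le_lt_trans a0 as_) (le_trans sb bT).
  have [r r0 Hr] := as_left sol hphi sT h0.
  exists r => // v /andP[av vs] vr.
  have v0 : 0 <= v < s by rewrite (le_trans a0 av).
  have h1 := Hr v v0 vr.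
  have h2 : `|rhs (C n s) phi - q| <= eta / 2.
    apply: Hdl => //; last by apply: near_t; rewrite (ltW as_) sb.
    by case/andP: sT => s0 sT; rewrite (ltW s0).
  have sv : 0 <= s - v by rewrite subr_ge0 ltW.
  have -> : \int[C n s]_x phi x - \int[C n v]_x phi x - q * (s - v) =
    (\int[C n s]_x phi x - \int[C n v]_x phi x - rhs (C n s) phi * (s - v)) +
    (rhs (C n s) phi - q) * (s - v) by ring.
  rewrite (le_trans (ler_normD _ _))// normrM (ger0_norm sv).
  have h3 : `|rhs (C n s) phi - q| * (s - v) <= eta / 2 * (s - v) by rewrite ler_wpM2r.
  have h4 : eps n * (s - v) <= eta / 2 * (s - v) by rewrite ler_wpM2r.
  rewrite (mulrDl (eps n) h) in h1.
  have h5 : (eta + h) * (s - v) = eta / 2 * (s - v) + eta / 2 * (s - v) + h * (s - v).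
    by field.
  rewrite h5; apply: (le_trans (lerD h1 h3)); move: h4.
  by move: (eps n * (s - v)) (h * (s - v)) (eta / 2 * (s - v)) => *; lra.
exists (Num.min dl 1); first by rewrite lt_min dl0 ltr01.
move=> s s0; rewrite lt_min => /andP[sdl s1].
have sT : s <= T.
  by have := ltr_normlW s1; rewrite ltrBlDr addrC => /ltW.
have [st|ts] := leP s t.
  have near_t v : s <= v <= t -> `|v - t| < dl.
    move=> /andP[sv vt]; apply: le_lt_trans sdl; rewrite !(distrC _ t) !ger0_norm ?subr_ge0//.
    by rewrite lerD2l lerN2.
  have tT : t <= T by rewrite /T lerDl ler01.
  have := key s t s0 st tT near_t; rewrite (distrC s t) (ger0_norm (x := t - s)) ?subr_ge0//.
  apply: le_trans; rewrite -normrN le_eqVlt; apply/orP; left; apply/eqP; congr (`|_|).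
  by rewrite !opprB -mulrN opprB; ring.
have near_t v : t <= v <= s -> `|v - t| < dl.
  move=> /andP[tv vs]; apply: le_lt_trans sdl; rewrite !ger0_norm ?subr_ge0 ?(ltW ts)//.
  by rewrite lerD2r.
have := key t s t0 (ltW ts) sT near_t.
by rewrite (ger0_norm (x := s - t)) ?subr_ge0 ?(ltW ts).
Unshelve. all: by end_near. Qed.

Lemma halfline_derivativeZ (f g : R -> R) k t q :
  (forall s, 0 <= s -> f s = k * g s) -> 0 <= t ->
  halfline_derivative g t q -> halfline_derivative f t (k * q).
Proof.
move=> fg t0 hg e e0; have k1 : 0 < `|k| + 1 by rewrite ltr_wpDl.
have [r r0 hr] := hg (e / (`|k| + 1)) (divr_gt0 e0 k1).
exists r => // s s0 sr; rewrite !fg//.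
have -> : k * g s - k * g t - k * q * (s - t) = k * (g s - g t - q * (s - t)) by ring.
rewrite normrM; apply: (le_trans (ler_wpM2l (normr_ge0 k) (hr s s0 sr))).
rewrite mulrA ler_wpM2r// mulrA ler_pdivrMr// mulrC ler_wpM2l ?(ltW e0)//.
by rewrite lerDl.
Qed.

Theorem limit_weak_solution : weak_solution cin K F beta lam c.
Proof.
have deriv phi t : holder_class lam phi -> 0 <= t ->
    derivable_halfline (fun s => pairing (c s) phi) t /\
    derive_halfline (fun s => pairing (c s) phi) t = weak_rhs K F beta (c t) phi.
  move=> hphi t0; have p0 : phi 0 = 0 by case: hphi.
  have [B hB] := holder_class_holder hphi; have B0 := holder_ge0 hB.
  set psi := fun x => phi (Num.max x 0) in hB.
  (* [B] may be 0; dividing by B + 1 brings the Hoelder constant below 1. *)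
  have B1 : B + 1 != 0 by rewrite gt_eqF// ltr_wpDl.
  have h1 : holder l 1 (fun x => (B + 1)^-1 * psi x).
    split=> [x x0|x y]; first by rewrite hB.1// mulr0.
    have Bp : 0 < B + 1 by rewrite ltr_wpDl.
    rewrite -mulrBr normrM ger0_norm ?invr_ge0 ?(ltW Bp)// mul1r.
    rewrite ler_pdivrMl//; apply: (le_trans (hB.2 x y)).
    by rewrite ler_wpM2r ?pw_ge0// lerDl.
  apply/derive_halflineP => //; rewrite (weak_rhsE K F beta (c t) p0) -/psi.
  have -> : rhs (c t) psi = (B + 1) * rhs (c t) (fun x => (B + 1)^-1 * psi x).
    by rewrite (rhsZ hKF hC _ (c_mom t0) hB) mulrA divff// mul1r.
  apply: (halfline_derivativeZ _ t0 (c_derivative h1 t0)) => s s0.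
  rewrite pairingE// (pairingZ _ (c_mom s0) (holder_pw_bounded hB)).
  by rewrite mulrA divff// mul1r.
split.
- by move=> t t0; have [mt ct0 _] := Hc t0; exact: (has_moment_radon mt ct0).
- exact: c_init.
- by move=> phi hphi t t0; case: (deriv phi t hphi t0).
- move=> t t0; apply: (@le_lt_trans _ _ (M t)%:E); last exact: ltry.
  apply: ge_ereal_sup => _ [s /= st <-]; rewrite in_itv/= in st.
  by rewrite moment_mass ?lee_fin ?c_mass//; case/andP: st => s0 _; exact: c_mom.
- by move=> phi hphi t t0; case: (deriv phi t hphi t0).
Qed.

End limit.

Theorem weak_solution_exists : exists c, weak_solution cin K F beta lam c.
Proof.
have [A A0 HA] := approx_exists hKF hC.
have ex n : exists C : R -> {measure set R -> \bar R},
    (forall T, 0 <= T <= n.+1%:R ->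
      approx_sol l K F beta T (eps n) (mass l cin * expR (A * T)) C) /\
    dist (C 0) cin <= eps n.
  have [d [ad dM hd]] := admissible_dense mcin (eps_gt0 n).
  have n0 : 0 < n.+1%:R :> R by rewrite ltr0n.
  have [C [HC CM Cd]] := HA _ _ d n0 (eps_gt0 n) ad.
  have z : 0 <= (0 : R) <= (n.+1%:R : R) by rewrite lexx /=.
  exists C; split.
    move=> T /[dup] Tn /andP[T0 _]; have [h1 h2 h3 h4] := approx_sol_le Tn HC.
    split=> // t /andP[t0 tT].
    have tn : 0 <= t <= n.+1%:R by case/andP: Tn => _ h; rewrite t0 (le_trans tT).
    apply: (le_trans (CM t tn)); apply: (@le_trans _ _ (mass l cin * expR (A * t))).
      by rewrite ler_wpM2r// expR_ge0.
    by rewrite ler_wpM2l ?mass_ge0// ler_expR ler_wpM2l.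
  have mC := as_moment HC z; have md := admissible_moment ad.
  apply: (le_trans (dist_triangle mC md mcin)); rewrite (dist_sym l d).
  (* [C 0] and [d] agree on functions dominated by [wt], in particular on the indicators of ]y, oo[,
     so their tails coincide. *)
  rewrite dist_eq_tail ?add0r// => y y0; apply: (Cd 1); first exact: ler01.
  split; first exact: measurable_gt.
  move=> x; rewrite mul1r (le_trans _ (wt_ge1 l x))// /lt01.
  by case: (y < x); rewrite ?normr1 ?normr0.
have [C HC] := choice ex.
have [c Hc] := limit_exists (fun n => (HC n).1) (fun n => (HC n).2).
by exists c; exact: (limit_weak_solution (fun n => (HC n).1) (fun n => (HC n).2) Hc).
Qed.

End existence.

Theorem theorem2p5 (R : realType) (lambda : R) (hlambda : 0 < lambda <= 1)
    (cin : {measure set R -> \bar R}) (hcin : radon_pos_moment lambda cin)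
    (K : R -> R -> R) (F : R -> R) (hKF : hypothesis_KF lambda K F)
    (beta : {measure set (Theta R) -> \bar R})
    (hB : hypothesis_B lambda beta) :
  exists c : R -> {measure set R -> \bar R},
    weak_solution cin K F beta lambda c /\
    forall c' : R -> {measure set R -> \bar R},
      weak_solution cin K F beta lambda c' ->
      forall t : R, 0 <= t -> forall A : set R, measurable A -> c' t A = c t A.
Proof.
have [[cin0 _] mcin] := hcin; have [_ hC] := hB.
pose l := Exponent hlambda.
have [c wc] := @weak_solution_exists R l K F beta hKF hC cin (moment_has_moment (l := l) cin0 mcin) cin0.
exists c; split=> // c' wc' t t0 A mA.
exact: (@weak_solution_unique R l K F beta cin c' c hKF hC wc' wc t t0 A mA).
Qed.
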